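(* Let $X_n$ be the $n\times n$ random matrix whose entries are iid complex random variables with mean $0$ and variance $1$. Then the ESD $\mu_{\frac{1}{\sqrt n}X_n}$ of $\frac{1}{\sqrt n}X_n$ converges, both in probability and in the almost sure sense, to the uniform distribution on the unit disk $\{z\in\mathbb{C}:|z|\le1\}$.
   Context: For an $n\times n$ complex matrix $A$ with eigenvalues $\lambda_1,\dots,\lambda_n$ (with algebraic multiplicity), the empirical spectral distribution (ESD) is the probability measure $\mu_A=\frac1n\sum_{i=1}^n\delta_{\lambda_i}$ on $\mathbb{C}$. Mean $0$ and variance $1$ for a complex random variable $x$ means $\mathbf{E}x=0$, $\mathbf{E}|x|^2=1$; the common distribution of the entries does not depend on $n$. Random probability measures $\mu_n$ on $\mathbb{C}$ converge in probability to $\mu$ if for every continuous compactly supported $f:\mathbb{C}\to\mathbb{R}$, $\int f\,d\mu_n\to\int f\,d\mu$ in probability; they converge almost surely to $\mu$ if with probability $1$, $\int f\,d\mu_n\to\int f\,d\mu$ for all such $f$. The matrices $X_n$ are the upper-left $n\times n$ blocks $(x_{ij})_{1\le i,j\le n}$ of a single infinite array $(x_{ij})_{i,j\ge1}$ of iid random variables. *)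

(* Defs.v *)
From HB Require Import structures.
From mathcomp Require Import all_boot all_order all_algebra.
From mathcomp Require Import complex finmap ring lra zify.
From mathcomp Require Import all_classical all_reals all_analysis.

Set Implicit Arguments.
Unset Strict Implicit.
Unset Printing Implicit Defensive.

Import Order.TTheory GRing.Theory Num.Theory.
Import numFieldNormedType.Exports.

Local Open Scope classical_set_scope.
Local Open Scope complex_scope.
Local Open Scope ring_scope.

(* The usual topology and Borel sigma-algebra on the complex numbers.         *)
HB.instance Definition _ (R : realType) := NormedModule.copy R[i] R[i]^o.
HB.instance Definition _ (R : realType) :=
  Measurable.copy R[i] (g_sigma_algebraType (@open R[i])).

Section complex_measure.
Variable R : realType.

Lemma normc_le (z : R[i]) : `|z| <= (`|complex.Re z| + `|complex.Im z|)%:C.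
Proof.
case: z => a b /=.
rewrite [X in `|X|](_ : _ = a%:C + (0 +i* b)); last first.
  by rewrite /real_complex_def; simpc.
apply: (le_trans (ler_normD _ _)).
rewrite rmorphD lerD// normc_def /= expr0n /=.
  by rewrite addr0 sqrtr_sqr.
by rewrite add0r sqrtr_sqr.
Qed.

Definition complex_of_pair (p : R * R) : R[i] := p.1 +i* p.2.

Lemma measurable_complex_of_pair : measurable_fun [set: R * R] complex_of_pair.
Proof.
apply: (measurability (@open R[i])) => // _ [U oU <-].
rewrite setTI.
pose box (q : (rat * rat) * (rat * rat)) : set (R * R) :=
  `]ratr q.1.1, ratr q.1.2[%classic `*` `]ratr q.2.1, ratr q.2.2[%classic.
pose F q := if `[< box q `<=` complex_of_pair @^-1` U >] then box q else set0.
have -> : complex_of_pair @^-1` U = \bigcup_q F q.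
  apply/seteqP; split => [[x y] /= Uxy|p [q _]]; last first.
    by rewrite /F; case: asboolP => // + pq; exact.
  have := @open_nbhs_nbhs _ (complex_of_pair (x, y)) U (conj oU Uxy).
  rewrite -nbhs_ballE => -[[e e'] /= ee Ue].
  move: ee; rewrite ltcE /= => /andP[/eqP e'0 e0]; subst e'.
  have near (u : R) : exists a b : rat,
      [/\ ratr a < u, u < ratr b, u - e / 2 < ratr a & ratr b < u + e / 2].
    have e20 : 0 < e / 2 by rewrite divr_gt0.
    have [a] := @rat_in_itvoo R (u - e / 2) u ltac:(by rewrite ltrBlDr ltrDl).
    have [b] := @rat_in_itvoo R u (u + e / 2) ltac:(by rewrite ltrDl).
    rewrite !in_itv /= => /andP[ub be] /andP[ea au].
    by exists a, b; split.
  have [a [b [ax xb xa bx]]] := near x.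
  have [c [d [cy yd yc dy]]] := near y.
  have bin (u u' l r : R) : l < u -> u < r -> u - e / 2 < l ->
      r < u + e / 2 -> l < u' < r -> `|u - u'| < e / 2.
    move=> lu ur ul ru /andP[lu' ur']; rewrite ltr_distlC.
    by rewrite (lt_trans ul lu') (lt_trans ur' ru).
  exists ((a, b), (c, d)) => //; rewrite /F; case: asboolP => [_|]; last first.
    case; move=> [x' y'] [] /=; rewrite !in_itv /= => hx hy; apply: Ue.
    rewrite /ball /=; apply: (le_lt_trans (normc_le _)) => /=.
    rewrite ltcR [e]splitr ltrD//.
      exact: (bin x x' _ _ ax xb xa bx hx).
    exact: (bin y y' _ _ cy yd yc dy hy).
  by rewrite /box; split; rewrite /= in_itv /= ?ax ?cy.
apply: countable_bigcupT_measurable => // q.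
rewrite /F; case: asboolP => _ //; exact: measurableX.
Qed.

Definition lebesgue_complex : set R[i] -> \bar R :=
  pushforward (lebesgue_measure \x lebesgue_measure)%E complex_of_pair.

Lemma lebesgue_complex0 : lebesgue_complex set0 = 0%E.
Proof. by rewrite /lebesgue_complex /pushforward preimage_set0 measure0. Qed.

Lemma lebesgue_complex_ge0 A : (0 <= lebesgue_complex A)%E.
Proof. exact: (measure_ge0 (lebesgue_measure \x lebesgue_measure)%E). Qed.

Lemma lebesgue_complex_sigma_additive : semi_sigma_additive lebesgue_complex.
Proof.
move=> F mF tF mUF; rewrite /lebesgue_complex /pushforward preimage_bigcup.
have mpre A : measurable A -> measurable (complex_of_pair @^-1` A).
  move=> mA; rewrite -[X in measurable X]setTI.
  exact: measurable_complex_of_pair.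
apply: measure_semi_sigma_additive.
- by move=> n; exact: mpre.
- apply/trivIsetP => /= i j _ _ ij; rewrite -preimage_setI.
  by move/trivIsetP : tF => /(_ _ _ _ _ ij) ->//; rewrite preimage_set0.
- by rewrite -preimage_bigcup; exact: mpre.
Qed.

HB.instance Definition _ := isMeasure.Build _ _ _ lebesgue_complex
  lebesgue_complex0 lebesgue_complex_ge0 lebesgue_complex_sigma_additive.

Definition unit_disk : set R[i] := [set z | `|z| <= 1].

Lemma measurable_unit_disk : measurable unit_disk.
Proof.
rewrite -[unit_disk]setCK; apply: measurableC; apply: sub_sigma_algebra.
rewrite openE => z /= /negP; rewrite -real_ltNge ?normr_real ?real1// => z1.
apply/nbhs_ballP; exists (`|z| - 1); rewrite /= ?subr_gt0// => w.
rewrite /ball /= => zw /= w1.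
suff : `|z| < `|z| by rewrite ltxx.
rewrite -{1}(subrK w z) (le_lt_trans (ler_normD _ _))//.
by rewrite -[ltRHS](subrK 1) ltr_leD.
Qed.

(* The normalized restriction of Lebesgue measure. The second argument of     *)
(* mnormalize only matters for measures of total mass 0 or +oo, which         *)
(* lebesgue_unit_disk_gt0 and lebesgue_unit_disk_lty exclude.                 *)
Definition uniform_disk : set R[i] -> \bar R :=
  mnormalize (mrestr lebesgue_complex measurable_unit_disk) (dirac (0 : R[i])).

HB.instance Definition _ := Probability.on uniform_disk.

Let lebesgue_square (e : R) : 0 < e ->
  (lebesgue_measure \x lebesgue_measure)%E
    (`[- e, e]%classic `*` `[- e, e]%classic)
  = ((e + e) ^+ 2)%:E :> \bar R.
Proof.
move=> e0; rewrite product_measure1E//= lebesgue_measure_itv /= lte_fin gtrN//.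
by rewrite -EFinD -EFinM opprK expr2.
Qed.

Let lebesgue_square_measurable (e : R) :
  measurable (`[- e, e]%classic `*` `[- e, e]%classic : set (R * R)).
Proof. exact: measurableX. Qed.

Let unit_disk_preimage (p : R * R) :
  (complex_of_pair @^-1` unit_disk) p <-> p.1 ^+ 2 + p.2 ^+ 2 <= 1.
Proof.
rewrite /unit_disk /= normc_def /= -[X in _ <= X]/(1%:C) lecR.
by rewrite -[X in _ <= X]sqrtr1 ler_sqrt.
Qed.

Let measurable_unit_disk_preimage :
  measurable (complex_of_pair @^-1` unit_disk).
Proof.
rewrite -[X in measurable X]setTI; apply: measurable_complex_of_pair => //.
exact: measurable_unit_disk.
Qed.

Lemma lebesgue_unit_disk_gt0 : (0 < lebesgue_complex unit_disk)%E.
Proof.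
apply: (@lt_le_trans _ _ (((2^-1 + 2^-1 : R) ^+ 2)%:E)%E).
  by rewrite lte_fin exprn_gt0// addr_gt0.
rewrite -lebesgue_square//.
apply: (le_measure (lebesgue_measure \x lebesgue_measure)%E
  (mem_set (lebesgue_square_measurable _))
  (mem_set measurable_unit_disk_preimage)).
move=> [a b] [] /=; rewrite !in_itv /= => /andP[a1 a2] /andP[b1 b2].
by apply/unit_disk_preimage => /=; nra.
Qed.

Lemma lebesgue_unit_disk_lty : (lebesgue_complex unit_disk < +oo)%E.
Proof.
apply: (@le_lt_trans _ _ (((1 + 1 : R) ^+ 2)%:E)%E); last exact: ltry.
rewrite -lebesgue_square//.
apply: (le_measure (lebesgue_measure \x lebesgue_measure)%E
  (mem_set measurable_unit_disk_preimage)
  (mem_set (lebesgue_square_measurable _))).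
move=> [a b] /unit_disk_preimage /= ab1.
by split; rewrite /= in_itv /=; apply/andP; split; nra.
Qed.

End complex_measure.

Section empirical_spectral_distribution.
Variables (R : realType) (n : nat) (A : 'M[R[i]]_n).

Definition eigenvalues : seq R[i] :=
  sval (closed_field_poly_normal (char_poly A)).

Lemma char_poly_eigenvalues :
  char_poly A = \prod_(z <- eigenvalues) ('X - z%:P).
Proof.
rewrite /eigenvalues; case: closed_field_poly_normal => r /= {1}->.
by rewrite (monicP (char_poly_monic A)) scale1r.
Qed.

Lemma size_eigenvalues : size eigenvalues = n.
Proof.
have := size_char_poly A.
by rewrite char_poly_eigenvalues size_prod_XsubC => -[].
Qed.

Definition esd : set R[i] -> \bar R :=
  mscale (n%:R^-1)%:nng (msum (fun k => \d_(eigenvalues`_k)) n).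

HB.instance Definition _ := Measure.on esd.

Lemma esd_setT : (0 < n)%N -> esd setT = 1%E.
Proof.
move=> n0; rewrite /esd /mscale /= /msum.
under eq_bigr do rewrite /= diracT.
rewrite sumEFin sumr_const card_ord -EFinM mulVf// pnatr_eq0; lia.
Qed.

End empirical_spectral_distribution.

Section random_measures.
Context d (T : measurableType d) (R : realType) (P : probability T R).

Definition test_function (f : R[i] -> R) :=
  continuous f /\ compact (closure [set z | f z != 0]).

Definition cvg_measure_in_probability
    (mu : nat -> T -> {measure set R[i] -> \bar R})
    (nu : {measure set R[i] -> \bar R}) :=
  forall f, test_function f -> forall eps : R, 0 < eps ->
    P [set t | eps <= `|\int[mu n t]_z f z - \int[nu]_z f z|]
      @[n --> \oo] --> 0%E.

Definition cvg_measure_almost_surely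
    (mu : nat -> T -> {measure set R[i] -> \bar R})
    (nu : {measure set R[i] -> \bar R}) :=
  {ae P, forall t, forall f, test_function f ->
    (\int[mu n t]_z f z) @[n --> \oo] --> \int[nu]_z f z}.

End random_measures.

Section random_variables.
Context d d' (T : measurableType d) (T' : measurableType d') (R : realType).
Variables (P : probability T R) (I : choiceType) (X : I -> {RV P >-> T'}).

Definition mutually_independent :=
  forall (J : {fset I}) (B : I -> set T'), (forall i, measurable (B i)) ->
    P (\bigcap_(i in [set` J]) (X i @^-1` B i))
    = (\prod_(i <- J) P (X i @^-1` B i))%E.

Definition identically_distributed :=
  forall i j (B : set T'), measurable B ->
    distribution P (X i) B = distribution P (X j) B.

Definition iid := mutually_independent /\ identically_distributed.

End random_variables.

Section complex_random_variables.
Context d (T : measurableType d) (R : realType) (P : probability T R).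

Definition mean_zero (x : T -> R[i]) :=
  ('E_P[fun t => complex.Re (x t)] = 0 /\
   'E_P[fun t => complex.Im (x t)] = 0)%E.

(* Finiteness of this second moment makes the real and imaginary parts of x   *)
(* integrable, so that the expectations in mean_zero are genuine.             *)
Definition unit_variance (x : T -> R[i]) :=
  ('E_P[fun t => (Normc.normc (x t) ^+ 2)%R] = 1)%E.

End complex_random_variables.

Section random_matrix.
Context d (T : measurableType d) (R : realType).

Definition random_matrix (x : nat * nat -> T -> R[i]) (n : nat) (t : T) :
    'M[R[i]]_n :=
  \matrix_(i < n, j < n) x (i : nat, j : nat) t.

End random_matrix.

(* Main.v *)
(** Logarithmic potentials, with volumes of rows in place of singular values.
    The second moment of the determinant bounds the regularized potential of the
    ESD from above; averaging over roots of unity and reflecting factors across a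
    circle does the work of Jensen's formula.  For the lower bound, a determinant
    is the volume of all but the last few rows times the volume of the last rows
    in the orthogonal complement.  A regularized Gram determinant Z satisfies
    E Z * E Z^-1 <= exp (o (n)), tensorized row by row, and controls the first
    volume.  The last rows cannot be nearly singular at all of several nearby
    points at once, so the determinant is large at one of them.  Comparing the
    potential at different radii gives liminf mu_n (D) >= |D| / pi on small disks
    in the unit disk, hence liminf int f >= int f for continuous f >= 0; apply
    this to M + f and M - f.  Summable error probabilities and Borel-Cantelli
    give the almost sure convergence, which implies convergence in probability
    because continuity of roots makes int f d mu_n measurable. *)
Require Import Defs.
From HB Require Import structures.
From mathcomp Require Import all_boot all_order all_algebra.
From mathcomp Require Import complex finmap ring lra zify.
From mathcomp Require Import all_classical all_reals all_analysis.
From mathcomp Require Import measurable_realfun.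

Set Implicit Arguments.
Unset Strict Implicit.
Unset Printing Implicit Defensive.

Import Order.TTheory GRing.Theory Num.Theory.
Import numFieldNormedType.Exports.
From mathcomp Require Import sesquilinear spectral cyclic separable cyclotomic.

Local Open Scope classical_set_scope.
Local Open Scope complex_scope.
Local Open Scope ring_scope.
Local Open Scope sesquilinear_scope.

(** * Resampling one entry of the array *)

(** Only two moments are assumed: no density and no fourth moment are at hand, and the sole source
    of anticoncentration is a constant q < 1 for one entry. A row against a subspace of codimension
    k then fails with probability exponentially small in k. This says little once k is bounded: at a
    single point z the last few rows may produce a singular matrix with a probability that these
    bounds do not make summable. Hence the detour through about n^(1/16) points. The kernels of the
    shifted matrices are robustly independent, so failures at a given step behave as if independent,
    and the probability that every point fails decays exponentially in n^(1/16). Not knowing which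
    point succeeds is harmless: the determinant is used only inside products over a circle, and
    these tolerate a small displacement of their points. Cutting the logarithm off at a radius makes
    the potential Lipschitz in z, so that countably many almost sure statements suffice. A lower
    bound on mass is enough since the limit has mass one. *)

Section configurations.
Variable R : realType.
Notation C := R[i].

Definition cfg := nat * nat -> C.

Definition upd (xi : cfg) (e : nat * nat) (u : C) : cfg :=
  fun e' => if e' == e then u else xi e'.

Lemma updE xi e u : upd xi e u e = u.
Proof. by rewrite /upd eqxx. Qed.

Lemma upd_neq xi e u e' : e' != e -> upd xi e u e' = xi e'.
Proof. by rewrite /upd => /negbTE ->. Qed.

Lemma updC xi e e' u v : e != e' -> upd (upd xi e u) e' v = upd (upd xi e' v) e u.
Proof.
move=> ee'; apply/funext => a; rewrite /upd.
by case: (eqVneq a e') => [->|//]; rewrite eq_sym (negbTE ee').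
Qed.

(** Measurability along every array of measurable functions. This is measurability for the product
    sigma-algebra, which is introduced only where two laws on arrays must be compared. *)
Definition measf d' (T' : measurableType d') (f : cfg -> T') :=
  forall d (S : measurableType d) (Xi : S -> cfg),
    (forall e, measurable_fun setT (fun s => Xi s e)) ->
    measurable_fun setT (f \o Xi).

Lemma measf_coord e : measf (fun xi => xi e : C).
Proof. by move=> d S Xi; exact. Qed.

Lemma measf_cst d' (T' : measurableType d') (c : T') : measf (fun=> c).
Proof. by move=> d S Xi _; exact: measurable_cst. Qed.

Lemma measf_comp d1 (T1 : measurableType d1) d2 (T2 : measurableType d2)
    (g : T1 -> T2) (f : cfg -> T1) :
  measurable_fun setT g -> measf f -> measf (g \o f).
Proof.
move=> mg mf d S Xi mXi; rewrite -compA.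
by apply: measurableT_comp => //; exact: mf.
Qed.

Lemma upd_measurable d (S : measurableType d) (Xi : S -> cfg) e :
  (forall e, measurable_fun setT (fun s => Xi s e)) ->
  forall e', measurable_fun setT (fun p : S * C => upd (Xi p.1) e p.2 e').
Proof.
move=> mXi e'; rewrite /upd; case: (e' == e); first exact: measurable_snd.
by apply: (measurableT_comp (f := fun s => Xi s e')) => //; exact: measurable_fst.
Qed.

Section with_law.
Variable mu : probability C R.
Local Open Scope ereal_scope.

Implicit Types f g : cfg -> \bar R.

(** For an iid array of law [mu] this is the conditional expectation given all entries other than
    [e]. *)
Definition E1 e f : cfg -> \bar R := fun xi => \int[mu]_u f (upd xi e u).

Definition EJ (J : seq (nat * nat)) f : cfg -> \bar R := foldr E1 f J.

Lemma measf_upd d' (T' : measurableType d') (f : cfg -> T') xi e :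
  measf f -> measurable_fun setT (fun u : C => f (upd xi e u)).
Proof.
move=> mf; apply: (mf _ _ (fun u => upd xi e u)) => e'.
by rewrite /upd; case: (e' == e); [exact: measurable_id|exact: measurable_cst].
Qed.

Lemma E1_ge0 e f : (forall xi, 0 <= f xi) -> forall xi, 0 <= E1 e f xi.
Proof. by move=> f0 xi; apply: integral_ge0 => u _. Qed.

Lemma E1_meas e f : (forall xi, 0 <= f xi) -> measf f -> measf (E1 e f).
Proof.
move=> f0 mf d S Xi mXi.
apply: (@measurable_fun_fubini_tonelli_F _ _ S C R mu
  (fun p => f (upd (Xi p.1) e p.2))) => //.
by apply: (mf _ _ (fun p : S * C => upd (Xi p.1) e p.2)); exact: upd_measurable.
Qed.

Lemma EJ_ge0 J f : (forall xi, 0 <= f xi) -> forall xi, 0 <= EJ J f xi.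
Proof. by move=> f0; elim: J => //= e J IH; exact: E1_ge0. Qed.

Lemma EJ_meas J f : (forall xi, 0 <= f xi) -> measf f -> measf (EJ J f).
Proof. by move=> f0 mf; elim: J => //= e J IH; apply: E1_meas => //; exact: EJ_ge0. Qed.

Lemma E1_le e f g : (forall xi, 0 <= f xi) -> measf f -> measf g ->
  (forall xi, f xi <= g xi) -> forall xi, E1 e f xi <= E1 e g xi.
Proof.
move=> f0 mf mg fg xi; apply: ge0_le_integral => //.
- exact: measf_upd.
- exact: measf_upd.
Qed.

Lemma EJ_le J f g : (forall xi, 0 <= f xi) -> measf f -> measf g ->
  (forall xi, f xi <= g xi) -> forall xi, EJ J f xi <= EJ J g xi.
Proof.
move=> f0 mf mg fg.
have g0 xi : 0 <= g xi by exact: le_trans (fg _).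
elim: J => //= e J IH; apply: E1_le => //; try exact: EJ_meas.
exact: EJ_ge0.
Qed.

Lemma E1_cst e f xi : (forall u, f (upd xi e u) = f xi) -> E1 e f xi = f xi.
Proof.
move=> fe; rewrite /E1; under eq_integral do rewrite fe.
by rewrite integral_cst//= probability_setT mule1.
Qed.

Lemma E1C e e' f xi : (forall xi, 0 <= f xi) -> measf f ->
  E1 e (E1 e' f) xi = E1 e' (E1 e f) xi.
Proof.
move=> f0 mf; case: (eqVneq e e') => [->//|ee']; rewrite /E1.
have mf2 : measurable_fun setT
    (fun p : C * C => f (upd (upd xi e p.1) e' p.2)).
  apply: (mf _ _ (fun p : C * C => upd (upd xi e p.1) e' p.2)).
  apply: (@upd_measurable _ C (fun u => upd xi e u)) => a.
  by rewrite /upd; case: (a == e); [exact: measurable_id|exact: measurable_cst].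
rewrite (@fubini_tonelli _ _ C C R mu mu _ mf2)//.
apply: eq_integral => v _; apply: eq_integral => u _ /=.
by rewrite updC.
Qed.

Lemma EJ_cat J K f : EJ (J ++ K) f = EJ J (EJ K f).
Proof. by rewrite /EJ foldr_cat. Qed.

Lemma E1_EJ e J f xi : (forall xi, 0 <= f xi) -> measf f ->
  E1 e (EJ J f) xi = EJ J (E1 e f) xi.
Proof.
move=> f0 mf; elim: J xi => //= a J IH xi.
rewrite E1C//; [|exact: EJ_ge0|exact: EJ_meas].
by rewrite {1}/E1; apply: eq_integral => u _; exact: IH.
Qed.

Definition dep_on (T' : Type) (J : seq (nat * nat)) (f : cfg -> T') :=
  forall xi xi', {in J, xi =1 xi'} -> f xi = f xi'.

Lemma EJ_dep J f : dep_on J f -> forall xi xi', EJ J f xi = EJ J f xi'.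
Proof.
(* K collects the entries already redrawn: both configurations received the same new value there. *)
suff H K xi xi' : dep_on (K ++ J) f ->
    {in K, xi =1 xi'} -> EJ J f xi = EJ J f xi'.
  by move=> Jf xi xi'; apply: (H [::]).
elim: J K xi xi' => [|e J IH] K xi xi' Kf KE /=.
  by apply: Kf => a; rewrite cats0; exact: KE.
apply: eq_integral => u _; apply: (IH (rcons K e)); first by rewrite cat_rcons.
move=> a; rewrite mem_rcons inE /upd; case: eqP => //= _; exact: KE.
Qed.

End with_law.
End configurations.

Section resampling.
Context d (T : measurableType d) (R : realType) (P : probability T R).
Notation C := R[i].
Variable x : nat * nat -> {RV P >-> C}.
Hypothesis x_iid : iid x.

Let mu : probability C R := distribution P (x (0%N, 0%N)).

Definition config (t : T) : cfg R := fun e => x e t.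

Let cyl : set (set (cfg R)) := [set A | exists (J : {fset nat * nat}) B,
  (forall i, measurable (B i)) /\
  A = \bigcap_(i in [set` J]) [set xi : cfg R | B i (xi i)]].

Let cfgM := g_sigma_algebraType cyl.

Let cylI : setI_closed cyl.
Proof.
move=> _ _ [J [B [mB ->]]] [J' [B' [mB' ->]]].
exists (J `|` J')%fset, (fun i => (if i \in J then B i else setT) `&`
  (if i \in J' then B' i else setT)); split.
  by move=> i; apply: measurableI; case: ifP.
apply/seteqP; split => [xi [h h'] i /=|xi h].
  rewrite inE => _; split; case: ifPn => // iJ.
    exact: (h _ iJ).
  exact: (h' _ iJ).
by split => i /= iJ; have := h i; rewrite /= inE iJ ?orbT => /(_ isT) [].
Qed.

Let measurable_to_cfgM d' (S : measurableType d') (phi : S -> cfgM) :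
  (forall e, measurable_fun setT (fun s => phi s e : C)) ->
  measurable_fun setT phi.
Proof.
move=> mphi; have := @measurability _ _ S cfgM setT phi cyl. apply => // _ [A [J [B [mB ->]]] <-].
rewrite setTI preimage_bigcap.
apply: fin_bigcap_measurable => // i _.
by rewrite -[X in measurable X]setTI; apply: (mphi i) => //; exact: mB.
Qed.

Let measurable_from_cfgM d' (S : measurableType d') (f : cfg R -> S) :
  measf f -> measurable_fun setT (f : cfgM -> S).
Proof.
move=> mf; apply: (mf _ cfgM id) => e _ B mB; rewrite setTI.
apply: sub_sigma_algebra; exists [fset e]%fset, (fun=> B); split => //.
apply/seteqP; split => [xi Bxi i /=|xi /(_ e)]; last by rewrite /= inE; exact.
by rewrite inE => /eqP ->.
Qed.

Let mconfig : measurable_fun setT (config : T -> cfgM).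
Proof. by apply: measurable_to_cfgM => e; exact: measurable_funP. Qed.

Let mupd e : measurable_fun setT
  (fun p : T * C => upd (config p.1) e p.2 : cfgM).
Proof.
apply: measurable_to_cfgM => e'; apply: (@upd_measurable R _ T config) => a.
exact: measurable_funP.
Qed.

Let mu_x e B : measurable B -> mu B = P (x e @^-1` B).
Proof. by move=> mB; have [_ /(_ (0%N, 0%N) e B mB)] := x_iid. Qed.

(** Redrawing one entry independently preserves the law of the array. The two laws agree on
    cylinders, by independence and equidistribution, and the cylinders are stable under intersection
    and generate the sigma-algebra. *)
Let law_eq e A : (measurable : set (set cfgM)) A ->
  pushforward P (config : T -> cfgM) A =
  pushforward (P \x mu)%E (fun p : T * C => upd (config p.1) e p.2 : cfgM) A.
Proof.
move=> mA.
pose m1 : {measure set cfgM -> \bar R} :=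
  measure_function_pushforward__canonical__measure_function_Measure P mconfig.
pose m2 : {measure set cfgM -> \bar R} :=
  measure_function_pushforward__canonical__measure_function_Measure (P \x mu)%E (mupd e).
rewrite -[LHS]/(m1 A) -[RHS]/(m2 A).
have m1T : m1 setT = 1%E by rewrite /m1/= /pushforward preimage_setT probability_setT.
have cylT : cyl setT.
  exists fset0, (fun=> setT); split => //; apply/seteqP; split => // xi _ i /=.
have := @measure_unique _ R cfgM cyl (fun=> setT).
apply => //.
- by rewrite bigcup_const//; exists 0%N.
- move=> _ [J [B [mB ->]]].
  (* The constraint at [e] is made explicit, and trivial when [e] is outside J, so that every
     cylinder splits into a condition at [e] and a condition off [e]. *)
  pose B' i := if i == e then (if e \in J then B e else setT) else B i.
  pose K := (J `\ e)%fset.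
  have mB' i : measurable (B' i).
    by rewrite /B'; case: eqP => // _; case: ifP.
  have eK : e \notin K by rewrite !inE eqxx.
  have -> : \bigcap_(i in [set` J]) [set xi : cfg R | B i (xi i)] =
      [set xi | B' e (xi e)] `&` \bigcap_(i in [set` K]) [set xi : cfg R | B' i (xi i)].
    apply/seteqP; split => [xi h|xi [h h']].
      split => [|i /=]; first by rewrite /= /B' eqxx; case: ifPn => // /h.
      by rewrite !inE /= /B' => /andP[/negbTE -> iJ]; exact: h.
    move=> i /= iJ; case: (eqVneq i e) => [ie|ie].
      by move: h; rewrite /= /B' eqxx -ie iJ.
    by have := h' i; rewrite /= /B' (negbTE ie) !inE iJ ie; apply.
  clearbody B'.
  have indep (L : {fset nat * nat}) : P (\bigcap_(i in [set` L]) (x i @^-1` B' i)) =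
      (\prod_(i <- L) P (x i @^-1` B' i))%E.
    by have [h _] := x_iid; exact: h.
  have m1E : m1 ([set xi | B' e (xi e)] `&`
      \bigcap_(i in [set` K]) [set xi : cfg R | B' i (xi i)]) =
      (P (x e @^-1` B' e) * P (\bigcap_(i in [set` K]) (x i @^-1` B' i)))%E.
    rewrite indep -[RHS](@big_fsetU1 _ _ _ _ e K (fun i => P (x i @^-1` B' i)))// -indep.
    rewrite /m1 /= /pushforward; congr (P _).
    apply/seteqP; split => [t [h h'] i /=|t h].
      by rewrite !inE => /orP[/eqP ->//|ik]; apply: h'; rewrite /= !inE.
    split; first by apply: (h e); rewrite /= !inE eqxx.
    by move=> i /= iK; apply: (h i); rewrite /= !inE; move: iK; rewrite !inE => ->; rewrite orbT.
  have mK : measurable (\bigcap_(i in [set` K]) (x i @^-1` B' i)).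
    apply: fin_bigcap_measurable => // i _; rewrite -[X in measurable X]setTI.
    exact: measurable_funP.
  rewrite m1E -mu_x// muleC -product_measure1E//.
  rewrite /m2 /= /pushforward; congr ((P \x mu)%E _).
  apply/seteqP; split => [[t u] /= [h h']|[t u] /= [h h']]; split => /=.
  + by rewrite updE.
  + move=> i /= iK; have := h i iK; rewrite /= upd_neq//.
    by move: iK; rewrite !inE => /andP[].
  + move=> i /= iK; have := h' i iK; rewrite /= upd_neq//.
    by move: iK; rewrite !inE => /andP[].
  + by move: h; rewrite updE.
- move=> _; rewrite m1T; exact: ltry.
Qed.

(** The only use of the iid hypothesis on the law of the whole array: from here on probabilities are
    estimated by freezing all entries but those of one row. *)
Lemma resample e (f : cfg R -> \bar R) : (forall xi, 0 <= f xi)%E -> measf f ->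
  (\int[P]_t f (config t) = \int[P]_t E1 mu e f (config t))%E.
Proof.
move=> f0 mf; have mf' := measurable_from_cfgM mf.
transitivity (\int[pushforward P (config : T -> cfgM)]_xi f xi)%E.
  by rewrite ge0_integral_pushforward// preimage_setT.
transitivity (\int[pushforward (P \x mu)%E
    (fun p : T * C => upd (config p.1) e p.2 : cfgM)]_xi f xi)%E.
  exact: (@eq_measure_integral _ _ _ setT
    (measure_function_pushforward__canonical__measure_function_Measure
      (P \x mu)%E (mupd e))
    (measure_function_pushforward__canonical__measure_function_Measure
      P mconfig) f (fun A mA _ => law_eq e mA)).
rewrite ge0_integral_pushforward// preimage_setT/=.
rewrite (fubini_tonelli1 (m1 := P) (m2 := mu))//.
exact: (measurableT_comp mf' (mupd e)).
Qed.

(** Once all relevant entries are redrawn the iterated integral is constant, which is why [xi] is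
    arbitrary. *)
Lemma integral_config J (f : cfg R -> \bar R) xi : (forall xi, 0 <= f xi)%E ->
  measf f -> dep_on J f -> (\int[P]_t f (config t) = EJ mu J f xi)%E.
Proof.
move=> f0 mf fJ.
transitivity (\int[P]_t EJ mu J f (config t))%E.
  elim: J {fJ} => //= e J ->; rewrite (resample e)//; first exact: EJ_ge0.
  exact: EJ_meas.
under eq_integral do rewrite (EJ_dep mu fJ _ xi).
by rewrite integral_cst//= probability_setT mule1.
Qed.

End resampling.

(** * Squared moduli and measurable functions of the array *)

Section measurable_calculus.
Variable R : realType.
Notation C := R[i].

(** The squared modulus as a real number: a polynomial in the real and imaginary parts, free of
    square roots and of the partial order on complex numbers. *)
Definition nsq (z : C) : R := complex.Re z ^+ 2 + complex.Im z ^+ 2.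

Lemma nsq_ge0 z : 0 <= nsq z. Proof. by rewrite addr_ge0 ?sqr_ge0. Qed.

Lemma nsqE z : (nsq z)%:C = `|z| ^+ 2. Proof. exact: add_Re2_Im2. Qed.

Lemma nsqM z w : nsq (z * w) = nsq z * nsq w.
Proof. by case: z w => a b [c e]; rewrite /nsq /=; ring. Qed.

Lemma nsqN z : nsq (- z) = nsq z.
Proof. by case: z => a b; rewrite /nsq /= !sqrrN. Qed.

Lemma nsq1 : nsq 1 = 1. Proof. by rewrite /nsq /= expr1n expr0n addr0. Qed.

Lemma nsq0 : nsq 0 = 0. Proof. by rewrite /nsq /= expr0n addr0. Qed.

Lemma nsqX z n : nsq (z ^+ n) = nsq z ^+ n.
Proof. by elim: n => [|n IH]; rewrite ?expr0 ?nsq1// !exprS nsqM IH. Qed.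

Lemma nsq_prod (I : Type) (s : seq I) (Q : pred I) (F : I -> C) :
  nsq (\prod_(i <- s | Q i) F i) = \prod_(i <- s | Q i) nsq (F i).
Proof. by apply: (big_morph _ nsqM nsq1). Qed.

Lemma nsqC (r : R) : nsq r%:C = r ^+ 2.
Proof. by rewrite /nsq /= expr0n addr0. Qed.

Lemma nsq_eq0 z : (nsq z == 0) = (z == 0).
Proof.
case: z => a b; rewrite eq_complex /nsq /= paddr_eq0 ?sqr_ge0//.
by rewrite !expf_eq0.
Qed.

Lemma nsqJ z : nsq z^*%C = nsq z.
Proof. by case: z => a b; rewrite /nsq /= sqrrN. Qed.

Lemma nsqD z w : nsq (z + w) = nsq z + nsq w + 2 * complex.Re (z * w^*%C).
Proof. by case: z w => a b [c e]; rewrite /nsq /=; ring. Qed.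

Lemma normc_nsq z : Normc.normc z ^+ 2 = nsq z.
Proof. by case: z => a b; rewrite /= sqr_sqrtr// addr_ge0 ?sqr_ge0. Qed.

Definition cmeasf (f : cfg R -> C) :=
  measf (fun xi => complex.Re (f xi)) /\ measf (fun xi => complex.Im (f xi)).

Lemma measurable_Re : measurable_fun setT (@complex.Re R : C -> R).
Proof.
apply: (measurability _ (RGenOInfty.measurableE R)) => //.
move=> _ [_ [a ->] <-]; rewrite setTI; apply: sub_sigma_algebra.
suff : @open C [set z | a < complex.Re z].
  by congr open; apply/seteqP; split => z /=; rewrite in_itv /= andbT.
rewrite openE => z /= az.
apply/nbhs_ballP; exists (complex.Re z - a)%:C => /=; first by rewrite ltcR subr_gt0.
move=> w; rewrite /ball /= => /(le_lt_trans (normc_ge_Re _)).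
by rewrite ltcR raddfB/= ltr_distlC subKr => /andP[].
Qed.

Lemma measurable_Im : measurable_fun setT (@complex.Im R : C -> R).
Proof.
have ImE (z : C) : complex.Im z = complex.Re (- 'i * z).
  by case: z => a b /=; ring.
apply: (measurability _ (RGenOInfty.measurableE R)) => //.
move=> _ [_ [a ->] <-]; rewrite setTI; apply: sub_sigma_algebra.
suff : @open C [set z | a < complex.Im z].
  by congr open; apply/seteqP; split => z /=; rewrite in_itv /= andbT.
rewrite openE => z /= az.
apply/nbhs_ballP; exists (complex.Im z - a)%:C => /=; first by rewrite ltcR subr_gt0.
move=> w; rewrite /ball /= => zw.
have : `|-'i * z - -'i * w| < (complex.Im z - a)%:C :> C.
  rewrite -mulrBr normrM normrN.
  suff -> : `|'i| = 1 :> C by rewrite mul1r.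
  by rewrite normc_def /= expr0n /= expr1n add0r sqrtr1.
move=> /(le_lt_trans (normc_ge_Re _)).
by rewrite ltcR raddfB/= -!ImE ltr_distlC subKr => /andP[].
Qed.

Lemma cmeasf_coord e : cmeasf (fun xi => xi e).
Proof.
split; apply: (measf_comp (f := fun xi : cfg R => xi e : C));
  by [exact: measurable_Re|exact: measurable_Im|exact: measf_coord].
Qed.

Implicit Types f g : cfg R -> R.

Lemma measfD f g : measf f -> measf g -> measf (fun xi => f xi + g xi).
Proof. by move=> mf mg d S Xi mXi; apply: measurable_funD; [exact: mf|exact: mg]. Qed.

Lemma measfM f g : measf f -> measf g -> measf (fun xi => f xi * g xi).
Proof. by move=> mf mg d S Xi mXi; apply: measurable_funM; [exact: mf|exact: mg]. Qed.

Lemma measfN f : measf f -> measf (fun xi => - f xi).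
Proof. by move=> mf d S Xi mXi; apply: measurable_funN; exact: mf. Qed.

Lemma measfB f g : measf f -> measf g -> measf (fun xi => f xi - g xi).
Proof. by move=> mf mg; apply: measfD => //; exact: measfN. Qed.

Lemma measfX f n : measf f -> measf (fun xi => f xi ^+ n).
Proof.
move=> mf; elim: n => [|n IH]; first exact: measf_cst.
by under eq_fun do rewrite exprS; exact: measfM.
Qed.

Lemma measf_sum (I : Type) (s : seq I) (Q : pred I) (h : I -> cfg R -> R) :
  (forall i, measf (h i)) -> measf (fun xi => \sum_(i <- s | Q i) h i xi).
Proof.
move=> mh; elim: s => [|i s IH].
  by under eq_fun do rewrite big_nil; exact: measf_cst.
under eq_fun do rewrite big_cons; case: (Q i) => //; exact: measfD.
Qed.

Lemma measf_prod (I : Type) (s : seq I) (Q : pred I) (h : I -> cfg R -> R) :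
  (forall i, measf (h i)) -> measf (fun xi => \prod_(i <- s | Q i) h i xi).
Proof.
move=> mh; elim: s => [|i s IH].
  by under eq_fun do rewrite big_nil; exact: measf_cst.
under eq_fun do rewrite big_cons; case: (Q i) => //; exact: measfM.
Qed.

Lemma measf_EFin f : measf f -> measf (fun xi => (f xi)%:E).
Proof. by move=> mf d S Xi mXi; apply/measurable_EFinP; exact: mf. Qed.

Lemma measf_le f g : measf f -> measf g -> measf (fun xi => f xi <= g xi).
Proof. by move=> mf mg d S Xi mXi; apply: measurable_fun_ler; [exact: mf|exact: mg]. Qed.

Lemma measf_lt f g : measf f -> measf g -> measf (fun xi => f xi < g xi).
Proof. by move=> mf mg d S Xi mXi; apply: measurable_fun_ltr; [exact: mf|exact: mg]. Qed.

Lemma measurable_of_bool d' (T' : measurableType d') (h : bool -> T') :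
  measurable_fun setT h.
Proof. by move=> _ B _. Qed.

Lemma measf_ind (b : cfg R -> bool) : measf b -> measf (fun xi => (b xi)%:R : R).
Proof.
by move=> mb; apply: (measf_comp (g := fun c : bool => c%:R : R)).
Qed.

Lemma measf_neg (b : cfg R -> bool) : measf b -> measf (fun xi => ~~ b xi).
Proof.
by move=> mb; apply: (measf_comp (g := negb)) => //; exact: measurable_of_bool.
Qed.

Lemma measf_and (b c : cfg R -> bool) : measf b -> measf c ->
  measf (fun xi => b xi && c xi).
Proof.
move=> /measf_ind mb /measf_ind mc.
have -> : (fun xi => b xi && c xi) = (fun xi => 0 < (b xi)%:R * (c xi)%:R :> R).
  by apply/funext => xi; case: (b xi); case: (c xi); rewrite ?mulr1 ?mulr0 ?ltr01 ?ltxx.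
by apply: measf_lt; [exact: measf_cst|exact: measfM].
Qed.

Lemma measf_or (b c : cfg R -> bool) : measf b -> measf c ->
  measf (fun xi => b xi || c xi).
Proof.
move=> mb mc; have -> : (fun xi => b xi || c xi) = (fun xi => ~~ (~~ b xi && ~~ c xi)).
  by apply/funext => xi; rewrite negb_and !negbK.
by apply: measf_neg; apply: measf_and; exact: measf_neg.
Qed.

Lemma measf_has (I : Type) (s : seq I) (b : I -> cfg R -> bool) :
  (forall i, measf (b i)) -> measf (fun xi => has (fun i => b i xi) s).
Proof.
by move=> mb; elim: s => [|i s IH] /=; [exact: measf_cst|exact: measf_or].
Qed.

Lemma measf_all (I : Type) (s : seq I) (b : I -> cfg R -> bool) :
  (forall i, measf (b i)) -> measf (fun xi => all (fun i => b i xi) s).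
Proof.
by move=> mb; elim: s => [|i s IH] /=; [exact: measf_cst|exact: measf_and].
Qed.

Implicit Types F G : cfg R -> C.

Lemma cmeasf_cst c : cmeasf (fun=> c).
Proof. by split; exact: measf_cst. Qed.

Lemma cmeasfD F G : cmeasf F -> cmeasf G -> cmeasf (fun xi => F xi + G xi).
Proof.
move=> [F1 F2] [G1 G2]; split; under eq_fun do rewrite raddfD; exact: measfD.
Qed.

Lemma cmeasfN F : cmeasf F -> cmeasf (fun xi => - F xi).
Proof. by move=> [F1 F2]; split; under eq_fun do rewrite raddfN; exact: measfN. Qed.

Lemma cmeasfB F G : cmeasf F -> cmeasf G -> cmeasf (fun xi => F xi - G xi).
Proof. by move=> mF mG; apply: cmeasfD => //; exact: cmeasfN. Qed.

Lemma cmeasfM F G : cmeasf F -> cmeasf G -> cmeasf (fun xi => F xi * G xi).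
Proof.
have ReM (z w : C) : complex.Re (z * w) =
    complex.Re z * complex.Re w - complex.Im z * complex.Im w by case: z w => ? ? [].
have ImM (z w : C) : complex.Im (z * w) =
    complex.Re z * complex.Im w + complex.Im z * complex.Re w by case: z w => ? ? [].
move=> [F1 F2] [G1 G2]; split.
  by under eq_fun do rewrite ReM; apply: measfB; exact: measfM.
by under eq_fun do rewrite ImM; apply: measfD; exact: measfM.
Qed.

Lemma cmeasfJ F : cmeasf F -> cmeasf (fun xi => (F xi)^*%C).
Proof.
have ReJ (z : C) : complex.Re z^*%C = complex.Re z by case: z.
have ImJ (z : C) : complex.Im z^*%C = - complex.Im z by case: z.
move=> [F1 F2]; split; first by under eq_fun do rewrite ReJ.
by under eq_fun do rewrite ImJ; exact: measfN.
Qed.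

Lemma cmeasf_sum (I : Type) (s : seq I) (Q : pred I) (h : I -> cfg R -> C) :
  (forall i, cmeasf (h i)) -> cmeasf (fun xi => \sum_(i <- s | Q i) h i xi).
Proof.
move=> mh; elim: s => [|i s IH].
  by under eq_fun do rewrite big_nil; exact: cmeasf_cst.
under eq_fun do rewrite big_cons; case: (Q i) => //; exact: cmeasfD.
Qed.

Lemma cmeasf_prod (I : Type) (s : seq I) (Q : pred I) (h : I -> cfg R -> C) :
  (forall i, cmeasf (h i)) -> cmeasf (fun xi => \prod_(i <- s | Q i) h i xi).
Proof.
move=> mh; elim: s => [|i s IH].
  by under eq_fun do rewrite big_nil; exact: cmeasf_cst.
under eq_fun do rewrite big_cons; case: (Q i) => //; exact: cmeasfM.
Qed.

Lemma measf_nsq F : cmeasf F -> measf (fun xi => nsq (F xi)).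
Proof. by move=> [F1 F2]; apply: measfD; exact: measfX. Qed.

Definition mxmeasf m n (A : cfg R -> 'M[C]_(m, n)) :=
  forall i j, cmeasf (fun xi => A xi i j).

Lemma mxmeasfM m n p (A : cfg R -> 'M[C]_(m, n)) (B : cfg R -> 'M[C]_(n, p)) :
  mxmeasf A -> mxmeasf B -> mxmeasf (fun xi => A xi *m B xi).
Proof.
move=> mA mB i j; under eq_fun do rewrite mxE.
by apply: cmeasf_sum => k; exact: cmeasfM.
Qed.

Lemma cmeasf_det n (A : cfg R -> 'M[C]_n) : mxmeasf A -> cmeasf (fun xi => \det (A xi)).
Proof.
move=> mA; rewrite /determinant; apply: cmeasf_sum => s.
by apply: cmeasfM; [exact: cmeasf_cst|exact: cmeasf_prod].
Qed.

End measurable_calculus.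

(** * Volumes of rows *)

Section hermitian_algebra.
Variable C : numClosedFieldType.

Definition frob m n (A : 'M[C]_(m, n)) : C := \sum_i \sum_j `|A i j| ^+ 2.

Lemma trmxCM m n p (A : 'M[C]_(m, n)) (B : 'M[C]_(n, p)) :
  (A *m B)^t* = B^t* *m A^t*.
Proof. by rewrite trmx_mul map_mxM. Qed.

Lemma trmxCD m n (A B : 'M[C]_(m, n)) : (A + B)^t* = A^t* + B^t*.
Proof. by rewrite linearD /= map_mxD. Qed.

Lemma trmxCB m n (A B : 'M[C]_(m, n)) : (A - B)^t* = A^t* - B^t*.
Proof. by rewrite linearB /= map_mxB. Qed.

Lemma trmxCZ m n (a : C) (A : 'M[C]_(m, n)) : (a *: A)^t* = a^* *: A^t*.
Proof. by rewrite linearZ /= map_mxZ. Qed.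

Lemma trmxC1 n : (1%:M : 'M[C]_n)^t* = 1%:M.
Proof. by rewrite trmx1 map_mx1. Qed.

Lemma frobE m n (A : 'M[C]_(m, n)) : frob A = \tr (A *m A^t*).
Proof.
apply: eq_bigr => i _; rewrite mxE; apply: eq_bigr => j _.
by rewrite !mxE normCK.
Qed.

Lemma frob_ge0 m n (A : 'M[C]_(m, n)) : 0 <= frob A.
Proof. by apply: sumr_ge0 => i _; apply: sumr_ge0 => j _; rewrite exprn_ge0. Qed.

Lemma frob_eq0 m n (A : 'M[C]_(m, n)) : (frob A == 0) = (A == 0).
Proof.
apply/eqP/eqP => [A0|->]; last first.
  by rewrite /frob big1// => i _; rewrite big1// => j _; rewrite mxE normr0 expr0n.
apply/matrixP => i j; rewrite mxE; apply/eqP; rewrite -normr_eq0 -sqrf_eq0.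
have s0 k : 0 <= \sum_l `|A k l| ^+ 2 by apply: sumr_ge0 => l _; rewrite exprn_ge0.
move: A0 => /eqP; rewrite psumr_eq0// => /allP/(_ i (mem_index_enum _))/=.
rewrite psumr_eq0; first by move=> /allP/(_ j (mem_index_enum _)).
by move=> l _; rewrite exprn_ge0.
Qed.

Lemma frobZ m n a (A : 'M[C]_(m, n)) : frob (a *: A) = `|a| ^+ 2 * frob A.
Proof.
rewrite /frob mulr_sumr; apply: eq_bigr => i _; rewrite mulr_sumr.
by apply: eq_bigr => j _; rewrite mxE normrM exprMn.
Qed.

Lemma frob_tr m n (A : 'M[C]_(m, n)) : frob (A^t*) = frob A.
Proof.
rewrite /frob exchange_big; apply: eq_bigr => i _; apply: eq_bigr => j _.
by rewrite !mxE norm_conjC.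
Qed.

Lemma frob_row n (v : 'rV[C]_n) : frob v = (v *m v^t*) 0 0.
Proof. by rewrite frobE /mxtrace big_ord1. Qed.

Lemma frobD_orth m n (A B : 'M[C]_(m, n)) : A *m B^t* = 0 ->
  frob (A + B) = frob A + frob B.
Proof.
move=> AB; rewrite !frobE trmxCD mulmxDr !mulmxDl AB add0r.
have -> : B *m A^t* = 0.
  by rewrite -[LHS]trmxCK trmxCM trmxCK AB trmx0 map_mx0.
by rewrite addr0 raddfD.
Qed.

(** Parallelogram law: the two sides differ by [frob (A - B)]. *)
Lemma frobD_le m n (A B : 'M[C]_(m, n)) : frob (A + B) <= 2 * (frob A + frob B).
Proof.
rewrite -subr_ge0; suff -> : 2 * (frob A + frob B) - frob (A + B) = frob (A - B).
  exact: frob_ge0.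
rewrite !frobE trmxCD trmxCB mulmxBr !mulmxDr !mulmxDl !mulNmx !raddfD /= !raddfN/=.
ring.
Qed.

(** The sum of the |A b_i - S conj(a_i)|^2 is nonnegative and equals A (A B - |S|^2). *)
Lemma CauchySchwarz_sum (I : finType) (a b : I -> C) :
  `|\sum_i a i * b i| ^+ 2 <= (\sum_i `|a i| ^+ 2) * (\sum_i `|b i| ^+ 2).
Proof.
set A := \sum_i `|a i| ^+ 2; set B := \sum_i `|b i| ^+ 2; set S := \sum_i a i * b i.
have A0 : 0 <= A by apply: sumr_ge0 => i _; rewrite exprn_ge0.
have [Az|An0] := eqVneq A 0.
  suff -> : S = 0 by rewrite normr0 expr0n Az mul0r.
  apply: big1 => i _; suff -> : a i = 0 by rewrite mul0r.
  move: Az => /eqP; rewrite psumr_eq0; last by move=> k _; rewrite exprn_ge0.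
  by move=> /allP/(_ i (mem_index_enum _)); rewrite sqrf_eq0 normr_eq0 => /eqP.
have key : 0 <= \sum_i `|A * b i - S * (a i)^*| ^+ 2.
  by apply: sumr_ge0 => i _; rewrite exprn_ge0.
have Ar : A^* = A by apply: geC0_conj.
have E : \sum_i `|A * b i - S * (a i)^*| ^+ 2 = A * (A * B - `|S| ^+ 2).
  transitivity (\sum_i (A ^+ 2 * `|b i| ^+ 2 - A * S^* * (a i * b i)
     - A * S * (a i * b i)^* + `|S| ^+ 2 * `|a i| ^+ 2)).
    apply: eq_bigr => i _; rewrite !normCK rmorphB !rmorphM /= Ar conjCK; ring.
  rewrite !big_split /= !sumrN -!mulr_sumr -/A -/B -/S -rmorph_sum /= -/S.
  rewrite normCK; ring.
move: key; rewrite E pmulr_rge0; last by rewrite lt_def An0.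
by rewrite subr_ge0.
Qed.

Lemma frobM_le m n p (A : 'M[C]_(m, n)) (B : 'M[C]_(n, p)) :
  frob (A *m B) <= frob A * frob B.
Proof.
have -> : frob B = \sum_k \sum_j `|B j k| ^+ 2 by rewrite /frob exchange_big.
rewrite /frob mulr_suml; apply: ler_sum => i _.
rewrite mulr_sumr; apply: ler_sum => k _; rewrite mxE.
exact: CauchySchwarz_sum.
Qed.

Definition isproj n (P : 'M[C]_n) := P^t* = P /\ P *m P = P.

Lemma proj_compl n (P : 'M[C]_n) : isproj P -> isproj (1%:M - P).
Proof.
move=> [Ph P2]; split; first by rewrite trmxCB trmxC1 Ph.
by rewrite mulmxBr !mulmxBl !mulmx1 !mul1mx P2 subrr subr0.
Qed.

Lemma frob_proj m n (P : 'M[C]_n) (A : 'M[C]_(m, n)) : isproj P ->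
  frob A = frob (A *m P) + frob (A *m (1%:M - P)).
Proof.
move=> hP; have [Ph P2] := hP; have [Qh Q2] := proj_compl hP.
rewrite -frobD_orth; first by rewrite -mulmxDr addrC subrK mulmx1.
by rewrite trmxCM Qh mulmxA -(mulmxA A) mulmxBr mulmx1 P2 subrr mulmx0 mul0mx.
Qed.

Lemma frob_proj_le m n (P : 'M[C]_n) (A : 'M[C]_(m, n)) : isproj P ->
  frob (A *m P) <= frob A.
Proof. by move=> hP; rewrite [leRHS](frob_proj A hP) lerDl frob_ge0. Qed.

Lemma proj_diag n (P : 'M[C]_n) i : isproj P -> P i i = frob (row i P).
Proof.
move=> [Ph P2]; rewrite -{1}P2 mxE /frob big_ord1; apply: eq_bigr => j _.
rewrite mxE normCK -{2}Ph !mxE //.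
Qed.

Definition obasis m n (A : 'M[C]_(m, n)) : 'M[C]_(\rank A, n) := schmidt (row_base A).

Lemma obasis_unitary m n (A : 'M[C]_(m, n)) : obasis A *m (obasis A)^t* = 1%:M.
Proof. by apply/unitarymxP; rewrite schmidt_unitarymx// rank_leq_col. Qed.

Lemma eq_obasis m n (A : 'M[C]_(m, n)) : (obasis A :=: A)%MS.
Proof.
apply: eqmx_trans (eq_row_base A); apply: eqmx_schmidt_free.
exact: row_base_free.
Qed.

(** Orthogonal projection onto the row space. Matrices act on rows from the right, so
    [B *m pcompl A] holds the components of the rows of B orthogonal to those of A. *)
Definition pspan m n (A : 'M[C]_(m, n)) : 'M[C]_n := (obasis A)^t* *m obasis A.
Definition pcompl m n (A : 'M[C]_(m, n)) : 'M[C]_n := 1%:M - pspan A.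

Lemma pspan_proj m n (A : 'M[C]_(m, n)) : isproj (pspan A).
Proof.
split; first by rewrite trmxCM trmxCK.
by rewrite /pspan mulmxA -(mulmxA _ (obasis A)) obasis_unitary mulmx1.
Qed.

Lemma pcompl_proj m n (A : 'M[C]_(m, n)) : isproj (pcompl A).
Proof. exact: proj_compl (pspan_proj A). Qed.

Lemma pspan_trace m n (A : 'M[C]_(m, n)) : \tr (pspan A) = (\rank A)%:R.
Proof. by rewrite mxtrace_mulC obasis_unitary mxtrace1. Qed.

Lemma pcompl_trace m n (A : 'M[C]_(m, n)) : \tr (pcompl A) = (n - \rank A)%:R.
Proof. by rewrite raddfB /= mxtrace1 pspan_trace natrB// rank_leq_col. Qed.

Lemma pspan_id m n p (A : 'M[C]_(m, n)) (B : 'M[C]_(p, n)) : (B <= A)%MS ->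
  B *m pspan A = B.
Proof.
rewrite -(eq_obasis A) => /submxP[D ->].
by rewrite /pspan mulmxA -(mulmxA D) obasis_unitary mulmx1.
Qed.

Lemma pspan_sub m n p (A : 'M[C]_(m, n)) (B : 'M[C]_(p, n)) :
  (B *m pspan A <= A)%MS.
Proof. by rewrite /pspan mulmxA -(eq_obasis A) submxMl. Qed.

Lemma pcompl_sub0 m n p (A : 'M[C]_(m, n)) (B : 'M[C]_(p, n)) : (B <= A)%MS ->
  B *m pcompl A = 0.
Proof. by move=> BA; rewrite mulmxBr mulmx1 pspan_id// subrr. Qed.

Lemma pcompl_id m n p (A : 'M[C]_(m, n)) (B : 'M[C]_(p, n)) : B *m A^t* = 0 ->
  B *m pcompl A = B.
Proof.
move=> BA; rewrite mulmxBr mulmx1 /pspan mulmxA.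
have /submxP[D ->] : (obasis A <= A)%MS by rewrite eq_obasis.
by rewrite trmxCM !mulmxA BA !mul0mx subr0.
Qed.

(** Squared volume of the parallelepiped spanned by the rows. *)
Definition gdet m n (A : 'M[C]_(m, n)) : C := \det (A *m A^t*).

Lemma gram_free m n (A : 'M[C]_(m, n)) : row_free A -> A *m A^t* \in unitmx.
Proof.
move=> Af; rewrite -row_free_unit -kermx_eq0; apply/eqP.
apply/row_matrixP => i; rewrite row0; set u := row i _.
have uA : u *m (A *m A^t*) = 0 by rewrite /u -row_mul mulmx_ker row0.
have : frob (u *m A) = 0.
  by rewrite frobE trmxCM mulmxA -(mulmxA u) uA mul0mx raddf0.
move/eqP; rewrite frob_eq0 => /eqP uA0.
by apply: (row_free_inj Af); rewrite mul0mx.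
Qed.

Lemma gdet_neq0 m n (A : 'M[C]_(m, n)) : (gdet A != 0) = row_free A.
Proof.
apply/idP/idP => [d0|/gram_free]; last by rewrite unitmxE unitfE.
rewrite -kermx_eq0; apply/eqP.
have AU : A *m A^t* \in unitmx by rewrite unitmxE unitfE.
by rewrite -[LHS](mulmxK AU) mulmxA mulmx_ker !mul0mx.
Qed.

(* Distances to the span of the other rows are ratios of Gram determinants:
   subtracting from row i its projection leaves u A with u_i = 1, and
   u A A^H is a multiple of the i-th basis vector. *)
Lemma gdet_row m n (A : 'M[C]_(m.+1, n)) i :
  gdet A = gdet (row' i A) * frob (row i A *m pcompl (row' i A)).
Proof.
set B := row' i A; set y := row i A; set v := y *m pcompl B.
have [Bf|] := boolP (row_free B); last first.
  rewrite -gdet_neq0 negbK => /eqP B0; rewrite B0 mul0r; apply/eqP.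
  rewrite -[_ == 0]negbK gdet_neq0; apply/negP => Af.
  move/eqP: B0; apply/negP; rewrite gdet_neq0 -kermx_eq0; apply/eqP.
  apply/row_matrixP => k; rewrite row0; set w := row k _.
  have wB : w *m B = 0 by rewrite /w -row_mul mulmx_ker row0.
  clearbody w.
  pose w' : 'rV[C]_m.+1 := \row_j (if unlift i j is Some k then w 0 k else 0).
  have w'A : w' *m A = 0.
    rewrite -wB; apply/rowP => j; rewrite mxE (bigD1_ord i)//= mxE unlift_none mul0r add0r.
    by rewrite mxE; apply: eq_bigr => q _; rewrite !mxE liftK.
  have : w' = 0 by apply: (row_free_inj Af); rewrite mul0mx.
  move=> /rowP w'0; apply/rowP => j; have := w'0 (lift i j).
  by rewrite !mxE liftK.
have vB : v *m B^t* = 0.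
  have [Ph _] := pcompl_proj B.
  rewrite /v -{1}Ph -mulmxA -trmxCM pcompl_sub0//.
  by rewrite trmx0 map_mx0 mulmx0.
have vy : v *m y^t* = (frob v)%:M.
  have [Ph P2] := pcompl_proj B.
  apply/matrixP => a b; rewrite !ord1 [RHS]mxE mulr1n frob_row.
  congr (fun_of_matrix _ _ _).
  by rewrite /v trmxCM Ph !mulmxA -(mulmxA y (pcompl B) (pcompl B)) P2.
have [u uA ui] : exists2 u : 'rV[C]_m.+1, u *m A = v & u 0 i = 1.
  have /submxP[w yw] := pspan_sub B y.
  pose u : 'rV[C]_m.+1 := \row_j (if unlift i j is Some k then - w 0 k else 1).
  have ui : u 0 i = 1 by rewrite mxE unlift_none.
  have ul k : u 0 (lift i k) = - w 0 k by rewrite mxE liftK.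
  exists u => //; rewrite /v mulmxBr mulmx1 yw.
  apply/rowP => j.
  transitivity (A i j - \sum_k w 0 k * A (lift i k) j).
    rewrite mxE (bigD1_ord i)//= ui mul1r -sumrN; congr (_ + _).
    by apply: eq_bigr => k _; rewrite ul mulNr.
  have -> : \sum_k w 0 k * A (lift i k) j = (w *m B) 0 j.
    by rewrite mxE; apply: eq_bigr => k _; rewrite [in RHS]mxE.
  have yj : y 0 j = A i j by rewrite mxE.
  by rewrite -yj [RHS]mxE [X in _ = _ + X]mxE.
clearbody v.
have uG : u *m (A *m A^t*) = frob v *: delta_mx 0 i.
  rewrite mulmxA uA; apply/rowP => j; rewrite [RHS]mxE [X in _ * X]mxE eqxx /=.
  have -> : (v *m A^t*) 0 j = (v *m (row j A)^t*) 0 0.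
    by rewrite !mxE; apply: eq_bigr => l _; rewrite !mxE.
  case: (unliftP i j) => [k ->|->].
    rewrite eq_sym (negbTE (neq_lift _ _)) mulr0.
    transitivity ((v *m B^t*) 0 k); last by rewrite vB mxE.
    by rewrite !mxE; apply: eq_bigr => l _; rewrite !mxE.
  by rewrite -/y vy mxE !eqxx mulr1.
have := congr1 (fun M => (M *m \adj (A *m A^t*)) 0 i) uG.
rewrite -mulmxA mul_mx_adj mul_mx_scalar mxE ui mulr1.
rewrite -/(gdet A) -scalemxAl mxE => ->.
rewrite mulrC; congr (_ * _).
rewrite -rowE 2!mxE /cofactor addnn -signr_odd odd_double expr0 mul1r /gdet.
congr (\det _); apply/matrixP => a b; rewrite !mxE; apply: eq_bigr => l _.
by rewrite !mxE.
Qed.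

Lemma gdet_nil n (A : 'M[C]_(0, n)) : gdet A = 1.
Proof. by rewrite /gdet det_mx00. Qed.

Lemma gdet_ge0 m n (A : 'M[C]_(m, n)) : 0 <= gdet A.
Proof.
elim: m A => [|m IH] A; first by rewrite gdet_nil.
by rewrite (gdet_row A ord_max) mulr_ge0 ?IH ?frob_ge0.
Qed.

Lemma gdet_row_le m n (A : 'M[C]_(m.+1, n)) i :
  gdet A <= gdet (row' i A) * frob (row i A).
Proof.
rewrite (gdet_row A i) ler_wpM2l ?gdet_ge0//.
exact/frob_proj_le/pcompl_proj.
Qed.

Lemma hadamard m n (A : 'M[C]_(m, n)) : gdet A <= \prod_i frob (row i A).
Proof.
elim: m A => [|m IH] A; first by rewrite gdet_nil big_ord0.
apply: (le_trans (gdet_row_le A ord_max)).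
rewrite big_ord_recr /= ler_wpM2r ?frob_ge0//.
apply: (le_trans (IH _)); rewrite le_eqVlt; apply/orP; left; apply/eqP.
apply: eq_bigr => k _; congr frob; apply/rowP => j; rewrite !mxE.
by congr (A _ _); apply: val_inj; rewrite /= /bump leqNgt ltn_ord.
Qed.

End hermitian_algebra.

(** * Moments and anticoncentration of one entry *)

Section one_entry.
Variable R : realType.
Notation C := R[i].
Variable mu : probability C R.

(** The mean of u^2 is left free, so the real and imaginary parts may have any covariance matrix of
    trace one. *)
Definition std_law :=
  [/\ (\int[mu]_u (nsq u)%:E = 1)%E, (\int[mu]_u (complex.Re u)%:E = 0)%E &
      (\int[mu]_u (complex.Im u)%:E = 0)%E].

Hypothesis mu_std : std_law.

Lemma measurable_of_measf d (T' : measurableType d) (g : C -> T') :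
  measf (fun xi : cfg R => g (xi (0%N, 0%N))) -> measurable_fun setT g.
Proof. by move=> mg; apply: (mg _ C (fun u _ => u)) => e; exact: measurable_id. Qed.

Lemma measurable_nsq : measurable_fun setT (@nsq R : C -> R).
Proof. by apply: measurable_of_measf; apply: measf_nsq; exact: cmeasf_coord. Qed.

Lemma integrable_nsq : mu.-integrable setT (fun u : C => (nsq u)%:E).
Proof.
have [h _ _] := mu_std; apply/integrableP; split.
  by apply/measurable_EFinP; exact: measurable_nsq.
under eq_integral do rewrite gee0_abs ?lee_fin ?nsq_ge0//.
by rewrite h ltry.
Qed.

Let sqr_le (a b : R) : `|a| <= 1 + (a ^+ 2 + b ^+ 2).
Proof.
have := sqr_ge0 (`|a| - 1); rewrite sqrrB expr1n mulr1 real_normK ?num_real// => h.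
have := sqr_ge0 b; have := sqr_ge0 a; have := normr_ge0 a; lra.
Qed.

Let integrable_1nsq : mu.-integrable setT (fun u : C => (1 + nsq u)%:E).
Proof.
under eq_fun do rewrite EFinD.
apply: integrableD => //; last exact: integrable_nsq.
exact: finite_measure_integrable_cst.
Qed.

Lemma integrable_Re : mu.-integrable setT (fun u : C => (complex.Re u)%:E).
Proof.
apply: (le_integrable _ _ _ integrable_1nsq) => //.
  by apply/measurable_EFinP; exact: measurable_Re.
move=> u _; rewrite [leRHS]gee0_abs; last by rewrite lee_fin addr_ge0 ?nsq_ge0.
by rewrite /= lee_fin; exact: sqr_le.
Qed.

Lemma integrable_Im : mu.-integrable setT (fun u : C => (complex.Im u)%:E).
Proof.
apply: (le_integrable _ _ _ integrable_1nsq) => //.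
  by apply/measurable_EFinP; exact: measurable_Im.
move=> u _; rewrite [leRHS]gee0_abs; last by rewrite lee_fin addr_ge0 ?nsq_ge0.
rewrite /= lee_fin.
by have := sqr_le (complex.Im u) (complex.Re u); rewrite [X in 1 + X]addrC.
Qed.

Lemma int_quad c0 c1 c2 c3 :
  (\int[mu]_u (c0 + c1 * complex.Re u + c2 * complex.Im u + c3 * nsq u)%:E
    = (c0 + c3)%:E)%E.
Proof.
have [h1 h2 h3] := mu_std.
have i0 : mu.-integrable setT (fun=> c0%:E : \bar R).
  exact: finite_measure_integrable_cst.
have i1 : mu.-integrable setT (fun u : C => (c1%:E * (complex.Re u)%:E)%E).
  by apply: integrableZl => //; exact: integrable_Re.
have i2 : mu.-integrable setT (fun u : C => (c2%:E * (complex.Im u)%:E)%E).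
  by apply: integrableZl => //; exact: integrable_Im.
have i3 : mu.-integrable setT (fun u : C => (c3%:E * (nsq u)%:E)%E).
  by apply: integrableZl => //; exact: integrable_nsq.
under eq_integral do rewrite !EFinD !EFinM.
rewrite integralD//; last by do 2?[apply: integrableD => //].
rewrite integralD//; last by apply: integrableD.
rewrite integralD// !integralZl//;
  [|exact: integrable_nsq|exact: integrable_Im|exact: integrable_Re].
rewrite h1 h2 h3 !mule0 !adde0 mule1 integral_cst//= probability_setT mule1.
by rewrite EFinD.
Qed.

Lemma int_affine (a b : C) :
  (\int[mu]_u (nsq (u * a + b))%:E = (nsq a + nsq b)%:E)%E.
Proof.
transitivity (\int[mu]_u (nsq b + 2 * complex.Re (a * b^*%C) * complex.Re u
   + (- 2 * complex.Im (a * b^*%C)) * complex.Im u + nsq a * nsq u)%:E)%E.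
  apply: eq_integral => u _; congr EFin.
  by case: u a b => [u1 u2] [a1 a2] [b1 b2]; rewrite /nsq /=; ring.
by rewrite int_quad addrC.
Qed.

(** Only an inequality, since the mean of u^2 is free. Adding 4 Im(u b)^2 completes the quadratic
    part to 4 |u|^2 |b|^2, whose mean is known. *)
Lemma int_reaffine (b : C) (c : R) :
  (\int[mu]_u ((2 * complex.Re (u * b) + c) ^+ 2)%:E <= (4 * nsq b + c ^+ 2)%:E)%E.
Proof.
rewrite [4 * _ + _]addrC -(int_quad _ (4 * c * complex.Re b) (- (4 * c * complex.Im b))).
have E (u : C) : c ^+ 2 + 4 * c * complex.Re b * complex.Re u
    + - (4 * c * complex.Im b) * complex.Im u + 4 * nsq b * nsq u =
    (2 * complex.Re (u * b) + c) ^+ 2 + 4 * (complex.Im (u * b)) ^+ 2.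
  by case: u b => [u1 u2] [b1 b2]; rewrite /nsq /=; ring.
have m1 : cmeasf (fun xi : cfg R => xi (0%N, 0%N) * b).
  by apply: cmeasfM; [exact: cmeasf_coord|exact: cmeasf_cst].
have m2 : measf (fun xi : cfg R => (2 * complex.Re (xi (0%N, 0%N) * b) + c) ^+ 2).
  apply: measfX; apply: measfD; last exact: measf_cst.
  by apply: measfM; [exact: measf_cst|case: m1].
under [leRHS]eq_integral do rewrite E.
apply: ge0_le_integral => //.
- by move=> u _; rewrite lee_fin sqr_ge0.
- by apply/measurable_EFinP; exact: measurable_of_measf.
- apply/measurable_EFinP; apply: measurable_of_measf; apply: measfD => //.
  by apply: measfM; [exact: measf_cst|apply: measfX; case: m1].
- by move=> u _; rewrite lee_fin lerDl mulr_ge0 ?sqr_ge0.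
Qed.

(** The square of |u|^2 need not be integrable; truncation restores a variance at the cost of a
    small bias in the mean. *)
Definition ntrunc (L : R) (u : C) : R := if nsq u <= L then nsq u else 0.

Lemma ntrunc_ge0 L u : 0 <= ntrunc L u.
Proof. by rewrite /ntrunc; case: ifP => // _; exact: nsq_ge0. Qed.

Lemma ntrunc_le L u : 0 <= L -> ntrunc L u <= L.
Proof. by rewrite /ntrunc; case: ifP. Qed.

Lemma ntrunc_nsq L u : ntrunc L u <= nsq u.
Proof. by rewrite /ntrunc; case: ifP => // _; exact: nsq_ge0. Qed.

Lemma measf_ntrunc L e : measf (fun xi : cfg R => ntrunc L (xi e)).
Proof.
have mn : measf (fun xi : cfg R => nsq (xi e)).
  by apply: measf_nsq; exact: cmeasf_coord.
have -> : (fun xi : cfg R => ntrunc L (xi e)) =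
    (fun xi => (nsq (xi e) <= L)%R%:R * nsq (xi e)).
  by apply/funext => xi; rewrite /ntrunc; case: ifP; rewrite ?mul1r ?mul0r.
by apply: measfM => //; apply: measf_ind; apply: measf_le => //; exact: measf_cst.
Qed.

(** Monotone convergence of the truncated second moments to the full one, which is 1. *)
Lemma ntrunc_tail (k : R) : 0 < k -> exists2 L, 0 < L &
  exists2 m, (\int[mu]_u (ntrunc L u)%:E = m%:E)%E & 1 - k <= m <= 1.
Proof.
move=> k0.
have mt L : measurable_fun setT (fun u : C => (ntrunc L u)%:E).
  by apply/measurable_EFinP; apply: measurable_of_measf; exact: measf_ntrunc.
have fin L : (\int[mu]_u (ntrunc L u)%:E <= 1)%E.
  have [<- _ _] := mu_std; apply: ge0_le_integral => //.
  - by move=> u _; rewrite lee_fin ntrunc_ge0.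
  - by apply/measurable_EFinP; exact: measurable_nsq.
  - by move=> u _; rewrite lee_fin ntrunc_nsq.
have cv : (\int[mu]_u (ntrunc n%:R u)%:E)%E @[n --> \oo] --> (1%E : \bar R).
  have [h _ _] := mu_std; rewrite -[X in _ --> X]h.
  have := @cvg_monotone_convergence _ _ R mu setT measurableT
    (fun n u => (ntrunc n%:R u)%:E).
  have -> : (fun u => limn (fun n => (ntrunc n%:R u)%:E : \bar R)) = (fun u => (nsq u)%:E).
    apply/funext => u; apply/cvg_lim => //.
    apply: cvg_near_cst; near=> n; rewrite /ntrunc ifT//.
    near: n; exact: nbhs_infty_ger.
  apply => //.
  - by move=> n u _; rewrite lee_fin ntrunc_ge0.
  - move=> u _ a b ab; rewrite lee_fin /ntrunc.
    case: ifP => ha; case: ifP => hb//; last exact: nsq_ge0.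
    by move: hb; rewrite (le_trans ha)// ler_nat.
have /fine_cvgP[finN cvf] := cv.
have : \forall n \near \oo, ((1 - k)%:E < \int[mu]_u (ntrunc n%:R u)%:E)%E.
  have k1 : 1 - k < 1 by rewrite ltrBlDr ltrDl.
  near=> n.
  have fn : (\int[mu]_u (ntrunc n%:R u)%:E)%E \is a fin_num by near: n.
  rewrite -(fineK fn) lte_fin; near: n; exact: cvgr_gt cvf _ k1.
move=> [N _ hN]; exists N.+1%:R; first by rewrite ltr0n.
have h1 := hN N.+1 (leqnSn _); have h2 := fin N.+1%:R.
exists (fine (\int[mu]_u (ntrunc N.+1%:R u)%:E)%E).
  rewrite fineK// ge0_fin_numE; first exact: le_lt_trans h2 (ltry _).
  by apply: integral_ge0 => u _; rewrite lee_fin ntrunc_ge0.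
move: h1 h2; case: (integral _ _ _) => [r| |]//=.
by rewrite lte_fin lee_fin => /ltW -> ->.
Unshelve. all: by end_near. Qed.

(** The cross term integrates to zero because m is the mean, and the centred variable lies in
    [-L, L]. *)
Lemma int_trunc L m (a c : R) : 0 < L -> (\int[mu]_u (ntrunc L u)%:E = m%:E)%E ->
  (\int[mu]_u ((a * (ntrunc L u - m) + c) ^+ 2)%:E <= (a ^+ 2 * L ^+ 2 + c ^+ 2)%:E)%E.
Proof.
move=> L0 hm.
have mt : measurable_fun setT (fun u : C => ntrunc L u).
  by apply: measurable_of_measf; exact: measf_ntrunc.
have it : mu.-integrable setT (fun u : C => (ntrunc L u)%:E).
  have iL : mu.-integrable setT (fun=> L%:E : \bar R).
    exact: finite_measure_integrable_cst.
  apply: (le_integrable _ _ _ iL) => //; first exact/measurable_EFinP.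
  move=> u _; rewrite !gee0_abs ?lee_fin ?ntrunc_ge0 ?(ltW L0)//.
  exact: (ntrunc_le u (ltW L0)).
have m01 : 0 <= m <= L.
  rewrite -!lee_fin -hm integral_ge0 /=; last by move=> u _; rewrite lee_fin ntrunc_ge0.
  rewrite -[leRHS]mule1 -(probability_setT mu) -integral_cst//.
  apply: ge0_le_integral => //; first by move=> u _; rewrite lee_fin ntrunc_ge0.
    exact/measurable_EFinP.
  by move=> u _; rewrite lee_fin ntrunc_le// ltW.
have -> : (a ^+ 2 * L ^+ 2 + c ^+ 2)%:E =
  (\int[mu]_u (((a ^+ 2 * L ^+ 2 + c ^+ 2) - 2 * a * c * m) + 2 * a * c * ntrunc L u)%:E)%E.
  under eq_integral do rewrite EFinD EFinM.
  rewrite integralD//; [|exact: finite_measure_integrable_cst|exact: integrableZl].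
  rewrite integralZl// hm integral_cst//= probability_setT mule1 -EFinM -EFinD.
  by congr EFin; ring.
apply: ge0_le_integral => //.
- by move=> u _; rewrite lee_fin sqr_ge0.
- apply/measurable_EFinP; apply: measurable_funX; apply: measurable_funD => //.
  by apply: measurable_funM => //; apply: measurable_funB.
- apply/measurable_EFinP; apply: measurable_funD => //.
  exact: measurable_funM.
move=> u _; rewrite lee_fin.
have h : (ntrunc L u - m) ^+ 2 <= L ^+ 2.
  have := ntrunc_ge0 L u; have := ntrunc_le u (ltW L0); case/andP: m01.
  by nra.
have := ler_wpM2l (sqr_ge0 a) h; lra.
Qed.

End one_entry.

Section iterated_expectation.
Variable R : realType.
Notation C := R[i].
Variable mu : probability C R.
Local Open Scope ereal_scope.
Implicit Types f g : cfg R -> \bar R.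

Lemma EJ_cst J (c : \bar R) xi : EJ mu J (fun=> c) xi = c.
Proof.
elim: J xi => //= e J IH xi; rewrite /E1; under eq_integral do rewrite IH.
by rewrite integral_cst//= probability_setT mule1.
Qed.

Lemma EJ_Zl J (c : R) f xi : (0 <= c)%R -> (forall xi, 0 <= f xi) -> measf f ->
  EJ mu J (fun xi => c%:E * f xi) xi = c%:E * EJ mu J f xi.
Proof.
move=> c0 f0 mf; elim: J xi => //= e J IH xi; rewrite /E1.
under eq_integral do rewrite IH.
rewrite ge0_integralZl//; last by move=> u _; apply: EJ_ge0.
by apply: (measf_upd (f := EJ mu J f)); exact: EJ_meas.
Qed.

Lemma EJ_D J f g xi : (forall xi, 0 <= f xi) -> (forall xi, 0 <= g xi) ->
  measf f -> measf g ->
  EJ mu J (fun xi => f xi + g xi) xi = EJ mu J f xi + EJ mu J g xi.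
Proof.
move=> f0 g0 mf mg; elim: J xi => //= e J IH xi; rewrite /E1.
under eq_integral do rewrite IH.
rewrite ge0_integralD//.
- by move=> u _; apply: EJ_ge0.
- by apply: (measf_upd (f := EJ mu J f)); exact: EJ_meas.
- by move=> u _; apply: EJ_ge0.
- by apply: (measf_upd (f := EJ mu J g)); exact: EJ_meas.
Qed.

(** Redrawing J from [xi] reaches only configurations that agree with [xi] off J. *)
Lemma EJ_congr (J : seq (nat * nat)) f g xi :
  (forall xi', (forall e, e \notin J -> xi' e = xi e) -> f xi' = g xi') ->
  EJ mu J f xi = EJ mu J g xi.
Proof.
elim: J xi => [|e J IH] xi fg /=; first exact: fg.
apply: eq_integral => u _; apply: IH => xi' h; apply: fg => a.
rewrite inE negb_or => /andP[ae aJ]; rewrite h//.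
by rewrite upd_neq.
Qed.

Lemma EJ_le_on (J : seq (nat * nat)) f g xi :
  (forall xi, 0 <= f xi) -> (forall xi, 0 <= g xi) -> measf f -> measf g ->
  (forall xi', (forall e, e \notin J -> xi' e = xi e) -> f xi' <= g xi') ->
  EJ mu J f xi <= EJ mu J g xi.
Proof.
move=> f0 g0 mf mg; elim: J xi => [|e J IH] xi fg /=; first exact: fg.
apply: ge0_le_integral => //.
- by move=> u _; apply: EJ_ge0.
- by apply: (measf_upd (f := EJ mu J f)); exact: EJ_meas.
- by apply: (measf_upd (f := EJ mu J g)); exact: EJ_meas.
move=> u _; apply: IH => xi' h; apply: fg => a.
rewrite inE negb_or => /andP[ae aJ]; rewrite h//.
by rewrite upd_neq.
Qed.

Lemma EJ_perm J K f xi : (forall xi, 0 <= f xi) -> measf f -> perm_eq J K ->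
  EJ mu J f xi = EJ mu K f xi.
Proof.
move=> f0 mf; elim: J K xi => [|e J IH] K xi.
  by rewrite perm_sym => /perm_nilP ->.
move=> JK; have eK : e \in K by rewrite -(perm_mem JK) mem_head.
have [K1 [K2 KE]] : exists K1 K2, K = K1 ++ e :: K2.
  by case/splitPr: eK => K1 K2; exists K1, K2.
rewrite {}KE in JK *; have {}JK : perm_eq J (K1 ++ K2).
  by rewrite -(perm_cons e) (permPl JK) -cat1s perm_catCA.
rewrite EJ_cat /= -E1_EJ; [|exact: EJ_ge0|exact: EJ_meas].
by apply: eq_integral => u _; rewrite (IH _ _ JK) EJ_cat.
Qed.

Lemma EJ_notin (J : seq (nat * nat)) f xi :
  (forall xi', (forall e, e \notin J -> xi' e = xi e) -> f xi' = f xi) ->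
  EJ mu J f xi = f xi.
Proof. by move=> h; rewrite (EJ_congr (g := fun=> f xi)) ?EJ_cst. Qed.

End iterated_expectation.

Section small_ball.
Variable R : realType.
Notation C := R[i].
Variable mu : probability C R.
Hypothesis mu_std : std_law mu.

Let pr (p : C * C) : cfg R := fun e => if e == (0%N, 0%N) then p.1 else p.2.

Let mpr e : measurable_fun setT (fun p => pr p e).
Proof.
by rewrite /pr; case: eqP => _; [exact: measurable_fst|exact: measurable_snd].
Qed.

Lemma measf_expR (f : cfg R -> R) : measf f -> measf (fun xi => expR (f xi)).
Proof. by move=> mf; apply: (measf_comp (g := expR)) => //; exact: measurable_expR. Qed.

Lemma nsq_sub_le (u u' v : C) : nsq (u - u') <= 2 * nsq (u - v) + 2 * nsq (u' - v).
Proof.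
case: u u' v => [a b] [c d] [e f]; rewrite /nsq /= -subr_ge0.
have := sqr_ge0 (a + c - 2 * e); have := sqr_ge0 (b + d - 2 * f); nra.
Qed.

Let F (p : C * C) := expR (- (nsq (p.1 - p.2) / 2)).

Let mF : measurable_fun setT F.
Proof.
apply: (_ : measf (fun xi : cfg R => expR (- (nsq (xi (0%N,0%N) - xi (0%N,1%N)) / 2)))) mpr.
apply: measf_expR; apply: measfN; apply: measfM; last exact: measf_cst.
by apply: measf_nsq; apply: cmeasfB; exact: cmeasf_coord.
Qed.

Let mG : measurable_fun setT (fun p : C * C => nsq (p.1 - p.2)).
Proof.
apply: (_ : measf (fun xi : cfg R => nsq (xi (0%N,0%N) - xi (0%N,1%N)))) mpr.
by apply: measf_nsq; apply: cmeasfB; exact: cmeasf_coord.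
Qed.

Let intG : (\int[(mu \x mu)]_p (nsq (p.1 - p.2))%:E = 2%:E)%E.
Proof.
rewrite fubini_tonelli1//; [|exact/measurable_EFinP|by move=> p; rewrite lee_fin nsq_ge0].
transitivity (\int[mu]_u (nsq (u * 1 + 0) + 1)%:E)%E.
  apply: eq_integral => u _ /=; rewrite /fubini_F/= mulr1 addr0.
  under eq_integral do rewrite -[X in nsq X]opprB nsqN -[X in X - _](mulr1).
  by rewrite int_affine// nsqN nsq1 addrC.
under eq_integral do rewrite EFinD.
rewrite ge0_integralD//.
- by rewrite int_affine// nsq1 nsq0 integral_cst//= probability_setT mule1 -EFinD addr0.
- by move=> u _; rewrite lee_fin nsq_ge0.
- apply/measurable_EFinP; apply: measurable_of_measf; apply: measf_nsq.
  apply: cmeasfD; last exact: cmeasf_cst.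
  by apply: cmeasfM; [exact: cmeasf_coord|exact: cmeasf_cst].
Qed.

Let F01 p : 0 <= F p <= 1.
Proof. by rewrite expR_ge0 /F -expR0 ler_expR oppr_le0 divr_ge0 ?nsq_ge0. Qed.

(** Otherwise F = 1 almost everywhere, and two independent copies of the entry would coincide almost
    surely, against E|u - u'|^2 = 2. *)
Let intF_lt1 : (\int[(mu \x mu)]_p (F p)%:E < 1)%E.
Proof.
have PT : (mu \x mu)%E setT = 1%E.
  by rewrite -setXTT product_measure1E//= !probability_setT mule1.
have F1 p : (0 <= 1 - F p)%R by rewrite subr_ge0; have /andP[] := F01 p.
have F0 p : (0 <= F p)%R by have /andP[] := F01 p.
have m1F : measurable_fun setT (fun p => (1 - F p)%:E).
  by apply/measurable_EFinP; apply: measurable_funB.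
have S : (\int[(mu \x mu)]_p (1 - F p)%:E + \int[(mu \x mu)]_p (F p)%:E = 1)%E.
  rewrite -ge0_integralD//.
  - under eq_integral do rewrite -EFinD subrK.
    by rewrite integral_cst//= PT mule1.
  - by move=> p _; rewrite lee_fin.
  - by move=> p _; rewrite lee_fin.
  - exact/measurable_EFinP.
rewrite ltNge; apply/negP => h.
have I0 : (\int[(mu \x mu)]_p `|(1 - F p)%:E| = 0)%E.
  under eq_integral do rewrite gee0_abs ?lee_fin//.
  apply/eqP; rewrite eq_le integral_ge0 ?andbT; last by move=> p _; rewrite lee_fin.
  rewrite leNgt; apply/negP => h0.
  suff : (1 < 1 :> \bar R)%E by rewrite ltxx.
  rewrite -[X in (_ < X)%E]S -[X in (X < _)%E]add0e.
  by apply: lte_leD => //; rewrite ge0_fin_numE ?ltry.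
have := (ae_eq_integral_abs (mu \x mu)%E measurableT m1F).1 I0.
move=> h1.
have : ae_eq (mu \x mu)%E setT (fun p => (nsq (p.1 - p.2))%:E) (cst 0%E).
  apply: filterS h1 => p /(_ Logic.I) [] /eqP; rewrite subr_eq0 => /eqP e1 _.
  move: e1; rewrite /F -[X in X = _](@expR0 R) => /expR_inj e1.
  have -> : nsq (p.1 - p.2) = 0 by lra.
  by [].
move=> /(ge0_ae_eq_integral measurableT) h2.
have : (\int[(mu \x mu)]_p (nsq (p.1 - p.2))%:E = 0)%E.
  rewrite h2//; first by rewrite integral_cst//= mul0e.
  - exact/measurable_EFinP.
  - by move=> p _; rewrite lee_fin nsq_ge0.
by rewrite intG => -[] /eqP; rewrite pnatr_eq0.
Qed.

(** Symmetrization: the square of the integral is an integral over two independent copies, and |u -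
    u'|^2 <= 2 |u - v|^2 + 2 |u' - v|^2 removes the unknown centre v. *)
Lemma concentration_lt1 : exists2 q : R, 0 < q < 1 &
  forall v s, 1 <= s -> (\int[mu]_u (expR (- (s * nsq (u - v))))%:E <= q%:E)%E.
Proof.
have F0 p : (0 <= F p)%R by have /andP[] := F01 p.
have [k kE /andP[k0 k1]] : exists2 k, (\int[(mu \x mu)]_p (F p)%:E = k%:E)%E & (0 <= k < 1)%R.
  have := intF_lt1; have : (0 <= \int[(mu \x mu)]_p (F p)%:E)%E.
    by apply: integral_ge0 => p _; rewrite lee_fin.
  case: integral => [r| |]//; rewrite lee_fin => r0; rewrite lte_fin => r1.
  by exists r => //; rewrite r0.
(* k bounds the square of the integral; replacing it by (1 + k) / 2 keeps the constant positive even
   if k = 0, and still below 1. *)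
exists (Num.sqrt ((1 + k) / 2)).
  rewrite sqrtr_gt0 divr_gt0 ?ltr_wpDr//= -[X in _ < X]sqrtr1 ltr_sqrt//; lra.
have me s v : measurable_fun setT (fun u : C => (expR (- (s * nsq (u - v))))%:E).
  apply/measurable_EFinP; apply: measurable_of_measf; apply: measf_expR.
  apply: measfN; apply: measfM; first exact: measf_cst.
  by apply: measf_nsq; apply: cmeasfB; [exact: cmeasf_coord|exact: cmeasf_cst].
move=> v s s1.
apply: (@le_trans _ _ (\int[mu]_u (expR (- (1 * nsq (u - v))))%:E)%E).
  apply: ge0_le_integral => //.
  by move=> u _; rewrite lee_fin ler_expR lerN2 ler_wpM2r// nsq_ge0.
set psi := (\int[mu]_u _)%E.
have psi0 : (0 <= psi)%E by apply: integral_ge0 => u _; rewrite lee_fin expR_ge0.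
have psi2 : (psi * psi <= k%:E)%E.
  rewrite -kE fubini_tonelli1//; last exact/measurable_EFinP.
  rewrite {1}/psi -ge0_integralZr//.
  apply: ge0_le_integral => //.
  - by move=> u _; rewrite mule_ge0// lee_fin expR_ge0.
  - by apply: emeasurable_funM => //; exact: measurable_cst.
  - apply: (@measurable_fun_fubini_tonelli_F _ _ C C R mu (fun p => (F p)%:E)) => //.
    exact/measurable_EFinP.
  move=> u _; rewrite /fubini_F/= /psi -ge0_integralZl//.
  apply: ge0_le_integral => //.
  - by apply: emeasurable_funM => //; exact: measurable_cst.
  - apply/measurable_EFinP; apply: (measurableT_comp mF).
    exact: measurable_pair1.
  move=> w _; rewrite -EFinM lee_fin -expRD /F ler_expR /=.
  by have := nsq_sub_le u w v; lra.
move: psi0 psi2; case: (psi) => [r| |]//.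
rewrite -EFinM !lee_fin => r0 r2.
rewrite -[r]ger0_norm// -sqrtr_sqr ler_sqrt ?expr2; last by rewrite divr_ge0// addr_ge0.
by rewrite (le_trans r2)//; lra.
Qed.

End small_ball.

Section real_frobenius.
Variable R : realType.
Notation C := R[i].

Definition fr m n (A : 'M[C]_(m, n)) : R := \sum_i \sum_j nsq (A i j).

Lemma frE m n (A : 'M[C]_(m, n)) : (fr A)%:C = frob A.
Proof.
rewrite /fr rmorph_sum; apply: eq_bigr => i _.
by rewrite rmorph_sum; apply: eq_bigr => j _; rewrite -nsqE.
Qed.

Lemma fr_ge0 m n (A : 'M[C]_(m, n)) : 0 <= fr A.
Proof. by apply: sumr_ge0 => i _; apply: sumr_ge0 => j _; exact: nsq_ge0. Qed.

Lemma conjcE (z : C) : z^* = (z^*)%C.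
Proof. by []. Qed.

Lemma mxmeasf_cst m n (A : 'M[C]_(m, n)) : mxmeasf (fun=> A).
Proof. by move=> i j; exact: cmeasf_cst. Qed.

Lemma mxmeasfB m n (A B : cfg R -> 'M[C]_(m, n)) : mxmeasf A -> mxmeasf B ->
  mxmeasf (fun xi => A xi - B xi).
Proof.
by move=> mA mB i j; under eq_fun do rewrite !mxE; exact: cmeasfB.
Qed.

Lemma mxmeasf_tr m n (A : cfg R -> 'M[C]_(m, n)) : mxmeasf A ->
  mxmeasf (fun xi => (A xi)^t*).
Proof.
by move=> mA i j; under eq_fun do rewrite !mxE conjcE; exact: cmeasfJ.
Qed.

Lemma measf_fr m n (A : cfg R -> 'M[C]_(m, n)) : mxmeasf A ->
  measf (fun xi => fr (A xi)).
Proof.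
by move=> mA; apply: measf_sum => i; apply: measf_sum => j; exact: measf_nsq.
Qed.

(* gdet is a nonnegative real number, so its real part loses nothing. *)
Definition grm m n (A : 'M[C]_(m, n)) : R := complex.Re (gdet A).

Lemma grmE m n (A : 'M[C]_(m, n)) : (grm A)%:C = gdet A.
Proof. by rewrite /grm RRe_real// ger0_real// gdet_ge0. Qed.

Lemma grm_ge0 m n (A : 'M[C]_(m, n)) : 0 <= grm A.
Proof. by rewrite -lecR grmE; exact: gdet_ge0. Qed.

Lemma measf_grm m n (A : cfg R -> 'M[C]_(m, n)) : mxmeasf A ->
  measf (fun xi => grm (A xi)).
Proof.
move=> mA; suff [h _] : cmeasf (fun xi => gdet (A xi)) by [].
apply: cmeasf_det; apply: mxmeasfM => //; exact: mxmeasf_tr.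
Qed.

End real_frobenius.

(** * Small balls for one random row *)

Section small_ball_lemma.
Variable R : realType.
Notation C := R[i].
Variable mu : probability C R.

Definition rowof n (iota : 'I_n -> nat * nat) (xi : cfg R) : 'rV[C]_n :=
  \row_j xi (iota j).

Definition coords n (iota : 'I_n -> nat * nat) := [seq iota j | j <- enum 'I_n].

Lemma mxmeasf_rowof n (iota : 'I_n -> nat * nat) : mxmeasf (rowof iota).
Proof. by move=> i j; under eq_fun do rewrite mxE; exact: cmeasf_coord. Qed.

(* With Q = 1 - M_j* M_j / |M_j|^2 the j-th coordinate contributes exactly
   |M_j|^2 |x_j - v|^2 to |x M - u|^2, the rest being |(x M - u) Q|^2. *)
Lemma eliminate_coord n N (M : 'M[C]_(n, N)) (u : 'rV[C]_N) (j : 'I_n) :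
  0 < fr (row j M) ->
  let Q := 1%:M - ((fr (row j M))^-1)%:C *: ((row j M)^t* *m row j M) in
  [/\ isproj Q, row j (M *m Q) = 0 &
   exists v : 'rV[C]_n -> C,
     (forall x y : 'rV[C]_n, (forall k, k != j -> x 0 k = y 0 k) -> v x = v y) /\
     forall x : 'rV[C]_n,
       fr (x *m M - u) = fr (x *m (M *m Q) - u *m Q)
         + fr (row j M) * nsq (x 0 j - v x)].
Proof.
set m := row j M; set a := fr m => a0 Q.
have aC : a%:C != 0 :> C by rewrite eq_complex /= eqxx andbT gt_eqF.
have mm : m *m m^t* = (a%:C)%:M.
  apply/matrixP => i k; rewrite !ord1 [RHS]mxE mulr1n /a frE frob_row//.
have Pp : isproj ((a^-1)%:C *: (m^t* *m m)).
  split.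
    rewrite trmxCZ trmxCM trmxCK; congr (_ *: _).
    by rewrite conjcE; exact: conjc_real.
  rewrite -scalemxAl -scalemxAr scalerA mulmxA -(mulmxA (m^t*)) mm.
  rewrite mul_mx_scalar -scalemxAl scalerA; congr (_ *: _).
  by rewrite -mulrA -rmorphM /= mulVf ?gt_eqF// mulr1.
have Qp : isproj Q by exact: proj_compl.
have mQ : m *m Q = 0.
  rewrite mulmxBr mulmx1 -scalemxAr mulmxA mm mul_scalar_mx scalerA.
  by rewrite -rmorphM /= mulVf ?gt_eqF// scale1r subrr.
split => //; first by rewrite row_mul -/m mQ.
pose w (x : 'rV[C]_n) : C := ((x *m M - u) *m m^t*) 0 0.
exists (fun x : 'rV[C]_n => x 0 j - (a^-1)%:C * w x); split => [x y xy|x].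
  have wE z : w z = z 0 j * a%:C + (\sum_(k | k != j) z 0 k * (M *m m^t*) k 0 - (u *m m^t*) 0 0).
    rewrite /w mulmxBl -mulmxA mxE [X in _ + X]mxE addrA; congr (_ - _).
    rewrite mxE (bigD1 j)//=; congr (_ * _ + _).
    have -> : (M *m m^t*) j 0 = (m *m m^t*) 0 0.
      by transitivity ((row j (M *m m^t*)) 0 0); [rewrite [RHS]mxE|rewrite row_mul].
    by rewrite mm mxE eqxx mulr1n.
  have E (z : 'rV[C]_n) : z 0 j - (a^-1)%:C * w z = - ((a^-1)%:C *
      (\sum_(k | k != j) z 0 k * (M *m m^t*) k 0 - (u *m m^t*) 0 0)).
    by rewrite wE fmorphV mulrDr mulrCA mulVf// mulr1 opprD addrA subrr sub0r.
  rewrite !E; congr (- (_ * (_ - _))).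
  by apply: eq_bigr => k kj; rewrite xy.
rewrite subKr nsqM nsqC.
apply: complexI; rewrite rmorphD /= !frE (frob_proj (x *m M - u) Qp) [x *m (M *m Q)]mulmxA -mulmxBl.
congr (_ + _); rewrite /Q subKr -scalemxAr mulmxA.
set W := (x *m M - u) *m m^t*.
rewrite (_ : W = (w x)%:M); last first.
  by apply/matrixP => i k; rewrite !ord1 [RHS]mxE mulr1n.
rewrite mul_scalar_mx !frobZ -frE -/a -!nsqE !nsqC -!rmorphM /=; congr (_%:C).
by rewrite expr2 -!mulrA; field; rewrite gt_eqF.
Qed.

Hypothesis q : R.
Hypothesis q01 : 0 < q < 1.
Hypothesis conc : forall v s, 1 <= s ->
  (\int[mu]_u (expR (- (s * nsq (u - v))))%:E <= q%:E)%E.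

Let pred_subn (k j t : nat) : (k - j < t.+1)%N -> (j < k)%N ->
  [/\ k.-1 - j < t, j <= k.-1 & (k.-1 - j).+1 = k - j]%N.
Proof. by move=> h1 h2; split; lia. Qed.

(** Each elimination of a coordinate with a long row of M gains a factor q and costs one unit of the
    trace of P. A long row exists while the trace exceeds j0: some diagonal entry of P is at least k
    / n, so [lam] times the squared length of that row of M is at least 1. *)
Lemma small_ball n (iota : 'I_n -> nat * nat) N (M : 'M[C]_(n, N)) (u : 'rV[C]_N)
    (P : 'M[C]_n) (lam nu : R) (k j0 : nat) xi :
  injective iota -> isproj P -> \tr P = k%:R ->
  (forall x : 'rV[C]_n, nu * fr (x *m P) <= fr (x *m M)) ->
  0 <= nu -> 0 <= lam -> n%:R <= lam * nu * j0.+1%:R -> (j0 <= k)%N ->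
  (EJ mu (coords iota) (fun xi => (expR (- (lam * fr (rowof iota xi *m M - u))))%:E) xi
     <= (q ^+ (k - j0))%:E)%E.
Proof.
move=> inj_iota; have /andP[q0 q1] := q01.
have mF N' (M' : 'M[C]_(n, N')) u' :
    measf (fun xi => expR (- (lam * fr (rowof iota xi *m M' - u')))).
  apply: measf_expR; apply: measfN; apply: measfM; first exact: measf_cst.
  apply: measf_fr; apply: mxmeasfB; last exact: mxmeasf_cst.
  by apply: mxmeasfM; [exact: mxmeasf_rowof|exact: mxmeasf_cst].
have [t kt] := ubnP (k - j0).
elim: t => // t IH in k kt N M u P *.
move=> hP trP MP nu0 lam0 hj jk.
case: (leqP k j0) => [kj|kj].
  have -> : (k - j0)%N = 0%N by apply/eqP; rewrite subn_eq0.
  rewrite expr0 -[leRHS](EJ_cst mu (coords iota) 1%:E xi).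
  apply: EJ_le => [xi'|||xi'].
  - by rewrite lee_fin expR_ge0.
  - exact: measf_EFin.
  - exact: measf_cst.
  - by rewrite lee_fin -expR0 ler_expR oppr_le0 mulr_ge0// fr_ge0.
have k0 : (0 < k)%N by exact: leq_ltn_trans kj.
have trr : \sum_i fr (row i P) = k%:R.
  apply: complexI; rewrite rmorph_sum /= rmorph_nat -trP; apply: eq_bigr => i _.
  by rewrite frE proj_diag.
(* The squared length of a row of a projection is its diagonal entry, and some diagonal entry
   reaches the average of the trace. *)
have [j Pj] : exists j, k%:R <= n%:R * fr (row j P).
  apply/existsP; rewrite -[X in is_true X]negbK negb_exists; apply/negP => /forallP h.
  have n0 : (0 < n)%N.
    case: (posnP n) => // n0; move/eqP: trr; rewrite big1 => [|i _]; last first.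
      by have := ltn_ord i; rewrite {2}n0.
    by rewrite eq_sym pnatr_eq0 -[_ == _]negbK -lt0n k0.
  have : \sum_i n%:R * fr (row i P) < \sum_(i < n) k%:R.
    apply: ltr_sum => [|i _]; first by apply/hasP; exists (Ordinal n0); rewrite ?mem_index_enum.
    by rewrite ltNge h.
  by rewrite -mulr_sumr trr sumr_const card_ord mulr_natl ltxx.
set a := fr (row j M).
have rowM K (A : 'M[C]_(n, K)) : row j A = delta_mx 0 j *m A by rewrite rowE.
have aP : nu * fr (row j P) <= a by rewrite /a !rowM.
have n0 : 0 < n%:R :> R by rewrite ltr0n (leq_ltn_trans _ (ltn_ord j)).
have lamnu : 0 < lam * nu.
  rewrite lt_neqAle mulr_ge0// andbT eq_sym; apply/negP => /eqP h.
  by move: hj; rewrite h mul0r leNgt n0.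
have la1 : 1 <= lam * a.
  have h1 : lam * nu * fr (row j P) <= lam * a by rewrite -mulrA ler_wpM2l.
  apply: le_trans h1; rewrite -(ler_pM2l n0) mulr1 mulrCA.
  apply: (le_trans hj); rewrite ler_pM2l//; apply: le_trans Pj.
  by rewrite ler_nat.
have lam_gt0 : 0 < lam.
  by rewrite lt_neqAle lam0 andbT eq_sym; apply/negP => /eqP h; rewrite h mul0r ltxx in lamnu.
have a0 : 0 < a by rewrite -(pmulr_rgt0 _ lam_gt0); apply: lt_le_trans la1.
have [] := eliminate_coord u a0; set Q := 1%:M - _ => hQ MQj [v [vloc vE]].
have p0 : 0 < fr (row j P).
  by rewrite -(pmulr_rgt0 _ n0) (lt_le_trans _ Pj)// ltr0n.
have [] := eliminate_coord 0 p0; set Q' := 1%:M - _ => hQ' PQj _.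
(* The range of P without the direction of its j-th row, so that the trace drops by exactly one. *)
pose P' := P *m Q' *m P.
have [Ph P2] := hP; have [Qh Q2] := hQ; have [Qh' Q2'] := hQ'.
pose r := row j P.
have rr : r *m r^t* = ((fr r)%:C)%:M.
  by apply/matrixP => i l; rewrite !ord1 [RHS]mxE mulr1n frE frob_row.
have rP : r *m P = r by rewrite /r -row_mul P2.
have rQ : r *m Q' = 0 by rewrite /r -row_mul.
have P'E : P' = P - ((fr r)^-1)%:C *: (r^t* *m r).
  rewrite /P' /Q' mulmxBr mulmx1 mulmxBl P2 -scalemxAr -scalemxAl.
  congr (_ - _ *: _); rewrite -/r mulmxA -[LHS]mulmxA rP; congr (_ *m _).
  by rewrite -{1}Ph -trmxCM rP.
have frr : (fr r)%:C != 0 :> C by rewrite eq_complex /= eqxx andbT gt_eqF.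
have hP' : isproj P'.
  split; first by rewrite /P' !trmxCM Ph Qh' mulmxA.
  rewrite {1}P'E mulmxBl -scalemxAl -(mulmxA (r^t*)).
  have -> : r *m P' = 0 by rewrite /P' !mulmxA rP rQ mul0mx.
  by rewrite mulmx0 scaler0 subr0 /P' !mulmxA P2.
have trP' : \tr P' = (k.-1)%:R.
  rewrite P'E raddfB /= trP mxtraceZ mxtrace_mulC rr mxtrace_scalar mulr1n.
  rewrite -rmorphM /= mulVf ?gt_eqF//.
  by rewrite -[in LHS](prednK k0) -[_.+1]addn1 natrD addrK.
(* Projecting away row j of M amounts to moving the j-th coordinate of x to its best value, and such
   a move is invisible to [P']. *)
have MP' (x : 'rV[C]_n) : nu * fr (x *m P') <= fr (x *m (M *m Q)).
  pose c := (a^-1)%:C * (x *m M *m (row j M)^t*) 0 0.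
  have -> : x *m (M *m Q) = (x - c *: delta_mx 0 j) *m M.
    rewrite mulmxBl -scalemxAl -rowM /Q mulmxBr mulmx1 mulmxBr -scalemxAr; congr (_ - _).
    rewrite -scalemxAr !mulmxA (mx11_scalar (x *m M *m (row j M)^t*)) mul_scalar_mx scalerA.
    by [].
  apply: le_trans (MP _); rewrite ler_wpM2l//.
  have -> : x *m P' = (x - c *: delta_mx 0 j) *m P *m (Q' *m P).
    rewrite mulmxBl -scalemxAl -rowM -/r mulmxBl -scalemxAl mulmxA -/P'.
    have -> : r *m (Q' *m P) = 0 by rewrite mulmxA rQ mul0mx.
    by rewrite scaler0 subr0 /P' !mulmxA.
  rewrite -lecR !frE mulmxA; apply: le_trans (frob_proj_le _ hP) _.
  exact: frob_proj_le.
have [k1 k2 k3] := pred_subn kt kj.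
have IHk := IH _ k1 _ _ (u *m Q) _ hP' trP' MP' nu0 lam0 hj.
pose e := iota j; pose J' := [seq iota i | i <- enum 'I_n & i != j].
have Jperm : perm_eq (coords iota) (rcons J' e).
  rewrite perm_sym perm_rcons -map_cons; apply: perm_map.
  rewrite perm_sym; apply: uniq_perm; first exact: enum_uniq.
    by rewrite /= mem_filter eqxx /= filter_uniq// enum_uniq.
  by move=> i; rewrite inE mem_filter mem_enum; case: eqP.
pose f xi := (expR (- (lam * fr (rowof iota xi *m M - u))))%:E.
pose g xi := (expR (- (lam * fr (rowof iota xi *m (M *m Q) - u *m Q))))%:E.
have f0 xi' : (0 <= f xi')%E by rewrite lee_fin expR_ge0.
have g0 xi' : (0 <= g xi')%E by rewrite lee_fin expR_ge0.
have mf : measf f by exact: measf_EFin.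
have mg : measf g by exact: measf_EFin.
rewrite -/f (EJ_perm mu xi f0 mf Jperm) -cats1 EJ_cat /=.
have rowu xi' w l : l != j -> rowof iota (upd xi' e w) 0 l = rowof iota xi' 0 l.
  by move=> lj; rewrite !mxE upd_neq// /e (inj_eq inj_iota).
have ge xi' w : g (upd xi' e w) = g xi'.
  suff E : rowof iota (upd xi' e w) *m (M *m Q) = rowof iota xi' *m (M *m Q).
    by rewrite /g E.
  apply/rowP => b; rewrite [LHS]mxE [RHS]mxE; apply: eq_bigr => l _.
  case: (eqVneq l j) => [->|lj]; last by rewrite rowu.
  have -> : (M *m Q) j b = 0.
    by transitivity ((row j (M *m Q)) 0 b); [rewrite [RHS]mxE|rewrite MQj mxE].
  by rewrite !mulr0.
have Ef xi' : (E1 mu e f xi' <= q%:E * g xi')%E.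
  rewrite /E1 [leRHS]muleC.
  apply: (@le_trans _ _ (\int[mu]_w (g xi' *
      (expR (- (lam * a * nsq (w - v (rowof iota xi')))))%:E))%E).
    apply: ge0_le_integral => //.
    - exact: measf_upd.
    - apply/emeasurable_funM; first exact: measurable_cst.
      apply/measurable_EFinP; apply: measurable_of_measf; apply: measf_expR.
      apply: measfN; apply: measfM; first exact: measf_cst.
      by apply: measf_nsq; apply: cmeasfB; [exact: cmeasf_coord|exact: cmeasf_cst].
    move=> w _; rewrite -(ge xi' w) /f /g -EFinM lee_fin -expRD ler_expR vE.
    have -> : v (rowof iota xi') = v (rowof iota (upd xi' e w)).
      by apply: vloc => l lj; rewrite rowu.
    have -> : rowof iota (upd xi' e w) 0 j = w by rewrite mxE updE.
    by rewrite -/a mulrDr opprD mulrA.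
  rewrite ge0_integralZl//; last by apply/measurable_EFinP; apply: measurable_of_measf;
    apply: measf_expR; apply: measfN; apply: measfM; [exact: measf_cst|
    by apply: measf_nsq; apply: cmeasfB; [exact: cmeasf_coord|exact: cmeasf_cst]].
  by rewrite lee_pmul2l// ?conc// lte_fin expR_gt0.
apply: (@le_trans _ _ (EJ mu J' (fun xi => q%:E * g xi)%E xi)).
  apply: EJ_le => //; [exact: E1_ge0|exact: E1_meas|].
  by apply: measf_EFin; apply: measfM; [exact: measf_cst|exact: mF].
rewrite EJ_Zl//; last exact: ltW.
have -> : EJ mu J' g xi = EJ mu (coords iota) g xi.
  rewrite (EJ_perm mu xi g0 mg Jperm) -cats1 EJ_cat /=.
  by congr (EJ mu J' _ xi); apply/funext => xi'; rewrite E1_cst.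
apply: (@le_trans _ _ (q%:E * (q ^+ (k.-1 - j0))%:E)%E).
  rewrite lee_pmul2l//; exact: IHk.
by rewrite -EFinM -exprS lee_fin k3.
Qed.

End small_ball_lemma.

Section indicators.
Variable R : realType.
Notation C := R[i].
Variable mu : probability C R.
Local Open Scope ereal_scope.

Definition ind (b : cfg R -> bool) : cfg R -> \bar R := fun xi => ((b xi)%:R)%:E.

Lemma ind_ge0 b xi : 0 <= ind b xi. Proof. by rewrite lee_fin. Qed.

Lemma ind_le1 b xi : ind b xi <= 1.
Proof. by rewrite lee_fin lern1 leq_b1. Qed.

Lemma measf_indE b : measf b -> measf (ind b).
Proof. by move=> mb; apply: measf_EFin; exact: measf_ind. Qed.

Lemma markov_EJ K (f : cfg R -> R) (a : R) xi : (forall xi, 0 <= f xi)%R -> measf f -> (0 < a)%R ->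
  EJ mu K (ind (fun xi => (a <= f xi)%R)) xi <= (a^-1)%:E * EJ mu K (fun xi => (f xi)%:E) xi.
Proof.
move=> f0 mf a0; rewrite -EJ_Zl ?invr_ge0 ?(ltW a0)//; last exact: measf_EFin.
apply: EJ_le.
- exact: ind_ge0.
- by apply: measf_indE; apply: measf_le => //; exact: measf_cst.
- by apply: measf_EFin; apply: measfM => //; exact: measf_cst.
move=> xi'; rewrite /ind -EFinM lee_fin /=.
case: (lerP a (f xi')) => [h|_]; last by rewrite mulr_ge0 ?invr_ge0 ?(ltW a0).
by rewrite ler_pdivlMl// mulr1.
Qed.

End indicators.

Section events.
Context d (T : measurableType d) (R : realType) (P : probability T R).
Notation C := R[i].
Variable x : nat * nat -> {RV P >-> C}.
Hypothesis x_iid : iid x.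

Local Notation mu := (distribution P (x (0%N, 0%N))).
Local Open Scope ereal_scope.

Definition ex (f : cfg R -> \bar R) : \bar R := \int[P]_t f (config x t).
Definition pr (b : cfg R -> bool) : \bar R := ex (ind b).

Lemma measf_config d' (T' : measurableType d') (f : cfg R -> T') : measf f ->
  measurable_fun setT (fun t => f (config x t)).
Proof. by move=> mf; apply: (mf _ T (config x)) => e; exact: measurable_funP. Qed.

Lemma ex_EJ K f : (forall xi, 0 <= f xi) -> measf f -> ex f = ex (EJ mu K f).
Proof.
move=> f0 mf; elim: K => //= e K ->; rewrite /ex (resample x_iid e)//.
  exact: EJ_ge0.
exact: EJ_meas.
Qed.

Lemma ex_le f g : (forall xi, 0 <= f xi) -> measf f -> measf g ->
  (forall xi, f xi <= g xi) -> ex f <= ex g.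
Proof.
move=> f0 mf mg fg; apply: ge0_le_integral => //.
- exact: measf_config.
- exact: measf_config.
Qed.

Lemma ex_cst c : ex (fun=> c) = c.
Proof. by rewrite /ex integral_cst//= probability_setT mule1. Qed.

Lemma ex_cond K f c : (forall xi, 0 <= f xi) -> measf f ->
  (forall xi, EJ mu K f xi <= c) -> ex f <= c.
Proof.
move=> f0 mf h; rewrite (ex_EJ K)// -[leRHS]ex_cst; apply: ex_le => //.
- exact: EJ_ge0.
- exact: EJ_meas.
- exact: measf_cst.
Qed.

Lemma pr_cond K b c : measf b -> (forall xi, EJ mu K (ind b) xi <= c) -> pr b <= c.
Proof. by move=> mb; apply: ex_cond; [exact: ind_ge0|exact: measf_indE]. Qed.

Lemma pr_le (b c : cfg R -> bool) : measf b -> measf c -> (forall xi, b xi -> c xi) -> pr b <= pr c.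
Proof.
move=> mb mc bc; apply: ex_le; [exact: ind_ge0|exact: measf_indE|exact: measf_indE|].
move=> xi; rewrite lee_fin ler_nat; have := bc xi; case: (b xi); case: (c xi) => //.
by move=> /(_ isT).
Qed.

Lemma pr_or b c : measf b -> measf c -> pr (fun xi => b xi || c xi) <= pr b + pr c.
Proof.
move=> mb mc; rewrite /pr /ex -ge0_integralD//;
  [|by move=> t _; exact: ind_ge0|by apply: measf_config; exact: measf_indE
   |by move=> t _; exact: ind_ge0|by apply: measf_config; exact: measf_indE].
apply: ge0_le_integral => //.
- by move=> t _; exact: ind_ge0.
- by apply: measf_config; apply: measf_indE; exact: measf_or.
- by apply: emeasurable_funD; apply: measf_config; exact: measf_indE.
- by move=> t _; rewrite /ind -EFinD lee_fin -natrD ler_nat; case: (b _); case: (c _).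
Qed.

Lemma pr_has (I : eqType) (s : seq I) (b : I -> cfg R -> bool) (p : I -> R) :
  (forall i, measf (b i)) -> (forall i, i \in s -> pr (b i) <= (p i)%:E) ->
  pr (fun xi => has (fun i => b i xi) s) <= (\sum_(i <- s) p i)%:E.
Proof.
move=> mb; elim: s => [|i s IH] h.
  by rewrite big_nil /pr /ind /= ex_cst.
rewrite big_cons EFinD; apply: (le_trans (pr_or _ _)) => //; first exact: measf_has.
rewrite leeD//; first by apply: h; rewrite mem_head.
by apply: IH => j js; apply: h; rewrite inE js orbT.
Qed.

Lemma prE b : measf b -> pr b = P [set t | b (config x t)].
Proof.
move=> mb; rewrite /pr /ex -[RHS]mul1e -integral_cst//; last first.
  rewrite -[X in measurable X]setTI.
  exact: (measf_config mb measurableT (Y := [set true])).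
rewrite integral_mkcond; apply: eq_integral => t _.
rewrite /ind patchE; case: ifPn => [|]; first by rewrite inE /= => ->.
by rewrite notin_setE /= => /negP /negbTE ->.
Qed.

Lemma markov_ex (f : cfg R -> R) (a : R) : (forall xi, 0 <= f xi)%R -> measf f -> (0 < a)%R ->
  pr (fun xi => (a <= f xi)%R) <= (a^-1)%:E * ex (fun xi => (f xi)%:E).
Proof.
move=> f0 mf a0; rewrite /ex -ge0_integralZl//;
  [|exact: (measf_config (measf_EFin mf))|by move=> t _; rewrite lee_fin
   |by rewrite lee_fin invr_ge0 ltW].
apply: ge0_le_integral => //.
- by move=> t _; exact: ind_ge0.
- by apply: measf_config; apply: measf_indE; apply: measf_le => //; exact: measf_cst.
- apply: (measf_config (f := fun xi => ((a^-1)%:E * (f xi)%:E)%E)).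
  by apply: measf_EFin; apply: measfM => //; exact: measf_cst.
move=> t _; rewrite /ind -EFinM lee_fin /=.
case: (lerP a (f (config x t))) => [h|_]; last by rewrite mulr_ge0 ?invr_ge0 ?(ltW a0).
by rewrite ler_pdivlMl// mulr1.
Qed.

End events.

Section distances.
Variable R : realType.
Notation C := R[i].
Variable mu : probability C R.
Variable q : R.
Hypothesis q01 : 0 < q < 1.
Hypothesis conc : forall v s, 1 <= s ->
  (\int[mu]_u (expR (- (s * nsq (u - v))))%:E <= q%:E)%E.

(** With q = rho^4, half of the codimension k' yields rho^(2 k') in [small_ball], of which the
    exponential Markov inequality gives back rho^(k'). *)
Definition rho : R := Num.sqrt (Num.sqrt q).
Definition cdist : R := - ln rho / 2.

Lemma rho01 : 0 < rho < 1.
Proof.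
have /andP[q0 q1] := q01.
by rewrite /rho !sqrtr_gt0 q0 /= -[X in _ < X](@sqrtr1 R) ltr_sqrt// -[X in _ < X](@sqrtr1 R) ltr_sqrt.
Qed.

Lemma rho4 : rho ^+ 4 = q.
Proof.
have /andP[q0 q1] := q01.
rewrite (_ : 4 = 2 * 2)%N// exprM /rho sqr_sqrtr ?sqrtr_ge0//.
by rewrite sqr_sqrtr// ltW.
Qed.

Lemma cdist_gt0 : 0 < cdist.
Proof. by rewrite /cdist divr_gt0// oppr_gt0 ln_lt0// rho01. Qed.

Let half_arith (k k' : nat) : (k <= k')%N -> (k + k' <= 4 * (k' - k'./2))%N.
Proof. by move=> h; rewrite -divn2; lia. Qed.

(** The typical squared distance to a subspace of codimension k is of order k. The threshold cdist
    k^2 / n is lower, but it costs only a bounded factor per row when k is proportional to n, and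
    the failure probability is exponential in k. *)
Lemma proj_small_ball n (iota : 'I_n -> nat * nat) (H : 'M[C]_n) (v : 'rV[C]_n) (k k' : nat) xi :
  injective iota -> isproj H -> \tr H = k'%:R -> (k <= k')%N ->
  (EJ mu (coords iota) (ind (fun xi =>
    (n%:R * fr ((rowof iota xi - v) *m H) <= cdist * k%:R ^+ 2)%R)) xi <= (rho ^+ k)%:E)%E.
Proof.
move=> inj_iota hH trH kk'; have /andP[r0 r1] := rho01; have c0 := cdist_gt0.
have [k0|kpos] := posnP k.
  rewrite k0 expr0 -[leRHS](EJ_cst mu (coords iota) 1%:E xi).
  apply: EJ_le => [xi'|||xi']; [exact: ind_ge0| |exact: measf_cst|].
    apply: measf_indE; apply: measf_le; last exact: measf_cst.
    apply: measfM; first exact: measf_cst.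
    apply: measf_fr; apply: mxmeasfM; last exact: mxmeasf_cst.
    by apply: mxmeasfB; [exact: mxmeasf_rowof|exact: mxmeasf_cst].
  exact: ind_le1.
have k'0 : (0 < k')%N by exact: leq_trans kk'.
have k'r : 0 < k'%:R :> R by rewrite ltr0n.
(* Up to rounding, the smallest exponent that [small_ball] accepts when [j0] is half of k'. *)
pose lam : R := 2 * n%:R / k'%:R.
have lam0 : 0 <= lam by rewrite divr_ge0// mulr_ge0.
pose f xi := expR (- (lam * fr (rowof iota xi *m H - v *m H))).
have f0 xi' : 0 <= f xi' by exact: expR_ge0.
have mf : measf f.
  apply: measf_expR; apply: measfN; apply: measfM; first exact: measf_cst.
  apply: measf_fr; apply: mxmeasfB; last exact: mxmeasf_cst.
  by apply: mxmeasfM; [exact: mxmeasf_rowof|exact: mxmeasf_cst].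
apply: (@le_trans _ _ (((rho ^+ k')^-1)%:E * EJ mu (coords iota) (fun xi => (f xi)%:E) xi)%E).
  have rk0 : 0 < rho ^+ k' by rewrite exprn_gt0.
  have hm := markov_EJ mu (coords iota) xi f0 mf rk0.
  apply: le_trans hm.
  apply: EJ_le; first exact: ind_ge0.
  - apply: measf_indE; apply: measf_le; last exact: measf_cst.
    apply: measfM; first exact: measf_cst.
    apply: measf_fr; apply: mxmeasfM; last exact: mxmeasf_cst.
    by apply: mxmeasfB; [exact: mxmeasf_rowof|exact: mxmeasf_cst].
  - by apply: measf_indE; apply: measf_le => //; exact: measf_cst.
  move=> xi'; rewrite lee_fin ler_nat; case: (lerP _ (cdist * _)) => // h.
  suff -> : rho ^+ k' <= f xi' by [].
  (* On the event, [lam] times the squared distance is at most 2 cdist k' = - k' ln rho; this fixes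
     the value of [cdist]. *)
  rewrite -[rho]lnK ?posrE// -expRM_natl ler_expR lerNr -mulmxBl.
  rewrite /lam.
  have -> : 2 * n%:R / k'%:R * fr ((rowof iota xi' - v) *m H) =
     2 / k'%:R * (n%:R * fr ((rowof iota xi' - v) *m H)) by field; rewrite gt_eqF.
  apply: (@le_trans _ _ (2 / k'%:R * (cdist * k'%:R ^+ 2))).
    rewrite ler_wpM2l ?divr_ge0//; apply: (le_trans h).
    by rewrite ler_wpM2l ?(ltW c0)// lerXn2r ?nnegrE// ler_nat.
  by rewrite /cdist le_eqVlt; apply/orP; left; apply/eqP; field; rewrite gt_eqF.
have hj : n%:R <= lam * 1 * (k'./2).+1%:R.
  rewrite mulr1 /lam mulrAC ler_pdivlMr// [2 * _]mulrC -mulrA ler_wpM2l//.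
  rewrite -natrM ler_nat mulnC muln2 -[X in (X <= _)%N]odd_double_half doubleS.
  by rewrite -add1n leq_add// ; case: odd.
have hM (y : 'rV[C]_n) : 1 * fr (y *m H) <= fr (y *m H) by rewrite mul1r.
have hk : (k'./2 <= k')%N by rewrite -[X in (_ <= X)%N]odd_double_half -addnn addnA leq_addl.
have hs := small_ball q01 conc (v *m H) xi inj_iota hH trH hM ler01 lam0 hj hk.
apply: (@le_trans _ _ (((rho ^+ k')^-1)%:E * (q ^+ (k' - k'./2))%:E)%E).
  by rewrite lee_pmul2l ?lte_fin ?invr_gt0 ?exprn_gt0//; exact: hs.
rewrite -EFinM lee_fin ler_pdivrMl ?exprn_gt0// -rho4 -exprM -exprD.
apply: ler_wiXn2l => //; [exact: ltW|exact: ltW|].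
by rewrite addnC; exact: half_arith.
Qed.

End distances.

Section random_rows.
Variable R : realType.
Notation C := R[i].

Definition inj2 (iota : nat -> nat -> nat * nat) :=
  forall i j i' j', iota i j = iota i' j' -> i = i' /\ j = j'.

Variables (n : nat) (iota : nat -> nat -> nat * nat) (V : nat -> 'rV[C]_n).
Hypothesis iota_inj : inj2 iota.

Definition rowi (i : nat) : 'I_n -> nat * nat := fun j => iota i j.
Definition rowW (xi : cfg R) (i : nat) : 'rV[C]_n := rowof (rowi i) xi - V i.
Definition top (m : nat) (xi : cfg R) : 'M[C]_(m, n) := \matrix_(i, j) rowW xi i 0 j.

Lemma rowi_inj i : injective (rowi i).
Proof. by move=> a b /iota_inj[_ h]; apply: val_inj. Qed.

Lemma row_top m xi (i : 'I_m) : row i (top m xi) = rowW xi i.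
Proof. by apply/rowP => j; rewrite !mxE. Qed.

Lemma top_last m xi : row' ord_max (top m.+1 xi) = top m xi.
Proof.
apply/matrixP => i j; rewrite !mxE.
by have -> : lift ord_max i = i :> nat by rewrite /= /bump leqNgt ltn_ord.
Qed.

Lemma mxmeasf_rowW i : mxmeasf (fun xi => rowW xi i).
Proof. by apply: mxmeasfB; [exact: mxmeasf_rowof|exact: mxmeasf_cst]. Qed.

Lemma mxmeasf_top m : mxmeasf (top m).
Proof. by move=> i j; under eq_fun do rewrite mxE; exact: mxmeasf_rowW. Qed.

Lemma mxmeasf_row' m p (A : cfg R -> 'M[C]_(m, p)) i : mxmeasf A ->
  mxmeasf (fun xi => row' i (A xi)).
Proof. by move=> mA a b; under eq_fun do rewrite mxE; exact: mA. Qed.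

Lemma rowW_dep xi xi' i k : i != k ->
  (forall e, e \notin coords (rowi k) -> xi' e = xi e) -> rowW xi' i = rowW xi i.
Proof.
move=> ik h; apply/rowP => j; rewrite !mxE h//.
apply/mapP => -[l _ /iota_inj[/eqP]]; by rewrite (negbTE ik).
Qed.

Lemma top_dep xi xi' m k : (m <= k)%N ->
  (forall e, e \notin coords (rowi k) -> xi' e = xi e) -> top m xi' = top m xi.
Proof.
move=> mk h; apply/matrixP => i j; rewrite !mxE.
have ik : val i != k by rewrite neq_ltn (leq_trans (ltn_ord i) mk).
by have /rowP/(_ j) := rowW_dep ik h; rewrite !mxE.
Qed.

Lemma row'_top_dep xi xi' m (i : 'I_m.+1) :
  (forall e, e \notin coords (rowi i) -> xi' e = xi e) ->
  row' i (top m.+1 xi') = row' i (top m.+1 xi).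
Proof.
move=> h; apply/matrixP => a j; rewrite !mxE.
have ik : val (lift i a) != val i by rewrite (inj_eq val_inj) eq_sym neq_lift.
by have /rowP/(_ j) := rowW_dep ik h; rewrite !mxE.
Qed.

Lemma grm_row m p (A : 'M[C]_(m.+1, p)) i :
  grm A = grm (row' i A) * fr (row i A *m pcompl (row' i A)).
Proof. by apply: complexI; rewrite rmorphM /= !grmE frE -gdet_row. Qed.

Variable mu : probability C R.
Variable q : R.
Hypothesis q01 : 0 < q < 1.
Hypothesis conc : forall v s, 1 <= s ->
  (\int[mu]_u (expR (- (s * nsq (u - v))))%:E <= q%:E)%E.

(** The subspace is spanned by r rows other than row i, so it is frozen while row i is redrawn, and
    its codimension is at least k. *)
Lemma dist_small_ball i r (k : nat) (H : cfg R -> 'M[C]_(r, n)) (b : cfg R -> bool) xi :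
  measf b -> (r + k <= n)%N ->
  (forall xi xi', (forall e, e \notin coords (rowi i) -> xi' e = xi e) -> H xi' = H xi) ->
  (forall xi, b xi -> n%:R * fr (rowW xi i *m pcompl (H xi)) <= cdist q * k%:R ^+ 2) ->
  (EJ mu (coords (rowi i)) (ind b) xi <= (rho q ^+ k)%:E)%E.
Proof.
move=> mb rk Hdep hb.
have hP := pcompl_proj (H xi).
have hk : (k <= n - \rank (H xi))%N.
  by rewrite leq_subRL ?rank_leq_col// (leq_trans _ rk)// leq_add2r rank_leq_row.
apply: le_trans (proj_small_ball q01 conc (V i) xi (@rowi_inj i) hP (pcompl_trace _) hk).
apply: EJ_le_on.
- exact: ind_ge0.
- exact: ind_ge0.
- exact: measf_indE.
- apply: measf_indE; apply: measf_le; last exact: measf_cst.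
  apply: measfM; first exact: measf_cst.
  by apply: measf_fr; apply: mxmeasfM; [exact: mxmeasf_rowW|exact: mxmeasf_cst].
move=> xi' h; rewrite /ind lee_fin ler_nat.
case: (boolP (b xi')) => // bxi; have := hb _ bxi; rewrite (Hdep _ _ h) /rowW => -> //.
Qed.

(** By [grm_row] the quotient of the two volumes is the squared distance of the new row to the
    previous ones. Writing the event without a quotient makes its measurability immediate; a
    vanishing smaller volume is not counted as bad. *)
Definition bad_last (m k : nat) (xi : cfg R) :=
  (0 < grm (top m xi)) &&
  (n%:R * grm (top m.+1 xi) <= cdist q * k%:R ^+ 2 * grm (top m xi)).

Definition bad_mid m (i : 'I_m.+1) (k : nat) (xi : cfg R) :=
  (0 < grm (row' i (top m.+1 xi))) &&
  (n%:R * grm (top m.+1 xi) <= cdist q * k%:R ^+ 2 * grm (row' i (top m.+1 xi))).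

Lemma measf_bad_mid m (i : 'I_m.+1) k : measf (bad_mid i k).
Proof.
have h1 := measf_grm (mxmeasf_row' i (mxmeasf_top (m:=m.+1))).
apply: measf_and; first by apply: measf_lt => //; exact: measf_cst.
apply: measf_le; apply: measfM => //; try exact: measf_cst.
by apply: measf_grm; exact: mxmeasf_top.
Qed.

Lemma bad_lastE m k : bad_last m k = bad_mid (@ord_max m) k.
Proof. by apply/funext => xi; rewrite /bad_last /bad_mid top_last. Qed.

Lemma measf_bad_last m k : measf (bad_last m k).
Proof. by rewrite bad_lastE; exact: measf_bad_mid. Qed.

Lemma EJ_bad_mid m (i : 'I_m.+1) k xi : (m + k <= n)%N ->
  (EJ mu (coords (rowi i)) (ind (bad_mid i k)) xi <= (rho q ^+ k)%:E)%E.
Proof.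
move=> mk; apply: (dist_small_ball (r := m) (H := fun xi => row' i (top m.+1 xi))) => //.
- exact: measf_bad_mid.
- by move=> xi1 xi2 h; exact: row'_top_dep.
move=> xi' /andP[h]; rewrite (grm_row _ i) row_top mulrCA [leRHS]mulrC.
by rewrite ler_pM2l.
Qed.

Lemma EJ_bad_last m k xi : (m + k <= n)%N ->
  (EJ mu (coords (rowi m)) (ind (bad_last m k)) xi <= (rho q ^+ k)%:E)%E.
Proof. by move=> mk; rewrite bad_lastE; exact: (EJ_bad_mid ord_max xi mk). Qed.

End random_rows.

(** * Concentration of regularized determinants *)

Section regularized_determinant.
Variable C : numClosedFieldType.

(** Appending s times the identity turns the Gram matrix into A A^H + |s|^2, so that a regularized
    determinant is again a squared volume and [gdet_row] and [hadamard] apply to it. *)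
Definition regm m n (A : 'M[C]_(m, n)) (s : C) : 'M[C]_(m, n + m) := row_mx A s%:M.

Lemma gram_regm m n (A : 'M[C]_(m, n)) s :
  regm A s *m (regm A s)^t* = A *m A^t* + (`|s| ^+ 2)%:M.
Proof.
rewrite /regm tr_row_mx map_col_mx mul_row_col; congr (_ + _).
rewrite tr_scalar_mx mul_scalar_mx; apply/matrixP => i j; rewrite !mxE normCK.
by rewrite rmorphMn /= mulrnAr.
Qed.

Lemma gdet_regm m n (A : 'M[C]_(m, n)) s :
  gdet (regm A s) = \det (A *m A^t* + (`|s| ^+ 2)%:M).
Proof. by rewrite /gdet gram_regm. Qed.

Lemma gdet_row'_regm m n (A : 'M[C]_(m.+1, n)) s i :
  gdet (row' i (regm A s)) = gdet (regm (row' i A) s).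
Proof.
rewrite gdet_regm /gdet; congr (\det _).
have h (B : 'M[C]_(m.+1, n + m.+1)) a b :
    (row' i B *m (row' i B)^t*) a b = (B *m B^t*) (lift i a) (lift i b).
  by rewrite !mxE; apply: eq_bigr => k _; rewrite !mxE.
apply/matrixP => a b; rewrite h gram_regm !mxE (inj_eq lift_inj); congr (_ + _).
by apply: eq_bigr => k _; rewrite !mxE.
Qed.

Lemma frob_row_diag m n (A : 'M[C]_(m, n)) i : frob (row i A) = (A *m A^t*) i i.
Proof.
by rewrite frob_row !mxE; apply: eq_bigr => k _; rewrite !mxE.
Qed.

Lemma frob_row_regm m n (A : 'M[C]_(m, n)) s i :
  frob (row i (regm A s)) = frob (row i A) + `|s| ^+ 2.
Proof. by rewrite !frob_row_diag gram_regm mxE [X in _ + X]mxE eqxx mulr1n. Qed.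

Lemma gdet_regm_row m n (A : 'M[C]_(m.+1, n)) s i :
  gdet (regm A s) <= gdet (regm (row' i A) s) * (frob (row i A) + `|s| ^+ 2).
Proof. by rewrite -gdet_row'_regm -frob_row_regm; exact: gdet_row_le. Qed.

(** Cramer's rule. The diagonal of the inverse Gram matrix consists of the inverse squared distances
    of the rows to the span of the others. *)
Lemma inv_gram_diag m n (A : 'M[C]_(m.+1, n)) i : gdet A != 0 ->
  (invmx (A *m A^t*)) i i = gdet (row' i A) / gdet A.
Proof.
move=> A0; have AU : A *m A^t* \in unitmx by rewrite unitmxE unitfE.
rewrite /invmx AU mxE mulrC; congr (_ / _); rewrite mxE /cofactor.
rewrite addnn -signr_odd odd_double expr0 mul1r; congr (\det _).
by apply/matrixP => a b; rewrite !mxE; apply: eq_bigr => k _; rewrite !mxE.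
Qed.

(** Factor det (G + |s|^2) = det G det (1 + |s|^2 G^-1). Since K K^H = G^-1, the second factor is
    the Gram determinant of [regm (s *: K) 1], which Hadamard's inequality bounds by its
    diagonal. *)
Lemma gdet_regm_le m n (A : 'M[C]_(m, n)) s : gdet A != 0 ->
  gdet (regm A s) <= gdet A * \prod_i (1 + `|s| ^+ 2 * (invmx (A *m A^t*)) i i).
Proof.
move=> A0; have AU : A *m A^t* \in unitmx by rewrite unitmxE unitfE.
set G := A *m A^t*; pose K := invmx G *m A.
have Gh : G^t* = G by rewrite trmxCM trmxCK.
have KK : K *m K^t* = invmx G.
  rewrite /K trmxCM mulmxA -(mulmxA (invmx G)) -/G mulVmx// mul1mx.
  by rewrite trmx_inv map_invmx Gh.
have sKK : (s *: K) *m (s *: K)^t* = `|s| ^+ 2 *: invmx G.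
  by rewrite trmxCZ -scalemxAl -scalemxAr scalerA KK -normCK.
have -> : gdet (regm A s) = gdet A * gdet (regm (s *: K) 1).
  rewrite !gdet_regm /gdet -/G -det_mulmx; congr (\det _).
  rewrite normr1 expr1n mulmxDr mulmx1 addrC; congr (_ + _).
  by rewrite sKK -scalemxAr mulmxV// scalemx1.
rewrite ler_wpM2l ?gdet_ge0//; apply: (le_trans (hadamard _)).
rewrite le_eqVlt; apply/orP; left; apply/eqP; apply: eq_bigr => i _.
rewrite frob_row_regm normr1 expr1n addrC; congr (_ + _).
by rewrite frob_row_diag sKK mxE.
Qed.

End regularized_determinant.

Section volume_of_first_rows.
Variable R : realType.
Notation C := R[i].
Variables (n : nat) (iota : nat -> nat -> nat * nat) (V : nat -> 'rV[C]_n).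
Variables (q : R).
Hypothesis q01 : 0 < q < 1.
Variable h : R.
Hypothesis h0 : 0 < h.
Local Notation top := (top iota V).
Local Notation rowW := (rowW iota V).

Definition regdet (m : nat) (xi : cfg R) : R := grm (regm (top m xi) (Num.sqrt h)%:C).

Lemma norm_sqrth : `|(Num.sqrt h)%:C| ^+ 2 = h%:C :> C.
Proof. by rewrite -nsqE nsqC sqr_sqrtr// ltW. Qed.

Lemma regdet_step m xi : regdet m.+1 xi <= regdet m xi * (fr (rowW xi m) + h).
Proof.
rewrite -lecR rmorphM rmorphD /= !grmE frE -norm_sqrth.
apply: (le_trans (gdet_regm_row _ _ ord_max)).
by rewrite top_last row_top.
Qed.

Lemma regdet_le_prod m1 m2 xi : (m1 <= m2)%N ->
  regdet m2 xi <= regdet m1 xi * \prod_(m1 <= i < m2) (fr (rowW xi i) + h).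
Proof.
elim: m2 => [|m2 IH]; first by rewrite leqn0 => /eqP ->; rewrite big_geq// mulr1.
rewrite leq_eqVlt => /orP[/eqP ->|]; first by rewrite big_geq// mulr1.
rewrite ltnS => m12; rewrite big_nat_recr//= mulrA.
apply: (le_trans (regdet_step _ _)); rewrite ler_wpM2r ?IH//.
by rewrite addr_ge0 ?fr_ge0// ltW.
Qed.

Lemma regdet_le_grm m xi (b : R) : 0 <= b ->
  0 < grm (top m.+1 xi) ->
  (forall i : 'I_m.+1, grm (row' i (top m.+1 xi)) <= b * grm (top m.+1 xi)) ->
  regdet m.+1 xi <= grm (top m.+1 xi) * expR (h * b * m.+1%:R).
Proof.
move=> b0 g0 hb.
have gC : gdet (top m.+1 xi) != 0 by rewrite -grmE eq_complex /= eqxx andbT gt_eqF.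
rewrite -lecR rmorphM /= /regdet !grmE.
apply: (le_trans (gdet_regm_le _ gC)); rewrite ler_wpM2l ?gdet_ge0//.
have -> : (expR (h * b * m.+1%:R))%:C = \prod_(i < m.+1) (expR (h * b))%:C :> C.
  by rewrite prodr_const card_ord -rmorphXn /= -expRM_natr.
apply: ler_prod => i _; rewrite norm_sqrth inv_gram_diag// -!grmE -fmorphV -!rmorphM.
rewrite -(rmorph1 (real_complex R)) -rmorphD /= ler0c lecR addr_ge0 ?mulr_ge0 ?invr_ge0 ?grm_ge0 ?(ltW h0)//=.
apply: le_trans (expR_ge1Dx _); rewrite lerD2l ler_wpM2l ?(ltW h0)//.
by rewrite ler_pdivrMr.
Qed.

Lemma grm_chain m1 m2 xi : (m1 <= m2 <= n)%N ->
  0 < grm (top m1 xi) ->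
  (forall j, (m1 <= j < m2)%N -> ~~ bad_last iota V q j (n - j) xi) ->
  grm (top m1 xi) * \prod_(m1 <= j < m2) (cdist q * (n - j)%:R ^+ 2 / n%:R) <= grm (top m2 xi)
  /\ 0 < grm (top m2 xi).
Proof.
elim: m2 => [|m2 IH].
  by rewrite leqn0 => /andP[/eqP -> _] ? _; rewrite big_geq// mulr1.
move=> /andP[]; rewrite leq_eqVlt => /orP[/eqP -> _ ? _|]; first by rewrite big_geq// mulr1.
rewrite ltnS => m12 m2n g0 hb.
have [] := IH _ g0 _; first by rewrite m12 ltnW.
  by move=> j /andP[mj jm]; apply: hb; rewrite mj ltnS ltnW.
move=> h1 h2; have := hb m2; rewrite m12 ltnSn => /(_ isT).
rewrite /bad_last h2 /= -ltNge => h3.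
have n0 : 0 < n%:R :> R by rewrite ltr0n (leq_ltn_trans _ m2n).
have c0 := cdist_gt0 q01.
have h4 : cdist q * (n - m2)%:R ^+ 2 / n%:R * grm (top m2 xi) < grm (top m2.+1 xi).
  by rewrite mulrAC ltr_pdivrMr// [ltRHS]mulrC.
split; last first.
  by apply: le_lt_trans h4; rewrite mulr_ge0 ?grm_ge0// divr_ge0// mulr_ge0 ?sqr_ge0// ltW.
rewrite big_nat_recr//= mulrA mulrC; apply: le_trans (ltW h4).
by rewrite ler_wpM2l// divr_ge0// mulr_ge0 ?sqr_ge0// ltW.
Qed.

(* The regularized determinant controls the volume of the first m2 rows: the
   last rows cost at most the product of their lengths, the regularization of
   the first m1 rows costs h times the inverse squared distances. *)
Lemma volume_lower m1 m2 k xi (Z K : R) : (m1.+1 <= m2 <= n)%N -> (0 < k)%N ->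
  0 < K -> Z <= regdet n xi ->
  \prod_(m1.+1 <= i < n) (fr (rowW xi i) + h) <= K ->
  (forall j, (j < m2)%N -> ~~ bad_last iota V q j (n - j) xi) ->
  (forall i : 'I_m1.+1, ~~ bad_mid iota V q i k xi) ->
  Z / K * expR (- (h * (n%:R / (cdist q * k%:R ^+ 2)) * m1.+1%:R)) *
    \prod_(m1.+1 <= j < m2) (cdist q * (n - j)%:R ^+ 2 / n%:R) <= grm (top m2 xi)
  /\ 0 < grm (top m2 xi).
Proof.
move=> m12 k0 K0 ZR KP bl bm; have /andP[m12' m2n] := m12.
have c0 := cdist_gt0 q01.
have top0 : grm (top 0 xi) = 1 by apply: complexI; rewrite grmE gdet_nil.
have [_ g1] : grm (top 0 xi) * \prod_(0 <= j < m1.+1) (cdist q * (n - j)%:R ^+ 2 / n%:R)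
   <= grm (top m1.+1 xi) /\ 0 < grm (top m1.+1 xi).
  apply: grm_chain; first by rewrite /= (leq_trans m12').
    by rewrite top0.
  by move=> j /andP[_ jm]; apply: bl; exact: leq_trans m12'.
have [h2 h3] : grm (top m1.+1 xi) * \prod_(m1.+1 <= j < m2) (cdist q * (n - j)%:R ^+ 2 / n%:R)
   <= grm (top m2 xi) /\ 0 < grm (top m2 xi).
  by apply: grm_chain => // j /andP[_ jm]; exact: bl.
split => //; apply: le_trans h2.
have p0 : 0 <= \prod_(m1.+1 <= j < m2) (cdist q * (n - j)%:R ^+ 2 / n%:R).
  by apply: prodr_ge0 => j _; rewrite divr_ge0// mulr_ge0 ?sqr_ge0// ltW.
rewrite ler_wpM2r// expRN ler_pdivrMr ?expR_gt0// ler_pdivrMr//.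
apply: (le_trans ZR); apply: (le_trans (regdet_le_prod xi (leq_trans m12' m2n))).
have r0 : 0 <= regdet m1.+1 xi by exact: grm_ge0.
apply: (le_trans (ler_wpM2l r0 KP)); rewrite ler_wpM2r ?(ltW K0)//.
apply: regdet_le_grm => //; first by rewrite divr_ge0// mulr_ge0 ?sqr_ge0// ltW.
move=> i; have := bm i; rewrite /bad_mid.
have := grm_ge0 (row' i (top m1.+1 xi)); rewrite le_eqVlt => /orP[/eqP <-|gi].
  by rewrite mulr_ge0 ?(ltW g1)// divr_ge0// mulr_ge0 ?sqr_ge0// ltW.
rewrite gi /= -ltNge => /ltW hh.
have ck : 0 < cdist q * k%:R ^+ 2 by rewrite (mulr_gt0 c0)// exprn_gt0// ltr0n.
by rewrite mulrAC ler_pdivlMr// mulrC.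
Qed.

End volume_of_first_rows.

(** * Exact second moments of shifted determinants *)

Section affine_second_moment.
Variable R : realType.
Notation C := R[i].
Variable mu : probability C R.
Hypothesis mu_std : std_law mu.

(** The redrawn entries are independent, centred and of variance one, so all cross terms vanish. *)
Lemma EJ_nsq_affine (K : seq (nat * nat)) (F : nat * nat -> C) (c : C) xi : uniq K ->
  (EJ mu K (fun xi => (nsq (\sum_(e <- K) xi e * F e + c))%:E) xi
   = (\sum_(e <- K) nsq (F e) + nsq c)%:E)%E.
Proof.
elim: K c xi => [|e K IH] c xi /=; first by rewrite !big_nil !add0r.
move=> /andP[eK uK]; rewrite /E1.
transitivity (\int[mu]_u (nsq (u * F e + c) + \sum_(e0 <- K) nsq (F e0))%:E)%E.
  apply: eq_integral => u _; rewrite [nsq _ + \sum_(_ <- _) _]addrC -(IH _ (upd xi e u))//.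
  apply: EJ_congr => xi' h; rewrite big_cons h// updE.
  by congr (nsq _)%:E; rewrite addrAC addrC.
under eq_integral do rewrite EFinD.
rewrite ge0_integralD//.
- rewrite int_affine// integral_cst//= probability_setT mule1 -EFinD big_cons.
  by congr EFin; rewrite addrAC.
- by move=> u _; rewrite lee_fin nsq_ge0.
- apply/measurable_EFinP; apply: measurable_of_measf; apply: measf_nsq.
  apply: cmeasfD; last exact: cmeasf_cst.
  by apply: cmeasfM; [exact: cmeasf_coord|exact: cmeasf_cst].
- by move=> u _; rewrite lee_fin; apply: sumr_ge0 => e0 _; exact: nsq_ge0.
Qed.

End affine_second_moment.

Section second_moment.
Context d (T : measurableType d) (R : realType) (P : probability T R).
Notation C := R[i].
Variable x : nat * nat -> {RV P >-> C}.
Hypothesis x_iid : iid x.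
Local Notation mu := (distribution P (x (0%N, 0%N))).
Hypothesis mu_std : std_law mu.

Variable iota : nat -> nat -> nat * nat.
Hypothesis iota_inj : inj2 iota.

(** The index maps [a] and [b] make the principal minors instances of the same definition, as the
    inductions on n require. *)
Definition shiftmx n (a b : 'I_n -> nat) (s : 'I_n -> C) (xi : cfg R) : 'M[C]_n :=
  \matrix_(i, j) (xi (iota (a i) (b j)) - s i *+ (i == j)).

Definition Edet n (a b : 'I_n -> nat) (s : 'I_n -> C) : \bar R :=
  ex x (fun xi => (nsq (\det (shiftmx a b s xi)))%:E).

Lemma mxmeasf_shiftmx n (a b : 'I_n -> nat) s : mxmeasf (shiftmx a b s).
Proof.
move=> i j; under eq_fun do rewrite mxE.
by apply: cmeasfB; [exact: cmeasf_coord|exact: cmeasf_cst].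
Qed.

Definition zero_at n (i : 'I_n) (s : 'I_n -> C) : 'I_n -> C :=
  fun j => if j == i then 0 else s j.

Lemma cofactor_shiftmx n (a b : 'I_n.+1 -> nat) s i j xi :
  nsq (cofactor (shiftmx a b s xi) i j) = nsq (\det (row' i (col' j (shiftmx a b s xi)))).
Proof.
rewrite /cofactor nsqM nsqX nsqN nsq1 expr1n mul1r; congr (nsq (\det _)).
Qed.

Lemma minor_shiftmx n (a b : 'I_n.+1 -> nat) s i xi :
  row' i (col' i (shiftmx a b s xi)) = shiftmx (a \o lift i) (b \o lift i) (s \o lift i) xi.
Proof. by apply/matrixP => k l; rewrite !mxE (inj_eq lift_inj). Qed.

Lemma EJ_row_det n (a b : 'I_n.+1 -> nat) (s : 'I_n.+1 -> C) i xi :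
  injective a -> injective b ->
  (EJ mu [seq iota (a i) (b j) | j <- enum 'I_n.+1]
    (fun xi => (nsq (\det (shiftmx a b s xi)))%:E) xi =
   (\sum_j nsq (\det (row' i (col' j (shiftmx a b s xi))))
    + nsq (s i) * nsq (\det (row' i (col' i (shiftmx a b s xi)))))%:E)%E.
Proof.
move=> ia ib; set K := map _ _.
pose M := shiftmx a b s.
have uK : uniq K.
  by rewrite map_inj_uniq ?enum_uniq// => j j' /iota_inj[_ /ib].
pose jof (e : nat * nat) : 'I_n.+1 := odflt ord0 [pick j | iota (a i) (b j) == e].
have jofE j : jof (iota (a i) (b j)) = j.
  rewrite /jof; case: pickP => [j'|/(_ j)]; last by rewrite eqxx.
  by move=> /eqP /iota_inj[_ /ib].
rewrite (EJ_congr mu (g := fun xi' => (nsq (\sum_(e <- K) xi' e * cofactor (M xi) i (jof e)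
   + - s i * cofactor (M xi) i i))%:E)).
  rewrite EJ_nsq_affine//; congr (_%:E); rewrite nsqM nsqN cofactor_shiftmx; congr (_ + _).
  rewrite big_map big_enum /=; apply: eq_bigr => j _.
  by rewrite jofE cofactor_shiftmx.
move=> xi' h; congr (nsq _)%:E.
have cofE j : cofactor (M xi') i j = cofactor (M xi) i j.
  rewrite /cofactor; congr (_ * \det _); apply/matrixP => k l; rewrite !mxE h//.
  apply/mapP => -[j' _ /iota_inj[/ia/eqP]].
  by rewrite eq_sym (negbTE (neq_lift _ _)).
rewrite (expand_det_row _ i) big_map big_enum /=.
under eq_bigr do rewrite cofE mxE mulrBl.
rewrite sumrB; apply: (f_equal2 +%R); first by apply: eq_bigr => j _; rewrite jofE.
rewrite (bigD1 i)//= eqxx mulr1n big1 ?addr0 ?mulNr// => j ji.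
by rewrite eq_sym (negbTE ji) mulr0n mul0r.
Qed.

Lemma measf_nsqdet n (a b : 'I_n -> nat) s :
  measf (fun xi => (nsq (\det (shiftmx a b s xi)))%:E).
Proof. by apply: measf_EFin; apply: measf_nsq; apply: cmeasf_det; exact: mxmeasf_shiftmx. Qed.

(** The determinant is affine in row i; the shift s_i contributes only the constant - s_i times a
    principal minor, and the squared modulus of a constant term adds to the second moment. *)
Lemma Edet_zero_at n (a b : 'I_n.+1 -> nat) s i : injective a -> injective b ->
  (Edet a b s = Edet a b (zero_at i s) +
     (nsq (s i))%:E * Edet (a \o lift i) (b \o lift i) (s \o lift i))%E.
Proof.
move=> ia ib; pose K := [seq iota (a i) (b j) | j <- enum 'I_n.+1].
have nn m (a' b' : 'I_m -> nat) s' xi : (0 <= (nsq (\det (shiftmx a' b' s' xi)))%:E)%E.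
  by rewrite lee_fin nsq_ge0.
rewrite /Edet (ex_EJ x_iid K)//; last exact: measf_nsqdet.
rewrite [in RHS](ex_EJ x_iid K)//; last exact: measf_nsqdet.
have md m (a' b' : 'I_m -> nat) s' : measurable_fun setT
    (fun t => (nsq (\det (shiftmx a' b' s' (config x t))))%:E).
  exact: (measf_config x (measf_nsqdet a' b' s')).
rewrite -ge0_integralZl//; last by rewrite lee_fin nsq_ge0.
rewrite /ex -ge0_integralD//; first last.
- by apply: emeasurable_funM; [exact: measurable_cst|exact: md].
- by move=> t _; rewrite -EFinM lee_fin mulr_ge0 ?nsq_ge0.
- exact: (measf_config x (EJ_meas mu K (nn _ _ _ _) (measf_nsqdet _ _ _))).
- by move=> t _; apply: EJ_ge0.
apply: eq_integral => t _; rewrite !EJ_row_det// /zero_at eqxx nsq0 mul0r addr0.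
rewrite -EFinM -EFinD -minor_shiftmx; congr (_ + _)%:E.
apply: eq_bigr => j _; congr (nsq (\det _)); apply/matrixP => k l; rewrite !mxE.
by rewrite [lift i k == i]eq_sym (negbTE (neq_lift _ _)).
Qed.

Lemma Edet_ext n (a b : 'I_n -> nat) s s' : s =1 s' -> Edet a b s = Edet a b s'.
Proof. by move=> /funext ->. Qed.

Lemma Edet0 n (a b : 'I_n -> nat) : injective a -> injective b ->
  Edet a b (fun=> 0) = (n`!%:R)%:E.
Proof.
elim: n a b => [|n IH] a b ia ib.
  rewrite /Edet /ex; under eq_integral do rewrite det_mx00 nsq1.
  by rewrite integral_cst//= probability_setT mule1 fact0.
rewrite /Edet (ex_EJ x_iid [seq iota (a ord0) (b j) | j <- enum 'I_n.+1])//; last 2 first.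
- by move=> xi; rewrite lee_fin nsq_ge0.
- exact: measf_nsqdet.
transitivity (\sum_(j < n.+1) Edet (a \o lift ord0) (b \o lift j) (fun=> 0%R))%E.
  rewrite /Edet /ex -ge0_integral_sum//; last 2 first.
  - by move=> j; exact: (measf_config x (measf_nsqdet _ _ _)).
  - by move=> j t _; rewrite lee_fin nsq_ge0.
  apply: eq_integral => t _; rewrite EJ_row_det// nsq0 mul0r addr0 sumEFin.
  congr (_%:E); apply: eq_bigr => j _; congr (nsq (\det _)).
  by apply/matrixP => k l; rewrite !mxE !mul0rn.
under eq_bigr => j _.
  rewrite IH; [|by move=> ? ? /ia/lift_inj|by move=> ? ? /ib/lift_inj]. over.
by rewrite sumEFin sumr_const card_ord factS natrM mulr_natl.
Qed.

(** Second moment of the determinant when m of the n diagonal entries carry a shift of squared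
    modulus S: choose the k shifts that are used; a minor of size n - k remains, of second moment (n
    - k)!. *)
Definition tmom (S : R) (n m : nat) : R :=
  \sum_(k < m.+1) 'C(m, k)%:R * S ^+ k * (n - k)`!%:R.

(** Pascal's rule, in the form of the recursion of [Edet_zero_at]. *)
Lemma tmomS S n m : tmom S n.+1 m.+1 = tmom S n.+1 m + S * tmom S n m.
Proof.
rewrite /tmom big_ord_recl /= [in X in _ = X + _]big_ord_recl /= !bin0 -addrA; congr (_ + _).
rewrite mulr_sumr.
have -> : \sum_(i < m) 'C(m, bump 0 i)%:R * S ^+ bump 0 i * (n.+1 - bump 0 i)`!%:R =
  \sum_(i < m.+1) 'C(m, i.+1)%:R * S ^+ i.+1 * (n - i)`!%:R.
  by rewrite [RHS]big_ord_recr /= bin_small// mul0r mul0r addr0.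
rewrite -big_split /=; apply: eq_bigr => i _.
by rewrite /bump leq0n add1n subSS binS natrD exprS; ring.
Qed.

Lemma EdetE n (a b : 'I_n -> nat) (s : C) m : injective a -> injective b -> (m <= n)%N ->
  Edet a b (fun i => if (i < m)%N then s else 0) = (tmom (nsq s) n m)%:E.
Proof.
elim: m n a b => [|m IH] n a b ia ib mn.
  rewrite /tmom big_ord1 bin0 expr0 !mul1r subn0 -(Edet0 ia ib).
  by apply: Edet_ext.
case: n a b ia ib mn => // n a b ia ib mn.
have im : (m < n.+1)%N by [].
rewrite (Edet_zero_at _ (Ordinal im))// tmomS [in RHS]EFinD [(nsq s * _)%:E]EFinM /= ltnSn.
have mn' : (m <= n)%N by [].
have E1 : Edet a b (zero_at (Ordinal im) (fun i : 'I_n.+1 => if (i < m.+1)%N then s else 0))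
    = (tmom (nsq s) n.+1 m)%:E.
  apply: etrans (IH n.+1 a b ia ib (ltnW mn)).
  apply: Edet_ext => j; rewrite /zero_at -(inj_eq val_inj) /= ltnS.
  by case: ltngtP.
have E2 : Edet (a \o lift (Ordinal im)) (b \o lift (Ordinal im))
    ((fun i : 'I_n.+1 => if (i < m.+1)%N then s else 0) \o lift (Ordinal im))
    = (tmom (nsq s) n m)%:E.
  have ia' : injective (a \o lift (Ordinal im)) by move=> ? ? /ia/lift_inj.
  have ib' : injective (b \o lift (Ordinal im)) by move=> ? ? /ib/lift_inj.
  apply: etrans (IH n _ _ ia' ib' mn').
  apply: Edet_ext => j /=; rewrite /bump ltnS.
  by case: (leqP m j) => [mj|jm]; rewrite ?add1n ?add0n ?(ltnW jm)// ltnNge mj.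
by rewrite E1 E2.
Qed.

End second_moment.

(** * Tensorization of the bound on E Z * E (1 / Z) *)

Section tensorization.
Variable R : realType.
Notation C := R[i].
Variable mu : probability C R.
Implicit Types (f : cfg R -> \bar R) (Z : cfg R -> R).

Lemma E1_gt0 e f : measf f -> (forall xi, 0 < f xi)%E -> forall xi, (0 < E1 mu e f xi)%E.
Proof.
move=> mf f0 xi; have mu_f := measf_upd xi e mf.
rewrite lt_neqAle E1_ge0 ?andbT; last by move=> xi'; exact: ltW.
apply/negP => /eqP /esym; rewrite /E1 => h.
have : (\int[mu]_u `|f (upd xi e u)| = 0)%E.
  by rewrite -[RHS]h; apply: eq_integral => u _; rewrite gee0_abs// ltW.
move=> /(ae_eq_integral_abs mu measurableT mu_f).1 [N [mN N0 hN]].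
suff NT : N = setT.
  by have := probability_setT mu; rewrite -NT N0 => /eqP; rewrite eq_sym onee_eq0.
apply/seteqP; split => // u _; apply: hN => /= /(_ Logic.I).
by have := f0 (upd xi e u) => /[swap] ->; rewrite ltxx.
Qed.

Lemma EJ_gt0 K f : measf f -> (forall xi, 0 < f xi)%E -> forall xi, (0 < EJ mu K f xi)%E.
Proof.
move=> mf f0; elim: K => //= e K IH; apply: E1_gt0 => //.
by apply: EJ_meas => // xi; exact: ltW.
Qed.

Lemma EJ_off M f xi xi' : (forall e, e \notin M -> xi' e = xi e) ->
  EJ mu M f xi' = EJ mu M f xi.
Proof.
elim: M xi xi' => [|e M IH] xi xi' h /=; first by congr f; apply/funext => a; exact: h.
apply: eq_integral => u _; apply: IH => a aM; rewrite /upd.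
by case: eqP => // /eqP ae; apply: h; rewrite inE negb_or ae.
Qed.

Lemma measf_inv Z : measf Z -> (forall xi, 0 < Z xi) -> measf (fun xi => (Z xi)^-1).
Proof.
move=> mZ Z0; have -> : (fun xi => (Z xi)^-1) = (fun xi => expR (- ln (Z xi))).
  by apply/funext => xi; rewrite expRN lnK// posrE.
apply: measf_expR; apply: measfN; exact: (measf_comp (g := @ln R)).
Qed.

Lemma measf_fine f : measf f -> measf (fun xi => fine (f xi)).
Proof.
by move=> mf; apply: (measf_comp (g := @fine R)).
Qed.

(* Jensen for t |-> 1/t with the weights H / A is replaced by the tangent-line
   inequality H^2/Z + Z A^2/a^2 >= 2 A H / a. *)
Lemma EJ_tensor L K Z (c c2 : R) : measf Z -> (forall xi, 0 < Z xi) -> 0 <= c -> 0 <= c2 ->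
  (forall xi, EJ mu K (fun xi => (Z xi)%:E) xi * EJ mu K (fun xi => (Z xi)^-1%:E) xi <= c%:E)%E ->
  (forall xi, EJ mu L (fun xi => (Z xi)%:E) xi * EJ mu L (fun xi => (Z xi)^-1%:E) xi <= c2%:E)%E ->
  (forall xi, EJ mu (L ++ K) (fun xi => (Z xi)%:E) xi < +oo)%E ->
  forall xi, (EJ mu (L ++ K) (fun xi => (Z xi)%:E) xi *
    EJ mu (L ++ K) (fun xi => (Z xi)^-1%:E) xi <= (c * c2)%:E)%E.
Proof.
move=> mZ Z0 c0 c20 hK hL hfin xi.
have mZi := measf_inv mZ Z0.
have Zi0 xi' : 0 < (Z xi')^-1 by rewrite invr_gt0.
set fZ := fun xi => (Z xi)%:E; set fI := fun xi => (Z xi)^-1%:E.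
have mfZ : measf fZ by exact: measf_EFin.
have mfI : measf fI by exact: measf_EFin.
have fZ0 xi' : (0 < fZ xi')%E by rewrite lte_fin.
have fI0 xi' : (0 < fI xi')%E by rewrite lte_fin.
have fin (M : seq (nat * nat)) (b : R) xi' : (EJ mu M fZ xi' * EJ mu M fI xi' <= b%:E)%E ->
    EJ mu M fZ xi' \is a fin_num /\ EJ mu M fI xi' \is a fin_num.
  have := EJ_gt0 M mfZ fZ0 xi'; have := EJ_gt0 M mfI fI0 xi'.
  case: (EJ mu M fZ xi') => [r| |]; case: (EJ mu M fI xi') => [s| |] //.
  - by rewrite lte_fin => _ r0; rewrite gt0_muley// lte_fin.
  - by rewrite lte_fin => s0 _; rewrite gt0_mulye.
(* [a] and [H] are the partial expectations over K and over L. Redrawing K in [H] gives the same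
   total mean A as redrawing L in [a], because the order of integration is free. *)
pose a xi' := fine (EJ mu K fZ xi').
pose H xi' := fine (EJ mu L fZ xi').
have aE xi' : EJ mu K fZ xi' = (a xi')%:E by rewrite /a fineK//; case: (fin _ _ _ (hK xi')).
have HE xi' : EJ mu L fZ xi' = (H xi')%:E by rewrite /H fineK//; case: (fin _ _ _ (hL xi')).
have a0 xi' : 0 < a xi' by rewrite -lte_fin -aE; exact: EJ_gt0.
have H0 xi' : 0 < H xi' by rewrite -lte_fin -HE; exact: EJ_gt0.
have ma : measf a by apply: measf_fine; apply: EJ_meas => // ?; exact: ltW.
have mH : measf H by apply: measf_fine; apply: EJ_meas => // ?; exact: ltW.
have fZ0' xi' : (0 <= fZ xi')%E by exact: ltW.
have fI0' xi' : (0 <= fI xi')%E by exact: ltW.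
have ai0 xi' : 0 < (a xi')^-1 by rewrite invr_gt0.
have mai : measf (fun xi => ((a xi)^-1)%:E) by apply: measf_EFin; exact: measf_inv.
have bI xi' : (EJ mu K fI xi' <= c%:E * ((a xi')^-1)%:E)%E.
  have := hK xi'; have [_ /fineK <-] := fin _ _ _ (hK xi'); rewrite aE -!EFinM !lee_fin.
  by rewrite ler_pdivlMr// mulrC.
have [A AE] : exists A, EJ mu (L ++ K) fZ xi = A%:E.
  have := EJ_gt0 (L ++ K) mfZ fZ0 xi; have := hfin xi.
  by case: (EJ mu (L ++ K) _ xi) => [r| |]// _ _; exists r.
have A0 : 0 < A by rewrite -lte_fin -AE; exact: EJ_gt0.
pose G xi' := H xi' ^+ 2 / Z xi'.
have G0 xi' : 0 <= G xi' by rewrite divr_ge0 ?sqr_ge0// ltW.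
have mG : measf (fun xi => (G xi)%:E).
  by apply: measf_EFin; apply: measfM => //; exact: measfX.
have KLperm : perm_eq (K ++ L) (L ++ K) by rewrite perm_catC.
have ii xi' : (forall e, e \notin L -> xi' e = xi e) ->
    ((A ^+ 2 * (a xi')^-1)%:E <= EJ mu K (fun xi => (G xi)%:E) xi')%E.
  move=> h; set al := a xi'; have al0 : 0 < al := a0 xi'.
  have AK : EJ mu K (fun xi => (H xi)%:E) xi' = A%:E.
    transitivity (EJ mu K (EJ mu L fZ) xi').
      by congr (EJ mu K _ xi'); apply/funext => y; rewrite HE.
    rewrite -EJ_cat (EJ_perm mu xi' fZ0' mfZ KLperm) -AE; apply: EJ_off => e.
    by rewrite mem_cat negb_or => /andP[eL _]; exact: h.
  have h1 : (EJ mu K (fun xi => (2 * A / al)%:E * (H xi)%:E) xi' <=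
     EJ mu K (fun xi => (G xi)%:E + (A ^+ 2 / al ^+ 2)%:E * fZ xi) xi')%E.
    apply: EJ_le => [y|||y].
    - by rewrite -EFinM lee_fin mulr_ge0 ?(ltW (H0 _))// divr_ge0 ?mulr_ge0 ?(ltW A0) ?(ltW al0).
    - by apply: measf_EFin; apply: measfM => //; exact: measf_cst.
    - apply: measf_EFin; apply: measfD; last by apply: measfM => //; exact: measf_cst.
      by apply: measfM; [exact: measfX|exact: measf_inv].
    rewrite -!EFinM -EFinD lee_fin -subr_ge0 /G.
    have -> : H y ^+ 2 / Z y + A ^+ 2 / al ^+ 2 * Z y - 2 * A / al * H y =
       (H y - A / al * Z y) ^+ 2 / Z y.
      by field; rewrite !gt_eqF.
    by rewrite divr_ge0 ?sqr_ge0// ltW.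
  move: h1; rewrite EJ_Zl//; last 3 first.
  - by rewrite divr_ge0 ?mulr_ge0 ?(ltW A0) ?(ltW al0).
  - by move=> y; rewrite lee_fin ltW.
  - exact: measf_EFin.
  rewrite EJ_D//; last 2 first.
  - by move=> y; rewrite -EFinM lee_fin mulr_ge0 ?divr_ge0 ?sqr_ge0// ltW.
  - by apply: measf_EFin; apply: measfM => //; exact: measf_cst.
  rewrite EJ_Zl//; last by rewrite divr_ge0 ?sqr_ge0.
  rewrite AK aE -/al -!EFinM.
  have -> : (2 * A / al * A)%:E = ((A ^+ 2 * al^-1)%:E + (A ^+ 2 / al ^+ 2 * al)%:E)%E :> \bar R.
    by rewrite -EFinD; congr EFin; field; rewrite gt_eqF.
  by rewrite leeD2rE.
have iii : (EJ mu L (EJ mu K (fun xi => (G xi)%:E)) xi <= (c2 * A)%:E)%E.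
  rewrite -EJ_cat -(EJ_perm mu xi _ _ KLperm)// EJ_cat.
  have -> : (c2 * A)%:E = EJ mu K (fun xi => c2%:E * EJ mu L fZ xi)%E xi.
    rewrite EJ_Zl//; [|by move=> y; exact: EJ_ge0|by apply: EJ_meas].
    by rewrite -EJ_cat (EJ_perm mu xi fZ0' mfZ KLperm) AE.
  apply: EJ_le => [y|||y].
  - exact: EJ_ge0.
  - exact: EJ_meas.
  - by move=> d S Xi mXi; apply: emeasurable_funM; [exact: measurable_cst|exact: (EJ_meas mu L fZ0' mfZ)].
  have -> : EJ mu L (fun xi => (G xi)%:E) y = ((H y ^+ 2)%:E * EJ mu L fI y)%E.
    rewrite -EJ_Zl ?sqr_ge0//; apply: EJ_congr => y' h'.
    by rewrite /G /H (EJ_off fZ h') EFinM.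
  have := hL y; have [_ /fineK <-] := fin _ _ _ (hL y); rewrite HE -!EFinM !lee_fin.
  move=> h'; rewrite expr2 -mulrA mulrC; apply: ler_wpM2r => //; exact: ltW.
have iv : ((A ^+ 2)%:E * EJ mu L (fun xi => ((a xi)^-1)%:E) xi <= (c2 * A)%:E)%E.
  rewrite -EJ_Zl ?sqr_ge0//; last by move=> y; rewrite lee_fin ltW.
  apply: le_trans iii; apply: EJ_le_on => //.
  - by move=> y; rewrite -EFinM lee_fin mulr_ge0 ?sqr_ge0// ltW.
  - by move=> y; exact: EJ_ge0.
  - by apply: measf_EFin; apply: measfM; [exact: measf_cst|exact: measf_inv].
  - exact: EJ_meas.
have v : (EJ mu (L ++ K) fI xi <= c%:E * EJ mu L (fun xi => ((a xi)^-1)%:E) xi)%E.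
  rewrite EJ_cat -EJ_Zl//; last by move=> y; rewrite lee_fin ltW.
  apply: EJ_le => //; [by move=> y; exact: EJ_ge0|exact: EJ_meas|].
  by apply: measf_EFin; apply: measfM; [exact: measf_cst|exact: measf_inv].
rewrite AE; apply: (@le_trans _ _ (A%:E * (c%:E * EJ mu L (fun xi => ((a xi)^-1)%:E) xi))%E).
  by rewrite lee_pmul2l// lte_fin.
have := EJ_ge0 mu L (f := fun xi => ((a xi)^-1)%:E) _ xi.
move: iv; case: (EJ mu L _ xi) => [r| |].
- rewrite -!EFinM !lee_fin => h _; rewrite mulrCA; apply: ler_wpM2l => //.
  by rewrite -(ler_pM2l A0) mulrA -expr2 [leRHS]mulrC.
- by rewrite gt0_muley ?lte_fin ?exprn_gt0.
- by move=> _ /(_ (fun y => ltW (ai0 y))).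
Qed.

End tensorization.

(** * Squared length of a random linear combination *)

Section row_variance.
Variable R : realType.
Notation C := R[i].
Variable mu : probability C R.
Hypothesis mu_std : std_law mu.

Lemma EJ_coord K (g : C -> \bar R) e xi : uniq K -> e \in K ->
  EJ mu K (fun xi => g (xi e)) xi = (\int[mu]_u g u)%E.
Proof.
elim: K xi => [|e' K IH] xi //= /andP[e'K uK]; rewrite inE => /orP[/eqP ee'|eK].
  subst e'; apply: eq_integral => u _; rewrite EJ_notin ?updE// => xi' h.
  by rewrite h// updE.
rewrite E1_cst; first exact: IH.
by move=> u; rewrite !IH.
Qed.

Lemma EJ_sum J (I : Type) (s : seq I) (f : I -> cfg R -> \bar R) xi :
  (forall j xi, 0 <= f j xi)%E -> (forall j, measf (f j)) ->
  (EJ mu J (fun xi => \sum_(j <- s) f j xi) xi = \sum_(j <- s) EJ mu J (f j) xi)%E.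
Proof.
move=> f0 mf; elim: s => [|i s IH].
  rewrite big_nil -[RHS](EJ_cst mu J 0%E xi); congr (EJ _ _ _ _); apply/funext => y.
  by rewrite big_nil.
rewrite big_cons /= -IH -EJ_D//; last 2 first.
- by move=> y; apply: sume_ge0 => j _; exact: f0.
- by move=> d S Xi mXi; apply: (@emeasurable_sum _ _ _ _ _ _ (fun j t => f j (Xi t))) => j; exact: mf.
by congr (EJ _ _ _ _); apply/funext => y; rewrite big_cons.
Qed.

Variable e : nat -> nat * nat.
Hypothesis e_inj : injective e.
Local Notation K m := (map e (seq.iota 0 m)).

Lemma uniqK m : uniq (K m).
Proof. by rewrite map_inj_uniq// iota_uniq. Qed.

Lemma EJ_rcons m (f : cfg R -> \bar R) xi : EJ mu (K m.+1) f xi = EJ mu (K m) (E1 mu (e m) f) xi.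
Proof. by rewrite -addn1 iotaD map_cat EJ_cat. Qed.

(** Orthogonality of martingale differences: at step j the earlier terms are constants by [ginv],
    and [gint] says that a constant adds only its own square. *)
Lemma EJ_sq_sum (g G : nat -> cfg R -> R) (b : nat -> R) m xi :
  (forall j, measf (g j)) -> (forall j, measf (G j)) -> (forall j xi, 0 <= G j xi) ->
  (forall j k xi u, (j < k)%N -> g j (upd xi (e k) u) = g j xi) ->
  (forall j xi c, \int[mu]_u ((g j (upd xi (e j) u) + c) ^+ 2)%:E <= (G j xi + c ^+ 2)%:E)%E ->
  (forall j, (j < m)%N -> EJ mu (K j) (fun xi => (G j xi)%:E) xi <= (b j)%:E)%E ->
  (EJ mu (K m) (fun xi => ((\sum_(j < m) g j xi) ^+ 2)%:E) xi <= (\sum_(j < m) b j)%:E)%E.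
Proof.
move=> mg mG G0 ginv gint; elim: m => [_|m IH hb]; first by rewrite /= !big_ord0 expr0n.
rewrite EJ_rcons big_ord_recr /= EFinD.
have ms k : measf (fun xi => (\sum_(j < k) g j xi)) by apply: measf_sum => j; exact: mg.
have mss k : measf (fun xi => ((\sum_(j < k) g j xi) ^+ 2)%:E).
  by apply: measf_EFin; apply: measfX; exact: ms.
apply: (@le_trans _ _ (EJ mu (K m) (fun xi => (G m xi)%:E + ((\sum_(j < m) g j xi) ^+ 2)%:E)%E xi)).
  apply: EJ_le => [y||| y].
  - by apply: E1_ge0 => y'; rewrite lee_fin sqr_ge0.
  - by apply: E1_meas; [move=> y'; rewrite lee_fin sqr_ge0|exact: mss].
  - by apply: measf_EFin; apply: measfD => //; exact: measfX.
  rewrite -EFinD; apply: le_trans (gint m y (\sum_(j < m) g j y)).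
  rewrite /E1 le_eqVlt; apply/orP; left; apply/eqP; apply: eq_integral => u _.
  rewrite big_ord_recr /= addrC; congr (((_ + _) ^+ 2)%:E); apply: eq_bigr => j _.
  by rewrite ginv.
rewrite EJ_D//; last 3 first.
- by move=> y; rewrite lee_fin.
- by move=> y; rewrite lee_fin sqr_ge0.
- exact: measf_EFin.
rewrite [X in (X <= _)%E]addeC; apply: leeD; last exact: hb.
by apply: IH => j jm; apply: hb; exact: ltnW.
Qed.

Variables (N : nat) (w : nat -> 'rV[C]_N) (c : 'rV[C]_N).

Definition partrow m (xi : cfg R) : 'rV[C]_N := \sum_(j < m) xi (e j) *: w j - c.
(** Inner product of the next vector with the conjugated partial sum: the coefficient of entry m in
    the cross terms of the squared length, which involves only earlier entries. *)
Definition partcov m (xi : cfg R) : C := (w m *m (partrow m xi)^t*) 0 0.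

Lemma fr_row p (A : 'rV[C]_p) : fr A = \sum_j nsq (A 0 j).
Proof. by rewrite /fr big_ord1. Qed.

Lemma fr_addZ p (u r : 'rV[C]_p) (z : C) :
  fr (u + z *: r) = fr u + nsq z * fr r + 2 * complex.Re (z * (r *m u^t*) 0 0).
Proof.
rewrite !fr_row mxE mulr_sumr raddf_sum /= !mulr_sumr -!big_split /=.
apply: eq_bigr => j _; rewrite !mxE addrC nsqD nsqM conjcE mulrA.
by rewrite [nsq z * _ + nsq _]addrC.
Qed.

Lemma partrowS m xi : partrow m.+1 xi = partrow m xi + xi (e m) *: w m.
Proof. by rewrite /partrow big_ord_recr /= addrAC. Qed.

Lemma fr_partrow m xi : fr (partrow m xi) = fr c +
  \sum_(j < m) (nsq (xi (e j)) * fr (w j) + 2 * complex.Re (xi (e j) * partcov j xi)).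
Proof.
elim: m => [|m IH].
  by rewrite /partrow big_ord0 sub0r big_ord0 addr0 !fr_row; apply: eq_bigr => j _; rewrite mxE nsqN.
by rewrite partrowS fr_addZ IH big_ord_recr /= !addrA.
Qed.

Let sumr1_n n : \sum_(i < n) 1 = n%:R :> R.
Proof. by rewrite sumr_const card_ord. Qed.

Let sum_K (V : nmodType) m (F : nat * nat -> V) : \sum_(a <- K m) F a = \sum_(j < m) F (e j).
Proof. have -> : seq.iota 0 m = index_iota 0 m by rewrite /index_iota subn0.
by rewrite big_map big_mkord. Qed.

Let index_K m (j : 'I_m) : index (e j) (K m) = j.
Proof. rewrite (index_map e_inj); have := @index_uniq _ 0%N j (seq.iota 0 m).
by rewrite size_iota iota_uniq nth_iota// add0n; apply. Qed.

Lemma partcovJ m xi : (partcov m xi)^* =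
  \sum_(a <- K m) xi a * (w (index a (K m)) *m (w m)^t*) 0 0 - (c *m (w m)^t*) 0 0.
Proof.
have -> : (partcov m xi)^* = (partrow m xi *m (w m)^t*) 0 0.
  rewrite /partcov !mxE rmorph_sum; apply: eq_bigr => j _.
  by rewrite rmorphM !mxE /= conjCK mulrC.
rewrite /partrow mulmxBl mulmx_suml mxE summxE sum_K; congr (_ + _); last by rewrite mxE.
by apply: eq_bigr => j _; rewrite index_K -scalemxAl mxE.
Qed.

Lemma EJ_partcov m xi : (EJ mu (K m) (fun xi => (nsq (partcov m xi))%:E) xi =
  (\sum_(j < m) nsq ((w j *m (w m)^t*) 0 0) + nsq ((c *m (w m)^t*) 0 0))%:E)%E.
Proof.
have -> : (fun xi => (nsq (partcov m xi))%:E) =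
    (fun xi => (nsq (\sum_(a <- K m) xi a * (w (index a (K m)) *m (w m)^t*) 0 0
       + (- (c *m (w m)^t*) 0 0)))%:E).
  by apply/funext => y; rewrite -nsqJ -conjcE partcovJ.
rewrite EJ_nsq_affine ?uniqK// nsqN; congr (_ + _)%:E.
by rewrite sum_K; apply: eq_bigr => j _; rewrite index_K.
Qed.

Lemma cmeasf_partcov m : cmeasf (partcov m).
Proof.
rewrite (_ : partcov m = fun xi => ((partcov m xi)^*)^*%C); last first.
  by apply/funext => xi; rewrite -conjcE conjCK.
apply: cmeasfJ; rewrite (_ : (fun xi => (partcov m xi)^*) = fun xi => \sum_(a <- K m)
  xi a * (w (index a (K m)) *m (w m)^t*) 0 0 - (c *m (w m)^t*) 0 0); last first.
  by apply/funext => xi; exact: partcovJ.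
apply: cmeasfB; last exact: cmeasf_cst.
by apply: cmeasf_sum => j; apply: cmeasfM; [exact: cmeasf_coord|exact: cmeasf_cst].
Qed.

Lemma mxmeasf_partrow m : mxmeasf (partrow m).
Proof.
move=> i k; rewrite (_ : (fun xi => _) =
    fun xi => \sum_(j < m) xi (e j) * w j i k - c i k); last first.
  by apply/funext => xi; rewrite !mxE summxE; congr (_ - _); apply: eq_bigr => j _; rewrite mxE.
apply: cmeasfB; last exact: cmeasf_cst.
by apply: cmeasf_sum => j; apply: cmeasfM; [exact: cmeasf_coord|exact: cmeasf_cst].
Qed.

Lemma partcov_upd j k xi u : (j <= k)%N -> partcov j (upd xi (e k) u) = partcov j xi.
Proof.
move=> jk; suff h : partrow j (upd xi (e k) u) = partrow j xi by rewrite /partcov h.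
rewrite /partrow; apply: (f_equal2 +%R) => //; apply: eq_bigr => l _.
rewrite upd_neq//; apply/eqP => /e_inj lk.
by move: (ltn_ord l); rewrite lk ltnNge jk.
Qed.

Let am_gm (s X : R) : 0 < s -> `|X| <= s + X ^+ 2 / s.
Proof.
move=> s0; rewrite -subr_ge0 -(pmulr_lge0 _ s0) mulrBl mulrDl divfK ?gt_eqF//.
by rewrite -[X ^+ 2]real_normK ?num_real//; have := sqr_ge0 (`|X| - s); nra.
Qed.

(** The deviation splits into the centred truncated squares [X1], the cross terms [X2], a truncation
    error bounded by [Y] and a bias. The first two are sums of martingale differences with second
    moments at most n L^2 and 4 (n + B); the last two have mean at most n k each. The free parameter
    s turns second moments into first ones through |X| <= s + X^2 / s. *)
Lemma row_variance n (k L m B s : R) xi : 0 < k -> 0 < L -> 0 < s ->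
  (\int[mu]_u (ntrunc L u)%:E = m%:E)%E -> 1 - k <= m <= 1 ->
  (forall j, (j < n)%N -> fr (w j) <= 1) ->
  (forall j, (j < n)%N -> \sum_(l < j) nsq ((w l *m (w j)^t*) 0 0) <= 1) ->
  \sum_(j < n) nsq ((c *m (w j)^t*) 0 0) <= B ->
  (EJ mu (K n) (fun xi => `|fr (partrow n xi) - (fr c + \sum_(j < n) fr (w j))|%:E) xi <=
    (2 * s + (n%:R * L ^+ 2 + 4 * (n%:R + B)) / s + 2 * n%:R * k)%:E)%E.
Proof.
move=> k0 L0 s0 hm /andP[m1 m2] w1 w2 cB.
pose X1 xi := \sum_(j < n) fr (w j) * (ntrunc L (xi (e j)) - m).
pose X2 xi := \sum_(j < n) 2 * complex.Re (xi (e j) * partcov j xi).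
pose Y xi := \sum_(j < n) (nsq (xi (e j)) - ntrunc L (xi (e j))).
have mX1 : measf X1.
  apply: measf_sum => j; apply: measfM; first exact: measf_cst.
  by apply: measfB; [exact: measf_ntrunc|exact: measf_cst].
have mg j : measf (fun xi : cfg R => 2 * complex.Re (xi (e j) * partcov j xi)).
  apply: measfM; first exact: measf_cst.
  by case: (cmeasfM (@cmeasf_coord R (e j)) (cmeasf_partcov j)).
have mX2 : measf X2 by apply: measf_sum.
have mY1 j : measf (fun xi : cfg R => nsq (xi (e j)) - ntrunc L (xi (e j))).
  by apply: measfB; [apply: measf_nsq; exact: cmeasf_coord|exact: measf_ntrunc].
have mY : measf Y by exact: measf_sum.
have Y0 xi' : 0 <= Y xi' by apply: sumr_ge0 => j _; rewrite subr_ge0 ntrunc_nsq.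
have EX1 : (EJ mu (K n) (fun xi => (X1 xi ^+ 2)%:E) xi <= (n%:R * L ^+ 2)%:E)%E.
  apply: (@le_trans _ _ (\sum_(j < n) (fr (w j) ^+ 2 * L ^+ 2))%:E).
    apply: (EJ_sq_sum (g := fun j xi => fr (w j) * (ntrunc L (xi (e j)) - m))
      (G := fun j xi => fr (w j) ^+ 2 * L ^+ 2) (b := fun j => fr (w j) ^+ 2 * L ^+ 2)) => //.
    - move=> j; apply: measfM; first exact: measf_cst.
      by apply: measfB; [exact: measf_ntrunc|exact: measf_cst].
    - by move=> j; exact: measf_cst.
    - by move=> j _; rewrite mulr_ge0 ?sqr_ge0.
    - move=> j l y u jl; rewrite upd_neq//; apply/eqP => /e_inj lk.
      by move: jl; rewrite lk ltnn.
    - by move=> j y a; under eq_integral do rewrite updE; exact: int_trunc.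
    - by move=> j _; rewrite EJ_cst.
  rewrite lee_fin -mulr_suml ler_wpM2r ?sqr_ge0//.
  rewrite -[leRHS]sumr1_n; apply: ler_sum => j _.
  by rewrite expr_le1 ?fr_ge0 ?w1.
have EX2 : (EJ mu (K n) (fun xi => (X2 xi ^+ 2)%:E) xi <= (4 * (n%:R + B))%:E)%E.
  pose b j := 4 * (\sum_(l < j) nsq ((w l *m (w j)^t*) 0 0) + nsq ((c *m (w j)^t*) 0 0)).
  apply: (@le_trans _ _ (\sum_(j < n) b j)%:E).
    apply: (EJ_sq_sum (g := fun j xi => 2 * complex.Re (xi (e j) * partcov j xi))
      (G := fun j xi => 4 * nsq (partcov j xi)) (b := b)) => //.
    - move=> j; apply: measfM; first exact: measf_cst.
      by apply: measf_nsq; exact: cmeasf_partcov.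
    - by move=> j y; rewrite mulr_ge0 ?nsq_ge0.
    - move=> j l y u jl; rewrite partcov_upd ?(ltnW jl)// upd_neq//; apply/eqP => /e_inj lk.
      by move: jl; rewrite lk ltnn.
    - move=> j y a; under eq_integral do rewrite updE partcov_upd//; exact: int_reaffine.
    - move=> j _; rewrite /b EFinM -(EJ_partcov j xi) -EJ_Zl//.
      + by move=> y; rewrite lee_fin nsq_ge0.
      + by apply: measf_EFin; apply: measf_nsq; exact: cmeasf_partcov.
  rewrite lee_fin -mulr_sumr ler_wpM2l// big_split /= lerD//.
  by rewrite -[leRHS]sumr1_n; apply: ler_sum => j _; exact: w2.
have EY : (EJ mu (K n) (fun xi => (Y xi)%:E) xi <= (n%:R * k)%:E)%E.
  have -> : (fun xi => (Y xi)%:E) =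
      (fun xi => (\sum_(j < n) (nsq (xi (e j)) - ntrunc L (xi (e j)))%:E)%E).
    by apply/funext => y; rewrite sumEFin.
  rewrite (@EJ_sum _ _ _ (fun (j : 'I_n) xi => (nsq (xi (e j)) - ntrunc L (xi (e j)))%:E)).
  - apply: (@le_trans _ _ (\sum_(j < n) k%:E)%E).
      apply: lee_sum => j _.
      rewrite (EJ_coord (fun u => (nsq u - ntrunc L u)%:E)) ?uniqK//; last first.
        by apply: map_f; rewrite mem_iota add0n /=.
      have mt : measurable_fun setT (fun u : C => (ntrunc L u)%:E).
        by apply/measurable_EFinP; apply: measurable_of_measf; exact: measf_ntrunc.
      have md : measurable_fun setT (fun u : C => (nsq u - ntrunc L u)%:E).
        apply/measurable_EFinP; apply: measurable_of_measf; apply: measfB; last exact: measf_ntrunc.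
        by apply: measf_nsq; exact: cmeasf_coord.
      have : (\int[mu]_u ((nsq u - ntrunc L u)%:E + (ntrunc L u)%:E) = 1)%E.
        by case: mu_std => <- _ _; apply: eq_integral => u _; rewrite -EFinD subrK.
      rewrite ge0_integralD//; last 2 first.
      - by move=> u _; rewrite lee_fin subr_ge0 ntrunc_nsq.
      - by move=> u _; rewrite lee_fin ntrunc_ge0.
      rewrite hm; case: (\int[mu]_u _)%E => [r| |]//.
      by rewrite -EFinD => -[hr]; rewrite lee_fin; lra.
    by rewrite sumEFin sumr_const card_ord lee_fin -[leLHS]mulr_natl.
  - by move=> j y; rewrite lee_fin subr_ge0 ntrunc_nsq.
  - by move=> j; apply: measf_EFin.
apply: (@le_trans _ _ (EJ mu (K n) (fun xi => (2 * s + n%:R * k)%:E +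
    ((s^-1)%:E * ((X1 xi ^+ 2)%:E + (X2 xi ^+ 2)%:E) + (Y xi)%:E))%E xi)).
  apply: EJ_le => [y|||y].
  - by rewrite lee_fin.
  - apply: measf_EFin; apply: (measf_comp (g := fun r : R => `|r|)) => //.
  by apply: measfB; [apply: measf_fr; exact: mxmeasf_partrow|exact: measf_cst].
  - rewrite (_ : (fun xi => _) = (fun xi => (2 * s + n%:R * k + (s^-1 * (X1 xi ^+ 2 + X2 xi ^+ 2) + Y xi))%:E)); last first.
      by apply/funext => z; rewrite EFinD [in RHS]EFinD EFinM EFinD.
    apply: measf_EFin; apply: measfD; first exact: measf_cst.
    apply: measfD => //; apply: measfM; first exact: measf_cst.
    by apply: measfD; exact: measfX.
  rewrite -!EFinM -!EFinD lee_fin.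
  have -> : fr (partrow n y) - (fr c + \sum_(j < n) fr (w j)) =
      X1 y + X2 y + (\sum_(j < n) fr (w j) * (nsq (y (e j)) - ntrunc L (y (e j))))
      - (1 - m) * \sum_(j < n) fr (w j).
    rewrite fr_partrow opprD addrACA subrr add0r mulr_sumr /X1 /X2 -!sumrN -!big_split /=.
    by apply: eq_bigr => j _; ring.
  have hX1 := am_gm (X1 y) s0; have hX2 := am_gm (X2 y) s0.
  have hY : `|\sum_(j < n) fr (w j) * (nsq (y (e j)) - ntrunc L (y (e j)))| <= Y y.
    rewrite ger0_norm; last by apply: sumr_ge0 => j _; rewrite mulr_ge0 ?fr_ge0// subr_ge0 ntrunc_nsq.
    by apply: ler_sum => j _; rewrite ler_piMl ?w1// subr_ge0 ntrunc_nsq.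
  have hm' : `|(1 - m) * \sum_(j < n) fr (w j)| <= n%:R * k.
    rewrite ger0_norm; last by rewrite mulr_ge0 ?subr_ge0// sumr_ge0// => j _; exact: fr_ge0.
    rewrite mulrC ler_pM ?subr_ge0//; first by apply: sumr_ge0 => j _; exact: fr_ge0.
      by rewrite -[leRHS]sumr1_n; apply: ler_sum => j _; exact: w1.
    lra.
  apply: (le_trans (ler_normB _ _)); apply: (le_trans (lerD (ler_normD _ _) hm')).
  have := ler_normD (X1 y) (X2 y).
  move: hX1 hX2 hY; set a1 := X1 y ^+ 2; set a2 := X2 y ^+ 2.
  rewrite [s^-1 * (_ + _)]mulrC mulrDl; lra.
have sq0 (X : cfg R -> R) y : (0 <= (X y ^+ 2)%:E)%E by rewrite lee_fin sqr_ge0.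
have msq (X : cfg R -> R) : measf X -> measf (fun y => (X y ^+ 2)%:E).
  by move=> mX; apply: measf_EFin; exact: measfX.
have si0 : 0 <= s^-1 by rewrite invr_ge0 ltW.
have ms12 : measf (fun xi => (X1 xi ^+ 2)%:E + (X2 xi ^+ 2)%:E)%E.
  rewrite (_ : (fun xi => _) = (fun xi => (X1 xi ^+ 2 + X2 xi ^+ 2)%:E)) //.
  by apply: measf_EFin; apply: measfD; exact: measfX.
have ms12' : measf (fun xi => s^-1%:E * ((X1 xi ^+ 2)%:E + (X2 xi ^+ 2)%:E))%E.
  rewrite (_ : (fun xi => _) = (fun xi => (s^-1 * (X1 xi ^+ 2 + X2 xi ^+ 2))%:E)) //.
  by apply: measf_EFin; apply: measfM; [exact: measf_cst|apply: measfD; exact: measfX].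
rewrite EJ_D//; last 4 first.
- by move=> y; rewrite lee_fin addr_ge0 ?mulr_ge0 ?(ltW s0) ?(ltW k0).
- by move=> y; rewrite adde_ge0 ?mule_ge0 ?adde_ge0 ?sq0 ?lee_fin.
- exact: measf_cst.
- rewrite (_ : (fun xi => _) = (fun xi => (s^-1 * (X1 xi ^+ 2 + X2 xi ^+ 2) + Y xi)%:E)) //.
  apply: measf_EFin; apply: measfD => //; apply: measfM; first exact: measf_cst.
  by apply: measfD; exact: measfX.
rewrite EJ_cst EJ_D//; last 2 first.
- by move=> y; rewrite mule_ge0 ?adde_ge0 ?sq0 ?lee_fin.
- exact: measf_EFin.
rewrite EJ_Zl//; last by move=> y; rewrite adde_ge0 ?sq0.
rewrite EJ_D//; [|exact: msq|exact: msq].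
have -> : (2 * s + (n%:R * L ^+ 2 + 4 * (n%:R + B)) / s + 2 * n%:R * k)%:E =
    ((2 * s + n%:R * k)%:E + (s^-1%:E * ((n%:R * L ^+ 2)%:E + (4 * (n%:R + B))%:E) + (n%:R * k)%:E))%E :> \bar R.
  rewrite -(EFinD (n%:R * L ^+ 2)) -(EFinM s^-1) -(EFinD (s^-1 * _)) -(EFinD (2 * s + n%:R * k)).
  by congr EFin; ring.
apply: leeD => //; apply: leeD => //; apply: lee_wpmul2l; first by rewrite lee_fin.
exact: leeD.
Qed.

End row_variance.

(** * The regularized determinant as a function of its rows *)

Section row_of_regularized_determinant.
Variable R : realType.
Notation C := R[i].
Variable mu : probability C R.

(** For the second factor, 1 / (h + Q) <= 1 / (h + m0) + |Q - m0| / (h (h + m0)): the regularization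
    h lets a first moment of the deviation control the inverse. *)
Lemma EJ_inverse K (Q : cfg R -> R) (m0 h d : R) xi : measf Q -> (forall xi, 0 <= Q xi) ->
  0 <= m0 -> 0 < h -> 0 <= d ->
  (EJ mu K (fun xi => `|Q xi - m0|%:E) xi <= d%:E)%E ->
  (EJ mu K (fun xi => (h + Q xi)%:E) xi * EJ mu K (fun xi => (h + Q xi)^-1%:E) xi
   <= ((1 + d / h) ^+ 2)%:E)%E.
Proof.
move=> mQ Q0 m00 h0 d0 hd; have a0 : 0 < h + m0 by rewrite ltr_wpDr.
have mD : measf (fun xi => `|Q xi - m0|%:E).
  apply: measf_EFin; apply: (measf_comp (g := fun r : R => `|r|)) => //.
  by apply: measfB => //; exact: measf_cst.
have D0 y : (0 <= `|Q y - m0|%:E)%E by rewrite lee_fin.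
have hQ0 y : 0 < h + Q y by rewrite ltr_wpDr.
have mhQ : measf (fun y => h + Q y) by apply: measfD => //; exact: measf_cst.
have h1 : (EJ mu K (fun xi => (h + Q xi)%:E) xi <= (h + m0 + d)%:E)%E.
  apply: (@le_trans _ _ (EJ mu K (fun xi => (h + m0)%:E + `|Q xi - m0|%:E)%E xi)).
    apply: EJ_le => [y|||y].
    - by rewrite lee_fin ltW.
    - exact: measf_EFin.
    - rewrite (_ : (fun xi => _) = (fun xi => (h + m0 + `|Q xi - m0|)%:E)) //.
      apply: measf_EFin; apply: measfD; first exact: measf_cst.
      apply: (measf_comp (g := fun r : R => `|r|)) => //.
      by apply: measfB => //; exact: measf_cst.
    by rewrite -EFinD lee_fin -addrA lerD2l -lerBlDl ler_norm.
  rewrite EJ_D//; last 2 first.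
  - by move=> y; rewrite lee_fin ltW.
  - exact: measf_cst.
  by rewrite EJ_cst (EFinD (h + m0)) leeD.
have h2 : (EJ mu K (fun xi => (h + Q xi)^-1%:E) xi <= ((h + m0)^-1 * (1 + d / h))%:E)%E.
  apply: (@le_trans _ _ (EJ mu K (fun xi => ((h + m0)^-1)%:E + ((h + m0)^-1 / h)%:E * `|Q xi - m0|%:E)%E xi)).
    apply: EJ_le => [y|||y].
    - by rewrite lee_fin invr_ge0 ltW.
    - by apply: measf_EFin; exact: measf_inv.
    - rewrite (_ : (fun xi => _) = (fun xi => ((h + m0)^-1 + ((h + m0)^-1 / h) * `|Q xi - m0|)%:E)) //.
      apply: measf_EFin; apply: measfD; first exact: measf_cst.
      apply: measfM; first exact: measf_cst.
      apply: (measf_comp (g := fun r : R => `|r|)) => //.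
      by apply: measfB => //; exact: measf_cst.
    rewrite -(EFinM ((h + m0)^-1 / h)) -(EFinD (h + m0)^-1) lee_fin -[X in _ <= X + _]mulr1 -mulrA -mulrDr.
    rewrite ler_pdivlMl// ler_pdivrMr// mulrDl mul1r.
    have : Q y * h^-1 * `|Q y - m0| >= 0 by rewrite !mulr_ge0 ?invr_ge0// ltW.
    have -> : h^-1 * `|Q y - m0| * (h + Q y) = `|Q y - m0| + Q y * h^-1 * `|Q y - m0|.
      by field; rewrite gt_eqF.
    have := ler_norm (m0 - Q y); rewrite distrC.
    lra.
  rewrite EJ_D//; last 4 first.
  - by move=> y; rewrite lee_fin invr_ge0 ltW.
  - by move=> y; rewrite mule_ge0// lee_fin divr_ge0 ?invr_ge0 ?(ltW a0) ?(ltW h0).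
  - exact: measf_cst.
  - rewrite (_ : (fun xi => _) = (fun xi => (((h + m0)^-1 / h) * `|Q xi - m0|)%:E)) //.
    apply: measf_EFin; apply: measfM; first exact: measf_cst.
    apply: (measf_comp (g := fun r : R => `|r|)) => //.
    by apply: measfB => //; exact: measf_cst.
  rewrite EJ_cst EJ_Zl//; last by rewrite divr_ge0 ?invr_ge0 ?(ltW a0) ?(ltW h0).
  rewrite mulrDr mulr1 EFinD; apply: leeD => //.
  rewrite [d / h]mulrC mulrA (EFinM _ d); apply: lee_wpmul2l => //.
  by rewrite lee_fin divr_ge0 ?invr_ge0 ?(ltW a0) ?(ltW h0).
have hdh : 0 <= d / h by rewrite divr_ge0// ltW.
apply: (@le_trans _ _ ((h + m0 + d)%:E * ((h + m0)^-1 * (1 + d / h))%:E)%E).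
  apply: lee_pmul => //; apply: EJ_ge0 => y; rewrite lee_fin ?invr_ge0; exact: ltW.
rewrite -EFinM lee_fin mulrA expr2 ler_wpM2r ?addr_ge0// mulrDl mulfV ?gt_eqF// lerD2l.
by rewrite ler_wpM2l// lef_pV2 ?posrE// lerDl.
Qed.

Hypothesis mu_std : std_law mu.
Variable iota : nat -> nat -> nat * nat.
Hypothesis iota_inj : inj2 iota.

Lemma coords_rowi n i : coords (rowi iota (n := n) i) = map (iota i) (seq.iota 0 n).
Proof. by rewrite /coords /rowi -val_enum_ord -map_comp. Qed.

Variables (n' : nat).
Local Notation n := n'.+1.
Variable V : nat -> 'rV[C]_n.
Variable h : R.
Hypothesis h0 : 0 < h.
Local Notation top := (top iota V).
Local Notation rowW := (rowW iota V).
Local Notation regdet := (regdet iota V h).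
Local Notation s := ((Num.sqrt h)%:C : C).

Lemma s_neq0 : s != 0.
Proof. by rewrite eq_complex /= eqxx andbT gt_eqF// sqrtr_gt0. Qed.

Lemma regm_free m p (A : 'M[C]_(m, p)) : row_free (regm A s).
Proof.
apply/inj_row_free => v; rewrite /regm mul_mx_row -[0]row_mx0 => /eq_row_mx[_].
rewrite mul_mx_scalar => /eqP; rewrite scaler_eq0 (negbTE s_neq0) /=; exact: eqP.
Qed.

Lemma regdet_gt0 m xi : 0 < regdet m xi.
Proof.
rewrite lt_neqAle grm_ge0 andbT eq_sym; apply/eqP => /(congr1 (real_complex R)).
rewrite grmE => /eqP; rewrite (negbTE (_ : gdet _ != 0))// gdet_neq0; exact: regm_free.
Qed.

Lemma mxmeasf_regm m p (A : cfg R -> 'M[C]_(m, p)) : mxmeasf A -> mxmeasf (fun xi => regm (A xi) s).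
Proof.
move=> mA i j; rewrite /regm; case: (splitP j) => k jk.
  have -> : j = lshift m k by exact: val_inj.
  by rewrite (_ : (fun xi => _) = (fun xi => A xi i k)) //; apply/funext => xi; rewrite row_mxEl.
have -> : j = rshift p k by exact: val_inj.
rewrite (_ : (fun xi => _) = (fun xi => (s%:M : 'M[C]_m) i k)); first exact: cmeasf_cst.
by apply/funext => xi; rewrite row_mxEr.
Qed.

Lemma measf_regdet m : measf (regdet m).
Proof. by apply: measf_grm; apply: mxmeasf_regm; exact: mxmeasf_top. Qed.

Section fixed_row.
Variables (i : 'I_n) (xi : cfg R).
Let A y := regm (top n y) s.
Let H := pcompl (row' i (A xi)).
(** The rows of the projection H at the coordinates of genuine entries: row i enters its distance to
    the other rows only through the random combination of these vectors. *)
Let w (j : nat) : 'rV[C]_(n + n) := if insub j is Some j' then row (lshift n j') H else 0.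
Let c : 'rV[C]_(n + n) := row_mx (V i) 0 *m H.
Let Hproj : isproj H. Proof. exact: pcompl_proj. Qed.

Let wE (j : 'I_n) : w j = row (lshift n j) H.
Proof. by rewrite /w valK. Qed.

Let mulHw p (u : 'M[C]_(p, n + n)) (j : 'I_n) :
  (u *m H) *m (w j)^t* = col (lshift n j) (u *m H).
Proof.
rewrite wE rowE trmxCM mulmxA; have [-> HH] := Hproj.
rewrite -(mulmxA u) HH colE; congr (_ *m _); apply/matrixP => a b.
by rewrite !mxE conjC_nat andbC.
Qed.

Let w_le1 j : (j < n)%N -> fr (w j) <= 1.
Proof.
move=> jn; rewrite -[j]/(nat_of_ord (Ordinal jn)) wE rowE -lecR frE.
apply: (le_trans (frob_proj_le _ Hproj)); rewrite frob_row mxE (bigD1 (lshift n (Ordinal jn)))//=.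
rewrite big1 => [|k kj]; first by rewrite !mxE !eqxx conjC1 mulr1 addr0.
by rewrite !mxE (negbTE kj) mul0r.
Qed.

(** The inner products of the w_j are entries of the projection H, so those with a fixed w_j have
    squares summing to at most the squared length of w_j. *)
Let w_cov j : (j < n)%N -> \sum_(l < j) nsq ((w l *m (w j)^t*) 0 0) <= 1.
Proof.
move=> jn; apply: le_trans (w_le1 jn).
have -> : \sum_(l < j) nsq ((w l *m (w j)^t*) 0 0) =
    \sum_(l < n | (l < j)%N) nsq ((w l *m (w j)^t*) 0 0).
  by rewrite (big_ord_widen n (fun l => nsq ((w l *m (w j)^t*) 0 0)) (ltnW jn)).
have -> : w j = w (Ordinal jn) by [].
set j' := Ordinal jn.
have hl (l : 'I_n) : nsq ((w l *m (w j')^t*) 0 0) = nsq (w j' 0 (lshift n l)).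
  rewrite -nsqJ -conjcE; congr nsq; have := mulHw (delta_mx 0 (lshift n j') : 'rV_(n + n)) l.
  rewrite -rowE -wE => /matrixP/(_ 0 0) h1; rewrite [RHS](_ : _ = (w j' *m (w l)^t*) 0 0); last by rewrite h1 mxE.
  by rewrite !mxE rmorph_sum; apply: eq_bigr => k _; rewrite rmorphM !mxE /= conjCK mulrC.
rewrite fr_row big_split_ord /= -[leLHS]addr0 lerD//; last by apply: sumr_ge0 => k _; exact: nsq_ge0.
rewrite big_mkcond /=; apply: ler_sum => l _; case: ifP => _; last exact: nsq_ge0.
by rewrite hl.
Qed.

Let fr_row_mx0 p q (u : 'rV[C]_p) : fr (row_mx u (0 : 'rV_q)) = fr u.
Proof.
rewrite !fr_row big_split_ord /= [X in _ + X]big1 ?addr0.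
  by apply: eq_bigr => k _; rewrite row_mxEl.
by move=> k _; rewrite row_mxEr mxE nsq0.
Qed.

Let c_le : fr c <= fr (V i).
Proof. by rewrite -(fr_row_mx0 n (V i)) -lecR !frE; exact: frob_proj_le. Qed.

Let c_cov : \sum_(j < n) nsq ((c *m (w j)^t*) 0 0) <= fr (V i).
Proof.
apply: le_trans c_le; rewrite [leRHS]fr_row big_split_ord /= -[leLHS]addr0 lerD//; last first.
  by apply: sumr_ge0 => k _; exact: nsq_ge0.
by apply: ler_sum => j _; rewrite /c mulHw mxE.
Qed.

Let mul_row_mx0 (u : 'rV[C]_n) : row_mx u 0 *m H = \sum_(j < n) u 0 j *: w j.
Proof.
rewrite mulmx_sum_row big_split_ord /= [X in _ + X]big1 ?addr0.
  by apply: eq_bigr => k _; rewrite row_mxEl wE.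
by move=> k _; rewrite row_mxEr mxE scale0r.
Qed.

(** The appended part of row i sits in a coordinate where all other rows vanish. It is orthogonal to
    them and to the projected random part, and contributes exactly h. *)
Let row_decomp y : (forall e, e \notin coords (rowi iota (n := n) i) -> y e = xi e) ->
  regdet n y = grm (row' i (A xi)) * (h + fr (partrow (iota i) w c n y)).
Proof.
move=> hy; rewrite /regdet (grm_row _ i) -/(A y).
have rA z : row' i (A z) = row_mx (row' i (top n z)) (row' i s%:M).
  apply/matrixP => a b; rewrite !mxE; case: splitP => k _; by rewrite !mxE.
have rAy : row' i (A y) = row' i (A xi) by rewrite !rA (row'_top_dep V iota_inj hy).
rewrite rAy -/H; congr (_ * _).
pose U : 'rV[C]_(n + n) := row_mx 0 (row i s%:M).
have -> : row i (A y) = row_mx (rowW y i) 0 + U.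
  by rewrite /A /regm row_row_mx row_top add_row_mx addr0 add0r.
have so : U *m (row' i (A xi))^t* = 0.
  rewrite rA /U tr_row_mx map_col_mx mul_row_col mul0mx add0r.
  apply/rowP => k; rewrite [LHS]mxE [RHS]mxE big1// => l _; rewrite !mxE.
  case: (eqVneq i l) => [<-|_]; last by rewrite mulr0n mul0r.
  by rewrite [lift i k == i]eq_sym (negbTE (neq_lift i k)) mulr0n rmorph0 mulr0.
have UH : U *m H = U by exact: pcompl_id.
rewrite mulmxDl UH; apply: complexI; rewrite frE frobD_orth; last first.
  have -> : row_mx (rowW y i) 0 *m H *m U^t* = row_mx (rowW y i) 0 *m (U *m H)^t*.
    by rewrite trmxCM -mulmxA; have [-> _] := Hproj.
  by rewrite UH /U tr_row_mx map_col_mx mul_row_col mul0mx trmx0 map_mx0 mulmx0 addr0.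
rewrite addrC rmorphD /= -!frE; congr (_%:C + _%:C); last first.
  rewrite /rowW /partrow /c !mul_row_mx0 -sumrB; congr fr; apply: eq_bigr => j _.
  by rewrite !mxE scalerBl.
rewrite /U fr_row big_split_ord /= big1 => [|k _]; last by rewrite row_mxEl mxE nsq0.
rewrite add0r (bigD1 i)//= big1 => [|k ki]; last by rewrite row_mxEr !mxE eq_sym (negbTE ki) nsq0.
by rewrite row_mxEr !mxE eqxx addr0 mulr1n nsqC sqr_sqrtr// ltW.
Qed.

Lemma EJ_regdet_row (k L m t b : R) : 0 < k -> 0 < L -> 0 < t ->
  (\int[mu]_u (ntrunc L u)%:E = m%:E)%E -> 1 - k <= m <= 1 -> fr (V i) <= b ->
  (EJ mu (coords (rowi iota (n := n) i)) (fun xi => (regdet n xi)%:E) xi *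
   EJ mu (coords (rowi iota (n := n) i)) (fun xi => (regdet n xi)^-1%:E) xi
   <= ((1 + (2 * t + (n%:R * L ^+ 2 + 4 * (n%:R + b)) / t + 2 * n%:R * k) / h) ^+ 2)%:E)%E.
Proof.
move=> k0 L0 t0 hm m1 Vb; set J := coords _; set d := 2 * t + _ + _.
have i_inj : injective (iota i) by move=> a1 a2 /iota_inj[].
have m1' := m1; have {m1'} /andP[m1l m1r] := m1'.
have h1 := row_variance mu_std i_inj xi k0 L0 t0 hm m1 w_le1 w_cov (le_trans c_cov Vb).
rewrite -coords_rowi -/J -/d in h1.
have mQ : measf (fun y => fr (partrow (iota i) w c n y)) by apply: measf_fr; exact: mxmeasf_partrow.
have b0 : 0 <= b := le_trans (fr_ge0 _) Vb.
have d0 : 0 <= d.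
  rewrite /d; apply: addr_ge0; last by rewrite !mulr_ge0// ltW.
  apply: addr_ge0; first by rewrite mulr_ge0// ltW.
  by rewrite divr_ge0 ?(ltW t0)// addr_ge0// mulr_ge0 ?sqr_ge0// addr_ge0.
have h2 := EJ_inverse mQ (fun y => fr_ge0 _) _ h0 d0 h1.
set g := grm (row' i (A xi)).
have g0 : 0 < g.
  have := regdet_gt0 n xi; rewrite row_decomp// -/g => h3.
  rewrite lt_neqAle grm_ge0 andbT eq_sym; apply/negP => /eqP g0.
  by move: h3; rewrite -/g g0 mul0r ltxx.
have hQ0 y : 0 < h + fr (partrow (iota i) w c n y) by rewrite ltr_wpDr// fr_ge0.
have mhQ : measf (fun y => h + fr (partrow (iota i) w c n y)) by apply: measfD => //; exact: measf_cst.
rewrite [X in (X * _)%E](_ : _ = EJ mu J (fun y => g%:E * (h + fr (partrow (iota i) w c n y))%:E)%E xi); last first.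
  by apply: EJ_congr => y hy; rewrite row_decomp// EFinM.
rewrite [X in (_ * X)%E](_ : _ = EJ mu J (fun y => g^-1%:E * (h + fr (partrow (iota i) w c n y))^-1%:E)%E xi); last first.
  by apply: EJ_congr => y hy; rewrite row_decomp// invfM EFinM.
rewrite EJ_Zl ?(ltW g0)//; last 2 first.
- by move=> y; rewrite lee_fin ltW.
- exact: measf_EFin.
rewrite EJ_Zl ?invr_ge0 ?(ltW g0)//; last 2 first.
- by move=> y; rewrite lee_fin invr_ge0 ltW.
- by apply: measf_EFin; exact: measf_inv.
rewrite muleACA -EFinM mulfV ?gt_eqF// mul1e; apply: h2.
by rewrite addr_ge0 ?fr_ge0// sumr_ge0// => j _; exact: fr_ge0.
Qed.

End fixed_row.

Fixpoint rows (m : nat) : seq (nat * nat) :=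
  if m is m'.+1 then coords (rowi iota (n := n) m') ++ rows m' else [::].

Lemma EJ_rowW i xi :
  EJ mu (coords (rowi iota (n := n) i)) (fun xi => (fr (rowW xi i) + h)%:E) xi =
  (n%:R + fr (V i) + h)%:E.
Proof.
have u : uniq (coords (rowi iota (n := n) i)).
  by rewrite map_inj_uniq ?enum_uniq//; exact: rowi_inj.
transitivity (EJ mu (coords (rowi iota (n := n) i)) (fun xi => (fr (rowW xi i))%:E + h%:E)%E xi).
  by congr (EJ _ _ _ _); apply/funext => y; rewrite EFinD.
rewrite EJ_D//; last 4 first.
- by move=> y; rewrite lee_fin fr_ge0.
- by move=> y; rewrite lee_fin ltW.
- by apply: measf_EFin; apply: measf_fr; exact: mxmeasf_rowW.
- exact: measf_cst.
rewrite EJ_cst EFinD; congr (_ + _)%E.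
rewrite (_ : (fun xi => _) = (fun xi => (\sum_(j < n) (nsq (xi (iota i j) * 1 + - V i 0 j))%:E)%E)); last first.
  by apply/funext => y; rewrite fr_row sumEFin; congr EFin; apply: eq_bigr => j _; rewrite !mxE mulr1.
rewrite (@EJ_sum _ _ _ _ _ (fun (j : 'I_n) xi => (nsq (xi (iota i j) * 1 + - V i 0 j))%:E)); last 2 first.
- by move=> j y; rewrite lee_fin nsq_ge0.
- move=> j; apply: measf_EFin; apply: measf_nsq; apply: cmeasfD; last exact: cmeasf_cst.
  by apply: cmeasfM; [exact: cmeasf_coord|exact: cmeasf_cst].
under eq_bigr => j _.
  rewrite (EJ_coord mu (fun v => (nsq (v * 1 + - V i 0 j))%:E) xi u); last first.
    by apply: map_f; rewrite mem_enum.
  rewrite int_affine// nsq1 nsqN EFinD.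
  over.
rewrite big_split /= sumEFin sumr_const card_ord sumEFin -EFinD; congr (_ + _)%:E.
by rewrite fr_row.
Qed.

Lemma rowW_dep' i k y xi : i != k -> (forall e, e \notin coords (rowi iota (n := n) k) -> y e = xi e) ->
  rowW y i = rowW xi i.
Proof. by move=> ik hy; exact: (rowW_dep V iota_inj ik hy). Qed.

(** Rows from m on stay frozen, which makes the induction possible. Besides the mean of the product
    of lengths, this gives the finiteness that [EJ_tensor] asks for. *)
Lemma EJ_rows_prod m0 m xi :
  EJ mu (rows m) (fun xi => (\prod_(i < n | (m0 <= i)%N) (fr (rowW xi i) + h))%:E) xi =
  (\prod_(i < n | (m0 <= i)%N) (if (i < m)%N then n%:R + fr (V i) + h else fr (rowW xi i) + h))%:E.
Proof.
elim: m xi => [|m IH] xi //=.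
rewrite EJ_cat (_ : EJ mu (rows m) _ = fun y => (\prod_(i < n | (m0 <= i)%N) (if (i < m)%N
   then n%:R + fr (V i) + h else fr (rowW y i) + h))%:E); last by apply/funext => y; rewrite IH.
have neq (j : 'I_n) : nat_of_ord j != m -> (j < m.+1)%N = (j < m)%N.
  by move=> jm'; rewrite [in LHS]ltnS [in LHS]leq_eqVlt (negbTE jm').
case: (boolP ((m < n) && (m0 <= m))%N) => [/andP[mn m0m]|nmn]; last first.
  have jm (j : 'I_n) : (m0 <= j)%N -> nat_of_ord j != m.
    by move=> m0j; apply: contraNneq nmn => jm; rewrite -jm ltn_ord m0j.
  rewrite EJ_notin.
    by congr EFin; apply: eq_bigr => j m0j; rewrite neq// jm.
  move=> y hy; congr EFin; apply: eq_bigr => j m0j; case: ifP => // _.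
  by rewrite (@rowW_dep' j m y xi)// jm.
pose m' := Ordinal mn.
pose a := \prod_(i < n | (m0 <= i)%N && (i != m')) (if (i < m)%N then n%:R + fr (V i) + h else fr (rowW xi i) + h).
have a0 : 0 <= a.
  by apply: prodr_ge0 => j _; case: ifP => _; rewrite !addr_ge0 ?fr_ge0 ?(ltW h0).
rewrite [LHS](_ : _ = EJ mu (coords (rowi iota (n := n) m)) (fun y => a%:E * (fr (rowW y m) + h)%:E)%E xi); last first.
  apply: EJ_congr => y hy; rewrite -EFinM (bigD1 m')//= ltnn mulrC; congr ((_ * _)%:E).
  apply: eq_bigr => j /andP[_ jm]; case: ifP => // _; rewrite (@rowW_dep' j m y xi)//.
rewrite EJ_Zl//; last 2 first.
- by move=> y; rewrite lee_fin addr_ge0 ?fr_ge0// ltW.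
- apply: measf_EFin; apply: measfD; last exact: measf_cst.
  by apply: measf_fr; exact: mxmeasf_rowW.
rewrite EJ_rowW -EFinM (bigD1 m')//= ltnSn mulrC; congr ((_ * _)%:E).
by apply: eq_bigr => j /andP[_ jm]; rewrite neq.
Qed.

Lemma EJ_regdet_rows (k L m t b : R) p xi : 0 < k -> 0 < L -> 0 < t ->
  (\int[mu]_u (ntrunc L u)%:E = m%:E)%E -> 1 - k <= m <= 1 -> (forall i, fr (V i) <= b) ->
  (p <= n)%N ->
  (EJ mu (rows p) (fun xi => (regdet n xi)%:E) xi * EJ mu (rows p) (fun xi => (regdet n xi)^-1%:E) xi
   <= ((((1 + (2 * t + (n%:R * L ^+ 2 + 4 * (n%:R + b)) / t + 2 * n%:R * k) / h) ^+ 2) ^+ p))%:E)%E.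
Proof.
move=> k0 L0 t0 hm m1 Vb; elim: p xi => [|p IH] xi pn /=.
  by rewrite -EFinM mulfV ?gt_eqF// regdet_gt0.
rewrite exprS mulrC; apply: EJ_tensor => //.
- exact: measf_regdet.
- by move=> y; exact: regdet_gt0.
- by rewrite exprn_ge0// sqr_ge0.
- by rewrite sqr_ge0.
- by move=> y; apply: IH; exact: ltnW.
- move=> y; have hh := (EJ_regdet_row (i := Ordinal pn) y k0 L0 t0 hm m1 (Vb p)); exact: hh.
move=> y; apply: (@le_lt_trans _ _ (EJ mu (rows p.+1) (fun xi => (\prod_(i < n | (0 <= i)%N) (fr (rowW xi i) + h))%:E) y)); last first.
  by rewrite EJ_rows_prod ltry.
apply: EJ_le => [z|||z].
- by rewrite lee_fin ltW// regdet_gt0.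
- by apply: measf_EFin; exact: measf_regdet.
- apply: measf_EFin; apply: measf_prod => j; apply: measfD; last exact: measf_cst.
  by apply: measf_fr; exact: mxmeasf_rowW.
rewrite lee_fin; apply: (le_trans (regdet_le_prod iota V h0 z (leq0n n))).
by rewrite big_mkord {1}/regdet /grm gdet_nil mul1r.
Qed.
End row_of_regularized_determinant.

(** * The last rows at several nearby points *)

Section horizontal_concatenation.
Variable R : realType.
Notation C := R[i].

(** Putting the matrices side by side turns the joint smallness of several images of one row into a
    single instance of [small_ball]. *)
Definition hcat r n p (B : 'I_r -> 'M[C]_(n, p)) : 'M[C]_(n, #|{: 'I_r * 'I_p}|) :=
  \matrix_(k, j) B (enum_val j).1 k (enum_val j).2.

Lemma sum_enum_pair (V : nmodType) r p (F : 'I_r * 'I_p -> V) :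
  \sum_(j < #|{: 'I_r * 'I_p}|) F (enum_val j) = \sum_(l < r) \sum_(t < p) F (l, t).
Proof.
rewrite pair_big /= -(big_enum_val (A := predT) F) /=.
by apply: eq_bigr => -[].
Qed.

Lemma fr_hcat r n p (B : 'I_r -> 'M[C]_(n, p)) (U : 'I_r -> 'rV[C]_p) (x : 'rV[C]_n) :
  fr (x *m hcat B - hcat U) = \sum_(l < r) fr (x *m B l - U l).
Proof.
rewrite fr_row (_ : \sum_j _ = \sum_(j < #|{: 'I_r * 'I_p}|)
    (fun lt : 'I_r * 'I_p => nsq ((x *m B lt.1 - U lt.1) 0 lt.2)) (enum_val j)).
  rewrite (sum_enum_pair (fun lt : 'I_r * 'I_p => nsq ((x *m B lt.1 - U lt.1) 0 lt.2))).
  by apply: eq_bigr => l _; rewrite fr_row.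
by apply: eq_bigr => j _; rewrite !mxE; congr (nsq (_ - _)); apply: eq_bigr => k _; rewrite mxE.
Qed.

Lemma fr_hcat0 r n p (B : 'I_r -> 'M[C]_(n, p)) (x : 'rV[C]_n) :
  fr (x *m hcat B) = \sum_(l < r) fr (x *m B l).
Proof.
have := fr_hcat B (fun=> 0) x; rewrite (_ : hcat (fun=> 0) = 0) ?subr0 => [->|].
  by apply: eq_bigr => l _; rewrite subr0.
by apply/matrixP => k j; rewrite !mxE.
Qed.

End horizontal_concatenation.

Lemma fr0 (R : realType) m n : fr (0 : 'M[R[i]]_(m, n)) = 0.
Proof. by rewrite /fr big1// => i _; rewrite big1// => j _; rewrite mxE nsq0. Qed.

Section independent_kernels.
Variable R : realType.
Notation C := R[i].
Variables (n r : nat) (P : 'I_r -> 'M[C]_n) (D : {set 'I_r}) (s2 : R).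
Hypothesis Pproj : forall l, isproj (P l).
Hypothesis s20 : 0 < s2.
Hypothesis indep : forall a : 'I_r -> 'rV[C]_n, (forall l, a l *m P l = a l) ->
  s2 * \sum_l fr (a l) <= fr (\sum_l a l).

Let S : 'M[C]_n := (\sum_(l in D) P l)%MS.

(** A positive [s2] makes the sum of the ranges direct, so the ranks add. *)
Lemma rank_independent d : (forall l, (d <= \rank (P l))%N) -> (d * #|D| <= \rank S)%N.
Proof.
move=> hd; have /mxdirectP /= -> : mxdirect (\sum_(l in D) P l).
  apply/mxdirect_sumsP => l lD; apply/eqP; rewrite -submx0; apply/row_subP => i.
  set v := row i _; have : (v <= P l :&: (\sum_(j in D | j != l) P j))%MS by exact: row_sub.
  rewrite sub_capmx => /andP[/submxP[u vu] /sub_sumsmxP[w vw]].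
  (* A vector v common to one range and to the sum of the others yields vectors [a j] with zero sum,
     and [indep] forces v = 0. *)
  pose a j : 'rV[C]_n := if j == l then v else if j \in D then - (w j *m P j) else 0.
  have aP j : a j *m P j = a j.
    rewrite /a; case: eqP => [->|_]; first by rewrite vu -mulmxA (proj2 (Pproj l)).
    by case: ifP; rewrite ?mul0mx// mulNmx -mulmxA (proj2 (Pproj j)).
  have sa : \sum_j a j = 0.
    rewrite (bigD1 l)//= {1}/a eqxx {1}vw; apply/eqP; rewrite addr_eq0 -sumrN; apply/eqP.
    rewrite big_mkcond [RHS]big_mkcond; apply: eq_bigr => j _; rewrite /a.
    by case: (j == l) => /=; rewrite ?andbF// andbT; case: ifP; rewrite ?opprK ?oppr0.
  have := indep aP; rewrite sa fr0.
  rewrite pmulr_rle0// => h.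
  have : fr v <= 0.
    have al : a l = v by rewrite /a eqxx.
    apply: le_trans h; rewrite (bigD1 l)//= al lerDl.
    by apply: sumr_ge0 => j _; exact: fr_ge0.
  by rewrite -lecR frE => h'; rewrite submx0 -frob_eq0 eq_le h' frob_ge0.
rewrite mulnC -sum_nat_const; exact: leq_sum.
Qed.

(** Dual form of [indep]. Write a = x [pspan S] as a sum of b_l in the ranges; then |a|^2 is the sum
    of the inner products of x P_l with b_l. By Cauchy-Schwarz it remains to bound the b_l by a,
    which is [indep]. *)
Lemma frob_independent (x : 'rV[C]_n) :
  s2 * fr (x *m pspan S) <= \sum_(l in D) fr (x *m P l).
Proof.
set a := x *m pspan S.
have : (a <= S)%MS by exact: pspan_sub.
move=> /sub_sumsmxP[u au].
pose b l : 'rV[C]_n := if l \in D then u l *m P l else 0.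
have bP l : b l *m P l = b l.
  by rewrite /b; case: ifP; rewrite ?mul0mx// -mulmxA (proj2 (Pproj l)).
have ab : a = \sum_l b l by rewrite au big_mkcond; apply: eq_bigr => l _.
have aa : (fr a)%:C = \sum_(lt : 'I_r * 'I_n) (if lt.1 \in D then (x *m P lt.1) 0 lt.2 else 0) * (b lt.1 0 lt.2)^*.
  rewrite frE frob_row.
  have -> : a *m a^t* = x *m a^t*.
    rewrite {1}/a -mulmxA; congr (_ *m _).
    have [h1 h2] := pspan_proj S; rewrite -{1}h1 -trmxCM; congr (_^t*).
    by rewrite /a -mulmxA h2.
  rewrite ab -(pair_big predT predT (fun l t => (if l \in D then (x *m P l) 0 t else 0) * (b l 0 t)^*)) /=.
  have -> : (\sum_l b l)^t* = \sum_l (b l)^t*.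
    by elim/big_rec2: _ => [|l A B _ <-]; rewrite ?trmxCD// trmx0 map_mx0.
  rewrite mulmx_sumr summxE; apply: eq_bigr => l _.
  rewrite -{1}(bP l) trmxCM (proj1 (Pproj l)) mulmxA mxE; apply: eq_bigr => t _.
  rewrite !mxE; case: ifP => // lD; rewrite /b lD mxE rmorph0 mulr0 mul0r//.
have cs := CauchySchwarz_sum (fun lt : 'I_r * 'I_n => if lt.1 \in D then (x *m P lt.1) 0 lt.2 else 0)
   (fun lt : 'I_r * 'I_n => (b lt.1 0 lt.2)^*).
have e1 : \sum_(lt : 'I_r * 'I_n) `|if lt.1 \in D then (x *m P lt.1) 0 lt.2 else 0| ^+ 2
    = (\sum_(l in D) fr (x *m P l))%:C.
  rewrite -(pair_big predT predT (fun l t => `|if l \in D then (x *m P l) 0 t else 0| ^+ 2)) /=.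
  rewrite [in RHS]big_mkcond rmorph_sum; apply: eq_bigr => l _; case: ifP => _.
    by rewrite fr_row rmorph_sum; apply: eq_bigr => t _; rewrite /= nsqE.
  by rewrite big1// => t _; rewrite normr0 expr0n.
have e2 : \sum_(lt : 'I_r * 'I_n) `|(b lt.1 0 lt.2)^*| ^+ 2 = (\sum_l fr (b l))%:C.
  rewrite -(pair_big predT predT (fun l t => `|(b l 0 t)^*| ^+ 2)) /=.
  rewrite rmorph_sum; apply: eq_bigr => l _.
  by rewrite fr_row rmorph_sum; apply: eq_bigr => t _; rewrite /= nsqE norm_conjC.
rewrite e1 e2 -aa -nsqE nsqC -rmorphM lecR in cs.
have := indep bP; rewrite -ab => h.
have Y0 : 0 <= \sum_(l in D) fr (x *m P l) by apply: sumr_ge0 => l _; exact: fr_ge0.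
have : s2 * fr a ^+ 2 <= (\sum_(l in D) fr (x *m P l)) * fr a.
  apply: (le_trans (ler_wpM2l (ltW s20) cs)); rewrite mulrCA ler_wpM2l//.
have := fr_ge0 a; rewrite le_eqVlt => /orP[/eqP <- _|a0]; first by rewrite mulr0.
by rewrite expr2 mulrA ler_pM2r.
Qed.

End independent_kernels.

(** * Survival of the volume at several points *)

Section dying_steps.
Context (R : realType).
Notation C := R[i].
Variable mu : probability C R.
Variables (n r : nat) (iota : nat -> nat -> nat * nat) (V : 'I_r -> nat -> 'rV[C]_n).
Hypothesis iota_inj : inj2 iota.
Variable q : R.
Hypothesis q01 : 0 < q < 1.
Hypothesis conc : forall v s, 1 <= s ->
  (\int[mu]_u (expR (- (s * nsq (u - v))))%:E <= q%:E)%E.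
Variables (m : nat) (s2 t2 : R).
Hypothesis s20 : 0 < s2.
Hypothesis t20 : 0 < t2.
Hypothesis st : n%:R * t2 <= s2 * (- ln q / 2).
Local Notation topl l := (top iota (V l)).

Definition alive l i xi := [forall j : 'I_i, (m <= j)%N ==> (t2 * grm (topl l j xi) < grm (topl l j.+1 xi))].
Definition dies l i xi := grm (topl l i.+1 xi) <= t2 * grm (topl l i xi).

Lemma aliveS l i xi : (m <= i)%N -> alive l i.+1 xi = alive l i xi && ~~ dies l i xi.
Proof.
move=> mi; apply/forallP/andP => [h|[/forallP h hd] j].
  split; last by have := h ord_max; rewrite /= mi /dies -ltNge.
  by apply/forallP => j; exact: (h (widen_ord (leqnSn i) j)).
have := ltn_ord j; rewrite ltnS leq_eqVlt => /orP[/eqP ->|ji].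
  by apply/implyP => _; rewrite ltNge.
exact: (h (Ordinal ji)).
Qed.

Lemma alive_gt0 l i xi : (m <= i)%N -> 0 < grm (topl l m xi) -> alive l i xi ->
  0 < grm (topl l i xi).
Proof.
move=> + g0; elim: i => [|i IH]; first by rewrite leqn0 => /eqP <-.
rewrite leq_eqVlt => /orP[/eqP <-//|]; rewrite ltnS => mi; rewrite aliveS// => /andP[al].
by rewrite /dies -ltNge; apply: le_lt_trans; rewrite mulr_ge0 ?grm_ge0// ltW.
Qed.

Lemma alive_grm l i xi : (m <= i)%N -> alive l i xi ->
  t2 ^+ (i - m) * grm (topl l m xi) <= grm (topl l i xi).
Proof.
elim: i => [|i IH]; first by rewrite leqn0 => /eqP -> _; rewrite subn0 mul1r.
rewrite leq_eqVlt => /orP[/eqP <- _|]; first by rewrite subnn mul1r.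
rewrite ltnS => mi; rewrite aliveS// => /andP[al]; rewrite /dies -ltNge => /ltW.
apply: le_trans; rewrite subSn// exprS -mulrA ler_wpM2l ?(ltW t20)//; exact: IH.
Qed.

(** Each [a l] ranges over the orthogonal complement of the first m rows at point l. Complements
    only shrink as rows are added, so the inequality persists at later steps. *)
Definition independent_kernels xi := forall a : 'I_r -> 'rV[C]_n,
  (forall l, a l *m (topl l m xi)^t* = 0) -> s2 * \sum_l fr (a l) <= fr (\sum_l a l).

Lemma measf_alive l i : measf (alive l i).
Proof.
rewrite (_ : alive l i = fun xi => all (fun j : 'I_i => (m <= j)%N ==> (t2 * grm (topl l j xi) < grm (topl l j.+1 xi))) (enum 'I_i)); last first.
  apply/funext => xi; apply/forallP/allP => h j; first by move=> _; exact: h.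
  by apply: h; rewrite mem_enum.
apply: measf_all => j; case: (m <= j)%N => /=; last exact: measf_cst.
by apply: measf_lt; [apply: measfM; [exact: measf_cst|]|]; apply: measf_grm; exact: mxmeasf_top.
Qed.

Lemma measf_dies l i : measf (dies l i).
Proof.
by apply: measf_le; [|apply: measfM; [exact: measf_cst|]]; apply: measf_grm; exact: mxmeasf_top.
Qed.

(** If all points of D die, the projections of the new row onto the complements are small together.
    The sum of these complements has dimension at least (n - i) |D|, hence a bound q^((n - i) |D|),
    of which Markov's inequality gives back at most half the exponent. *)
Lemma EJ_dies i (D : {set 'I_r}) xi : (m <= i < n)%N -> independent_kernels xi ->
  (forall l, 0 < grm (topl l m xi)) -> (forall l, l \in D -> alive l i xi) ->
  (EJ mu (coords (rowi iota (n := n) i)) (ind (fun xi => all (fun l => dies l i xi) (enum D))) xi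
    <= ((expR ((n - i)%:R * ln q / 2)) ^+ #|D|)%:E)%E.
Proof.
move=> /andP[mi im] ik g0 al.
have n0 : 0 < n%:R :> R by rewrite ltr0n (leq_ltn_trans _ im).
pose P l := pcompl (topl l i xi).
have Pproj l : isproj (P l) by exact: pcompl_proj.
have ind_P (a : 'I_r -> 'rV[C]_n) : (forall l, a l *m P l = a l) ->
    s2 * \sum_l fr (a l) <= fr (\sum_l a l).
  move=> aP; apply: ik => l; rewrite -aP -mulmxA.
  suff -> : P l *m (topl l m xi)^t* = 0 by rewrite mulmx0.
  have [Ph _] := Pproj l; rewrite -Ph -trmxCM pcompl_sub0 ?trmx0 ?map_mx0//.
  apply/row_subP => k; have ki : (k < i)%N by exact: leq_trans (ltn_ord k) mi.
  by rewrite row_top -(row_top _ _ _ (Ordinal ki)) row_sub.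
set S := (\sum_(l in D) P l)%MS.
have rP l : (n - i <= \rank (P l))%N.
  rewrite leq_subLR -[leqLHS](mxrank1 C n) -[1%:M](subrK (pspan (topl l i xi))).
  apply: (leq_trans (mxrank_add _ _)); rewrite addnC leq_add2r.
  apply: (leq_trans (mxrankM_maxr _ _)).
  by apply: (leq_trans (rank_leq_row _)); exact: rank_leq_row.
have rS : ((n - i) * #|D| <= \rank S)%N by exact: (rank_independent D Pproj s20 ind_P rP).
pose B l := if l \in D then P l else 0.
pose U l := if l \in D then V l i *m P l else 0.
have hnu (x : 'rV[C]_n) : s2 * fr (x *m pspan S) <= fr (x *m hcat B).
  apply: (le_trans (frob_independent D Pproj s20 ind_P x)).
  rewrite fr_hcat0 big_mkcond; apply: ler_sum => l _; rewrite /B; case: ifP => // _.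
  by rewrite fr_ge0.
(* The least exponent that [small_ball] accepts with [j0] = 0; the hypothesis [st] makes lam t2 at
   most - ln q / 2. *)
pose lam := n%:R / s2.
have lam0 : 0 <= lam by rewrite divr_ge0// ltW.
have := small_ball q01 conc (M := hcat B) (hcat U) xi (@rowi_inj n iota iota_inj i)
  (pspan_proj S) (pspan_trace S) hnu (ltW s20) lam0 (j0 := 0).
rewrite subn0 mulr1 divfK ?gt_eqF// => /(_ (lexx _) (leq0n _)) sb.
apply: (@le_trans _ _ ((expR (lam * t2 * #|D|%:R))%:E * (q ^+ \rank S)%:E)%E); last first.
  have /andP[q0 q1] := q01.
  rewrite -EFinM lee_fin -expRM_natr -[q in q ^+ _](lnK (x := q)) ?posrE// -expRM_natl -expRD ler_expR.
  have lnq : ln q < 0 by rewrite ln_lt0.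
  have h1 : lam * t2 <= - ln q / 2 by rewrite /lam mulrAC ler_pdivrMr// [leRHS]mulrC.
  set k := \rank S in rS *; have k1 : ((n - i) * #|D|)%:R * ln q >= k%:R * ln q.
    by rewrite ler_wnM2r ?ler_nat// ltW.
  have ni : 1 <= (n - i)%:R :> R by rewrite -[1]/(1%:R) ler_nat subn_gt0.
  have D0 : 0 <= #|D|%:R :> R by [].
  rewrite natrM in k1.
  have h2 : lam * t2 * #|D|%:R <= - ln q / 2 * (n - i)%:R * #|D|%:R.
    by rewrite ler_wpM2r//; apply: (le_trans h1); rewrite ler_peMr// divr_ge0// oppr_ge0 ltW.
  rewrite -[(_ / 2) * #|D|%:R]mulrA; move: k1 h2; move: (n - i)%:R #|D|%:R k%:R (ln q) => a b c e.
  by move=> k1 h2; apply: (le_trans (lerD h2 k1)); rewrite le_eqVlt; apply/orP; left; apply/eqP; field.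
apply: le_trans (lee_wpmul2l _ sb); last by rewrite lee_fin expR_ge0.
rewrite -EJ_Zl ?expR_ge0//; last first.
  apply: measf_EFin; apply: measf_expR; apply: measfN; apply: measfM; first exact: measf_cst.
  apply: measf_fr; apply: mxmeasfB; last exact: mxmeasf_cst.
  by apply: mxmeasfM; [exact: mxmeasf_rowof|exact: mxmeasf_cst].
apply: EJ_le_on.
- exact: ind_ge0.
- by move=> y; rewrite -EFinM lee_fin mulr_ge0// expR_ge0.
- by apply: measf_indE; apply: measf_all => l; exact: measf_dies.
- rewrite (_ : (fun xi => _) = fun xi => (expR (lam * t2 * #|D|%:R) *
    expR (- (lam * fr (rowof (rowi iota i) xi *m hcat B - hcat U))))%:E) //.
  apply: measf_EFin; apply: measfM; first exact: measf_cst.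
  apply: measf_expR; apply: measfN; apply: measfM; first exact: measf_cst.
  apply: measf_fr; apply: mxmeasfB; last exact: mxmeasf_cst.
  by apply: mxmeasfM; [exact: mxmeasf_rowof|exact: mxmeasf_cst].
move=> y hy; rewrite -EFinM lee_fin -expRD; case: (boolP (all _ _)) => [/allP hd|_]; last exact: expR_ge0.
rewrite -[leLHS](expR0 R) ler_expR subr_ge0 -mulrA ler_wpM2l// fr_hcat.
have -> : t2 * #|D|%:R = \sum_(l in D) t2 by rewrite sumr_const mulr_natr.
rewrite [leRHS]big_mkcond; apply: ler_sum => l _; rewrite /B /U; case: ifP => lD; last first.
  by rewrite mulmx0 subr0 fr0.
have := hd l; rewrite mem_enum => /(_ lD); rewrite /dies (grm_row _ ord_max) top_last row_top.
have -> : topl l i y = topl l i xi by exact: (top_dep _ iota_inj (leqnn i) hy).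
rewrite mulrC ler_pM2r ?(alive_gt0 mi (g0 l) (al _ lD))//.
by rewrite /rowW mulmxBl.
Qed.

(* G_i = prod_l (if l is alive before step i then theta i else 1), with
   theta i = theta i.+1 + (1 - theta i.+1) * p_i, is a supermartingale. *)
Definition pdie i := expR ((n - i)%:R * ln q / 2).

Lemma pdie01 i : 0 <= pdie i <= 1.
Proof.
have /andP[q0 q1] := q01; rewrite expR_ge0 -[leRHS]expR0 ler_expR pmulr_lle0 ?invr_gt0//.
by rewrite mulr_ge0_le0// ln_le0// ltW.
Qed.

Definition survive (p : R) (xi : cfg R) i :=
  \prod_(l < r) (if alive l i xi then p else 1).

Lemma prod_distr2 (a b : 'I_r -> R) :
  \prod_l (a l + b l) = \sum_(f : {ffun 'I_r -> bool}) \prod_l (if f l then b l else a l).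
Proof.
rewrite -(bigA_distr_bigA (fun l (c : bool) => if c then b l else a l)).
by apply: eq_bigr => l _; rewrite big_bool /= addrC.
Qed.

Lemma measf_survive p i : measf (fun xi => survive p xi i).
Proof.
apply: measf_prod => l.
rewrite (_ : (fun xi => _) = fun xi => (p - 1) * (alive l i xi)%:R + 1); last first.
  by apply/funext => xi; case: (alive l i xi); rewrite ?mulr1 ?mulr0 ?subrK ?add0r.
apply: measfD; last exact: measf_cst.
by apply: measfM; [exact: measf_cst|apply: measf_ind; exact: measf_alive].
Qed.

(** Expand the product over the sets of dying points. [EJ_dies] bounds the joint death of a set by
    the product of the individual bounds, so the expansion folds back as if the deaths were
    independent. *)
Lemma EJ_survive i (th : R) xi : (m <= i < n)%N -> 0 <= th <= 1 -> independent_kernels xi ->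
  (forall l, 0 < grm (topl l m xi)) ->
  (EJ mu (coords (rowi iota (n := n) i)) (fun xi => (survive th xi i.+1)%:E) xi
    <= (survive (th + (1 - th) * pdie i) xi i)%:E)%E.
Proof.
move=> /andP[mi im] /andP[th0 th1] ik g0; set K := coords _; set p := pdie i.
have /andP[p0 p1] := pdie01 i.
(* After step i the factor of point l is a + b [l dies]: a living point carries th, and death raises
   it to 1. *)
pose a l := if alive l i xi then th else 1.
pose b l := if alive l i xi then 1 - th else 0.
have a0 l : 0 <= a l by rewrite /a; case: ifP.
have b0 l : 0 <= b l by rewrite /b; case: ifP; rewrite ?subr_ge0.
pose c (f : {ffun 'I_r -> bool}) := \prod_l (if f l then b l else a l).
have c0 f : 0 <= c f by apply: prodr_ge0 => l _; case: ifP.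
pose D (f : {ffun 'I_r -> bool}) : {set 'I_r} := finset (fun l => f l).
rewrite [leLHS](_ : _ = EJ mu K (fun y => (\sum_(f : {ffun 'I_r -> bool})
    (c f)%:E * ind (fun xi => all (fun l => dies l i xi) (enum (D f))) y)%E) xi); last first.
  apply: EJ_congr => y hy; under eq_bigr do rewrite -EFinM; rewrite sumEFin; congr EFin.
  transitivity (\prod_l (a l + b l * (dies l i y)%:R)).
    apply: eq_bigr => l _; rewrite aliveS// /a /b.
    have -> : alive l i y = alive l i xi.
      apply: eq_forallb => j.
      have -> : topl l j.+1 y = topl l j.+1 xi by exact: (top_dep _ iota_inj (ltn_ord j) hy).
      by have -> : topl l j y = topl l j xi by exact: (top_dep _ iota_inj (ltnW (ltn_ord j)) hy).
    by case: alive; case: dies; rewrite ?mulr1 ?mulr0 ?mul0r ?addr0 ?subrKC.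
  rewrite prod_distr2; apply: eq_bigr => f _; rewrite /c.
  case: (boolP (all _ _)) => [/allP h|].
    rewrite mulr1; apply: eq_bigr => l _; case: ifP => // fl.
    by rewrite (h l) ?mulr1// mem_enum inE.
  move=> /allPn[l]; rewrite mem_enum inE => fl nd.
  by rewrite [RHS]mulr0; apply/eqP/prodf_eq0; exists l; rewrite // fl (negbTE nd) mulr0.
rewrite (@EJ_sum R mu K _ _ (fun (f : {ffun 'I_r -> bool}) y =>
  ((c f)%:E * ind (fun xi => all (fun l => dies l i xi) (enum (D f))) y)%E)); last 2 first.
- by move=> f y; rewrite mule_ge0 ?ind_ge0// lee_fin.
- move=> f; rewrite (_ : (fun xi => _) = fun y => (c f * (all (fun l => dies l i y) (enum (D f)))%:R)%:E) //.
  apply: measf_EFin; apply: measfM; first exact: measf_cst.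
  by apply: measf_ind; apply: measf_all => l; exact: measf_dies.
rewrite /survive (eq_bigr (fun l => a l + b l * p)); last first.
  by move=> l _; rewrite /a /b; case: ifP; rewrite ?mul0r ?addr0.
rewrite prod_distr2 -sumEFin; apply: lee_sum => f _.
have mall : measf (fun y => all (fun l => dies l i y) (enum (D f))).
  by apply: measf_all => l; exact: measf_dies.
rewrite EJ_Zl//; [|exact: ind_ge0|exact: measf_indE].
have -> : \prod_l (if f l then b l * p else a l) = c f * p ^+ #|D f|.
  rewrite /c -prodr_const [X in _ * X]big_mkcond -big_split /=; apply: eq_bigr => l _.
  transitivity ((if f l then b l else a l) * (if l \in D f then p else 1)); last by [].
  by rewrite /D inE; case: ifP; rewrite ?mulr1.
rewrite EFinM; case: (boolP [forall l in D f, alive l i xi]) => [/forall_inP h|].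
  by apply: lee_wpmul2l; [rewrite lee_fin|apply: EJ_dies; rewrite ?mi].
rewrite negb_forall_in => /exists_inP[l lD nal].
suff -> : c f = 0 by rewrite !mul0e.
by rewrite /c (bigD1 l)//=; move: lD; rewrite inE => ->; rewrite /b (negbTE nal) mul0r.
Qed.

(** Indexed by the number k of rows still to come, which is also the codimension before the next of
    them; 1 - theta k is the product of the one-step survival bounds. *)
Fixpoint theta k : R := if k is k'.+1 then theta k' + (1 - theta k') * pdie (n - k) else 0.

Lemma theta01 k : 0 <= theta k <= 1.
Proof.
elim: k => [|k /andP[h0 h1]] /=; first by rewrite lexx ler01.
have /andP[p0 p1] := pdie01 (n - k.+1); apply/andP; split; first by rewrite addr_ge0// mulr_ge0// subr_ge0.
by rewrite -lerBrDl ler_piMr// subr_ge0.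
Qed.

Lemma one_sub_theta k : (k <= n)%N ->
  1 - theta k = \prod_(1 <= d < k.+1) (1 - expR (d%:R * ln q / 2)).
Proof.
elim: k => [|k IH] kn; first by rewrite big_geq//= subr0.
rewrite big_nat_recr//= -IH ?(ltnW kn)// /pdie subKn//; ring.
Qed.

Variable gd : cfg R -> bool.
Hypothesis mgd : measf gd.
Hypothesis gd_dep : forall k xi xi', (m <= k)%N ->
  (forall e, e \notin coords (rowi iota (n := n) k) -> xi' e = xi e) -> gd xi' = gd xi.
Hypothesis gd_ik : forall xi, gd xi -> independent_kernels xi.
Hypothesis gd_gt0 : forall xi, gd xi -> forall l, 0 < grm (topl l m xi).

Fixpoint lastrows (i k : nat) : seq (nat * nat) :=
  if k is k'.+1 then coords (rowi iota (n := n) i) ++ lastrows i.+1 k' else [::].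

(** With parameter 0 at the end, [survive] is the indicator that no point is alive; integrating the
    rows backwards replaces the parameter by the successive values of [theta]. *)
Lemma EJ_all_dead k i xi : (m <= i)%N -> (i + k)%N = n ->
  (EJ mu (lastrows i k) (fun xi => ((gd xi)%:R * survive 0 xi n)%:E) xi
    <= ((gd xi)%:R * survive (theta k) xi i)%:E)%E.
Proof.
elim: k i xi => [|k IH] i xi mi ik; first by rewrite -ik addn0.
have mf : measf (fun xi => ((gd xi)%:R * survive 0 xi n)%:E).
  by apply: measf_EFin; apply: measfM; [exact: measf_ind|exact: measf_survive].
have f0 y : (0 <= ((gd y)%:R * survive 0 y n)%:E)%E.
  by rewrite lee_fin mulr_ge0// prodr_ge0// => l _; case: ifP.
have /andP[t0 t1] := theta01 k.
have s0 y j : 0 <= survive (theta k) y j by apply: prodr_ge0 => l _; case: ifP.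
rewrite /= EJ_cat; apply: (@le_trans _ _ (EJ mu (coords (rowi iota (n := n) i))
   (fun xi => ((gd xi)%:R * survive (theta k) xi i.+1)%:E) xi)).
  apply: EJ_le; [exact: EJ_ge0|exact: EJ_meas| |].
    by apply: measf_EFin; apply: measfM; [exact: measf_ind|exact: measf_survive].
  by move=> y; apply: IH; [exact: leqW|rewrite addSnnS].
rewrite [leLHS](_ : _ = EJ mu (coords (rowi iota (n := n) i))
   (fun y => ((gd xi)%:R)%:E * (survive (theta k) y i.+1)%:E)%E xi); last first.
  by apply: EJ_congr => y hy; rewrite (gd_dep mi hy) EFinM.
rewrite EJ_Zl//; last 2 first.
- by move=> y; rewrite lee_fin.
- by apply: measf_EFin; exact: measf_survive.
rewrite EFinM; case: (boolP (gd xi)) => g; last by rewrite !mul0e.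
have -> : (n - k.+1 = i)%N by rewrite -ik addnK.
rewrite !mul1e; apply: EJ_survive.
- by rewrite mi -ik -addn1 leq_add2l.
- exact: theta01.
- exact: gd_ik.
- exact: gd_gt0.
Qed.

End dying_steps.

(** * Right inverses up to low rank *)

Section approximate_inverse.
Variable R : realType.
Notation C := R[i].

Lemma fr1 n : fr (1%:M : 'M[C]_n) = n%:R.
Proof.
rewrite /fr (eq_bigr (fun=> 1)) ?sumr_const ?card_ord// => i _.
rewrite (bigD1 i)//= big1 => [|j ji]; first by rewrite mxE eqxx nsq1 addr0.
by rewrite mxE eq_sym (negbTE ji) nsq0.
Qed.

Lemma frM_le m n p (A : 'M[C]_(m, n)) (B : 'M[C]_(n, p)) : fr (A *m B) <= fr A * fr B.
Proof. by rewrite -lecR rmorphM /= !frE frobM_le. Qed.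

Lemma frZ m n (a : C) (A : 'M[C]_(m, n)) : fr (a *: A) = nsq a * fr A.
Proof.
by rewrite /fr mulr_sumr; apply: eq_bigr => i _; rewrite mulr_sumr; apply: eq_bigr => j _; rewrite mxE nsqM.
Qed.

Lemma frN m n (A : 'M[C]_(m, n)) : fr (- A) = fr A.
Proof. by rewrite -scaleN1r frZ nsqN nsq1 mul1r. Qed.

Lemma frD_le m n (A B : 'M[C]_(m, n)) : fr (A + B) <= 2 * (fr A + fr B).
Proof. by rewrite -lecR rmorphM rmorph_nat rmorphD /= !frE frobD_le. Qed.

Lemma fr_sum_le (I : finType) m n (A : I -> 'M[C]_(m, n)) :
  fr (\sum_i A i) <= #|I|%:R * \sum_i fr (A i).
Proof.
rewrite /fr (eq_bigr (fun i => \sum_j nsq (\sum_k A k i j))); last first.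
  by move=> i _; apply: eq_bigr => j _; rewrite summxE.
have h (f : I -> C) : nsq (\sum_k f k) <= #|I|%:R * \sum_k nsq (f k).
  have := CauchySchwarz_sum (fun _ : I => 1 : C) f.
  under eq_bigr do rewrite mul1r.
  have -> : \sum_(i : I) `|1 : C| ^+ 2 = #|I|%:R by rewrite normr1 expr1n sumr_const.
  have -> : \sum_i `|f i| ^+ 2 = (\sum_i nsq (f i))%:C.
    by rewrite rmorph_sum; apply: eq_bigr => i _; rewrite /= nsqE.
  by rewrite -nsqE -(rmorph_nat (real_complex R)) -rmorphM lecR.
apply: (@le_trans _ _ (\sum_i \sum_j #|I|%:R * \sum_k nsq (A k i j))).
  by apply: ler_sum => i _; apply: ler_sum => j _; exact: h.
rewrite le_eqVlt; apply/orP; left; apply/eqP.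
under eq_bigr do rewrite -mulr_sumr.
rewrite -mulr_sumr; congr (_ * _); under eq_bigr do rewrite exchange_big.
by rewrite exchange_big.
Qed.

(** The pseudo-inverse T^H (T T^H)^-1 of the first rows: its squared norm is the trace of the
    inverse Gram matrix, a sum of inverse squared distances. *)
Lemma approx_inverse p m (M : 'M[C]_m) (T : 'M[C]_(p.+1, m)) (b : R) :
  pid_mx p.+1 *m M = T -> 0 < grm T -> 0 <= b ->
  (forall i, grm (row' i T) <= b * grm T) ->
  exists2 S : 'M[C]_m, fr S <= b * p.+1%:R ^+ 2 & (pid_mx p.+1 : 'M[C]_(p.+1, m)) *m (1%:M - M *m S) = 0.
Proof.
move=> MT T0 b0 hb; set G := T *m T^t*.
have T0' : gdet T != 0 by rewrite -grmE eq_complex /= eqxx andbT gt_eqF.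
have GU : G \in unitmx by rewrite unitmxE unitfE.
have Gh : G^t* = G by rewrite trmxCM trmxCK.
have Gih : (invmx G)^t* = invmx G by rewrite trmx_inv map_invmx Gh.
exists (T^t* *m invmx G *m pid_mx p.+1); last first.
  by rewrite mulmxBr mulmx1 mulmxA MT !mulmxA -/G mulmxV// mul1mx subrr.
apply: (le_trans (frM_le _ _)).
have -> : fr (T^t* *m invmx G) = \sum_i grm (row' i T) / grm T.
  have e : (T^t* *m invmx G)^t* = invmx G *m T by rewrite trmxCM Gih trmxCK.
  apply: complexI; rewrite frE -frob_tr e frobE trmxCM Gih mulmxA -(mulmxA _ T) -/G.
  rewrite mulVmx// mul1mx rmorph_sum; apply: eq_bigr => i _.
  by rewrite inv_gram_diag// -!grmE fmorph_div.
have h1 : \sum_i grm (row' i T) / grm T <= b * p.+1%:R.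
  rewrite mulr_natr -[X in _ <= b *+ X](card_ord p.+1) -sumr_const.
  by apply: ler_sum => i _; rewrite ler_pdivrMr.
have h2 : fr (pid_mx p.+1 : 'M[C]_(p.+1, m)) <= p.+1%:R.
  rewrite -[leRHS](fr1 p.+1) /fr; apply: ler_sum => i _.
  rewrite [leRHS](bigD1 i)//= [X in _ + X]big1 => [|j ji]; last by rewrite mxE eq_sym (negbTE ji) nsq0.
  rewrite mxE eqxx nsq1 addr0.
  case: (ltnP i m) => im; last first.
    by rewrite big1// => j _; rewrite mxE gtn_eqF ?nsq0//; exact: leq_trans im.
  rewrite (bigD1 (Ordinal im))//= big1 ?addr0 => [|j ji].
    by rewrite mxE eqxx ltn_ord nsq1.
  rewrite mxE; have -> : (i == j :> nat) = false; last by rewrite nsq0.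
  by apply: contraNF ji => /eqP ij; apply/eqP/val_inj.
by rewrite expr2 mulrA ler_pM// ?fr_ge0// sumr_ge0// => i _; rewrite divr_ge0 ?grm_ge0.
Qed.

(** Invertibility up to rank k with a norm bound. Unlike a bound on the least singular value it
    holds with overwhelming probability for a random matrix, since the distances involved have
    codimension about k, and it is stable under products. *)
Definition has_ainv m (k : nat) (b : R) (M : 'M[C]_m) :=
  exists2 S : 'M[C]_m, fr S <= b & (\rank (1%:M - M *m S)%R <= k)%N.

Lemma has_ainv_pid p m (M S : 'M[C]_m) : (p <= m)%N ->
  (pid_mx p : 'M[C]_(p, m)) *m (1%:M - M *m S) = 0 -> (\rank (1%:M - M *m S)%R <= m - p)%N.
Proof.
move=> pm h; have := mulmx0_rank_max h; by rewrite rank_pid_mx// leq_subRL.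
Qed.

(** The defect of the product is (1 - M2 S2) + M2 (1 - M1 S1) S2, so the ranks add. *)
Lemma has_ainvM m k1 k2 b1 b2 (M1 M2 : 'M[C]_m) : 0 <= b2 ->
  has_ainv k1 b1 M1 -> has_ainv k2 b2 M2 -> has_ainv (k1 + k2) (b1 * b2) (M2 *m M1).
Proof.
move=> b20 [S1 hS1 r1] [S2 hS2 r2]; exists (S1 *m S2).
  by apply: (le_trans (frM_le _ _)); rewrite ler_pM ?fr_ge0.
have -> : 1%:M - M2 *m M1 *m (S1 *m S2) = (1%:M - M2 *m S2) + M2 *m (1%:M - M1 *m S1) *m S2.
  by rewrite mulmxBr mulmx1 mulmxBl !mulmxA addrA subrK.
rewrite addnC; apply: (leq_trans (mxrank_add _ _)); apply: leq_add => //.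
by apply: (leq_trans (mxrankM_maxl _ _)); apply: (leq_trans (mxrankM_maxr _ _)).
Qed.

Lemma has_ainv_prod m k b (Z : 'M[C]_m) (s : seq C) : 0 <= b ->
  (forall a, a \in s -> has_ainv k b (Z - a%:M)) ->
  has_ainv (size s * k) (m%:R * b ^+ size s) (foldr (fun a M => M *m (Z - a%:M)) 1%:M s).
Proof.
move=> b0; elim: s => [_|a s IH h] /=.
  exists 1%:M; first by rewrite fr1 mulr1.
  by rewrite mulmx1 subrr mxrank0.
rewrite mulSn exprS mulrCA.
apply: has_ainvM; first by rewrite mulr_ge0// exprn_ge0.
  by apply: h; rewrite inE eqxx.
by apply: IH => a' a's; apply: h; rewrite inE a's orbT.
Qed.

Lemma horner_mx_factor m' (Z : 'M[C]_m'.+1) (p : {poly C}) (s : seq C) :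
  p = lead_coef p *: \prod_(a <- s) ('X - a%:P) ->
  horner_mx Z p = lead_coef p *: foldr (fun a M => M *m (Z - a%:M)) 1%:M s.
Proof.
move=> ->; rewrite lead_coefZ (monicP (monic_prod_XsubC _ _ _)) mulr1 linearZ /=; congr (_ *: _).
elim: s => [|a s IH]; first by rewrite big_nil rmorph1.
rewrite big_cons mulrC rmorphM /= IH; congr (_ *m _).
by rewrite rmorphB /= horner_mx_X horner_mx_C.
Qed.

Variable mu : probability C R.
Variable q : R.
Hypothesis q01 : 0 < q < 1.
Hypothesis conc : forall v s, 1 <= s ->
  (\int[mu]_u (expR (- (s * nsq (u - v))))%:E <= q%:E)%E.

(** Applying S and then [pcompl D] to x (phi M) gives phi x [pcompl D], D being the defect. Hence
    phi M shrinks squared lengths on the complement of D, of dimension at least m - k, by no more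
    than b / nsq phi. *)
Lemma ainv_small_ball m (io : 'I_m -> nat * nat) (M : 'M[C]_m) (phi : C) (u : 'rV[C]_m) k b (t : R) xi :
  (0 < m)%N -> injective io -> has_ainv k b M -> phi != 0 -> 0 < b -> t * m%:R * b <= nsq phi ->
  (EJ mu (coords io) (ind (fun xi => (fr (rowof io xi *m (phi *: M) - u) <= t)%R)) xi
     <= (expR 1 * q ^+ (m - k))%:E)%E.
Proof.
move=> m0 io_inj [S Sb rS] phi0 b0 hb.
have phi0' : 0 < nsq phi by rewrite lt_neqAle nsq_ge0 andbT eq_sym nsq_eq0.
have m0' : 0 < m%:R :> R by rewrite ltr0n.
set D := 1%:M - M *m S in rS.
pose nu := nsq phi / b; have nu0 : 0 < nu by rewrite divr_gt0.
pose lam := m%:R / nu; have lam0 : 0 <= lam by rewrite divr_ge0// ltW.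
have hnu (x : 'rV[C]_m) : nu * fr (x *m pcompl D) <= fr (x *m (phi *: M)).
  rewrite /nu mulrAC ler_pdivrMr// -frZ.
  have -> : phi *: (x *m pcompl D) = x *m (phi *: M) *m S *m pcompl D.
    have -> : x *m (phi *: M) *m S = phi *: (x *m (1%:M - D)).
      by rewrite /D opprB addrC subrK -scalemxAr -scalemxAl mulmxA.
    by rewrite -scalemxAl -mulmxA mulmxBl mul1mx (pcompl_sub0 (submx_refl D)) subr0.
  apply: (@le_trans _ _ (fr (x *m (phi *: M) *m S))).
    by rewrite -lecR !frE; apply: frob_proj_le; exact: pcompl_proj.
  by apply: (le_trans (frM_le _ _)); rewrite ler_wpM2l ?fr_ge0.
have := small_ball q01 conc (M := phi *: M) u xi io_inj (pcompl_proj D) (pcompl_trace D)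
   hnu (ltW nu0) lam0 (j0 := 0).
rewrite subn0 mulr1 divfK ?gt_eqF// => /(_ (lexx _) (leq0n _)) sb.
have mex : measf (fun xi => expR (- (lam * fr (rowof io xi *m (phi *: M) - u)))).
  apply: measf_expR; apply: measfN; apply: measfM; first exact: measf_cst.
  apply: measf_fr; apply: mxmeasfB; last exact: mxmeasf_cst.
  by apply: mxmeasfM; [exact: mxmeasf_rowof|exact: mxmeasf_cst].
apply: (@le_trans _ _ (EJ mu (coords io) (fun xi => (expR 1)%:E * (expR (- (lam * fr (rowof io xi *m (phi *: M) - u))))%:E)%E xi)).
  apply: EJ_le.
  - exact: ind_ge0.
  - apply: measf_indE; apply: measf_le; last exact: measf_cst.
    apply: measf_fr; apply: mxmeasfB; last exact: mxmeasf_cst.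
    by apply: mxmeasfM; [exact: mxmeasf_rowof|exact: mxmeasf_cst].
  - by apply: (measf_EFin (f := fun xi => expR 1 * expR (- (lam * fr (rowof io xi *m (phi *: M) - u))))); apply: measfM => //; exact: measf_cst.
  move=> y; rewrite -EFinM lee_fin -expRD; case: (boolP (fr _ <= t)) => [h|_]; last exact: expR_ge0.
  rewrite -[leLHS](expR0 R) ler_expR subr_ge0; apply: (le_trans (ler_wpM2l lam0 h)).
  rewrite /lam /nu invf_div mulrA mulrAC ler_pdivrMr// mul1r.
  by rewrite mulrC mulrA.
rewrite EJ_Zl ?expR_ge0//; [|exact: measf_EFin].
rewrite EFinM; apply: lee_wpmul2l; first by rewrite lee_fin expR_ge0.
apply: (le_trans sb); rewrite lee_fin; have /andP[q0 q1] := q01.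
by rewrite ler_wiXn2l ?(ltW q0) ?(ltW q1)// leq_sub2l.
Qed.

End approximate_inverse.

(** * From Krylov vectors to independent kernels *)

Section krylov_independence.
Variable R : realType.
Notation C := R[i].
Variables (m' k r : nat).
Local Notation m := m'.+1.
Variables (Z : 'M[C]_m) (G : 'M[C]_(k, m)) (w : 'I_r -> C) (d : nat -> C) (ell : 'I_r -> 'I_r -> C).
Variables (L Ld Lv kap : R).
Hypotheses (L1 : 1 <= L) (ZL : fr Z <= L) (GL : fr G <= L) (Ld1 : 1 <= Ld) (kap0 : 0 < kap).
Hypotheses (dLd : forall p, nsq (d p) <= Ld) (dr : d r = 1).
Hypothesis dw : forall l, \sum_(p < r.+1) d p * w l ^+ p = 0.
Hypothesis ellLv : forall j p, nsq (ell j p) <= Lv.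
Hypothesis ellw : forall j l, \sum_(p < r) ell j p * w l ^+ p = (j == l)%:R.
Hypothesis krylov : forall (psi : 'I_r -> 'rV[C]_k) i c,
  kap * nsq (psi i 0 c) <= fr (\sum_(i < r) psi i *m G *m Z ^+ i).
Variables (B : 'I_r -> 'rV[C]_m) (F : 'I_r -> 'rV[C]_k).
Hypothesis BF : forall l, B l *m (Z - (w l)%:M) + F l *m G = 0.

Let u p := \sum_l w l ^+ p *: B l.
Let ph p := \sum_l w l ^+ p *: F l.
(** Horner scheme for the polynomial with coefficients d, applied to the moments [u p]: [Y t] uses
    its top t + 1 coefficients, and [Y r] vanishes because every w_l is a root. *)
Let Y t := \sum_(p < t.+1) d (r - t + p) *: u p.
Let ps t := \sum_(p < t.+1) d (r - t + p) *: ph p.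
(** What the Horner recursion produces from [u 0] alone, without the terms in G. *)
Let e t : 'rV[C]_m := iteri t (fun t e => e *m Z + d (r - t.+1) *: u 0) (u 0).

Let uS p : u p.+1 = u p *m Z + ph p *m G.
Proof.
rewrite /u /ph !mulmx_suml -big_split /=; apply: eq_bigr => l _.
have := BF l; rewrite mulmxBr mul_mx_scalar addrAC => /eqP; rewrite subr_eq0 => /eqP h.
by rewrite exprSr -scalerA -h scalerDr -!scalemxAl.
Qed.

Let YS t : (t < r)%N -> Y t.+1 = Y t *m Z + ps t *m G + d (r - t.+1) *: u 0.
Proof.
move=> tr; rewrite /Y big_ord_recl /= addn0 addrC; congr (_ + _).
rewrite /ps !mulmx_suml -big_split /=; apply: eq_bigr => p _.
rewrite /bump /= add1n -!scalemxAl -scalerDr -uS; congr (d _ *: _).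
by lia.
Qed.

Let YE t : (t <= r)%N -> Y t = \sum_(s < t) ps s *m G *m Z ^+ (t.-1 - s) + e t.
Proof.
elim: t => [_|t IH tr]; first by rewrite big_ord0 add0r /Y big_ord1 subn0 addn0 dr scale1r.
rewrite YS// IH ?(ltnW tr)// [e t.+1]/= addrA; congr (_ + _).
rewrite big_ord_recr /= subnn expr0 mulmx1 mulmxDl addrAC; congr (_ + _ + _).
rewrite mulmx_suml; apply: eq_bigr => s _; rewrite -mulmxA -[_ *m Z]/(_ * Z) -exprSr.
by case: t s {IH tr} => [[]//|t s] /=; rewrite -subSn// -ltnS.
Qed.

Let Yr : Y r = 0.
Proof.
rewrite /Y subnn; under eq_bigr do rewrite add0n scaler_sumr.
rewrite exchange_big big1//= => l _; under eq_bigr do rewrite scalerA.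
by rewrite -scaler_suml dw scale0r.
Qed.

Let e0 := fr (\sum_l B l).
Let u0E : u 0 = \sum_l B l.
Proof. by apply: eq_bigr => l _; rewrite expr0 scale1r. Qed.
Let e00 : 0 <= e0. Proof. exact: fr_ge0. Qed.

Let A := 4 * L * Ld.
Let A1 : 1 <= A.
Proof. by rewrite /A; move: L1 Ld1; nra. Qed.

Let e_le t : fr (e t) <= A ^+ t * e0.
Proof.
elim: t => [|t IH]; first by rewrite mul1r /= u0E.
rewrite [e _]/=; apply: (le_trans (frD_le _ _)).
have h1 : fr (e t *m Z) <= A ^+ t * e0 * L.
  by apply: (le_trans (frM_le _ _)); rewrite ler_pM ?fr_ge0.
have h2 : fr (d (r - t.+1) *: u 0) <= Ld * e0.
  by rewrite frZ u0E ler_pM ?nsq_ge0 ?fr_ge0.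
have h3 : e0 <= A ^+ t * e0 by rewrite ler_peMl// exprn_ege1.
rewrite exprS -mulrA; move: h1 h2 h3; set a := A ^+ t * e0 => h1 h2 h3; rewrite /A.
have a0 : 0 <= a by exact: le_trans h3.
have p1 : a * L <= a * L * Ld by rewrite ler_peMr// mulr_ge0// (le_trans ler01).
have p2 : Ld * e0 <= a * L * Ld.
  rewrite mulrC ler_wpM2r ?(le_trans ler01)//; apply: (le_trans h3).
  by rewrite ler_peMr.
lra.
Qed.

Let e1 := k%:R * (A ^+ r * e0 / kap).
Let e10 : 0 <= e1. Proof. by rewrite mulr_ge0// divr_ge0 ?(ltW kap0)// mulr_ge0// exprn_ge0// (le_trans ler01). Qed.

Let ps_le t : (t < r)%N -> fr (ps t) <= e1.
Proof.
move=> tr; rewrite fr_row /e1 mulr_natl -[X in _ *+ X]card_ord -sumr_const.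
apply: ler_sum => c _; rewrite ler_pdivlMr// mulrC.
pose psi (i : 'I_r) := ps (rev_ord i).
have -> : nsq (ps t 0 c) = nsq (psi (rev_ord (Ordinal tr)) 0 c) by rewrite /psi rev_ordK.
apply: (le_trans (krylov _ _ _)); apply: le_trans (e_le r).
rewrite (reindex_inj rev_ord_inj) /=.
have : Y r = 0 by [].
rewrite YE// => /eqP; rewrite addr_eq0 => /eqP h.
rewrite -(frN (e r)) -h le_eqVlt; apply/orP; left; apply/eqP; congr fr; apply: eq_bigr => s _.
rewrite /psi rev_ordK /=; congr (_ *m _ ^+ _); case: r s {tr} => [[]//|r' s'] /=; exact: subSS.
Qed.

Let X := 4 * r%:R ^+ 2 * Ld.

Let ph_le t : (t < r)%N -> fr (ph t) <= X ^+ t * e1.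
Proof.
elim/ltn_ind: t => t IH tr.
have r1 : 1 <= r%:R :> R by rewrite -[1]/(1%:R) ler_nat (leq_ltn_trans _ tr).
have X1 : 1 <= X by rewrite /X; move: Ld1; nra.
have -> : ph t = ps t - \sum_(p < t) d (r - t + p) *: ph p.
  by rewrite /ps big_ord_recr /= subnK ?(ltnW tr)// dr scale1r addrAC subrr add0r.
case: t IH tr => [|t] IH tr; first by rewrite big_ord0 subr0 mul1r; exact: ps_le.
apply: (le_trans (frD_le _ _)); rewrite frN.
have h1 := ps_le tr.
have h2 : fr (\sum_(p < t.+1) d (r - t.+1 + p) *: ph p) <= r%:R * (r%:R * (Ld * (X ^+ t * e1))).
  apply: (le_trans (fr_sum_le _)); rewrite card_ord.
  have tr' : t.+1%:R <= r%:R :> R by rewrite ler_nat ltnW.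
  apply: ler_pM => //; first by apply: sumr_ge0 => p _; exact: fr_ge0.
  apply: (@le_trans _ _ (\sum_(p < t.+1) Ld * (X ^+ t * e1))).
    apply: ler_sum => p _; rewrite frZ ler_pM ?nsq_ge0 ?fr_ge0//.
    apply: (le_trans (IH p (ltn_ord p) (ltn_trans (ltn_ord p) tr))).
    by rewrite ler_wpM2r// ler_weXn2l// -ltnS.
  rewrite sumr_const card_ord -[leLHS]mulr_natl ler_wpM2r//.
  by apply: mulr_ge0; [exact: le_trans Ld1|apply: mulr_ge0 => //; apply: exprn_ge0; exact: le_trans X1].
have h3 : e1 <= X ^+ t * e1 by rewrite ler_peMl// exprn_ege1.
rewrite exprS -mulrA; move: h1 h2 h3; move: (X ^+ t * e1) => a h1 h2 h3; rewrite /X.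
have : e1 <= r%:R * (r%:R * (Ld * a)).
  have a0 : 0 <= a by exact: le_trans h3.
  by apply: (le_trans h3); rewrite !mulrA ler_peMl// !mulr_ege1.
lra.
Qed.

Let e2 := X ^+ r * e1.

Let ph_le2 t : (t < r)%N -> fr (ph t) <= e2.
Proof.
move=> tr; apply: (le_trans (ph_le tr)); rewrite ler_wpM2r// ler_weXn2l ?(ltnW tr)//.
have r1 : 1 <= r%:R :> R by rewrite -[1]/(1%:R) ler_nat (leq_ltn_trans _ tr).
by rewrite /X; move: Ld1; nra.
Qed.

Let e20 : 0 <= e2.
Proof. by rewrite mulr_ge0// exprn_ge0// !mulr_ge0// (le_trans ler01). Qed.

Let u_le t : (t <= r)%N -> fr (u t) <= (4 * L) ^+ t * (e0 + e2).
Proof.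
elim: t => [_|t IH tr]; first by rewrite u0E mul1r lerDl.
rewrite uS; apply: (le_trans (frD_le _ _)).
have h1 := IH (ltnW tr); have h2 := ph_le2 tr.
have h3 : e0 + e2 <= (4 * L) ^+ t * (e0 + e2).
  by rewrite ler_peMl ?addr_ge0// exprn_ege1//; move: L1; lra.
have h4 : fr (u t *m Z) <= (4 * L) ^+ t * (e0 + e2) * L.
  by apply: (le_trans (frM_le _ _)); rewrite ler_pM ?fr_ge0.
have h5 : fr (ph t *m G) <= e2 * L.
  by apply: (le_trans (frM_le _ _)); rewrite ler_pM ?fr_ge0.
rewrite exprS -mulrA; move: h3 h4 h5; set a := _ ^+ t * _ => h3 h4 h5.
have : e2 * L <= a * L by rewrite ler_wpM2r ?(le_trans ler01)// (le_trans _ h3)// lerDr.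
lra.
Qed.

(** By [BF] the moments obey u_(p+1) = u_p Z + ph_p G. Since [Y r] = 0, the combination of the G Z^i
    with coefficients [ps] equals, up to sign, a vector built from u_0, so [krylov] bounds [ps] by
    the sum of the B_l. The [ph] follow from a triangular system, d_r being 1, then the u_p, and the
    dual coefficients [ell] recover each B_l and F_l. *)
Lemma kernels_independent :
  \sum_l (fr (B l) + fr (F l)) <=
  2 * r%:R ^+ 3 * Lv * (4 * L) ^+ r * (1 + X ^+ r * k%:R * A ^+ r / kap) * fr (\sum_l B l).
Proof.
have lag n (V : 'I_r -> 'rV[C]_n) (b : R) : 0 <= b -> (forall p, (p < r)%N -> fr (\sum_l w l ^+ p *: V l) <= b) ->
    forall j, fr (V j) <= r%:R ^+ 2 * Lv * b.
  move=> b0 hb j; have -> : V j = \sum_(p < r) ell j p *: \sum_l w l ^+ p *: V l.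
    under eq_bigr do rewrite scaler_sumr; rewrite exchange_big /=.
    under eq_bigr do (under eq_bigr do rewrite scalerA; rewrite -scaler_suml ellw).
    rewrite (bigD1 j)//= eqxx scale1r big1 ?addr0// => l lj.
    by rewrite eq_sym (negbTE lj) scale0r.
  apply: (le_trans (fr_sum_le _)); rewrite card_ord expr2 -!mulrA ler_wpM2l//.
  apply: (@le_trans _ _ (\sum_(p < r) Lv * b)); last by rewrite sumr_const card_ord mulr_natl.
  by apply: ler_sum => p _; rewrite frZ ler_pM ?nsq_ge0 ?fr_ge0// hb.
have LL : 1 <= (4 * L) ^+ r by rewrite exprn_ege1//; move: L1; lra.
have e02 : 0 <= e0 + e2 by rewrite addr_ge0.
have hB j : fr (B j) <= r%:R ^+ 2 * Lv * ((4 * L) ^+ r * (e0 + e2)).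
  apply: lag => [|p pr]; first by rewrite mulr_ge0// (le_trans ler01).
  apply: (le_trans (u_le (ltnW pr))); rewrite ler_wpM2r// ler_weXn2l ?(ltnW pr)//.
  by move: L1; lra.
have hF j : fr (F j) <= r%:R ^+ 2 * Lv * ((4 * L) ^+ r * (e0 + e2)).
  apply: lag => [|p pr]; first by rewrite mulr_ge0// (le_trans ler01).
  apply: (le_trans (ph_le2 pr)); apply: (@le_trans _ _ (e0 + e2)); first by rewrite lerDr.
  by rewrite ler_peMl.
apply: (@le_trans _ _ (\sum_(l < r) 2 * (r%:R ^+ 2 * Lv * ((4 * L) ^+ r * (e0 + e2))))).
  by apply: ler_sum => l _; have := hB l; have := hF l; lra.
rewrite sumr_const card_ord -mulr_natl le_eqVlt; apply/orP; left; apply/eqP.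
have -> : e0 + e2 = (1 + X ^+ r * k%:R * A ^+ r / kap) * e0 by rewrite /e2 /e1; field; rewrite gt_eqF.
by rewrite -/e0; move: (X ^+ r) (A ^+ r) ((4 * L) ^+ r) => x a l; ring.
Qed.

End krylov_independence.

(** * A weighted net for the Krylov condition *)

Section net.
Variable R : realType.
Notation C := R[i].
Variables (m' k r N : nat).
Local Notation m := m'.+1.
Variables (th L beta kap : R).

Definition gridv (a : 'I_(N + N).+1 * 'I_(N + N).+1) : C :=
  ((a.1%:R - N%:R) / N%:R) +i* ((a.2%:R - N%:R) / N%:R).

Lemma gridv_near (z : C) : (0 < N)%N -> nsq z <= 1 -> exists a, nsq (gridv a - z) <= 2 / N%:R ^+ 2.
Proof.
move=> N0; have N0' : 0 < N%:R :> R by rewrite ltr0n.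
have near (x : R) : x ^+ 2 <= 1 -> exists a : 'I_(N + N).+1, ((a%:R - N%:R) / N%:R - x) ^+ 2 <= 1 / N%:R ^+ 2.
  move=> x1; have /andP[xl xu] : - 1 <= x <= 1 by rewrite -ler_norml -(expr_le1 (n := 2))// real_normK ?num_real.
  pose y := x * N%:R + N%:R; have y0 : 0 <= y by rewrite /y; nra.
  have yN : y <= (N + N)%:R by rewrite natrD /y; nra.
  have /andP[t1 t2] := truncn_itv y0.
  have tN : (Num.truncn y < (N + N).+1)%N.
    by rewrite ltnS -(ler_nat R); exact: le_trans yN.
  exists (Ordinal tN) => /=.
  have -> : ((Num.truncn y)%:R - N%:R) / N%:R - x = ((Num.truncn y)%:R - y) / N%:R.
    by rewrite /y; field; rewrite gt_eqF.
  rewrite expr_div_n ler_pM2r ?invr_gt0 ?exprn_gt0//.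
  by rewrite -natr1 in t2; nra.
move=> z1; have [|a ha] := near (complex.Re z).
  by apply: le_trans z1; rewrite /nsq lerDl sqr_ge0.
have [|b hb] := near (complex.Im z).
  by apply: le_trans z1; rewrite /nsq lerDr sqr_ge0.
exists (a, b); rewrite /nsq !raddfB /=.
have -> : 2 / N%:R ^+ 2 = 1 / N%:R ^+ 2 + 1 / N%:R ^+ 2 :> R by rewrite -mulrDl.
exact: lerD.
Qed.

(** Coefficients carry powers of th, and those of row c0 beyond i0 are dropped: row c0 of G is then
    multiplied by a polynomial in Z of degree at most i0 whose leading coefficient is th^i0 times g
    i0 c0. *)
Definition netT (Z : 'M[C]_m) (G : 'M[C]_(k, m)) (g : 'I_r -> 'I_k -> C) (i0 : 'I_r) (c0 : 'I_k) : 'rV[C]_m :=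
  \sum_(ic : 'I_r * 'I_k) (if (ic.2 == c0) && (i0 < ic.1)%N then 0 else (th ^+ ic.1)%:C * g ic.1 ic.2)
     *: (row ic.2 G *m Z ^+ ic.1).

Lemma krylov_sum (Z : 'M[C]_m) (G : 'M[C]_(k, m)) (psi : 'I_r -> 'rV[C]_k) :
  \sum_(i < r) psi i *m G *m Z ^+ i =
  \sum_(ic : 'I_r * 'I_k) psi ic.1 0 ic.2 *: (row ic.2 G *m Z ^+ ic.1).
Proof.
rewrite -(pair_big predT predT (fun i c => psi i 0 c *: (row c G *m Z ^+ i))) /=.
apply: eq_bigr => i _; rewrite [psi i *m G]mulmx_sum_row mulmx_suml; apply: eq_bigr => c _.
by rewrite -scalemxAl.
Qed.

Hypothesis th01 : 0 < th <= 1.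
Hypothesis L1 : 1 <= L.
Hypothesis N3 : (2 < N)%N.
Hypothesis kap0 : 0 < kap.
Hypothesis hkap : 6 * kap <= th ^+ 2 ^+ r * beta.
Hypothesis hth : 6 * (r * k)%:R ^+ 2 * th ^+ 2 * L ^+ r <= beta.
Hypothesis hN : 12 * (r * k)%:R ^+ 2 * L ^+ r / N%:R ^+ 2 <= th ^+ 2 ^+ r * beta.

Lemma fr_row_le (A : 'M[C]_(k, m)) c : fr (row c A) <= fr A.
Proof.
rewrite fr_row [leRHS](bigD1 c)//= (eq_bigr (fun j => nsq (A c j))); last by move=> j _; rewrite mxE.
by rewrite lerDl; apply: sumr_ge0 => i _; apply: sumr_ge0 => j _; exact: nsq_ge0.
Qed.

(** Let (i0, c0) maximize nsq psi / th^(2 i), scale this maximum to one and round all coefficients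
    to the grid. The dropped coefficients of row c0 have squared size at most th^(2 i0 + 2), small
    against th^(2 i0) beta. The hypotheses [hkap], [hth] and [hN] each pay one third of that
    bound. *)
Lemma krylov_of_net (Z : 'M[C]_m) (G : 'M[C]_(k, m)) : fr Z <= L -> fr G <= L ->
  (forall (g : 'I_r -> 'I_k -> 'I_(N + N).+1 * 'I_(N + N).+1) i0 c0, 4^-1 <= nsq (gridv (g i0 c0)) ->
     th ^+ 2 ^+ i0 * beta < fr (netT Z G (fun i c => gridv (g i c)) i0 c0)) ->
  forall (psi : 'I_r -> 'rV[C]_k) i c,
    kap * nsq (psi i 0 c) <= fr (\sum_(i < r) psi i *m G *m Z ^+ i).
Proof.
move=> ZL GL hnet psi i1 c1; rewrite leNgt; apply/negP => hlt.
have /andP[th0 th1] := th01.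
have p0 : 0 < nsq (psi i1 0 c1).
  rewrite lt_neqAle nsq_ge0 andbT eq_sym; apply/eqP => h.
  by move: hlt; rewrite h mulr0 ltNge fr_ge0.
pose M (ic : 'I_r * 'I_k) := nsq (psi ic.1 0 ic.2) / th ^+ 2 ^+ ic.1.
have [[i0 c0] _ hmax] := @arg_maxP _ R _ (i1, c1) predT M isT.
have thp j : 0 < th ^+ 2 ^+ j by rewrite !exprn_gt0.
have mu0 : 0 < M (i0, c0).
  by apply: lt_le_trans (hmax (i1, c1) isT); rewrite divr_gt0.
set mu2 := M (i0, c0) in mu0 hmax; pose mu := Num.sqrt mu2.
have muE : mu ^+ 2 = mu2 by rewrite sqr_sqrtr// ltW.
have mup : 0 < mu by rewrite sqrtr_gt0.
pose chi i c := psi i 0 c / (mu * th ^+ i)%:C.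
have mt i : 0 < mu * th ^+ i by rewrite mulr_gt0// exprn_gt0.
have mtC i : (mu * th ^+ i)%:C != 0 :> C by rewrite eq_complex /= eqxx andbT gt_eqF.
have chiE i c : nsq (chi i c) = M (i, c) / mu2.
  rewrite /chi nsqM -fmorphV nsqC /M /= exprVn exprMn muE -exprM mulnC exprM invfM.
  by rewrite -mulrA [_^-1 / mu2]mulrC.
have chi1 i c : nsq (chi i c) <= 1.
  by rewrite chiE ler_pdivrMr// mul1r; exact: (hmax (i, c)).
have chi01 : nsq (chi i0 c0) = 1 by rewrite chiE divff// gt_eqF.
have N0 : (0 < N)%N by exact: leq_trans N3.
have /choice[gg hgg] : forall ic : 'I_r * 'I_k, exists a, nsq (gridv a - chi ic.1 ic.2) <= 2 / N%:R ^+ 2.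
  by move=> ic; exact: gridv_near.
pose g i c := gridv (gg (i, c)).
pose Tchi := \sum_(ic : 'I_r * 'I_k) ((th ^+ ic.1)%:C * chi ic.1 ic.2) *: (row ic.2 G *m Z ^+ ic.1).
have TE : \sum_(i < r) psi i *m G *m Z ^+ i = mu%:C *: Tchi.
  rewrite krylov_sum scaler_sumr; apply: eq_bigr => ic _; rewrite scalerA; congr (_ *: _).
  by rewrite [RHS]mulrA -rmorphM /= /chi mulrC divfK.
have hT : fr Tchi < kap.
  rewrite TE frZ nsqC muE in hlt.
  rewrite -(ltr_pM2l mu0); apply: (lt_le_trans hlt).
  rewrite mulrC ler_wpM2r ?(ltW kap0)//; apply: le_trans (hmax (i1, c1) isT).
  rewrite /M /= ler_pdivlMr// ler_piMr ?nsq_ge0// exprn_ile1// ?sqr_ge0//.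
  by rewrite exprn_ile1// ltW.
have N0' : 0 < N%:R :> R by rewrite ltr0n.
have N9 : 2 / N%:R ^+ 2 <= 2 / 9 :> R.
  have : 3 <= N%:R :> R by rewrite -[3]/(3%:R) ler_nat.
  move=> h3; rewrite ler_pM2l// lef_pV2 ?posrE ?exprn_gt0//.
  by move: h3; nra.
(* The maximal coefficient has modulus one; with N >= 3, rounding leaves a squared modulus of at
   least 1/2 - 2/9, above 1/4. *)
have g14 : 4^-1 <= nsq (gridv (gg (i0, c0))).
  have := hgg (i0, c0); rewrite /= => h1; have : nsq (chi i0 c0) <= 2 * (nsq (gridv (gg (i0, c0))) + nsq (gridv (gg (i0, c0)) - chi i0 c0)).
    have := nsq_sub_le (chi i0 c0) 0 (gridv (gg (i0, c0))).
    by rewrite subr0 sub0r nsqN -(nsqN (chi i0 c0 - _)) opprB; lra.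
  by rewrite chi01 => h2; lra.
have := hnet (fun i c => gg (i, c)) i0 c0 g14.
apply/negP; rewrite -leNgt.
pose ev (ic : 'I_r * 'I_k) := (if (ic.2 == c0) && (i0 < ic.1)%N then 0 else (th ^+ ic.1)%:C * g ic.1 ic.2) - (th ^+ ic.1)%:C * chi ic.1 ic.2.
have ev_le ic : nsq (ev ic) <= th ^+ 2 ^+ i0.+1 + 2 / N%:R ^+ 2.
  rewrite /ev; case: ifP => [/andP[_ h]|_].
    rewrite sub0r nsqN nsqM nsqC -exprM mulnC exprM.
    apply: (@le_trans _ _ (th ^+ 2 ^+ i0.+1)); last by rewrite lerDl divr_ge0 ?sqr_ge0.
    apply: (@le_trans _ _ (th ^+ 2 ^+ ic.1)); first by rewrite ler_piMr// ltW.
    by rewrite ler_wiXn2l ?sqr_ge0// exprn_ile1// ltW.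
  rewrite -mulrBr nsqM nsqC; apply: (@le_trans _ _ (2 / N%:R ^+ 2)); last by rewrite lerDr ltW.
  apply: le_trans (hgg ic); rewrite /g -surjective_pairing ler_piMl ?nsq_ge0//.
  by rewrite !exprn_ile1 ?exprn_ge0// ltW.
have GZ i c : fr (row c G *m Z ^+ i) <= L ^+ i.+1.
  elim: i => [|i IH]; first by rewrite expr0 mulmx1 expr1 (le_trans (fr_row_le _ _)).
  rewrite exprSr -[_ ^+ i * Z]/(_ *m Z) mulmxA; apply: (le_trans (frM_le _ _)).
  by rewrite [leRHS]exprSr ler_pM ?fr_ge0.
have -> : netT Z G (fun i c => gridv (gg (i, c))) i0 c0 = Tchi + \sum_ic ev ic *: (row ic.2 G *m Z ^+ ic.1).
  rewrite /netT /Tchi -big_split /=; apply: eq_bigr => ic _.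
  by rewrite -scalerDl /ev addrC subrK.
apply: (le_trans (frD_le _ _)).
have h1 : fr (\sum_ic ev ic *: (row ic.2 G *m Z ^+ ic.1)) <=
    (r * k)%:R ^+ 2 * ((th ^+ 2 ^+ i0.+1 + 2 / N%:R ^+ 2) * L ^+ r).
  apply: (le_trans (fr_sum_le _)); rewrite card_prod !card_ord expr2 -mulrA ler_wpM2l//.
  apply: (@le_trans _ _ (\sum_(ic : 'I_r * 'I_k) (th ^+ 2 ^+ i0.+1 + 2 / N%:R ^+ 2) * L ^+ r)).
    apply: ler_sum => ic _; rewrite frZ ler_pM ?nsq_ge0 ?fr_ge0//.
    by apply: (le_trans (GZ _ _)); rewrite ler_weXn2l.
  by rewrite sumr_const card_prod !card_ord [leRHS]mulr_natl.
have h2 : th ^+ 2 ^+ r * beta <= th ^+ 2 ^+ i0 * beta.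
  have b0 : 0 <= beta.
    apply: le_trans hth; apply: mulr_ge0; last by rewrite exprn_ge0// (le_trans ler01).
    by rewrite mulr_ge0 ?sqr_ge0// mulr_ge0 ?sqr_ge0.
  have thi : th ^+ 2 <= 1 by rewrite exprn_ile1// ltW.
  by rewrite ler_wpM2r// ler_wiXn2l ?sqr_ge0// ltnW.
have h3 : 6 * ((r * k)%:R ^+ 2 * (th ^+ 2 ^+ i0.+1 * L ^+ r)) <= th ^+ 2 ^+ i0 * beta.
  have -> : 6 * ((r * k)%:R ^+ 2 * (th ^+ 2 ^+ i0.+1 * L ^+ r)) = th ^+ 2 ^+ i0 * (6 * (r * k)%:R ^+ 2 * th ^+ 2 * L ^+ r).
    by rewrite (exprSr (th ^+ 2)); move: (th ^+ 2 ^+ i0) (L ^+ r) => a b; ring.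
  by rewrite ler_wpM2l// ltW.
have h4 : 12 * (r * k)%:R ^+ 2 * L ^+ r / N%:R ^+ 2 = 6 * ((r * k)%:R ^+ 2 * (2 / N%:R ^+ 2 * L ^+ r)).
  by field; rewrite gt_eqF.
have := hN; rewrite h4; move: h1 h3; rewrite mulrDl mulrDr.
move: (th ^+ 2 ^+ i0 * beta) (th ^+ 2 ^+ r * beta) h2 hkap => a b h2 hk.
by move: (_ * (_ * L ^+ r)) (_ * (2 / _ * L ^+ r)) => x y; lra.
Qed.

End net.

(** * Probability of the Krylov condition *)

Section krylov_probability.
Context d (T : measurableType d) (R : realType) (P : probability T R).
Notation C := R[i].
Variable x : nat * nat -> {RV P >-> C}.
Hypothesis x_iid : iid x.
Local Notation mu := (distribution P (x (0%N, 0%N))).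
Variable q : R.
Hypothesis q01 : 0 < q < 1.
Hypothesis conc : forall v s, 1 <= s ->
  (\int[mu]_u (expR (- (s * nsq (u - v))))%:E <= q%:E)%E.
Variable io : nat -> nat -> nat * nat.
Hypothesis io_inj : inj2 io.
Variables (m' k r p k1 : nat).
Local Notation m := m'.+1.
Hypothesis pk1 : (p.+1 + k1 = m)%N.
Hypothesis k10 : (0 < k1)%N.

Definition Zmx (xi : cfg R) : 'M[C]_m := top io (fun=> 0) m xi.
Definition Gmx (xi : cfg R) : 'M[C]_(k, m) := \matrix_(c, j) xi (io (m + c) j).
Definition diagshift (a : C) (i : nat) : 'rV[C]_m := \row_j (a *+ (i == j)).

Lemma top_diagshift a xi : top io (diagshift a) m xi = Zmx xi - a%:M.
Proof. by apply/matrixP => i j; rewrite !mxE subr0. Qed.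

(** The distance bounds that give Z - a an approximate inverse of defect k1. Only the first p + 1
    rows take part, so that all codimensions stay at least k1. *)
Definition good_root (a : C) (xi : cfg R) :=
  [forall j : 'I_p.+1, ~~ bad_last io (diagshift a) q j (m - j) xi] &&
  [forall i : 'I_p.+1, ~~ bad_mid io (diagshift a) q i k1 xi].

Lemma measf_forall (I : finType) (b : I -> cfg R -> bool) :
  (forall i, measf (b i)) -> measf (fun xi => [forall i, b i xi]).
Proof.
move=> mb; rewrite (_ : (fun xi => _) = fun xi => all (fun i => b i xi) (enum I)).
  exact: measf_all.
apply/funext => xi; apply/forallP/allP => h i; first by move=> _; exact: h.
by apply: h; rewrite mem_enum.
Qed.

Lemma measf_good_root a : measf (good_root a).
Proof.
apply: measf_and; apply: measf_forall => i; apply: measf_neg; first exact: measf_bad_last.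
exact: measf_bad_mid.
Qed.

Lemma good_root_ainv a xi (Lb : R) : m%:R ^+ 3 / (cdist q * k1%:R ^+ 2) <= Lb ->
  good_root a xi -> has_ainv k1 Lb (Zmx xi - a%:M).
Proof.
move=> hLb /andP[/forallP h1 /forallP h2].
have pm : (p.+1 <= m)%N by rewrite -pk1 leq_addr.
have c0 := cdist_gt0 q01.
have ck : 0 < cdist q * k1%:R ^+ 2 by rewrite mulr_gt0// exprn_gt0// ltr0n.
have top0 : grm (top io (diagshift a) 0 xi) = 1 by apply: complexI; rewrite grmE gdet_nil.
have [_ g1] : grm (top io (diagshift a) 0 xi) *
    \prod_(0 <= j < p.+1) (cdist q * (m - j)%:R ^+ 2 / m%:R) <= grm (top io (diagshift a) p.+1 xi)
    /\ 0 < grm (top io (diagshift a) p.+1 xi).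
  apply: grm_chain => //; first by rewrite top0.
  by move=> j jp; exact: (h1 (Ordinal jp)).
have pidE : pid_mx p.+1 *m (Zmx xi - a%:M) = top io (diagshift a) p.+1 xi.
  rewrite -top_diagshift; apply/matrixP => i j; rewrite !mxE (bigD1 (widen_ord pm i))//=.
  rewrite big1 => [|l li]; first by rewrite !mxE eqxx ltn_ord mul1r addr0.
  rewrite !mxE; have -> : (i == l :> nat) = false; last by rewrite mul0r.
  by apply: contraNF li => /eqP il; apply/eqP/val_inj.
have b0 : 0 <= m%:R / (cdist q * k1%:R ^+ 2) by rewrite divr_ge0// ltW.
have [|S hS hd] := approx_inverse pidE g1 b0.
  move=> i; have := h2 i; rewrite /bad_mid.
  have := grm_ge0 (row' i (top io (diagshift a) p.+1 xi)); rewrite le_eqVlt => /orP[/eqP <- _|gi].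
    by rewrite mulr_ge0// ltW.
  by rewrite gi /= -ltNge => /ltW hh; rewrite mulrAC ler_pdivlMr// mulrC.
exists S; last by have := has_ainv_pid pm hd; rewrite -[in (m - p.+1)%N]pk1 addKn.
apply: (le_trans hS); apply: le_trans hLb; rewrite mulrAC ler_pM2r ?invr_gt0//.
by rewrite [m%:R ^+ 3]exprS ler_wpM2l// ler_pXn2r ?nnegrE// ler_nat.
Qed.

Lemma pr_bad_root a : (pr x (fun xi => ~~ good_root a xi) <= (2 * m%:R * rho q ^+ k1)%:E)%E.
Proof.
have /andP[r0 r1] := rho01 q01.
have pm : (p.+1 <= m)%N by rewrite -pk1 leq_addr.
have mL (i : 'I_p.+1) : measf (bad_last io (diagshift a) q i (m - i)) by exact: measf_bad_last.
have mM (i : 'I_p.+1) : measf (bad_mid io (diagshift a) q i k1) by exact: measf_bad_mid.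
pose b1 xi := has (fun i : 'I_p.+1 => bad_last io (diagshift a) q i (m - i) xi) (enum 'I_p.+1).
pose b2 xi := has (fun i : 'I_p.+1 => bad_mid io (diagshift a) q i k1 xi) (enum 'I_p.+1).
apply: (@le_trans _ _ (pr x (fun xi => b1 xi || b2 xi))).
  apply: pr_le.
  - by apply: measf_neg; exact: measf_good_root.
  - by apply: measf_or; apply: measf_has.
  move=> xi; apply: contraR; rewrite negb_or => /andP[/hasPn h1 /hasPn h2].
  by apply/andP; split; apply/forallP => i; [apply: h1|apply: h2]; rewrite mem_enum.
apply: (le_trans (pr_or _ _ _)); [exact: measf_has|exact: measf_has|].
have hsum : \sum_(i <- enum 'I_p.+1) rho q ^+ k1 <= m%:R * rho q ^+ k1.
  rewrite big_enum sumr_const card_ord -[leLHS]mulr_natl ler_wpM2r ?exprn_ge0 ?(ltW r0)//.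
  by rewrite ler_nat.
have -> : 2 * m%:R * rho q ^+ k1 = m%:R * rho q ^+ k1 + m%:R * rho q ^+ k1 by ring.
rewrite EFinD; apply: leeD.
  apply: (@le_trans _ _ (\sum_(i <- enum 'I_p.+1) rho q ^+ k1)%:E); last by rewrite lee_fin.
  apply: pr_has => // i _; apply: (pr_cond x_iid (K := coords (rowi io i))) => // xi.
  apply: (@le_trans _ _ (rho q ^+ (m - i))%:E).
    by apply: EJ_bad_last => //; rewrite subnKC// ltnW// (leq_trans (ltn_ord i)).
  rewrite lee_fin ler_wiXn2l ?(ltW r0) ?(ltW r1)// -pk1.
  by have := ltn_ord i; lia.
apply: (@le_trans _ _ (\sum_(i <- enum 'I_p.+1) rho q ^+ k1)%:E); last by rewrite lee_fin.
apply: pr_has => // i _; apply: (pr_cond x_iid (K := coords (rowi io i))) => // xi.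
by apply: EJ_bad_mid => //; rewrite -pk1 addSn.
Qed.

Variables (N : nat) (th beta Lb : R).
Hypothesis th01 : 0 < th <= 1.
Hypothesis Lb1 : 1 <= Lb.
Hypothesis hLb : m%:R ^+ 3 / (cdist q * k1%:R ^+ 2) <= Lb.
Hypothesis hbeta : 4 * beta * m%:R ^+ 2 * Lb ^+ r <= 1.
Hypothesis beta0 : 0 < beta.

(** The polynomial in Z by which row c0 of G is multiplied in [netT]. *)
Definition net_poly (g : 'I_r -> 'I_k -> C) (i0 : 'I_r) (c0 : 'I_k) : {poly C} :=
  \poly_(i < i0.+1) (if insub i is Some i' then (th ^+ i)%:C * g i' c0 else 0).

Definition net_roots g i0 c0 : seq C := sval (closed_field_poly_normal (net_poly g i0 c0)).

Lemma measf_netT (g : 'I_r -> 'I_k -> C) (i0 : 'I_r) (c0 : 'I_k) : mxmeasf (fun xi => netT th (Zmx xi) (Gmx xi) g i0 c0).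
Proof.
have mZ i : mxmeasf (fun xi => Zmx xi ^+ i).
  elim: i => [|i IH]; first exact: mxmeasf_cst.
  rewrite (_ : (fun xi => _) = fun xi => Zmx xi ^+ i *m Zmx xi); last by apply/funext => xi; rewrite exprSr.
  by apply: mxmeasfM => //; exact: mxmeasf_top.
move=> a b; rewrite (_ : (fun xi => _) = fun xi => \sum_(ic : 'I_r * 'I_k)
  (if (ic.2 == c0) && (i0 < ic.1)%N then 0 else (th ^+ ic.1)%:C * g ic.1 ic.2) * (row ic.2 (Gmx xi) *m Zmx xi ^+ ic.1) a b); last first.
  by apply/funext => xi; rewrite /netT summxE; apply: eq_bigr => ic _; rewrite mxE.
apply: cmeasf_sum => ic; apply: cmeasfM; first exact: cmeasf_cst.
apply: (mxmeasfM (A := fun xi => row ic.2 (Gmx xi)) (B := fun xi => Zmx xi ^+ ic.1)) => //.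
move=> i j; rewrite (_ : (fun xi => _) = fun xi => xi (io (m + ic.2) j)); first exact: cmeasf_coord.
by apply/funext => xi; rewrite !mxE.
Qed.

Definition bad_net g i0 c0 xi :=
  all (fun a => good_root a xi) (net_roots g i0 c0) &&
  (fr (netT th (Zmx xi) (Gmx xi) g i0 c0) <= th ^+ 2 ^+ i0 * beta).

Lemma measf_bad_net g i0 c0 : measf (bad_net g i0 c0).
Proof.
apply: measf_and; first by apply: measf_all => a; exact: measf_good_root.
by apply: measf_le; [apply: measf_fr; exact: measf_netT|exact: measf_cst].
Qed.

Lemma good_root_dep a i xi xi' : (m <= i)%N ->
  (forall e, e \notin coords (rowi io (n := m) i) -> xi' e = xi e) -> good_root a xi' = good_root a xi.
Proof.
move=> mi h; have pm : (p.+1 <= m)%N by rewrite -pk1 leq_addr.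
have tE j : (j <= m)%N -> top io (diagshift a) j xi' = top io (diagshift a) j xi.
  by move=> jm; apply: (top_dep _ io_inj _ h); exact: leq_trans mi.
rewrite /good_root; apply: (f_equal2 andb); apply: eq_forallb => j.
  have e1 := tE j (ltnW (leq_trans (ltn_ord j) pm)).
  have e2 := tE j.+1 (leq_trans (ltn_ord j) pm).
  by rewrite /bad_last e1 e2.
by rewrite /bad_mid (tE p.+1 pm).
Qed.

(** Freeze everything except row c0 of G, which meets the fixed matrix h(Z), a multiple of the
    product of the Z - a over the roots of h. If all roots are good, this product has an approximate
    inverse of defect at most r k1 and [ainv_small_ball] applies. *)
Lemma pr_bad_net g i0 c0 : 4^-1 <= nsq (g i0 c0) ->
  (pr x (bad_net g i0 c0) <= (expR 1 * q ^+ (m - r * k1))%:E)%E.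
Proof.
move=> g4; have /andP[q0 q1] := q01; have /andP[th0 th1] := th01.
apply: (pr_cond x_iid (K := coords (rowi io (n := m) (m + c0)))); first exact: measf_bad_net.
move=> xi; set K := coords _.
have dep y : (forall e, e \notin K -> y e = xi e) ->
    [/\ forall a, good_root a y = good_root a xi, Zmx y = Zmx xi &
      forall c, c != c0 -> row c (Gmx y) = row c (Gmx xi)].
  move=> hy; split.
  - by move=> a; apply: good_root_dep hy; exact: leq_addr.
  - by apply: (top_dep _ io_inj _ hy); exact: leq_addr.
  move=> c cc0; apply/rowP => j; rewrite !mxE hy//.
  by apply/mapP => -[l _ /io_inj[/addnI /val_inj h]]; rewrite h eqxx in cc0.
case: (boolP (all (fun a => good_root a xi) (net_roots g i0 c0))) => hall; last first.
  rewrite [X in (X <= _)%E](_ : _ = 0%E); last first.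
    rewrite -(EJ_cst mu K 0%E xi); apply: EJ_congr => y hy.
    have [h1 _ _] := dep y hy; rewrite /ind /bad_net (eq_all h1) (negbTE hall)//.
  by rewrite lee_fin mulr_ge0 ?expR_ge0// exprn_ge0// ltW.
set h := net_poly g i0 c0.
have hcoef i : h`_i = if (i < i0.+1)%N then (if insub i is Some i' then (th ^+ i)%:C * g i' c0 else 0) else 0.
  by rewrite coef_poly.
pose phi := (th ^+ i0)%:C * g i0 c0.
have hphi : nsq phi >= th ^+ 2 ^+ i0 / 4.
  by rewrite nsqM nsqC -exprM mulnC exprM ler_wpM2l// !exprn_ge0// ltW.
have thi : 0 < th ^+ 2 ^+ i0 by rewrite !exprn_gt0.
have phi0 : phi != 0 by rewrite -nsq_eq0 gt_eqF//; apply: lt_le_trans hphi; rewrite divr_gt0.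
have szh : size h = i0.+1.
  by apply: size_poly_eq; rewrite valK.
have lch : lead_coef h = phi by rewrite lead_coefE szh hcoef ltnSn /= valK.
have hroots : h = lead_coef h *: \prod_(a <- net_roots g i0 c0) ('X - a%:P).
  by rewrite /net_roots; case: closed_field_poly_normal.
have szr : size (net_roots g i0 c0) = i0.
  have := szh; rewrite hroots size_scale; first by rewrite size_prod_XsubC => -[].
  by rewrite lch.
pose Z := Zmx xi.
set M := foldr (fun a M => M *m (Z - a%:M)) 1%:M (net_roots g i0 c0).
have hM : has_ainv (i0 * k1) (m%:R * Lb ^+ i0) M.
  have := @has_ainv_prod R m k1 Lb Z (net_roots g i0 c0) (le_trans ler01 Lb1).
  by rewrite szr; apply => a /(allP hall); exact: good_root_ainv.
(* The contribution of the other rows of G is a frozen target for the small ball. *)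
pose u : 'rV[C]_m := - \sum_(ic : 'I_r * 'I_k | ic.2 != c0) ((th ^+ ic.1)%:C * g ic.1 ic.2)
     *: (row ic.2 (Gmx xi) *m Z ^+ ic.1).
have Lbi : 0 < Lb ^+ i0 by rewrite exprn_gt0// (lt_le_trans ltr01).
have hb : th ^+ 2 ^+ i0 * beta * m%:R * (m%:R * Lb ^+ i0) <= nsq phi.
  apply: le_trans hphi.
  have : 4 * beta * m%:R ^+ 2 * Lb ^+ i0 <= 1.
    apply: le_trans hbeta; rewrite ler_wpM2l//; last by rewrite ler_weXn2l// ltnW.
    by rewrite mulr_ge0 ?sqr_ge0// mulr_ge0// ltW.
  rewrite -(ler_pM2l thi) mulr1 ler_pdivlMr// => hh; apply: le_trans hh.
  by rewrite le_eqVlt; apply/orP; left; apply/eqP; move: (th ^+ 2 ^+ i0) (Lb ^+ i0) => a b; ring.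
have := ainv_small_ball q01 conc u xi (ltn0Sn m') (@rowi_inj m io io_inj (m + c0)) hM phi0 _ hb.
rewrite mulr_gt0 ?ltr0n// => /(_ isT) sb.
apply: (@le_trans _ _ (expR 1 * q ^+ (m - i0 * k1))%:E); last first.
  rewrite lee_fin ler_wpM2l ?expR_ge0// ler_wiXn2l ?(ltW q0) ?(ltW q1)// leq_sub2l//.
  by rewrite leq_mul2r (ltnW (ltn_ord i0)) orbT.
apply: le_trans sb; apply: EJ_le_on.
- exact: ind_ge0.
- exact: ind_ge0.
- by apply: measf_indE; exact: measf_bad_net.
- apply: measf_indE; apply: measf_le; last exact: measf_cst.
  apply: measf_fr; apply: mxmeasfB; last exact: mxmeasf_cst.
  by apply: mxmeasfM; [exact: mxmeasf_rowof|exact: mxmeasf_cst].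
move=> y hy; have [_ h2 h3] := dep y hy; rewrite /ind lee_fin ler_nat.
suff E : netT th (Zmx y) (Gmx y) g i0 c0 = rowof (rowi io (m + c0)) y *m (phi *: M) - u.
  by rewrite /bad_net -E; case: (fr _ <= _); rewrite ?andbF// andbT; case: (all _ _).
have hX i : horner_mx Z 'X^i = Z ^+ i.
  elim: i => [|i IH]; first by rewrite !expr0 rmorph1.
  by rewrite !exprS rmorphM /= horner_mx_X IH.
have MZ : phi *: M = \sum_(i < i0.+1) h`_i *: Z ^+ i.
  rewrite -lch -(horner_mx_factor Z hroots) {1}/h /net_poly poly_def linear_sum /=.
  apply: eq_bigr => i _; rewrite horner_mxZ hX.
  by rewrite hcoef ltn_ord.
have rG : row c0 (Gmx y) = rowof (rowi io (m + c0)) y by apply/rowP => j; rewrite !mxE.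
rewrite /u opprK /netT (bigID (fun ic : 'I_r * 'I_k => ic.2 == c0)) /=.
apply: (f_equal2 +%R); last first.
  by apply: eq_bigr => ic cc0; rewrite (negbTE cc0) /= h2 (h3 _ cc0).
rewrite MZ mulmx_sumr h2 -/Z -rG.
rewrite (big_ord_widen r (fun i => row c0 (Gmx y) *m (h`_i *: Z ^+ i)) (ltn_ord i0)).
rewrite [RHS]big_mkcond /=.
rewrite -(pair_big_dep predT (fun (i : 'I_r) c => c == c0) (fun i c =>
   (if (c == c0) && (i0 < i)%N then 0 else (th ^+ i)%:C * g i c) *: (row c (Gmx y) *m Z ^+ i))) /=.
apply: eq_bigr => i _; rewrite big_pred1_eq eqxx /= hcoef ltnS ltnNge; case: (i <= i0)%N => /=.
  by rewrite valK -scalemxAr.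
by rewrite scale0r.
Qed.

End krylov_probability.

Section lagrange_coefficients.
Variable R : realType.
Notation C := R[i].

Lemma nsqD_le (a b : C) : nsq (a + b) <= 2 * (nsq a + nsq b).
Proof. by have := nsq_sub_le a (- b) 0; rewrite opprK !subr0 nsqN; lra. Qed.

Lemma coef_prod_XsubC_le (s : seq C) i : (forall a, a \in s -> nsq a <= 1) ->
  nsq (\prod_(a <- s) ('X - a%:P))`_i <= 4 ^+ size s.
Proof.
elim: s i => [|a s IH] i hs; first by rewrite big_nil coefC; case: eqP; rewrite ?nsq1 ?nsq0.
rewrite big_cons mulrBl coefB coefXM coefCM /= exprS.
have a1 : nsq a <= 1 by apply: hs; rewrite inE eqxx.
have hs' b : b \in s -> nsq b <= 1 by move=> bs; apply: hs; rewrite inE bs orbT.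
have {}IH j := IH j hs'.
set Q := \prod_(_ <- s) _ in IH *.
apply: (le_trans (nsqD_le _ _)); rewrite nsqN nsqM.
have h1 : nsq (if i == 0%N then 0 else Q`_i.-1) <= 4 ^+ size s.
  by case: eqP => _; rewrite ?nsq0 ?exprn_ge0.
have h2 : nsq a * nsq Q`_i <= 4 ^+ size s.
  by apply: le_trans (IH i); rewrite ler_piMl ?nsq_ge0.
lra.
Qed.

Variables (r : nat) (w : 'I_r -> C) (gap : R).
Hypothesis w1 : forall l, nsq (w l) <= 1.
Hypothesis gap01 : 0 < gap <= 1.
Hypothesis wgap : forall j l, j != l -> gap <= nsq (w j - w l).

Lemma annihilator : exists d : nat -> C,
  [/\ d r = 1, forall p, nsq (d p) <= 4 ^+ r & forall l, \sum_(p < r.+1) d p * w l ^+ p = 0].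
Proof.
pose D := \prod_(a <- [seq w l | l <- enum 'I_r]) ('X - a%:P).
have szD : size D = r.+1 by rewrite size_prod_XsubC size_map size_enum_ord.
exists (fun p => D`_p); split.
- have : lead_coef D = 1 by apply/monicP; exact: monic_prod_XsubC.
  by rewrite lead_coefE szD.
- move=> p; have := @coef_prod_XsubC_le [seq w l | l <- enum 'I_r] p.
  by rewrite size_map size_enum_ord; apply => a /mapP[l _ ->].
move=> l; have -> : \sum_(p < r.+1) D`_p * w l ^+ p = D.[w l].
  by rewrite horner_coef szD.
apply/eqP; rewrite -/(root D (w l)) root_prod_XsubC; apply/mapP; exists l => //.
by rewrite mem_enum.
Qed.

(** Coefficients of the Lagrange basis polynomials at the points w; the gap bounds their
    denominators from below. *)
Lemma inverse_vandermonde : exists ell : 'I_r -> 'I_r -> C,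
  (forall j p, nsq (ell j p) <= (4 / gap) ^+ r) /\
  forall j l, \sum_(p < r) ell j p * w l ^+ p = (j == l)%:R.
Proof.
have /andP[g0 g1] := gap01.
pose s j := [seq w l | l <- enum 'I_r & l != j].
pose Q j := \prod_(a <- s j) ('X - a%:P).
pose c j := (Q j).[w j].
have szs j : (size (s j)).+1 = r.
  rewrite size_map size_filter; have := count_predC (pred1 j) (enum 'I_r).
  by rewrite size_enum_ord (count_uniq_mem _ (enum_uniq _)) mem_enum add1n.
have szQ j : size (Q j) = r by rewrite size_prod_XsubC szs.
have cE j : c j = \prod_(l <- enum 'I_r | l != j) (w j - w l).
  rewrite /c /Q /s big_map big_filter horner_prod; apply: eq_bigr => l _.
  by rewrite hornerXsubC.
have c_ge j : gap ^+ r <= nsq (c j).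
  rewrite cE nsq_prod -[X in _ ^+ X](size_enum_ord r) -[leLHS]mulr1.
  elim: (enum 'I_r) => [|l e IH]; first by rewrite big_nil mul1r.
  rewrite big_cons /= exprS -mulrA; case: eqP => /= [_|/eqP lj].
    by apply: le_trans IH; rewrite ler_piMl// mulr1 exprn_ge0// ltW.
  by rewrite ler_pM ?(ltW g0)// ?mulr1 ?exprn_ge0 ?(ltW g0)// ?wgap 1?eq_sym// -[_ ^+ _]mulr1.
have c0 j : c j != 0.
  by rewrite -nsq_eq0 gt_eqF// (lt_le_trans _ (c_ge j))// exprn_gt0.
exists (fun j p => (Q j)`_p / c j); split => [j p|j l].
  rewrite nsqM exprMn exprVn; have -> : nsq (c j)^-1 = (nsq (c j))^-1.
    have := nsqM (c j) (c j)^-1; rewrite mulfV// nsq1 => h.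
    by apply: (mulfI (x := nsq (c j))); rewrite ?nsq_eq0// -h mulfV// nsq_eq0.
  have h1 : nsq (Q j)`_p <= 4 ^+ r.
    apply: le_trans (coef_prod_XsubC_le p _) _; first by move=> a /mapP[l _ ->].
    by rewrite ler_weXn2l// ?ler1n// -[r in (_ <= r)%N](szs j) leqnSn.
  rewrite ler_pM ?nsq_ge0 ?invr_ge0 ?nsq_ge0//.
  by rewrite lef_pV2 ?posrE ?exprn_gt0// (lt_le_trans _ (c_ge j))// exprn_gt0.
have -> : \sum_(p < r) (Q j)`_p / c j * w l ^+ p = (Q j).[w l] / c j.
  by rewrite horner_coef szQ mulr_suml; apply: eq_bigr => p _; rewrite mulrAC.
case: (eqVneq j l) => [<-|jl]; first by rewrite -/(c j) mulfV.
have /eqP -> : root (Q j) (w l).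
  rewrite root_prod_XsubC; apply/mapP; exists l => //.
  by rewrite mem_filter mem_enum andbT eq_sym.
by rewrite mul0r.
Qed.

End lagrange_coefficients.

Section kernels_of_shifts.
Variable R : realType.
Notation C := R[i].
Variables (m' k r : nat) (iota : nat -> nat -> nat * nat).
Local Notation m := m'.+1.
Local Notation n := (m'.+1 + k)%N.
Variables (w : 'I_r -> C) (gap L kap : R).
Hypothesis w1 : forall l, nsq (w l) <= 1.
Hypothesis gap01 : 0 < gap <= 1.
Hypothesis wgap : forall j l, j != l -> gap <= nsq (w j - w l).
Hypothesis L1 : 1 <= L.
Hypothesis kap0 : 0 < kap.

Local Notation s := ((Num.sqrt (n%:R : R))%:C : C).
(** Kernel vectors are treated as rows, so Z and G are transposes: Z of the square block of the
    first m rows, G of their last k columns. *)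
Definition iotaT (i j : nat) := iota j i.
Definition shiftrow (a : C) (i : nat) : 'rV[C]_n := \row_j (a *+ (i == j)).
Definition wshift (l : 'I_r) := shiftrow (s * w l).
Local Notation topl l := (top iota (wshift l)).
Local Notation Z := (Zmx iotaT m').
Local Notation G := (Gmx iotaT m' k).

Definition ri_const : R :=
  2 * r%:R ^+ 3 * (4 / gap) ^+ r * (4 * L) ^+ r *
    (1 + (4 * r%:R ^+ 2 * 4 ^+ r) ^+ r * k%:R * (4 * L * 4 ^+ r) ^+ r / (kap / n%:R ^+ r)).

(** A conjugated kernel row, cut into its first m and last k coordinates, is a pair (B, F) as in
    [kernels_independent]. Dividing Z and G by sqrt n makes the shifts the w_l themselves and costs
    at most n^r in the Krylov constant. *)
Lemma independent_kernels_shifts xi : fr (Z xi) <= L -> fr (G xi) <= L ->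
  (forall (psi : 'I_r -> 'rV[C]_k) i c,
    kap * nsq (psi i 0 c) <= fr (\sum_(i < r) psi i *m G xi *m Z xi ^+ i)) ->
  forall a : 'I_r -> 'rV[C]_n, (forall l, a l *m (topl l m xi)^t* = 0) ->
   \sum_l fr (a l) <= ri_const * fr (\sum_l a l).
Proof.
move=> ZL GL kry a ha.
have [d [dr dLd dw]] := annihilator w1.
have [ell [ellL ellw]] := inverse_vandermonde w1 gap01 wgap.
have n1 : 1 <= n%:R :> R by rewrite -[1]/(1%:R) ler_nat.
have n0 : 0 < n%:R :> R by exact: lt_le_trans n1.
have s0 : s != 0 by rewrite eq_complex /= eqxx andbT gt_eqF// sqrtr_gt0.
have nsqs : nsq s^-1 = n%:R^-1 by rewrite -fmorphV nsqC exprVn sqr_sqrtr// ltW.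
pose Z1 := s^-1 *: Z xi; pose G1 := s^-1 *: G xi.
have si1 : nsq s^-1 <= 1 by rewrite nsqs invf_le1.
have Z1L : fr Z1 <= L by rewrite frZ; apply: le_trans ZL; rewrite ler_piMl ?fr_ge0.
have G1L : fr G1 <= L by rewrite frZ; apply: le_trans GL; rewrite ler_piMl ?fr_ge0.
pose B l : 'rV[C]_m := \row_j (a l 0 (lshift k j))^*.
pose F l : 'rV[C]_k := \row_c (a l 0 (rshift m c))^*.
have BF l : B l *m (Z1 - (w l)%:M) + F l *m G1 = 0.
  apply/rowP => i; have /matrixP/(_ 0 i) := ha l; rewrite mxE [RHS]mxE => /(congr1 (fun z => z^*)).
  rewrite rmorph0 rmorph_sum /= => h.
  rewrite mulmxBr mul_mx_scalar !mxE.
  apply: (mulfI s0); rewrite mulr0 -[RHS]h big_split_ord /= mulrDr; congr (_ + _); last first.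
    rewrite mulr_sumr; apply: eq_bigr => c _; rewrite !mxE rmorphM /= conjCK.
    rewrite mulrCA mulVKf//; congr (_ * _); rewrite /iotaT /=.
    have -> : (i == m + c :> nat) = false by apply/eqP => hic; have := ltn_ord i; rewrite hic ltnNge leq_addr.
    by rewrite mulr0n subr0.
  rewrite mulrBr mulr_sumr; transitivity (\sum_j (a l 0 (lshift k j))^* * (xi (iota i j) - (s * w l) *+ (i == j))); last first.
    by apply: eq_bigr => j _; rewrite !mxE rmorphM /= conjCK.
  under [RHS]eq_bigr do rewrite mulrBr; rewrite sumrB; congr (_ - _).
    by apply: eq_bigr => j _; rewrite !mxE subr0 mulrCA mulVKf.
  rewrite (bigD1 i)//= eqxx big1 ?addr0 => [|j ji].
    by rewrite mulr1n mulrA mulrC.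
  case: eqP => [ij|_]; last by rewrite mulr0n mulr0.
  by move: ji; rewrite -(inj_eq val_inj) /= -ij eqxx.
have kap1 : 0 < kap / n%:R ^+ r by rewrite divr_gt0// exprn_gt0.
have kry1 (psi : 'I_r -> 'rV[C]_k) i c :
    kap / n%:R ^+ r * nsq (psi i 0 c) <= fr (\sum_(i < r) psi i *m G1 *m Z1 ^+ i).
  have -> : \sum_(i < r) psi i *m G1 *m Z1 ^+ i =
      \sum_(i < r) (s^-1 ^+ i.+1 *: psi i) *m G xi *m Z xi ^+ i.
    apply: eq_bigr => j _; rewrite /G1 /Z1 exprZn -!scalemxAr -!scalemxAl scalerA.
    by rewrite -exprSr.
  apply: le_trans (kry _ i c); rewrite mxE nsqM nsqX nsqs -mulrA ler_wpM2l ?(ltW kap0)//.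
  rewrite ler_wpM2r ?nsq_ge0// -exprVn ler_wiXn2l ?invr_ge0 ?(ltW n0)//.
  by rewrite invf_le1.
have Ld1 : 1 <= 4 ^+ r :> R by rewrite exprn_ege1// ler1n.
have fra (b : 'rV[C]_n) : fr b = fr (\row_j (b 0 (lshift k j))^* : 'rV_m) + fr (\row_c (b 0 (rshift m c))^* : 'rV_k).
  rewrite !fr_row big_split_ord /=; congr (_ + _); apply: eq_bigr => j _.
    by rewrite mxE conjcE nsqJ.
  by rewrite mxE conjcE nsqJ.
have := kernels_independent L1 Z1L G1L Ld1 kap1 dLd dr dw ellL ellw kry1 BF.
rewrite (eq_bigr (fun l => fr (a l))) => [|l _]; last by rewrite [RHS]fra.
move=> h; apply: (le_trans h); rewrite -/ri_const; apply: ler_wpM2l.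
  rewrite /ri_const; have g0 : 0 <= 4 / gap by case/andP: gap01 => ? _; rewrite divr_ge0// ltW.
  have L0 : 0 <= L by exact: le_trans L1.
  have p1 : 0 <= 4 * L by rewrite mulr_ge0.
  have p2 : 0 <= 4 * r%:R ^+ 2 * 4 ^+ r :> R by rewrite mulr_ge0 ?exprn_ge0// mulr_ge0 ?exprn_ge0.
  have p3 : 0 <= 4 * L * 4 ^+ r by rewrite mulr_ge0// exprn_ge0.
  apply: mulr_ge0.
    apply: mulr_ge0; last exact: exprn_ge0.
    by apply: mulr_ge0; [rewrite mulr_ge0// exprn_ge0|exact: exprn_ge0].
  apply: addr_ge0 => //; apply: divr_ge0; last exact: ltW.
  by apply: mulr_ge0; [apply: mulr_ge0 => //; exact: exprn_ge0|exact: exprn_ge0].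
rewrite [leRHS]fra -[leLHS]addr0 lerD ?fr_ge0// le_eqVlt; apply/orP; left; apply/eqP.
congr fr; apply/rowP => j; rewrite !summxE mxE summxE rmorph_sum; apply: eq_bigr => l _.
by rewrite mxE.
Qed.

End kernels_of_shifts.

(** * All points fail only rarely *)

Section last_rows.
Context d (T : measurableType d) (R : realType) (P : probability T R).
Notation C := R[i].
Variable x : nat * nat -> {RV P >-> C}.
Hypothesis x_iid : iid x.
Local Notation mu := (distribution P (x (0%N, 0%N))).
Variable q : R.
Hypothesis q01 : 0 < q < 1.
Hypothesis conc : forall v s, 1 <= s ->
  (\int[mu]_u (expR (- (s * nsq (u - v))))%:E <= q%:E)%E.
Variable iota : nat -> nat -> nat * nat.
Hypothesis iota_inj : inj2 iota.
Variables (m' k r p k1 N : nat).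
Local Notation m := m'.+1.
Local Notation n := (m'.+1 + k)%N.
Hypothesis pk1 : (p.+1 + k1)%N = m.
Hypothesis k10 : (0 < k1)%N.
Variables (w : 'I_r -> C) (gap L kap th beta Lb s2 t2 v : R).
Hypothesis w1 : forall l, nsq (w l) <= 1.
Hypothesis gap01 : 0 < gap <= 1.
Hypothesis wgap : forall j l, j != l -> gap <= nsq (w j - w l).
Hypothesis L1 : 1 <= L.
Hypothesis kap0 : 0 < kap.
Hypothesis th01 : 0 < th <= 1.
Hypothesis N3 : (2 < N)%N.
Hypothesis hkap : 6 * kap <= th ^+ 2 ^+ r * beta.
Hypothesis hth : 6 * (r * k)%:R ^+ 2 * th ^+ 2 * L ^+ r <= beta.
Hypothesis hN : 12 * (r * k)%:R ^+ 2 * L ^+ r / N%:R ^+ 2 <= th ^+ 2 ^+ r * beta.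
Hypothesis Lb1 : 1 <= Lb.
Hypothesis hLb : m%:R ^+ 3 / (cdist q * k1%:R ^+ 2) <= Lb.
Hypothesis hbeta : 4 * beta * m%:R ^+ 2 * Lb ^+ r <= 1.
Hypothesis beta0 : 0 < beta.
Hypothesis s20 : 0 < s2.
Hypothesis hs2 : s2 * ri_const m' k r gap L kap <= 1.
Hypothesis t20 : 0 < t2.
Hypothesis st : n%:R * t2 <= s2 * (- ln q / 2).
Hypothesis v0 : 0 < v.

Local Notation io := (iotaT iota).
Local Notation topl l := (top iota (wshift m' k w l)).
Local Notation Z := (Zmx io m').
Local Notation G := (Gmx io m' k).

Lemma iotaT_inj : inj2 io.
Proof. by move=> i j i' j' /iota_inj[]. Qed.

Definition gridfun (g : {ffun 'I_r * 'I_k -> 'I_(N + N).+1 * 'I_(N + N).+1}) (i : 'I_r) (c : 'I_k) : C :=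
  gridv R (g (i, c)).

Definition net_fails (g : {ffun 'I_r * 'I_k -> 'I_(N + N).+1 * 'I_(N + N).+1}) (ic : 'I_r * 'I_k) (xi : cfg R) :=
  (4^-1 <= nsq (gridv R (g ic))) &&
  (has (fun a => ~~ good_root q io m' p k1 a xi) (net_roots th (gridfun g) ic.1 ic.2) ||
   bad_net q io m' p k1 th beta (gridfun g) ic.1 ic.2 xi).

Definition net_good (xi : cfg R) := [forall gic, ~~ net_fails gic.1 gic.2 xi].

(** Everything asked of the first m rows before the last k rows are exposed one at a time; [gd_dep]
    records that later rows do not affect it. *)
Definition gd (xi : cfg R) := [&& fr (Z xi) <= L, fr (G xi) <= L, net_good xi &
  [forall l, v <= grm (topl l m xi)]].

Lemma measf_net_fails g ic : measf (net_fails g ic).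
Proof.
apply: measf_and; first exact: measf_cst.
apply: measf_or; last exact: measf_bad_net.
by apply: measf_has => a; apply: measf_neg; exact: measf_good_root.
Qed.

Lemma measf_net_good : measf net_good.
Proof. by apply: measf_forall => gic; apply: measf_neg; exact: measf_net_fails. Qed.

Lemma mxmeasf_Gmx : mxmeasf (fun xi : cfg R => G xi).
Proof.
move=> i j; rewrite (_ : (fun xi => _) = fun xi => xi (io (m + i) j)); first exact: cmeasf_coord.
by apply/funext => xi; rewrite mxE.
Qed.

Lemma measf_gd : measf gd.
Proof.
apply: measf_and.
  by apply: measf_le; [apply: measf_fr; exact: mxmeasf_top|exact: measf_cst].
apply: measf_and.
  by apply: measf_le; [apply: measf_fr; exact: mxmeasf_Gmx|exact: measf_cst].
apply: measf_and; first exact: measf_net_good.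
apply: measf_forall => l; apply: measf_le; first exact: measf_cst.
by apply: measf_grm; exact: mxmeasf_top.
Qed.

Lemma gd_krylov xi : gd xi -> forall (psi : 'I_r -> 'rV[C]_k) i c,
  kap * nsq (psi i 0 c) <= fr (\sum_(i < r) psi i *m G xi *m Z xi ^+ i).
Proof.
move=> /and4P[h1 h2 /forallP h3 _].
apply: (krylov_of_net th01 L1 N3 kap0 hkap hth hN h1 h2) => g i0 c0 g4.
have := h3 ([ffun ic => g ic.1 ic.2], (i0, c0)); rewrite /net_fails /= ffunE /= g4 /=.
rewrite negb_or => /andP[/hasPn hr].
have -> : gridfun [ffun ic => g ic.1 ic.2] = fun i c => gridv R (g i c).
  by apply/funext => i; apply/funext => c; rewrite /gridfun ffunE.
rewrite /bad_net negb_and => /orP[/allPn[a ar]|]; last by rewrite -ltNge.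
move=> hb; have := hr a; rewrite negbK => hr'; exfalso; move/negP: hb; apply; apply: hr'.
rewrite (_ : gridfun _ = fun i c => gridv R (g i c))//.
by apply/funext => i; apply/funext => c; rewrite /gridfun ffunE.
Qed.

Lemma gd_ik xi : gd xi -> independent_kernels iota (fun l => wshift m' k w l) m s2 xi.
Proof.
move=> h a ha; have h' := h; have {h'} /and4P[h1 h2 _ _] := h'.
have := independent_kernels_shifts w1 gap01 wgap L1 kap0 h1 h2 (gd_krylov h) ha.
move=> hh; apply: (le_trans (ler_wpM2l (ltW s20) hh)); rewrite mulrA ler_piMl ?fr_ge0//.
Qed.

Lemma gd_gt0 xi : gd xi -> forall l, 0 < grm (topl l m xi).
Proof. by move=> /and4P[_ _ _ /forallP h] l; exact: lt_le_trans (h l). Qed.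

Lemma gd_dep i xi xi' : (m <= i)%N ->
  (forall e, e \notin coords (rowi iota (n := n) i) -> xi' e = xi e) -> gd xi' = gd xi.
Proof.
move=> mi h.
have hx a b : (a < m)%N -> xi' (iota a b) = xi (iota a b).
  move=> am; apply: h; apply/mapP => -[l _ /iota_inj[ai _]].
  by move: am; rewrite ai ltnNge mi.
have tZ a c : top io (diagshift m' a) c xi' = top io (diagshift m' a) c xi.
  by apply/matrixP => i' j'; rewrite !mxE /rowi /iotaT hx.
have ZE : Z xi' = Z xi by apply/matrixP => i' j'; rewrite !mxE /rowi /iotaT hx.
have GE : G xi' = G xi by apply/matrixP => i' j'; rewrite !mxE /iotaT hx.
have gE a : good_root q io m' p k1 a xi' = good_root q io m' p k1 a xi.
  rewrite /good_root; apply: (f_equal2 andb); apply: eq_forallb => j.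
    by rewrite /bad_last !tZ.
  by rewrite /bad_mid !tZ.
have nE g ic : net_fails g ic xi' = net_fails g ic xi.
  rewrite /net_fails; apply: (congr1 (andb _)); apply: (f_equal2 orb).
    by apply: eq_has => a /=; rewrite gE.
  rewrite /bad_net; apply: (f_equal2 andb); first by apply: eq_all => a /=; exact: gE.
  by rewrite ZE GE.
rewrite /gd ZE GE; apply: (congr1 (andb _)); apply: (congr1 (andb _)); apply: (f_equal2 andb).
  by apply: eq_forallb => gic; rewrite nE.
apply: eq_forallb => l; have -> // : topl l m xi' = topl l m xi.
exact: (top_dep _ iota_inj mi h).
Qed.

Lemma size_net_roots (g : 'I_r -> 'I_k -> C) (i0 : 'I_r) (c0 : 'I_k) : g i0 c0 != 0 ->
  (size (net_roots th g i0 c0) <= r)%N.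
Proof.
move=> g0; have /andP[th0 _] := th01; rewrite /net_roots; case: closed_field_poly_normal => s /= hs.
have szh : size (net_poly th g i0 c0) = i0.+1.
  apply: size_poly_eq; rewrite valK mulf_neq0// eq_complex /= eqxx andbT expf_neq0// gt_eqF//.
have : size (net_poly th g i0 c0) = (size s).+1.
  rewrite hs size_scale ?size_prod_XsubC// lead_coef_eq0 -size_poly_eq0 szh//.
by rewrite szh => -[<-]; exact: ltnW.
Qed.

(** Either one of at most r roots is not good, or all are good and the net vector is short
    nevertheless. *)
Lemma pr_net_fails g ic :
  (pr x (net_fails g ic) <= (r%:R * (2 * m%:R * rho q ^+ k1) + expR 1 * q ^+ (m - r * k1))%:E)%E.
Proof.
have /andP[r0 r1] := rho01 q01; have /andP[q0 q1] := q01.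
have b0 : 0 <= 2 * m%:R * rho q ^+ k1 by rewrite mulr_ge0// exprn_ge0// ltW.
case: (boolP (4^-1 <= nsq (gridv R (g ic)))) => g4; last first.
  rewrite /pr (_ : ind _ = fun=> 0%E); last first.
    by apply/funext => xi; rewrite /ind /net_fails (negbTE g4).
  by rewrite ex_cst lee_fin addr_ge0 ?mulr_ge0 ?expR_ge0// exprn_ge0// ltW.
apply: (@le_trans _ _ (pr x (fun xi => has (fun a => ~~ good_root q io m' p k1 a xi) (net_roots th (gridfun g) ic.1 ic.2) ||
   bad_net q io m' p k1 th beta (gridfun g) ic.1 ic.2 xi))).
  apply: pr_le; first exact: measf_net_fails.
    apply: measf_or; last exact: measf_bad_net.
    by apply: measf_has => a; apply: measf_neg; exact: measf_good_root.
  by move=> xi /andP[].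
apply: (le_trans (pr_or _ _ _)).
- by apply: measf_has => a; apply: measf_neg; exact: measf_good_root.
- exact: measf_bad_net.
have g4' : 4^-1 <= nsq (gridfun g ic.1 ic.2) by rewrite /gridfun -surjective_pairing.
rewrite EFinD; apply: leeD; last first.
  by apply: (pr_bad_net x_iid q01 conc iotaT_inj pk1 k10 th01 Lb1 hLb hbeta beta0 g4').
apply: (@le_trans _ _ (\sum_(a <- net_roots th (gridfun g) ic.1 ic.2) (2 * m%:R * rho q ^+ k1))%:E).
  apply: pr_has => a; first by apply: measf_neg; exact: measf_good_root.
  by move=> _; exact: (pr_bad_root x_iid q01 conc iotaT_inj pk1).
rewrite lee_fin big_const_seq count_predT iter_addr_0 -[leLHS]mulr_natl ler_wpM2r//.
rewrite ler_nat; apply: size_net_roots; rewrite -nsq_eq0 gt_eqF//.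
by apply: lt_le_trans g4'; rewrite invr_gt0.
Qed.

Lemma pr_net_bad : (pr x (fun xi => ~~ net_good xi) <=
  ((N + N).+1%:R ^+ (2 * (r * k)) * (r * k)%:R *
   (r%:R * (2 * m%:R * rho q ^+ k1) + expR 1 * q ^+ (m - r * k1)))%:E)%E.
Proof.
pose I : finType := ({ffun 'I_r * 'I_k -> 'I_(N + N).+1 * 'I_(N + N).+1} * ('I_r * 'I_k))%type.
apply: (@le_trans _ _ (pr x (fun xi => has (fun gic : I => net_fails gic.1 gic.2 xi) (enum {: I})))).
  apply: pr_le.
  - by apply: measf_neg; exact: measf_net_good.
  - by apply: measf_has => gic; exact: measf_net_fails.
  move=> xi; apply: contraR => /hasPn h; apply/forallP => gic; apply: h.
  by rewrite mem_enum.
set c := _ + _; apply: (@le_trans _ _ (\sum_(gic <- enum {: I}) c)%:E).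
  by apply: pr_has => [gic|gic _]; [exact: measf_net_fails|exact: pr_net_fails].
rewrite big_enum sumr_const !card_prod card_ffun !card_prod !card_ord.
rewrite -[X in (X%:E <= _)%E]mulr_natl natrM natrX natrM -expr2 -exprM.
by [].
Qed.

Lemma pr_all_dead : (pr x (fun xi => gd xi && [forall l, ~~ alive iota (fun l => wshift m' k w l) m t2 l n xi])
  <= ((theta n q k) ^+ r)%:E)%E.
Proof.
have mal l : measf (alive iota (fun l => wshift m' k w l) m t2 l n) by exact: measf_alive.
set K := lastrows n iota m k.
apply: (pr_cond x_iid (K := K)).
  by apply: measf_and; [exact: measf_gd|apply: measf_forall => l; exact: measf_neg].
move=> xi; have /andP[t0 t1] := theta01 n q01 k.
have := EJ_all_dead iota_inj q01 conc s20 t20 st measf_gd gd_dep gd_ik gd_gt0 xi (leqnn m) (erefl n).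
move=> h; apply: (@le_trans _ _ ((gd xi)%:R * survive iota (fun l => wshift m' k w l) m t2 (theta n q k) xi m)%:E); last first.
  rewrite lee_fin /survive (eq_bigr (fun=> theta n q k)) => [|l _].
    by rewrite prodr_const card_ord ler_piMl ?exprn_ge0//; case: (gd xi).
  rewrite (_ : alive _ _ _ _ _ _ _ = true)//.
  by apply/forallP => j; apply/implyP; rewrite leqNgt ltn_ord.
apply: le_trans h; apply: EJ_le.
- exact: ind_ge0.
- by apply: measf_indE; apply: measf_and; [exact: measf_gd|apply: measf_forall => l; exact: measf_neg].
- by apply: measf_EFin; apply: measfM; [exact: measf_ind measf_gd|exact: measf_survive].
move=> y; rewrite /ind lee_fin; case: (gd y) => /=; last by rewrite mul0r.
rewrite mul1r /survive; case: (boolP [forall l, _]) => [/forallP hl|_].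
  by rewrite big1// => l _; rewrite (negbTE (hl l)).
by apply: prodr_ge0 => l _; case: ifP.
Qed.

(** Under [gd], a point alive to the end has squared volume at least t2^k v; so the event forces all
    points to be dead or [gd] to fail. *)
Lemma pr_last_rows : (pr x (fun xi => [forall l, (grm (topl l n xi) < t2 ^+ k * v)%R]) <=
  pr x (fun xi => ~~ gd xi) + ((theta n q k) ^+ r)%:E)%E.
Proof.
have mal l : measf (alive iota (fun l => wshift m' k w l) m t2 l n) by exact: measf_alive.
apply: le_trans (leeD (lexx _) pr_all_dead).
have m1 : measf (fun xi => ~~ gd xi) by apply: measf_neg; exact: measf_gd.
have m2 : measf (fun xi => gd xi && [forall l, ~~ alive iota (fun l => wshift m' k w l) m t2 l n xi]).
  by apply: measf_and; [exact: measf_gd|apply: measf_forall => l; exact: measf_neg].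
apply: le_trans (pr_or _ _ _) => //.
apply: pr_le => //.
- apply: measf_forall => l; apply: measf_lt; last exact: measf_cst.
  by apply: measf_grm; exact: mxmeasf_top.
- exact: measf_or.
move=> xi /forallP h; case: (boolP (gd xi)) => //= g; apply/forallP => l; apply/negP => al.
have := alive_grm t20 (leq_addr k m) al; rewrite addKn leNgt => /negP; apply.
apply: (lt_le_trans (h l)); rewrite ler_wpM2l ?exprn_ge0 ?(ltW t20)//.
by move: g => /and4P[_ _ _ /forallP].
Qed.

End last_rows.

Section gram_row_mx.
Variable R : realType.
Notation C := R[i].

Lemma fr_row_mx m p1 p2 (A : 'M[C]_(m, p1)) (B : 'M[C]_(m, p2)) : fr (row_mx A B) = fr A + fr B.
Proof.
rewrite /fr -big_split /=; apply: eq_bigr => i _; rewrite big_split_ord /=.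
by congr (_ + _); apply: eq_bigr => j _; rewrite ?row_mxEl ?row_mxEr.
Qed.

(** Extra columns can only lengthen the component of each row orthogonal to the previous ones. *)
Lemma grm_row_mx m p1 p2 (A : 'M[C]_(m, p1)) (B : 'M[C]_(m, p2)) : grm A <= grm (row_mx A B).
Proof.
elim: m A B => [|m IH] A B; first by rewrite /grm !gdet_nil.
rewrite (grm_row A ord_max) (grm_row (row_mx A B) ord_max).
have rE : row' ord_max (row_mx A B) = row_mx (row' ord_max A) (row' ord_max B).
  by apply/matrixP => i j; rewrite !mxE; case: splitP => k _; rewrite !mxE.
rewrite rE; apply: ler_pM; rewrite ?grm_ge0 ?fr_ge0 ?IH//.
set A' := row' ord_max A; set B' := row' ord_max B.
rewrite row_row_mx; set a := row ord_max A; set b := row ord_max B.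
have /submxP[y hy] := pspan_sub (row_mx A' B') (row_mx a b).
have -> : row_mx a b *m pcompl (row_mx A' B') = row_mx (a - y *m A') (b - y *m B').
  rewrite /pcompl mulmxBr mulmx1 hy mul_mx_row opp_row_mx add_row_mx.
  by [].
rewrite fr_row_mx; apply: (@le_trans _ _ (fr (a - y *m A'))); last by rewrite lerDl fr_ge0.
have -> : a *m pcompl A' = (a - y *m A') *m pcompl A'.
  by rewrite mulmxBl -mulmxA (pcompl_sub0 (submx_refl A')) mulmx0 subr0.
by rewrite -lecR !frE; apply: frob_proj_le; exact: pcompl_proj.
Qed.

End gram_row_mx.

(** * Stirling bounds for the second moment *)

Section stirling.
Variable R : realType.
Implicit Types n k : nat.

Lemma expR1_pow_ge n : expR 1 <= (1 + n.+1%:R^-1) ^+ n.+2 :> R.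
Proof.
have n0 : 0 < n.+1%:R :> R by [].
have h : expR (n.+2%:R^-1) <= 1 + n.+1%:R^-1 :> R.
  have := @expR_ge1Dx R (- n.+2%:R^-1); rewrite expRN => h.
  have e : 1 - n.+2%:R^-1 = (1 + n.+1%:R^-1)^-1 :> R.
    rewrite -[n.+2%:R]natr1; move: n.+1%:R n0 => a n0.
    have a1 : a + 1 != 0 by rewrite gt_eqF// addr_gt0.
    have -> : 1 + a^-1 = (a + 1) / a by rewrite mulrDl mul1r mulfV// gt_eqF.
    rewrite invf_div; apply: (mulIf a1); rewrite mulrBl mul1r mulVf// addrK divfK//.
  by rewrite e lef_pV2 ?posrE ?expR_gt0 ?addr_gt0 ?invr_gt0 in h.
rewrite -[X in expR X](mulVf (_ : n.+2%:R != 0 :> R)) ?pnatr_eq0// expRM_natr.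
by rewrite ler_pXn2r ?nnegrE ?expR_ge0 ?addr_ge0 ?invr_ge0.
Qed.

Lemma fact_ge n : (n%:R ^+ n) <= n`!%:R * expR n%:R :> R.
Proof.
case: n => [|n]; first by rewrite expr0 fact0 expR0 mulr1.
have := @expR_ge1Dxn R n.+1%:R n (ler0n _ _); rewrite /exp_coeff => h.
have f0 : 0 < (n.+1)`!%:R :> R by rewrite ltr0n fact_gt0.
rewrite mulrC -ler_pdivrMr//; apply: le_trans h; rewrite lerDr//.
Qed.

Lemma fact_le n : (0 < n)%N -> n`!%:R * expR n%:R <= expR 1 * n%:R ^+ n.+1 :> R.
Proof.
elim: n => [//|[|n] IH] _; first by rewrite mul1r expr1n mulr1.
have IH1 := IH isT.
have hx : expR n.+2%:R = expR n.+1%:R * expR 1 :> R by rewrite -expRD natr1.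
have key : expR 1 * n.+1%:R ^+ n.+2 <= n.+2%:R ^+ n.+2 :> R.
  have -> : n.+2%:R = n.+1%:R * (1 + n.+1%:R^-1) :> R by rewrite mulrDr mulr1 mulfV ?pnatr_eq0// natr1.
  by rewrite exprMn mulrC ler_wpM2l ?exprn_ge0// expR1_pow_ge.
rewrite factS natrM hx exprS.
apply: (@le_trans _ _ (n.+2%:R * expR 1 * ((n.+1)`!%:R * expR n.+1%:R))).
  by rewrite le_eqVlt; apply/orP; left; apply/eqP; ring.
apply: (@le_trans _ _ (n.+2%:R * expR 1 * (expR 1 * n.+1%:R ^+ n.+2))).
  by rewrite ler_wpM2l// mulr_ge0 ?expR_ge0.
rewrite [expR 1 * (n.+2%:R * _)]mulrCA -mulrA ler_wpM2l//.
by rewrite ler_wpM2l ?expR_ge0.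
Qed.

Lemma tmom_term (S : R) n k : (k <= n)%N ->
  'C(n, k)%:R * S ^+ k * (n - k)`!%:R = n`!%:R * (S ^+ k / k`!%:R).
Proof.
move=> kn; rewrite -(bin_fact kn) !natrM; have : k`!%:R != 0 :> R by rewrite pnatr_eq0 -lt0n fact_gt0.
by move=> k0; field.
Qed.

Lemma exp_series_le (S : R) n : 0 <= S -> \sum_(k < n) S ^+ k / k`!%:R <= expR S.
Proof.
move=> S0; have nd : nondecreasing_seq (series (exp_coeff S)).
  apply/nondecreasing_seqP => m; rewrite seriesS addrC lerDl /exp_coeff /=.
  by rewrite divr_ge0// exprn_ge0.
have := nondecreasing_cvgn_le nd (is_cvg_series_exp_coeff S) n.
by rewrite /series /= big_mkord.
Qed.

Lemma tmom_le (S : R) n : 0 <= S -> tmom S n n <= n`!%:R * expR S.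
Proof.
move=> S0; apply: le_trans (ler_wpM2l (ler0n _ _) (exp_series_le n.+1 S0)).
rewrite mulr_sumr; apply: ler_sum => k _; rewrite tmom_term//.
by rewrite -ltnS.
Qed.

(** The largest term of the exponential series, at k = floor S, is enough; the constant 2 absorbs
    the rounding of S and the factor e of [fact_le]. *)
Lemma tmom_ge (S : R) n : 0 <= S <= n%:R -> n%:R ^+ n * expR (S - n%:R - 2) / n.+1%:R <= tmom S n n.
Proof.
move=> /andP[S0 Sn]; have /andP[t1 t2] := truncn_itv S0; set k := Num.truncn S in t1 t2.
have kn : (k < n.+1)%N by rewrite ltnS -(ler_nat R); exact: le_trans Sn.
rewrite /tmom (bigD1 (Ordinal kn))//= -[leLHS]addr0 lerD//; last first.
  by apply: sumr_ge0 => i _; rewrite !mulr_ge0// exprn_ge0.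
rewrite tmom_term//.
have h1 : n%:R ^+ n * expR (- n%:R) <= n`!%:R :> R.
  by rewrite expRN ler_pdivrMr ?expR_gt0//; exact: fact_ge.
have h2 : expR (S - 2) / n.+1%:R <= S ^+ k / k`!%:R.
  have f0 : 0 < k`!%:R :> R by rewrite ltr0n fact_gt0.
  have [k0|k0] := posnP k.
    rewrite k0 expr0 fact0 divr1 ler_pdivrMr// mul1r.
    apply: (@le_trans _ _ 1); last by rewrite -[1]/(1%:R) ler_nat.
    rewrite -[leRHS]expR0 ler_expR; move: t2; rewrite k0; lra.
  rewrite ler_pdivlMr// mulrAC ler_pdivrMr//.
  apply: (@le_trans _ _ (expR (k%:R - 1) * k`!%:R)).
    by rewrite ler_wpM2r// ler_expR; rewrite -natr1 in t2; lra.
  rewrite expRD expRN mulrAC ler_pdivrMr ?expR_gt0// [expR _ * _]mulrC.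
  apply: (le_trans (fact_le k0)); rewrite mulrC ler_wpM2r ?expR_ge0// exprSr ler_pM ?exprn_ge0//.
    by rewrite ler_pXn2r ?nnegrE.
  by rewrite ler_nat ltnW.
have -> : n%:R ^+ n * expR (S - n%:R - 2) / n.+1%:R = (n%:R ^+ n * expR (- n%:R)) * (expR (S - 2) / n.+1%:R).
  by rewrite mulrA -[_ * expR (S - 2)]mulrA -expRD; congr (_ * expR _ / _); ring.
by rewrite ler_pM ?mulr_ge0 ?exprn_ge0 ?expR_ge0 ?divr_ge0 ?expR_ge0.
Qed.

End stirling.

(** * Probability of a small volume *)

Section volume_probability.
Context d (T : measurableType d) (R : realType) (P : probability T R).
Notation C := R[i].
Variable x : nat * nat -> {RV P >-> C}.
Hypothesis x_iid : iid x.
Local Notation mu := (distribution P (x (0%N, 0%N))).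
Hypothesis mu_std : std_law mu.
Variable q : R.
Hypothesis q01 : 0 < q < 1.
Hypothesis conc : forall v s, 1 <= s ->
  (\int[mu]_u (expR (- (s * nsq (u - v))))%:E <= q%:E)%E.
Variable iota : nat -> nat -> nat * nat.
Hypothesis iota_inj : inj2 iota.
Variable (n' : nat).
Local Notation n := n'.+1.
Variables (a : C) (h : R).
Hypothesis h0 : 0 < h.
Local Notation V := (fun i : nat => \row_(j < n) (a *+ (i == j :> nat)) : 'rV[C]_n).
Local Notation top := (top iota V).
Local Notation rowW := (rowW iota V).
Local Notation regdet := (regdet iota V h).
Local Notation rows := (rows iota n').

Lemma fr_V i : fr (V i) <= nsq a.
Proof.
rewrite fr_row; case: (ltnP i n) => [i_n|ni].
  rewrite (bigD1 (Ordinal i_n))//= mxE eqxx big1 ?addr0// => j ji.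
  rewrite mxE; case: eqP => [ij|_]; last by rewrite nsq0.
  by move: ji; rewrite -(inj_eq val_inj) /= ij eqxx.
rewrite big1 ?nsq_ge0// => j _; rewrite mxE gtn_eqF ?nsq0//.
exact: leq_trans (ltn_ord j) ni.
Qed.

Lemma top_square xi : top n xi = shiftmx iota val val (fun _ : 'I_n => a) xi.
Proof. by apply/matrixP => i j; rewrite !mxE. Qed.

Lemma grm_square (A : 'M[C]_n) : grm A = nsq (\det A).
Proof.
apply: complexI; rewrite grmE nsqE normCK /gdet det_mulmx; congr (_ * _).
by rewrite det_map_mx det_tr.
Qed.

Lemma rows_mem p i (j : 'I_n) : (i < p)%N -> iota i j \in rows p.
Proof.
elim: p => //= p IH; rewrite ltnS leq_eqVlt mem_cat => /orP[/eqP ->|ip].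
  by rewrite map_f// mem_enum.
by rewrite IH ?orbT.
Qed.

Lemma EJ_det xi : EJ mu (rows n) (fun xi => (nsq (\det (top n xi)))%:E) xi = (tmom (nsq a) n n)%:E.
Proof.
have mt : mxmeasf (top n) by exact: mxmeasf_top.
have := @EdetE _ _ _ _ x x_iid mu_std iota iota_inj n val val a n val_inj val_inj (leqnn n).
rewrite /Edet /ex => <-; rewrite -(integral_config x_iid (J := rows n)).
- apply: eq_integral => t _; rewrite top_square; congr (nsq (\det _))%:E.
  by apply/matrixP => i j; rewrite !mxE ltn_ord.
- by move=> y; rewrite lee_fin nsq_ge0.
- by apply: measf_EFin; apply: measf_nsq; exact: cmeasf_det.
move=> y y' hy; congr (nsq (\det _))%:E; apply/matrixP => i j; rewrite !mxE hy//.
exact: rows_mem.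
Qed.

(** Regularizing only appends columns, so the regularized volume dominates the squared
    determinant. *)
Lemma EJ_regdet_ge xi : ((tmom (nsq a) n n)%:E <= EJ mu (rows n) (fun xi => (regdet n xi)%:E) xi)%E.
Proof.
rewrite -(EJ_det xi); apply: EJ_le.
- by move=> y; rewrite lee_fin nsq_ge0.
- by apply: measf_EFin; apply: measf_nsq; apply: cmeasf_det; exact: mxmeasf_top.
- by apply: measf_EFin; exact: measf_regdet.
by move=> y; rewrite lee_fin -grm_square; exact: grm_row_mx.
Qed.

(** Markov's inequality for the inverse: tensorization bounds its mean by c^n divided by the mean of
    [regdet], and that mean is at least the second moment of the determinant. *)
Lemma pr_regdet (k L m t z : R) : 0 < k -> 0 < L -> 0 < t ->
  (\int[mu]_u (ntrunc L u)%:E = m%:E)%E -> 1 - k <= m <= 1 -> 0 < tmom (nsq a) n n -> 0 < z ->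
  (pr x (fun xi => (regdet n xi <= z)%R) <=
   (z * ((1 + (2 * t + (n%:R * L ^+ 2 + 4 * (n%:R + nsq a)) / t + 2 * n%:R * k) / h) ^+ 2) ^+ n / tmom (nsq a) n n)%:E)%E.
Proof.
move=> k0 L0 t0 hm m1 E0 z0; set c := (1 + _) ^+ 2.
have mZ : measf (regdet n) by exact: measf_regdet.
have Z0 y : 0 < regdet n y by exact: regdet_gt0.
have mZi := measf_inv mZ Z0.
apply: (pr_cond x_iid (K := rows n)); first by apply: measf_le => //; exact: measf_cst.
move=> xi.
have := EJ_regdet_rows mu_std iota_inj h0 xi k0 L0 t0 hm m1 fr_V (leqnn n); rewrite -/c => hc.
have i0 : (0 <= EJ mu (rows n) (fun xi => (regdet n xi)^-1%:E) xi)%E.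
  by apply: EJ_ge0 => y; rewrite lee_fin invr_ge0 ltW.
have hI : ((tmom (nsq a) n n)%:E * EJ mu (rows n) (fun xi => (regdet n xi)^-1%:E) xi <= (c ^+ n)%:E)%E.
  by apply: le_trans hc; apply: lee_wpmul2r => //; exact: EJ_regdet_ge.
apply: (@le_trans _ _ (EJ mu (rows n) (fun xi => z%:E * (regdet n xi)^-1%:E)%E xi)).
  apply: EJ_le.
  - exact: ind_ge0.
  - by apply: measf_indE; apply: measf_le => //; exact: measf_cst.
  - by apply: (measf_EFin (f := fun xi => z * (regdet n xi)^-1)); apply: measfM => //; exact: measf_cst.
  move=> y; rewrite /ind -EFinM lee_fin; case: (boolP (regdet n y <= z)) => hz; last first.
    by rewrite mulr_ge0 ?invr_ge0 ?(ltW z0) ?(ltW (Z0 _)).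
  by rewrite ler_pdivlMr// mul1r.
rewrite EJ_Zl ?(ltW z0)//; last 2 first.
- by move=> y; rewrite lee_fin invr_ge0 ltW.
- exact: measf_EFin.
move: hI i0; case: (EJ mu (rows n) _ xi) => [b| |]//.
- by rewrite -!EFinM !lee_fin => hb _; rewrite -mulrA ler_wpM2l ?(ltW z0)// ler_pdivlMr// mulrC.
- by rewrite gt0_muley ?lte_fin.
Qed.

Lemma pr_lengths m0 (K : R) : 0 < K ->
  (pr x (fun xi => (K <= \prod_(m0 <= i < n) (fr (rowW xi i) + h))%R) <=
   (K^-1 * (n%:R + nsq a + h) ^+ (n - m0))%:E)%E.
Proof.
move=> K0.
have E2 (F : nat -> R) : \prod_(m0 <= i < n) F i = \prod_(i < n | (m0 <= i)%N) F i.
  by rewrite (big_nat_widenl _ 0%N)// big_mkord.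
have E y := E2 (fun i => fr (rowW y i) + h).
have mp : measf (fun xi => \prod_(i < n | (m0 <= i)%N) (fr (rowW xi i) + h)).
  apply: measf_prod => j; apply: measfD; last exact: measf_cst.
  by apply: measf_fr; exact: mxmeasf_rowW.
have p0 y : 0 <= \prod_(i < n | (m0 <= i)%N) (fr (rowW y i) + h).
  by apply: prodr_ge0 => j _; rewrite addr_ge0 ?fr_ge0// ltW.
under [X in pr x X]eq_fun do rewrite E.
apply: (pr_cond x_iid (K := rows n)); first by apply: measf_le => //; exact: measf_cst.
move=> xi; apply: (le_trans (markov_EJ _ _ _ _ _ _)) => //.
rewrite (EJ_rows_prod mu_std iota_inj) // -EFinM lee_fin ler_wpM2l ?invr_ge0 ?(ltW K0)//.
rewrite -(E2 (fun i => if (i < n)%N then n%:R + fr (V i) + h else fr (rowW xi i) + h)) -prodr_const_nat.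
rewrite big_nat_cond [leRHS]big_nat_cond; apply: ler_prod => i /andP[/andP[_ i_n] _].
rewrite i_n !addr_ge0 ?fr_ge0 ?(ltW h0)//= lerD2r lerD2l; exact: fr_V.
Qed.

(** The four terms are the failure probabilities of the four hypotheses of [volume_lower]. *)
Lemma pr_volume (k L m t Z K : R) m1 m2 b : 0 < k -> 0 < L -> 0 < t ->
  (\int[mu]_u (ntrunc L u)%:E = m%:E)%E -> 1 - k <= m <= 1 -> 0 < tmom (nsq a) n n ->
  0 < Z -> 0 < K -> (m1.+1 <= m2 <= n)%N -> (0 < b)%N -> (m1 + b <= n)%N ->
  (pr x (fun xi => (grm (top m2 xi) < Z / K * expR (- (h * (n%:R / (cdist q * b%:R ^+ 2)) * m1.+1%:R)) *
    \prod_(m1.+1 <= j < m2) (cdist q * (n - j)%:R ^+ 2 / n%:R))%R) <=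
   (Z * ((1 + (2 * t + (n%:R * L ^+ 2 + 4 * (n%:R + nsq a)) / t + 2 * n%:R * k) / h) ^+ 2) ^+ n / tmom (nsq a) n n
    + K^-1 * (n%:R + nsq a + h) ^+ (n - m1.+1)
    + n%:R * rho q ^+ (n - m2).+1 + n%:R * rho q ^+ b)%:E)%E.
Proof.
move=> k0 L0 t0 hm hm1 E0 Z0 K0 m12 b0 m1b.
have /andP[r0 r1] := rho01 q01; have /andP[m12' m2n] := m12.
pose B1 xi := (regdet n xi <= Z)%R.
pose B2 xi := (K <= \prod_(m1.+1 <= i < n) (fr (rowW xi i) + h))%R.
pose B3 xi := has (fun j => bad_last iota V q j (n - j) xi) (seq.iota 0 m2).
pose B4 xi := has (fun i : 'I_m1.+1 => bad_mid iota V q i b xi) (enum 'I_m1.+1).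
have M1 : measf B1 by apply: measf_le; [exact: measf_regdet|exact: measf_cst].
have M2 : measf B2.
  apply: measf_le; first exact: measf_cst.
  apply: measf_prod => j; apply: measfD; last exact: measf_cst.
  by apply: measf_fr; exact: mxmeasf_rowW.
have M3 : measf B3 by apply: measf_has => j; exact: measf_bad_last.
have M4 : measf B4 by apply: measf_has => j; exact: measf_bad_mid.
have M12 : measf (fun xi => B1 xi || B2 xi) by exact: measf_or.
have M123 : measf (fun xi => (B1 xi || B2 xi) || B3 xi) by exact: measf_or.
apply: (@le_trans _ _ (pr x (fun xi => ((B1 xi || B2 xi) || B3 xi) || B4 xi))).
  apply: pr_le.
  - by apply: measf_lt; [apply: measf_grm; exact: mxmeasf_top|exact: measf_cst].
  - exact: measf_or.
  move=> xi; apply: contraTT; rewrite !negb_or -!ltNge => /andP[/andP[/andP[b1 b2] /hasPn b3] /hasPn b4].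
  have := @volume_lower R n iota V q q01 h h0 m1 m2 b xi Z K m12 b0 K0 (ltW b1) (ltW b2).
  move=> hv; rewrite -leNgt; apply: (proj1 (hv _ _)).
    by move=> j jm; apply: b3; rewrite mem_iota.
  by move=> i; apply: b4; rewrite mem_enum.
apply: (le_trans (pr_or _ _ _)) => //; rewrite EFinD; apply: leeD; last first.
  apply: (@le_trans _ _ (\sum_(i <- enum 'I_m1.+1) rho q ^+ b)%:E).
    apply: pr_has => [i|i _]; first exact: measf_bad_mid.
    apply: (pr_cond x_iid (K := coords (rowi iota i))); first exact: measf_bad_mid.
    by move=> xi; exact: EJ_bad_mid.
  rewrite lee_fin big_enum sumr_const card_ord -[leLHS]mulr_natl ler_wpM2r ?exprn_ge0 ?(ltW r0)//.
  by rewrite ler_nat (leq_trans m12').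
apply: (le_trans (pr_or _ _ _)) => //; rewrite EFinD; apply: leeD; last first.
  apply: (@le_trans _ _ (\sum_(i <- seq.iota 0 m2) rho q ^+ (n - m2).+1)%:E).
    apply: pr_has => [i|i]; first exact: measf_bad_last.
    rewrite mem_iota add0n /= => im.
    apply: (@le_trans _ _ (rho q ^+ (n - i))%:E).
      apply: (pr_cond x_iid (K := coords (rowi iota i))); first exact: measf_bad_last.
      by move=> xi; apply: EJ_bad_last => //; rewrite subnKC// ltnW// (leq_trans im).
    by rewrite lee_fin ler_wiXn2l ?(ltW r0) ?(ltW r1)// -subSn// -(subSS i n) leq_sub2l.
  rewrite lee_fin big_const_seq count_predT iter_addr_0 size_iota -[leLHS]mulr_natl.
  by rewrite ler_wpM2r ?exprn_ge0 ?(ltW r0)// ler_nat.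
apply: (le_trans (pr_or _ _ _)) => //; rewrite EFinD; apply: leeD.
  exact: (pr_regdet k0 L0 t0 hm hm1 E0 Z0).
exact: (pr_lengths m1.+1 K0).
Qed.

End volume_probability.

(** * Lower bound for the potential *)

Section sixteenth_root.
Variable R : realType.

(** Integer part of n^(1/16), used both as the number of last rows and as the number of points. As a
    power of n it dominates ln n, so exp (- c rt n) is summable; the exponent is small enough for
    r^3 ln n and r^7 to be negligible against n. *)
Definition rt (n : nat) : nat := \max_(r < n.+1 | (r ^ 16 <= n)%N) r.

Lemma rt_le n : (rt n ^ 16 <= n)%N.
Proof.
rewrite /rt; have : (0 < #|[pred r : 'I_n.+1 | (r ^ 16 <= n)%N]|)%N.
  by apply/card_gt0P; exists ord0; rewrite inE.
by move=> /(eq_bigmax_cond (fun r : 'I_n.+1 => nat_of_ord r)) [r hr ->].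
Qed.

Lemma rt_lt n : (n < (rt n).+1 ^ 16)%N.
Proof.
rewrite ltnNge; apply/negP => h.
have hn : ((rt n).+1 < n.+1)%N.
  by rewrite ltnS; apply: leq_trans h; rewrite -[X in (X <= _)%N]expn1 leq_pexp2l.
have := @leq_bigmax_cond _ (fun r : 'I_n.+1 => (r ^ 16 <= n)%N) (fun r => nat_of_ord r) (Ordinal hn) h.
by rewrite /= -/(rt n) ltnn.
Qed.

Lemma rt_ge (c n : nat) : (c ^ 16 <= n)%N -> (c <= rt n)%N.
Proof.
move=> cn; have cn' : (c < n.+1)%N.
  rewrite ltnS; apply: leq_trans cn; case: c => // c.
  by rewrite -[X in (X <= _)%N]expn1 leq_pexp2l.
exact: (@leq_bigmax_cond _ (fun r : 'I_n.+1 => (r ^ 16 <= n)%N) (fun r => nat_of_ord r) (Ordinal cn')).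
Qed.

Lemma near_ge (c : nat) : \forall n \near \oo, (c <= n)%N.
Proof. by exists c. Qed.

Lemma near_rt (c : R) : \forall n \near \oo, c <= (rt n)%:R.
Proof.
near=> n; apply: (@le_trans _ _ (Num.truncn `|c|).+1%:R).
  by apply: le_trans (ler_norm _) _; have /andP[_ /ltW] := truncn_itv (normr_ge0 c).
by rewrite ler_nat; apply: rt_ge; near: n; exact: near_ge.
Unshelve. all: end_near. Qed.

Lemma near_nat (c : R) : \forall n \near \oo, c <= n%:R.
Proof.
near=> n; apply: (@le_trans _ _ (rt n)%:R); first by near: n; exact: near_rt.
rewrite ler_nat; apply: leq_trans (rt_le n); case: (rt n) => // r.
by rewrite -[X in (X <= _)%N]expn1 leq_pexp2l.
Unshelve. all: end_near. Qed.

Lemma ln_sqrt_le (x : R) : 0 < x -> ln x <= 2 * Num.sqrt x.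
Proof.
move=> x0; have s0 : 0 < Num.sqrt x by rewrite sqrtr_gt0.
rewrite -{1}(sqr_sqrtr (ltW x0)) expr2 lnM ?posrE//.
by have := ltW (ln_sublinear s0); lra.
Qed.

Lemma near_ln_rt (e : R) : 0 < e -> \forall n \near \oo, ln n%:R <= e * (rt n)%:R.
Proof.
move=> e0; near=> n.
have r1 : 1 <= (rt n)%:R :> R by near: n; exact: near_rt.
(* 16 ln (1 + r) <= 32 sqrt (1 + r), and squaring with 1 + r <= 2 r leaves 2048 r <= e^2 r^2. *)
have rC : 2048 / e ^+ 2 <= (rt n)%:R by near: n; exact: near_rt.
have n1 : 1 <= n%:R :> R by near: n; exact: near_nat.
have n0 : 0 < n%:R :> R by exact: lt_le_trans n1.
have n_lt : n%:R <= (1 + (rt n)%:R) ^+ 16 :> R.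
  by rewrite addrC natr1 -natrX ler_nat ltnW// rt_lt.
move: r1 rC n_lt; set r : R := (rt n)%:R => r1 rC n_lt.
have h1 : ln n%:R <= 16 * ln (1 + r).
  have -> : 16 * ln (1 + r) = ln ((1 + r) ^+ 16) by rewrite lnXn ?addr_gt0 ?(lt_le_trans ltr01)// mulr_natl.
  by rewrite ler_ln ?posrE ?exprn_gt0 ?addr_gt0 ?(lt_le_trans ltr01).
apply: (le_trans h1); have p0 : 0 < 1 + r by lra.
apply: (@le_trans _ _ (32 * Num.sqrt (1 + r))).
  by have := ln_sqrt_le p0; lra.
have er : 0 <= e * r by rewrite mulr_ge0 ?(ltW e0)//; lra.
rewrite -(ler_pXn2r (n := 2)) ?nnegrE ?er ?mulr_ge0 ?sqrtr_ge0//.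
rewrite exprMn sqr_sqrtr ?(ltW p0)// exprMn.
have : 2048 <= e ^+ 2 * r by rewrite mulrC -ler_pdivrMr ?exprn_gt0.
rewrite -(ler_pM2r (lt_le_trans ltr01 r1)) => h2.
rewrite [r ^+ 2]expr2 mulrA; apply: le_trans h2; move: r1; lra.
Unshelve. all: end_near. Qed.

End sixteenth_root.

Section powers.
Variable R : realType.
Variable y : R.
Hypothesis y1 : 1 <= y.
Let y0 : 0 < y. Proof. exact: lt_le_trans y1. Qed.

Lemma pow_le (c : R) (e b a : nat) : c <= y ^+ e -> (e + b <= a)%N -> c * y ^+ b <= y ^+ a.
Proof.
move=> ce eba; apply: (@le_trans _ _ (y ^+ e * y ^+ b)).
  by rewrite ler_wpM2r// exprn_ge0// ltW.
by rewrite -exprD ler_weXn2l.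
Qed.

Lemma invpow_le (c : R) (e b a : nat) : c <= y ^+ e -> (e + b <= a)%N ->
  c * (y ^+ a)^-1 <= (y ^+ b)^-1.
Proof.
move=> ce eba; have ya := exprn_gt0 a y0; have yb := exprn_gt0 b y0.
by rewrite ler_pdivrMr// mulrC ler_pdivlMr// (pow_le ce eba).
Qed.
End powers.

(** * Choice of parameters as powers of n *)

Section parameters.
Variable R : realType.
Variables (n r : nat) (q gap : R).
Hypothesis q01 : 0 < q < 1.
Hypothesis r1 : (0 < r)%N.
Hypothesis rn : (r <= n)%N.
Hypothesis n100 : (100 <= n)%N.
Local Notation y := (n%:R : R).
Hypothesis gap0 : 0 < gap.
Hypothesis hgap : 4 / gap <= y ^+ 4.
Hypothesis hc : (cdist q)^-1 <= y.
Hypothesis hq : y^-1 <= - ln q / 2.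

(** The exponents are fixed in turn: [pb] must beat the power pL^r, [pth] must beat [pb], [pkap] and
    [pN] must beat th^(2 r) beta, [ps2] the constant [ri_const], and [pt2] must beat [ps2]. The
    final loss pt2^r is n^(-60 r^3), subexponential in n for r of the size of [rt n]. *)
Let pL : R := y ^+ 5.
Let pb : R := (y ^+ (5 * r + 4))^-1.
Let pth : R := (y ^+ (10 * r))^-1.
Let pkap : R := (y ^+ (20 * (r * r) + 5 * r + 5))^-1.
Let pN : nat := (n ^ (20 * (r * r)))%N.
Let ps2 : R := (y ^+ (58 * (r * r)))^-1.
Let pt2 : R := (y ^+ (60 * (r * r)))^-1.

Let rr : (r <= r * r)%N. Proof. by rewrite leq_pmulr. Qed.
Let y1 : 1 <= y. Proof. by rewrite -[1]/(1%:R) ler_nat (leq_trans _ n100). Qed.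
Let y0 : 0 < y. Proof. exact: lt_le_trans y1. Qed.
Let y100 : 100 <= y. Proof. by rewrite -[100]/(100%:R) ler_nat. Qed.
Let ry : r%:R <= y. Proof. by rewrite ler_nat. Qed.
Let rky : (r * r)%:R ^+ 2 <= y ^+ 4 :> R.
Proof.
by rewrite natrM -expr2 -exprM ler_pXn2r ?nnegrE.
Qed.

Let thE : pth ^+ 2 ^+ r * pb = (y ^+ (20 * (r * r) + 5 * r + 4))^-1.
Proof.
rewrite /pth /pb !exprVn -!exprM -invfM -exprD; congr ((_ ^+ _)^-1); clear -rr r1; lia.
Qed.

Lemma par_th : 0 < pth <= 1.
Proof. by rewrite invr_gt0 exprn_gt0//= invf_le1 ?exprn_gt0// exprn_ege1. Qed.

Lemma par_kap : 6 * pkap <= pth ^+ 2 ^+ r * pb.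
Proof. rewrite thE; apply: (invpow_le y1 (e := 1)); [rewrite expr1; move: y100; lra|clear -rr r1; lia]. Qed.

Lemma par_hth : 6 * (r * r)%:R ^+ 2 * pth ^+ 2 * pL ^+ r <= pb.
Proof.
have -> : 6 * (r * r)%:R ^+ 2 * pth ^+ 2 * pL ^+ r = 6 * (r * r)%:R ^+ 2 * y ^+ (5 * r) * (y ^+ (20 * r))^-1.
  rewrite /pth /pL exprVn -!exprM mulrAC; congr (_ * _ * (_ ^+ _)^-1); clear -rr r1; lia.
apply: (invpow_le y1 (e := 5 * r + 5)); last by clear -rr r1; lia.
rewrite [leRHS]exprD mulrC ler_wpM2l ?exprn_ge0//.
apply: (@le_trans _ _ (y * y ^+ 4)); last by rewrite -exprS.
by apply: ler_pM => //; move: y100; lra.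
Qed.

Lemma par_N : 12 * (r * r)%:R ^+ 2 * pL ^+ r / pN%:R ^+ 2 <= pth ^+ 2 ^+ r * pb.
Proof.
have -> : 12 * (r * r)%:R ^+ 2 * pL ^+ r / pN%:R ^+ 2 = 12 * (r * r)%:R ^+ 2 * y ^+ (5 * r) * (y ^+ (40 * (r * r)))^-1.
  rewrite /pN /pL natrX -!exprM; congr (_ * _ * (_ ^+ _)^-1); clear -rr r1; lia.
rewrite thE; apply: (invpow_le y1 (e := 5 * r + 5)); last by clear -rr r1; lia.
rewrite [leRHS]exprD mulrC ler_wpM2l ?exprn_ge0//.
apply: (@le_trans _ _ (y * y ^+ 4)); last by rewrite -exprS.
by apply: ler_pM => //; move: y100; lra.
Qed.

Lemma par_N3 : (2 < pN)%N.
Proof.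
apply: (@leq_trans n); first exact: leq_trans n100.
by rewrite -[X in (X <= _)%N]expn1 leq_pexp2l ?(leq_trans _ n100)//; clear -rr r1; lia.
Qed.

Lemma par_Lb m' k1 : (m'.+1 <= n)%N -> (0 < k1)%N -> m'.+1%:R ^+ 3 / (cdist q * k1%:R ^+ 2) <= pL.
Proof.
move=> mn k10; have c0 := cdist_gt0 q01; have hc' := hc; move: c0 hc'; move: (cdist q) => c c0 hc'.
have k1' : 1 <= k1%:R :> R by rewrite -[1]/(1%:R) ler_nat.
rewrite invfM mulrA; apply: (@le_trans _ _ (y ^+ 3 * y * 1)).
  apply: ler_pM; rewrite ?invr_ge0 ?exprn_ge0 ?divr_ge0 ?exprn_ge0 ?(ltW c0)//.
    by apply: ler_pM; rewrite ?exprn_ge0 ?invr_ge0 ?(ltW c0)// ler_pXn2r ?nnegrE// ler_nat.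
  by rewrite invf_le1 ?exprn_gt0 ?exprn_ege1// (lt_le_trans ltr01).
by rewrite mulr1 -exprSr ler_weXn2l.
Qed.

Lemma par_beta m' : (m'.+1 <= n)%N -> 4 * pb * m'.+1%:R ^+ 2 * pL ^+ r <= 1.
Proof.
move=> mn; have -> : 4 * pb * m'.+1%:R ^+ 2 * pL ^+ r = 4 * m'.+1%:R ^+ 2 * y ^+ (5 * r) * (y ^+ (5 * r + 4))^-1.
  by rewrite /pb /pL -exprM; move: (y ^+ (5 * r)) ((y ^+ (5 * r + 4))^-1) => a b; ring.
apply: (le_trans (invpow_le y1 (e := 5 * r + 3) (b := 0) _ _)); last by rewrite expr0 invr1.
  2: by clear -rr r1; lia.
rewrite [leRHS]exprD mulrC ler_wpM2l ?exprn_ge0//.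
apply: (@le_trans _ _ (y * y ^+ 2)); last by rewrite -exprS.
by apply: ler_pM; rewrite ?exprn_ge0//; [move: y100; lra|rewrite ler_pXn2r ?nnegrE// ler_nat].
Qed.

Lemma par_s2 m' : (m'.+1 + r)%N = n -> ps2 * ri_const m' r r gap pL pkap <= 1.
Proof.
move=> mrn; rewrite mulrC ler_pdivrMr ?exprn_gt0// mul1r /ri_const mrn.
have four : 4 ^+ r <= y ^+ r by rewrite ler_pXn2r ?nnegrE//; move: y100; lra.
have h1 : (4 / gap) ^+ r <= y ^+ (4 * r).
  by rewrite exprM ler_pXn2r ?nnegrE ?divr_ge0 ?exprn_ge0 ?(ltW gap0).
have h2 : (4 * pL) ^+ r <= y ^+ (6 * r).
  rewrite exprM ler_pXn2r ?nnegrE ?mulr_ge0 ?exprn_ge0// [in leRHS]exprS ler_wpM2r ?exprn_ge0//; move: y100; lra.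
have h3 : (4 * r%:R ^+ 2 * 4 ^+ r) ^+ r <= y ^+ ((3 + r) * r).
  have p0 : 0 <= 4 * r%:R ^+ 2 * 4 ^+ r :> R by rewrite mulr_ge0 ?exprn_ge0// mulr_ge0 ?exprn_ge0.
  rewrite exprM ler_pXn2r ?nnegrE ?p0 ?exprn_ge0// exprD.
  apply: ler_pM => //; rewrite ?exprn_ge0 ?mulr_ge0 ?exprn_ge0//; rewrite exprS.
  apply: ler_pM; rewrite ?exprn_ge0//; first (move: y100; lra).
  by apply: ler_pM.
have h4 : (4 * pL * 4 ^+ r) ^+ r <= y ^+ ((6 + r) * r).
  have p0 : 0 <= 4 * pL * 4 ^+ r :> R by rewrite mulr_ge0 ?exprn_ge0// mulr_ge0 ?exprn_ge0.
  rewrite exprM ler_pXn2r ?nnegrE ?p0 ?exprn_ge0// exprD.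
  apply: ler_pM => //; rewrite ?mulr_ge0 ?exprn_ge0// exprS ler_wpM2r ?exprn_ge0//; move: y100; lra.
have h5 : (pkap / y ^+ r)^-1 = y ^+ (20 * (r * r) + 5 * r + 5 + r).
  by rewrite invf_div /pkap invrK -exprD addnC.
rewrite h5.
have h6 : 1 + (4 * r%:R ^+ 2 * 4 ^+ r) ^+ r * r%:R * (4 * pL * 4 ^+ r) ^+ r * y ^+ (20 * (r * r) + 5 * r + 5 + r)
    <= y ^+ (44 * (r * r)).
  apply: (@le_trans _ _ (1 + y ^+ ((3 + r) * r) * y * y ^+ ((6 + r) * r) * y ^+ (20 * (r * r) + 5 * r + 5 + r))).
    rewrite lerD2l ler_wpM2r ?exprn_ge0//.
    have p1 : 0 <= (4 * r%:R ^+ 2 * 4 ^+ r) ^+ r :> R.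
      by apply: exprn_ge0; rewrite mulr_ge0 ?exprn_ge0// mulr_ge0 ?exprn_ge0.
    have p2 : 0 <= (4 * pL * 4 ^+ r) ^+ r.
      by apply: exprn_ge0; rewrite mulr_ge0 ?exprn_ge0// mulr_ge0 ?exprn_ge0.
    apply: ler_pM; rewrite ?mulr_ge0//; apply: ler_pM => //.
  rewrite -exprSr -!exprD; apply: (@le_trans _ _ (2 * y ^+ (43 * (r * r)))).
    have h7 : y ^+ (((3 + r) * r).+1 + (6 + r) * r + (20 * (r * r) + 5 * r + 5 + r)) <= y ^+ (43 * (r * r)).
      by rewrite ler_weXn2l//; clear -rr r1; lia.
    have : 1 <= y ^+ (43 * (r * r)) by exact: exprn_ege1.
    lra.
  by apply: (pow_le y1 (e := 1)); [rewrite expr1; move: y100; lra|clear -rr r1; lia].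
have h8 : 2 * r%:R ^+ 3 <= y ^+ 4.
  rewrite [leRHS]exprS; apply: ler_pM; rewrite ?exprn_ge0//; [move: y100; lra|rewrite ler_pXn2r ?nnegrE//].
have p1 : 0 <= (4 / gap) ^+ r by rewrite exprn_ge0// divr_ge0// ltW.
have p2 : 0 <= (4 * pL) ^+ r by rewrite exprn_ge0// mulr_ge0// exprn_ge0.
apply: (@le_trans _ _ (y ^+ 4 * y ^+ (4 * r) * y ^+ (6 * r) * y ^+ (44 * (r * r)))).
  apply: ler_pM => //.
  - by rewrite !mulr_ge0// exprn_ge0.
  - rewrite addr_ge0// !mulr_ge0 ?exprn_ge0 ?mulr_ge0 ?exprn_ge0//.
  apply: ler_pM => //; first by rewrite !mulr_ge0// exprn_ge0.
  by apply: ler_pM => //; rewrite mulr_ge0// exprn_ge0.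
by rewrite -!exprD ler_weXn2l//; clear -rr r1; lia.
Qed.

Lemma par_t2 : n%:R * pt2 <= ps2 * (- ln q / 2).
Proof.
apply: (@le_trans _ _ (ps2 * y^-1)); last by rewrite ler_wpM2l// invr_ge0 exprn_ge0.
rewrite /ps2 -invfM -exprSr; apply: (invpow_le y1 (e := 1)); [by rewrite expr1|clear -rr r1; lia].
Qed.

(** The net has about n^(42 r^4) elements, at most exp (42 r^5) when ln n <= r. A failure
    probability rho0^(r^6) per element wins against this, which is why the defect k1 is taken to be
    r^6. *)
Lemma par_net (rho0 : R) m' : 0 < rho0 < 1 -> (m'.+1 <= n)%N ->
  ln y <= r%:R -> 49 <= r%:R * - ln rho0 ->
  (pN + pN).+1%:R ^+ (2 * (r * r)) * (r * r)%:R *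
    (r%:R * (2 * m'.+1%:R * rho0 ^+ (r ^ 6)) + expR 1 * rho0 ^+ (r ^ 6)) <= (y ^+ 2)^-1.
Proof.
move=> /andP[rho00 rho01] mn lny hr.
have hN : (pN + pN).+1%:R <= y ^+ (21 * (r * r)).
  apply: (@le_trans _ _ (3 * y ^+ (20 * (r * r)))).
    have -> : 3 * y ^+ (20 * (r * r)) = (3 * pN)%:R by rewrite natrM natrX.
    by rewrite ler_nat; have := par_N3; move: pN => N; clear; lia.
  by apply: (pow_le y1 (e := 1)); [rewrite expr1; move: y100; lra|clear -rr r1; lia].
have e4 : expR 1 <= 4 :> R.
  have := @expR_ge1Dx R (- (2^-1)); rewrite expRN => h.
  have h2 : expR (2^-1) <= 2 :> R.
    by rewrite -lef_pV2 ?posrE ?expR_gt0//; move: h; set a := (expR _)^-1; lra.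
  have -> : 1 = 2^-1 + 2^-1 :> R by field.
  by rewrite expRD; have := expR_gt0 (2^-1 : R); nra.
have rho6 : 0 <= rho0 ^+ (r ^ 6) by rewrite exprn_ge0// ltW.
have h1 : r%:R * (2 * m'.+1%:R * rho0 ^+ (r ^ 6)) + expR 1 * rho0 ^+ (r ^ 6) <= y ^+ 3 * rho0 ^+ (r ^ 6).
  rewrite mulrA -mulrDl ler_wpM2r//.
  have my : m'.+1%:R <= y by rewrite ler_nat.
  have ry' : r%:R * m'.+1%:R <= y * y by apply: ler_pM.
  apply: (@le_trans _ _ (2 * (y * y) + 4)); first by rewrite mulrCA lerD// ler_wpM2l.
  rewrite !exprS expr0 mulr1; have h2 : 100 * (y * y) <= y * (y * y) by rewrite ler_wpM2r// mulr_ge0.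
  have h3 : 1 <= y * y by rewrite mulr_ege1.
  apply: le_trans h2; move: h3; move: (y * y) => yy; lra.
have h2 : (pN + pN).+1%:R ^+ (2 * (r * r)) * (r * r)%:R <= y ^+ (42 * (r * r) * (r * r) + 2).
  rewrite exprD; apply: ler_pM; rewrite ?exprn_ge0//.
    have -> : (42 * (r * r) * (r * r) = 21 * (r * r) * (2 * (r * r)))%N by clear; lia.
    by rewrite [leRHS]exprM; apply: lerXn2r; rewrite ?nnegrE ?exprn_ge0.
  by rewrite natrM expr2; apply: ler_pM.
apply: (@le_trans _ _ (y ^+ (42 * (r * r) * (r * r) + 2) * (y ^+ 3 * rho0 ^+ (r ^ 6)))).
  apply: ler_pM => //.
  by rewrite addr_ge0 ?mulr_ge0 ?expR_ge0.
rewrite mulrA -exprD -[leRHS]mul1r ler_pdivlMr ?exprn_gt0// mulrAC -exprD.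
apply: (@le_trans _ _ (y ^+ (49 * r ^ 4) * rho0 ^+ (r ^ 6))).
  rewrite ler_wpM2r// ler_weXn2l//.
  have -> : (r ^ 4 = (r * r) * (r * r))%N by rewrite !expnS expn0 muln1 !mulnA.
  have : (0 < r * r * (r * r))%N by rewrite !muln_gt0 r1.
  by rewrite -[(42 * _ * _)%N]mulnA; move: (r * r * (r * r))%N => c; clear; lia.
have -> : y ^+ (49 * r ^ 4) = expR (ln y * (49 * r ^ 4)%:R) by rewrite expRM_natr lnK ?posrE.
have -> : rho0 ^+ (r ^ 6) = expR (ln rho0 * (r ^ 6)%:R) by rewrite expRM_natr lnK ?posrE.
rewrite -expRD -[leRHS]expR0 ler_expR natrM !natrX.
have R1 : 0 <= r%:R :> R by [].
move: lny hr R1; move: (ln y) (ln rho0) (r%:R : R) => ly lr r0 lny hr R1.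
have A : ly * (49 * r0 ^+ 4) <= r0 * (49 * r0 ^+ 4) by rewrite ler_wpM2r// mulr_ge0// exprn_ge0.
have B : r0 ^+ 5 * 49 <= r0 ^+ 5 * (r0 * - lr) by rewrite ler_wpM2l// exprn_ge0.
apply: (le_trans (lerD A (lexx _))).
have -> : r0 * (49 * r0 ^+ 4) + lr * r0 ^+ 6 = r0 ^+ 5 * 49 - r0 ^+ 5 * (r0 * - lr) by ring.
by rewrite subr_le0.
Qed.

End parameters.

(** * The volume of all but the last rows *)

Section volume_asymptotics.
Context d (T : measurableType d) (R : realType) (P : probability T R).
Notation C := R[i].
Variable x : nat * nat -> {RV P >-> C}.
Hypothesis x_iid : iid x.
Local Notation mu := (distribution P (x (0%N, 0%N))).
Hypothesis mu_std : std_law mu.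
Variable q : R.
Hypothesis q01 : 0 < q < 1.
Hypothesis conc : forall v s, 1 <= s ->
  (\int[mu]_u (expR (- (s * nsq (u - v))))%:E <= q%:E)%E.
Variable iota : nat -> nat -> nat * nat.
Hypothesis iota_inj : inj2 iota.

Definition Vdiag n (a : C) (i : nat) : 'rV[C]_n := \row_(j < n) (a *+ (i == j :> nat)).

Lemma prod_rev_fact n b : (b <= n)%N -> (\prod_(n - b <= j < n) (n - j) = b`!)%N.
Proof.
elim: b => [|b IH] bn; first by rewrite subn0 big_geq.
rewrite big_ltn ?ltn_subrL ?(leq_ltn_trans _ bn)//= subKn// factS; congr (_ * _)%N.
by rewrite -IH ?(ltnW bn)// subnSK.
Qed.

(** Over the last b rows the distance bounds multiply to a b-th power times (b!)^2 / n^(2 b), which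
    Stirling turns into an exponential of order al n. Leaving out the last r factors only costs (3
    n)^r. *)
Lemma prod_dist_ge (c c' al : R) n b r : (0 < b <= n)%N -> (r <= b)%N -> 0 < c' <= 1 -> 3 * c' <= c ->
  0 < al -> al / 2 * n%:R <= b%:R -> b%:R <= al * n%:R -> al <= 1 ->
  expR (- (al * n%:R * (2 - ln (c' * (al / 2) ^+ 2)))) / (3 * n%:R) ^+ r <=
  (\prod_(n - b <= j < n - r) (c * (n - j)%:R ^+ 2 / n%:R)) / (3 * n%:R) ^+ b.
Proof.
move=> /andP[b0 bn] rb /andP[c0 c1] cc al0 bl bu al1.
have n0 : 0 < n%:R :> R by rewrite ltr0n (leq_trans b0).
have n30 : 0 < 3 * n%:R :> R by rewrite mulr_gt0.
pose F j : R := c' * (n - j)%:R ^+ 2 / n%:R ^+ 2.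
have F0 j : 0 <= F j by rewrite divr_ge0 ?exprn_ge0// mulr_ge0 ?exprn_ge0// ltW.
have F1 j : F j <= 1.
  rewrite /F ler_pdivrMr ?exprn_gt0// mul1r -[leRHS]mul1r ler_pM ?exprn_ge0 ?(ltW c0)//.
  by rewrite ler_pXn2r ?nnegrE// ler_nat leq_subr.
have h1 : \prod_(n - b <= j < n) F j <= \prod_(n - b <= j < n - r) F j.
  rewrite (@big_cat_nat _ _ _ (n - r) _ _ _ _ (leq_sub2l n rb) (leq_subr r n)) /=.
  rewrite ler_piMr//; first by apply: prodr_ge0.
  by apply: prodr_ile1 => j _; rewrite F0 F1.
have h2 : (3 * n%:R) ^+ (b - r) * \prod_(n - b <= j < n - r) F j <=
   \prod_(n - b <= j < n - r) (c * (n - j)%:R ^+ 2 / n%:R).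
  have -> : (b - r = (n - r) - (n - b))%N by move: rb bn; clear; lia.
  rewrite -prodr_const_nat -big_split /=; apply: ler_prod => j _.
  rewrite mulr_ge0 ?F0 ?(ltW n30)//= /F.
  have -> : 3 * n%:R * (c' * (n - j)%:R ^+ 2 / n%:R ^+ 2) = 3 * c' * (n - j)%:R ^+ 2 / n%:R.
    by field; rewrite gt_eqF.
  by rewrite ler_wpM2r ?invr_ge0 ?(ltW n0)// ler_wpM2r ?exprn_ge0.
have h3 : \prod_(n - b <= j < n) F j = c' ^+ b * (b`!%:R) ^+ 2 / n%:R ^+ 2 ^+ b.
  rewrite /F big_split /= big_split /= prodfV !prodr_const_nat subKn//; congr (_ * _ / _).
  by rewrite -(prod_rev_fact bn) natr_prod -prodrXl.
have h4 : expR (- (al * n%:R * (2 - ln (c' * (al / 2) ^+ 2)))) <= \prod_(n - b <= j < n) F j.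
  rewrite h3; have fb := @fact_ge R b.
  have f2 : b%:R ^+ b * expR (- b%:R) <= b`!%:R :> R by rewrite expRN ler_pdivrMr ?expR_gt0.
  have cal : 0 < c' * (al / 2) ^+ 2 by rewrite mulr_gt0// exprn_gt0// divr_gt0.
  have cal1 : c' * (al / 2) ^+ 2 <= 1.
    rewrite -[leRHS]mul1r ler_pM ?exprn_ge0 ?divr_ge0 ?(ltW c0) ?(ltW al0)//.
    by rewrite exprn_ile1 ?divr_ge0 ?(ltW al0)//; lra.
  have lnc : ln (c' * (al / 2) ^+ 2) <= 0 by rewrite ln_le0.
  apply: (@le_trans _ _ (expR (b%:R * (ln (c' * (al / 2) ^+ 2) - 2)))).
    rewrite ler_expR -mulrN opprB ler_wnM2r//; lra.
  rewrite expRM_natl expRD lnK ?posrE// exprMn.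
  apply: (@le_trans _ _ (c' ^+ b * (b%:R ^+ b * expR (- b%:R)) ^+ 2 / n%:R ^+ 2 ^+ b)); last first.
    rewrite ler_pM2r ?invr_gt0 ?exprn_gt0// ler_pM2l ?exprn_gt0//.
    by rewrite ler_pXn2r ?nnegrE ?mulr_ge0 ?exprn_ge0 ?expR_ge0.
  rewrite exprMn -!mulrA ler_pM2l ?exprn_gt0//.
  have -> : expR (-2) ^+ b = expR (- b%:R) ^+ 2 :> R.
    by rewrite -!expRM_natr; congr expR; ring.
  have -> : forall u v w : R, u * (v * (u * (v / w))) = u ^+ 2 / w * v ^+ 2 by move=> *; ring.
  apply: ler_wpM2r; first by rewrite exprn_ge0 ?expR_ge0.
  rewrite ler_pdivlMr ?exprn_gt0// -exprMn -exprMn [X in _ <= X]exprAC.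
  rewrite ler_pXn2r ?nnegrE ?exprn_ge0 ?mulr_ge0 ?divr_ge0 ?(ltW al0)//.
  by rewrite ler_pXn2r ?nnegrE ?exprn_ge0 ?mulr_ge0 ?divr_ge0 ?(ltW al0).
rewrite ler_pdivlMr ?exprn_gt0// mulrAC ler_pdivrMr ?exprn_gt0//.
apply: (@le_trans _ _ ((3 * n%:R) ^+ (b - r) * \prod_(n - b <= j < n - r) F j * (3 * n%:R) ^+ r)); last first.
  by rewrite ler_wpM2r// exprn_ge0// ltW.
rewrite [leRHS]mulrAC -exprD subnK// mulrC ler_wpM2l ?exprn_ge0 ?(ltW n30)//.
exact: le_trans h1.
Qed.

(** al ln (1 / al) tends to 0. Taking al = b^2 makes the crude bound - ln b <= 1 / b sufficient. *)
Lemma alpha_exists (c' e : R) : 0 < c' <= 1 -> 0 < e -> exists2 al, 0 < al <= 2^-1 & al * (2 - ln (c' * (al / 2) ^+ 2)) <= e.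
Proof.
move=> /andP[c0 c1] e0.
have lnc : ln (c' / 4) <= 0 by rewrite ln_le0//; lra.
pose A := 6 - ln (c' / 4); have A0 : 0 < A by rewrite /A; lra.
pose b := Num.min 2^-1 (e / A).
have b0 : 0 < b by rewrite /b lt_min invr_gt0 ltr0n/= divr_gt0.
have bA : b * A <= e by rewrite -ler_pdivlMr// /b ge_min lexx orbT.
have b2 : b <= 2^-1 by rewrite /b ge_min lexx.
exists (b ^+ 2); first by rewrite exprn_gt0//=; nra.
have -> : c' * (b ^+ 2 / 2) ^+ 2 = c' / 4 * b ^+ 4 by field.
rewrite lnM ?posrE ?exprn_gt0 ?divr_gt0// lnXn//.
have lb : - ln b <= b^-1.
  by rewrite -lnV ?posrE//; apply: ltW; apply: ln_sublinear; rewrite invr_gt0.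
rewrite opprD; apply: le_trans bA; rewrite /A -mulr_natl.
have : b ^+ 2 * (- ln b) <= b by rewrite -[leRHS](_ : b ^+ 2 * b^-1 = b) ?ler_pM2l ?exprn_gt0//; field; rewrite gt_eqF.
move: lnc; move: (ln (c' / 4)) (ln b) => u v h1 h2.
have : b ^+ 2 * (2 - u) <= b * (2 - u) by rewrite ler_wpM2r//; [lra|nra].
nra.
Qed.

(** Of the exponent 7 e1 n, two parts come from Z, one each from K, from the regularization and from
    the distances, and two absorb (3 n)^r and the polynomial factors. The value of [et] keeps the
    regularization cost below e1 n, and that of [k] keeps the tensorized constant below exp (e1
    n). *)
Lemma pr_volume_at n' r (a : C) (e1 al k L m : R) (et := Num.min 1 (e1 * cdist q * al ^+ 2 / 4)) (n := n'.+1) :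
  0 < e1 -> 0 < al <= 2^-1 -> al * (2 - ln (Num.min 1 (cdist q / 3) * (al / 2) ^+ 2)) <= e1 ->
  k = e1 * et / 10 -> 0 < L -> (\int[mu]_u (ntrunc L u)%:E = m%:E)%E -> 1 - k <= m <= 1 ->
  nsq a <= n%:R -> 3 <= n%:R :> R -> (L ^+ 2 + 8) / k ^+ 2 <= n%:R -> 4 / al <= n%:R ->
  1 <= r%:R :> R -> 16 / e1 <= r%:R -> 4 / al <= r%:R -> (r ^ 16 <= n)%N ->
  ln n%:R <= r%:R :> R -> ln n%:R <= - ln (rho q) / 8 * r%:R ->
  (pr x (fun xi => (grm (top iota (Vdiag n a) (n - r) xi) < n%:R ^+ n * expR (nsq a - n%:R - 7 * e1 * n%:R))%R)
   <= ((n%:R ^+ 4)^-1)%:E)%E.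
Proof.
move=> e10 /andP[al0 al2] hal kE L0 hm m1 an n3 nD nb r1 r2 r4 rn l1 l2.
have c0 := cdist_gt0 q01; have /andP[rho0 rho1] := rho01 q01.
set c' := Num.min 1 (cdist q / 3) in hal.
have c'0 : 0 < c' <= 1 by rewrite /c' lt_min ltr01 divr_gt0//= ge_min lexx.
have c'c : 3 * c' <= cdist q by rewrite mulrC -ler_pdivlMr// /c' ge_min lexx orbT.
have et0 : 0 < et by rewrite /et lt_min ltr01/= divr_gt0// mulr_gt0 ?exprn_gt0// mulr_gt0.
have et1 : et <= 1 by rewrite /et ge_min lexx.
have et2 : et <= e1 * cdist q * al ^+ 2 / 4 by rewrite /et ge_min lexx orbT.
have k0 : 0 < k by rewrite kE divr_gt0// mulr_gt0.
have y0 : 0 < n%:R :> R by rewrite ltr0n.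
have rr0 : 0 < r%:R :> R by lra.
have r0 : (0 < r)%N by rewrite -(ltr0n R).
have rn3 : (r ^ 3 <= n)%N by apply: leq_trans rn; rewrite leq_pexp2l.
have rn3R : r%:R ^+ 3 <= n%:R :> R by rewrite -natrX ler_nat.
have r16 : 16 <= e1 * r%:R by rewrite mulrC -ler_pdivrMr.
have r16n : 16 * r%:R ^+ 2 <= e1 * n%:R.
  apply: (@le_trans _ _ (e1 * r%:R ^+ 3)); last by rewrite ler_pM2l.
  by rewrite [_ ^+ 3]exprS mulrA ler_wpM2r ?exprn_ge0.
have alr : 4 <= al * r%:R by rewrite mulrC -ler_pdivrMr.
have aln : 4 <= al * n%:R by rewrite mulrC -ler_pdivrMr.
have rsq : r%:R <= r%:R ^+ 2 :> R by rewrite expr2 ler_peMr// ltW.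
(* About al n rows are handled by distance bounds alone; al is so small that their total cost stays
   below e1 n. *)
pose b := Num.truncn (al * n%:R).
have /andP[b1 b2] : b%:R <= al * n%:R < b.+1%:R.
  by apply: truncn_itv; rewrite mulr_ge0// ltW.
have b3 : al / 2 * n%:R <= b%:R by move: b2; rewrite -natr1; move: aln; lra.
have rb : (r <= b)%N.
  rewrite -(ler_nat R); apply: le_trans b3.
  apply: (@le_trans _ _ (al / 2 * r%:R ^+ 3)); last by rewrite ler_pM2l// divr_gt0.
  have : 4 * r%:R ^+ 2 <= al * r%:R ^+ 3 by rewrite [r%:R ^+ 3]exprS mulrA ler_wpM2r ?exprn_ge0.
  lra.
have b0 : (0 < b)%N by exact: leq_trans rb.
have bn : (b < n)%N by rewrite -(ltr_nat R); apply: (le_lt_trans b1); nra.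
have bR0 : 0 < b%:R :> R by rewrite ltr0n.
pose h := et * n%:R; have h0 : 0 < h by rewrite mulr_gt0.
pose t := k * n%:R; have t0 : 0 < t by rewrite mulr_gt0.
have nsqa := nsq_ge0 a.
have E0 : 0 < tmom (nsq a) n n.
  apply: lt_le_trans (tmom_ge (n := n) _); last by rewrite nsqa.
  by rewrite divr_gt0 ?mulr_gt0 ?exprn_gt0 ?expR_gt0.
pose Z := tmom (nsq a) n n * expR (- (2 * e1 * n%:R)).
have Z0 : 0 < Z by rewrite mulr_gt0// expR_gt0.
pose K := expR (e1 * n%:R) * (3 * n%:R) ^+ b.
have n30 : 0 < 3 * n%:R :> R by rewrite mulr_gt0.
have K0 : 0 < K by rewrite mulr_gt0 ?expR_gt0 ?exprn_gt0.
have b' : (n' - b).+1 = (n - b)%N by rewrite subSn.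
have m12 : ((n' - b).+1 <= n - r <= n)%N by rewrite b' leq_sub2l// leq_subr.
have m1b : (n' - b + b <= n)%N by rewrite subnK// ltnW.
have l1n : n%:R = expR (ln n%:R) :> R by rewrite lnK ?posrE.
have lrho : ln (rho q) < 0 by rewrite ln_lt0 ?rho0.
apply: (@le_trans _ _ (pr x (fun xi => (grm (top iota (fun i => \row_(j < n) (a *+ (i == j :> nat))) (n - r) xi) < Z / K * expR (- (h * (n%:R / (cdist q * b%:R ^+ 2)) * (n' - b).+1%:R)) *
    \prod_((n' - b).+1 <= j < n - r) (cdist q * (n - j)%:R ^+ 2 / n%:R))%R))).
  apply: pr_le.
  - by apply: measf_lt; [apply: measf_grm; exact: mxmeasf_top|exact: measf_cst].
  - by apply: measf_lt; [apply: measf_grm; exact: mxmeasf_top|exact: measf_cst].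
  move=> xi H; apply: (lt_le_trans H) => {xi H}; rewrite b'.
  apply: (@le_trans _ _ (n%:R ^+ n * expR (nsq a - n%:R - 2) / n.+1%:R * expR (- (2 * e1 * n%:R)) * expR (- (e1 * n%:R)) *
      expR (- (e1 * n%:R)) * (expR (- (e1 * n%:R)) / (3 * n%:R) ^+ r))).
    have -> : forall u v1 v2 v3 v4 v5 : R, u * v1 / v2 * v3 * v4 * v4 * (v4 / v5) = u * (v1 * v3 * v4 * v4 * v4 * (v2^-1 * v5^-1)).
      by move=> *; ring.
    rewrite ler_pM2l ?exprn_gt0//.
    apply: (@le_trans _ _ (expR (nsq a - n%:R - 2) * expR (- (2 * e1 * n%:R)) * expR (- (e1 * n%:R)) * expR (- (e1 * n%:R)) * expR (- (e1 * n%:R)) * (expR (- (2 * ln n%:R)) * expR (- (2 * r%:R * ln n%:R))))).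
      rewrite -!expRD ler_expR.
      have A : r%:R * ln n%:R <= r%:R * r%:R :> R by rewrite ler_pM2l.
      have -> : 2 * r%:R * ln n%:R = 2 * (r%:R * ln n%:R) :> R by rewrite mulrA.
      have -> : 7 * e1 * n%:R = 7 * (e1 * n%:R) by rewrite mulrA.
      have -> : 2 * e1 * n%:R = 2 * (e1 * n%:R) by rewrite mulrA.
      by move: A l1 r16n rsq r1; rewrite expr2; lra.
    rewrite ler_pM2l; last by rewrite !mulr_gt0 ?expR_gt0.
    apply: ler_pM; rewrite ?expR_ge0// expRN lef_pV2 ?posrE ?expR_gt0 ?exprn_gt0//.
      rewrite expRM_natl -l1n expr2; apply: (@le_trans _ _ (3 * n%:R)); last by rewrite ler_pM2r.
      by rewrite -natr1; move: n3; lra.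
    have -> : 2 * r%:R * ln n%:R = r%:R * (2 * ln n%:R) :> R by rewrite mulrA [r%:R * 2]mulrC.
    rewrite expRM_natl; rewrite ler_pXn2r ?nnegrE ?expR_ge0 ?(ltW n30)// expRM_natl -l1n expr2 ler_pM2r//.
  have tl := tmom_ge (n := n) (introT andP (conj nsqa an)).
  have pd := prod_dist_ge (introT andP (conj b0 (ltnW bn))) rb c'0 c'c al0 b3 b1 (le_trans al2 (ltac:(lra) : 2^-1 <= 1 :> R)).
  have dl : expR (- (e1 * n%:R)) <= expR (- (h * (n%:R / (cdist q * b%:R ^+ 2)) * (n - b)%:R)).
    rewrite ler_expR lerN2 mulrA.
    apply: (@le_trans _ _ (h * n%:R / (cdist q * b%:R ^+ 2) * n%:R)).
      apply: ler_wpM2l; last by rewrite ler_nat leq_subr.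
      by rewrite divr_ge0// mulr_ge0 ?exprn_ge0 ?(ltW h0) ?(ltW c0).
    rewrite ler_pM2r// ler_pdivrMr; last exact: mulr_gt0 c0 (exprn_gt0 _ bR0).
    apply: (@le_trans _ _ (e1 * (cdist q * (al / 2 * n%:R) ^+ 2))); last first.
      by rewrite !ler_pM2l// ler_pXn2r ?nnegrE// mulr_ge0 ?divr_ge0// ltW.
    rewrite /h; have -> : e1 * (cdist q * (al / 2 * n%:R) ^+ 2) = (e1 * cdist q * al ^+ 2 / 4) * n%:R * n%:R by field.
    by rewrite !ler_pM2r.
  have alle : al * n%:R * (2 - ln (c' * (al / 2) ^+ 2)) <= e1 * n%:R by rewrite mulrAC ler_pM2r.
  have pd2 : expR (- (e1 * n%:R)) / (3 * n%:R) ^+ r <= (\prod_(n - b <= j < n - r) (cdist q * (n - j)%:R ^+ 2 / n%:R)) / (3 * n%:R) ^+ b.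
    by apply: le_trans pd; rewrite ler_pM2r ?invr_gt0 ?exprn_gt0// ler_expR lerN2.
  rewrite [leRHS](_ : _ = tmom (nsq a) n n * expR (- (2 * e1 * n%:R)) * expR (- (e1 * n%:R)) *
     expR (- (h * (n%:R / (cdist q * b%:R ^+ 2)) * (n - b)%:R)) *
    ((\prod_(n - b <= j < n - r) (cdist q * (n - j)%:R ^+ 2 / n%:R)) / (3 * n%:R) ^+ b)); last first.
    by rewrite /Z /K invfM -expRN; ring.
  have Q0 : 0 <= expR (- (e1 * n%:R)) / (3 * n%:R) ^+ r by rewrite divr_ge0 ?expR_ge0 ?exprn_ge0 ?(ltW n30).
  have tl0 : 0 <= n%:R ^+ n * expR (nsq a - n%:R - 2) / n.+1%:R by rewrite divr_ge0 ?mulr_ge0 ?expR_ge0 ?exprn_ge0.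
  apply: ler_pM; rewrite ?mulr_ge0 ?expR_ge0//.
  apply: ler_pM; rewrite ?mulr_ge0 ?expR_ge0//.
  by rewrite ler_pM2r ?expR_gt0// ler_pM2r ?expR_gt0.
apply: (le_trans (pr_volume x_iid mu_std q01 conc iota_inj h0 k0 L0 t0 hm m1 E0 Z0 K0 m12 b0 m1b)).
rewrite lee_fin b'.
pose D := 2 * t + (n%:R * L ^+ 2 + 4 * (n%:R + nsq a)) / t + 2 * n%:R * k.
have D0 : 0 <= D.
  apply: addr_ge0; last by rewrite !mulr_ge0 ?(ltW k0).
  apply: addr_ge0; first by rewrite mulr_ge0 ?(ltW t0).
  apply: divr_ge0; last exact: ltW.
  apply: addr_ge0; first exact: mulr_ge0 (ltW y0) (sqr_ge0 L).
  by apply: mulr_ge0 => //; exact: addr_ge0 (ltW y0) nsqa.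
have hD : D <= 5 * (k * n%:R).
  have : (n%:R * L ^+ 2 + 4 * (n%:R + nsq a)) / t <= k * n%:R.
    apply: (@le_trans _ _ (n%:R * (L ^+ 2 + 8) / t)).
      by rewrite ler_pM2r ?invr_gt0//; move: an; lra.
    rewrite /t ler_pdivrMr// mulrACA [n%:R * (_ + _)]mulrC mulrA ler_pM2r//.
    by move: nD; rewrite ler_pdivrMr ?exprn_gt0// [k ^+ 2]expr2 mulrC.
  by rewrite /D /t; move=> H; apply: le_trans (lerD (lerD (lexx _) H) (lexx _)) _; lra.
have T1 : Z * ((1 + D / h) ^+ 2) ^+ n / tmom (nsq a) n n <= expR (- (e1 * n%:R)).
  rewrite /Z -!mulrA mulrC -!mulrA mulVf ?gt_eqF// mulr1 -exprM.
  have Dh : D / h <= e1 / 2.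
    rewrite ler_pdivrMr// (le_trans hD)// kE /h.
    by have -> : 5 * (e1 * et / 10 * n%:R) = e1 / 2 * (et * n%:R) by field.
  apply: (@le_trans _ _ (expR (- (2 * (e1 * n%:R))) * expR (e1 * n%:R))).
    rewrite ler_pM2l ?expR_gt0//.
    have -> : e1 * n%:R = e1 / 2 * (2 * n)%:R by rewrite natrM mulrA divfK.
    rewrite expRM_natr; apply: lerXn2r; rewrite ?nnegrE ?expR_ge0//.
      by apply: addr_ge0 => //; exact: divr_ge0 D0 (ltW h0).
    by apply: le_trans (expR_ge1Dx _); rewrite lerD2l.
  by rewrite -expRD ler_expR; lra.
have T2 : K^-1 * (n%:R + nsq a + h) ^+ (n - (n - b)) <= expR (- (e1 * n%:R)).
  rewrite subKn ?(ltnW bn)// /K invfM -expRN -mulrA ler_piMr ?expR_ge0// mulrC ler_pdivrMr ?exprn_gt0// mul1r.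
  have B : 0 <= n%:R + nsq a + h by apply: addr_ge0 (addr_ge0 (ltW y0) nsqa) (ltW h0).
  apply: lerXn2r; rewrite ?nnegrE ?B ?(ltW n30)//.
  have : h <= n%:R by rewrite /h -[leRHS]mul1r ler_pM2r.
  by move: an; lra.
have R0 : 0 <= rho q ^+ r by rewrite exprn_ge0// ltW.
have T3 : n%:R * rho q ^+ (n - (n - r)).+1 <= n%:R * rho q ^+ r.
  rewrite ler_pM2l// ler_wiXn2l ?(ltW rho0) ?(ltW rho1)// subKn//.
  by rewrite (leq_trans rb) ?(ltnW bn).
have T4 : n%:R * rho q ^+ b <= n%:R * rho q ^+ r.
  by rewrite ler_pM2l// ler_wiXn2l ?(ltW rho0) ?(ltW rho1).
have E1 : expR (- (e1 * n%:R)) <= (n%:R ^+ 8)^-1.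
  have -> : (n%:R ^+ 8)^-1 = expR (- (8 * ln n%:R)) :> R by rewrite expRN expRM_natl -l1n.
  rewrite ler_expR lerN2; apply: le_trans r16n.
  by move: l1 rsq rr0; lra.
have E2 : rho q ^+ r <= (n%:R ^+ 8)^-1.
  have -> : (n%:R ^+ 8)^-1 = expR (- (8 * ln n%:R)) :> R by rewrite expRN expRM_natl -l1n.
  rewrite -[rho q]lnK ?posrE// -expRM_natr ler_expR lerNr -mulNr.
  by move: l2; rewrite mulrAC ler_pdivlMr// [ln n%:R * 8]mulrC.
have nV : 0 < (n%:R ^+ 8)^-1 :> R by rewrite invr_gt0 exprn_gt0.
apply: (@le_trans _ _ (4 * (n%:R * (n%:R ^+ 8)^-1))).
  have F1 : n%:R * rho q ^+ r <= n%:R * (n%:R ^+ 8)^-1 by rewrite ler_pM2l.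
  have F2 : (n%:R ^+ 8)^-1 <= n%:R * (n%:R ^+ 8)^-1 :> R by rewrite ler_peMl ?(ltW nV)//; move: n3; lra.
  apply: (le_trans (lerD (lerD (lerD T1 T2) T3) T4)).
  by move: E1 F1 F2; lra.
have -> : 4 * (n%:R * (n%:R ^+ 8)^-1) = 4 / n%:R ^+ 3 * (n%:R ^+ 4)^-1 :> R.
  by field; rewrite gt_eqF.
rewrite ler_piMl ?invr_ge0 ?exprn_ge0// ler_pdivrMr ?exprn_gt0// mul1r.
rewrite !exprS expr0 mulr1; have : 3 * 3 <= n%:R * n%:R :> R by apply: ler_pM.
by move: n3; move: (n%:R) => y n3 yy; nra.
Qed.

Lemma pr_volume_near (e1 : R) : 0 < e1 -> \forall n \near \oo, forall a : C, nsq a <= n%:R ->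
  (pr x (fun xi => (grm (top iota (Vdiag n a) (n - rt n) xi) < n%:R ^+ n * expR (nsq a - n%:R - 7 * e1 * n%:R))%R)
   <= ((n%:R ^+ 4)^-1)%:E)%E.
Proof.
move=> e10; have c0 := cdist_gt0 q01; have /andP[rho0 rho1] := rho01 q01.
have c'0 : 0 < Num.min 1 (cdist q / 3) <= 1 by rewrite lt_min ltr01 divr_gt0//= ge_min lexx.
have [al al12 hal] := alpha_exists c'0 e10; have /andP[al0 _] := al12.
pose et := Num.min 1 (e1 * cdist q * al ^+ 2 / 4).
have et0 : 0 < et by rewrite /et lt_min ltr01/= divr_gt0// mulr_gt0 ?exprn_gt0// mulr_gt0.
pose k := e1 * et / 10; have k0 : 0 < k by rewrite divr_gt0// mulr_gt0.
have [L L0 [m hm m1]] := ntrunc_tail mu_std k0.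
have lnr : 0 < - ln (rho q) by rewrite oppr_gt0 ln_lt0 ?rho0.
have key n r (a : C) : nsq a <= n%:R -> 3 <= n%:R :> R -> (L ^+ 2 + 8) / k ^+ 2 <= n%:R -> 4 / al <= n%:R ->
  1 <= r%:R :> R -> 16 / e1 <= r%:R -> 4 / al <= r%:R -> (r ^ 16 <= n)%N ->
  ln n%:R <= r%:R :> R -> ln n%:R <= - ln (rho q) / 8 * r%:R ->
  (pr x (fun xi => (grm (top iota (Vdiag n a) (n - r) xi) < n%:R ^+ n * expR (nsq a - n%:R - 7 * e1 * n%:R))%R)
   <= ((n%:R ^+ 4)^-1)%:E)%E.
  case: n => [|n'] an n3; first by move: n3; rewrite lern0.
  exact: (pr_volume_at e10 al12 hal (erefl k) L0 hm m1 an n3).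
near=> n; move=> a an.
have n3 : 3 <= n%:R :> R by near: n; exact: near_nat.
have nD : (L ^+ 2 + 8) / k ^+ 2 <= n%:R by near: n; exact: near_nat.
have nb : 4 / al <= n%:R by near: n; exact: near_nat.
have r1 : 1 <= (rt n)%:R :> R by near: n; exact: near_rt.
have r2 : 16 / e1 <= (rt n)%:R by near: n; exact: near_rt.
have r3 : 4 / al <= (rt n)%:R by near: n; exact: near_rt.
have l1 : ln n%:R <= 1 * (rt n)%:R :> R by near: n; exact: near_ln_rt ltr01.
have l2 : ln n%:R <= - ln (rho q) / 8 * (rt n)%:R by near: n; apply: near_ln_rt; rewrite divr_gt0.
rewrite mul1r in l1; apply: key => //; exact: rt_le.
Unshelve. all: end_near. Qed.

End volume_asymptotics.

Section lower_bound.
Context d (T : measurableType d) (R : realType) (P : probability T R).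
Notation C := R[i].
Variable x : nat * nat -> {RV P >-> C}.
Hypothesis x_iid : iid x.
Local Notation mu := (distribution P (x (0%N, 0%N))).
Hypothesis mu_std : std_law mu.
Variable q : R.
Hypothesis q01 : 0 < q < 1.
Hypothesis conc : forall v s, 1 <= s ->
  (\int[mu]_u (expR (- (s * nsq (u - v))))%:E <= q%:E)%E.
Variable iota : nat -> nat -> nat * nat.
Hypothesis iota_inj : inj2 iota.

Lemma ex_nsq_coord e : ex x (fun xi => (nsq (xi e))%:E) = 1%E.
Proof.
rewrite (ex_EJ x_iid [:: e]); last 2 first.
- by move=> xi; rewrite lee_fin nsq_ge0.
- by apply: measf_EFin; apply: measf_nsq; exact: cmeasf_coord.
rewrite -[RHS](ex_cst x); congr (ex x _); apply/funext => xi.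
have [m1 _ _] := mu_std; rewrite /EJ /= /E1 -[RHS]m1; apply: eq_integral => u _.
by rewrite /upd eqxx.
Qed.

Lemma pr_frob (m n : nat) (e : 'I_m -> 'I_n -> nat * nat) (L : R) : 0 < L ->
  (pr x (fun xi => ~~ (fr (\matrix_(i, j) (xi (e i j) : C)) <= L)%R) <= ((m * n)%:R / L)%:E)%E.
Proof.
move=> L0; have mM : mxmeasf (fun xi : cfg R => \matrix_(i < m, j < n) (xi (e i j) : C)).
  by move=> i j; under eq_fun do rewrite mxE; exact: cmeasf_coord.
have mF := measf_fr mM.
apply: (@le_trans _ _ (pr x (fun xi => (L <= fr (\matrix_(i, j) (xi (e i j) : C)))%R))).
  apply: pr_le.
  - by apply: measf_neg; apply: measf_le => //; exact: measf_cst.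
  - by apply: measf_le => //; exact: measf_cst.
  by move=> xi; rewrite -ltNge => /ltW.
apply: (le_trans (markov_ex x _ mF L0)); first by move=> xi; exact: fr_ge0.
rewrite mulrC EFinM; apply: lee_wpmul2l; first by rewrite lee_fin invr_ge0 ltW.
have mc e' : measurable_fun setT (fun t => (nsq (config x t e'))%:E).
  by apply: (measf_config x (f := fun xi : cfg R => (nsq (xi e'))%:E)); apply: measf_EFin; apply: measf_nsq; exact: cmeasf_coord.
rewrite /ex; under eq_integral => t _.
  rewrite /fr -sumEFin; under eq_bigr => i _ do (rewrite -sumEFin; under eq_bigr => j _ do rewrite mxE).
  over.
rewrite ge0_integral_sum//; last 2 first.
- by move=> i; apply: emeasurable_sum => j.
- by move=> i t _; apply: sume_ge0 => j _; rewrite lee_fin nsq_ge0.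
under eq_bigr => i _.
  rewrite ge0_integral_sum//; last by move=> j t _; rewrite lee_fin nsq_ge0.
  under eq_bigr => j _ do rewrite -/(ex x (fun xi => (nsq (xi (e i j)))%:E)) ex_nsq_coord.
  rewrite sumEFin sumr_const card_ord.
  over.
by rewrite sumEFin sumr_const card_ord -mulrnA mulnC.
Qed.

(** With x = sqrt q, 1 - x^d >= exp (- x^d / (1 - x)) and the exponents are summable, so 1 - theta
    stays above a positive constant whatever the number of steps. *)
Lemma theta_pow_le n r : (r <= n)%N ->
  theta n q r ^+ r <= expR (- (expR (- ((1 - expR (ln q / 2)) ^+ 2)^-1) * r%:R)).
Proof.
move=> rn; have /andP[q0 q1] := q01; have /andP[t0 t1] := theta01 n q01 r.
set xx := expR (ln q / 2).
have x1 : xx < 1 by rewrite /xx -[ltRHS]expR0 ltr_expR; have := ln_lt0 q01; lra.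
have x0 : 0 < xx by exact: expR_gt0.
set c := expR (- ((1 - xx) ^+ 2)^-1).
have h : c <= 1 - theta n q r.
  rewrite one_sub_theta//.
  apply: (@le_trans _ _ (\prod_(1 <= d0 < r.+1) expR (- (xx ^+ d0 / (1 - xx))))).
    rewrite -(big_morph _ (@expRD R) (@expR0 R)) ler_expR sumrN lerN2 -mulr_suml -exprVn expr2 ler_pM2r ?invr_gt0 ?subr_gt0//.
    rewrite -[leRHS]div1r ler_pdivlMr ?subr_gt0//.
    rewrite big_add1 /= big_mkord.
    have := subrX1 xx r => E; have G : (\sum_(i < r) xx ^+ i.+1) * (1 - xx) = xx * (1 - xx ^+ r).
      by rewrite -[1 - xx ^+ r]opprB E -mulNr opprB mulrCA mulrC; congr (_ * _); rewrite mulr_sumr; apply: eq_bigr => i _; rewrite exprS.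
    rewrite G; have : 0 <= xx ^+ r by rewrite exprn_ge0// ltW.
    by move: x0 x1; nra.
  rewrite big_nat_cond [leRHS]big_nat_cond; apply: ler_prod => i; rewrite andbT => /andP[i1 _].
  rewrite expR_ge0/= -mulrA expRM_natl -/xx.
  have xi0 : 0 < xx ^+ i by rewrite exprn_gt0.
  have xix : xx ^+ i <= xx by case: i i1 {xi0} => // i _; rewrite exprS ler_piMr ?(ltW x0)// exprn_ile1// ltW.
  have xi1 : 0 < 1 - xx ^+ i by lra.
  rewrite -[leRHS]invrK expRN lef_pV2 ?posrE ?invr_gt0 ?expR_gt0//.
  apply: le_trans (expR_ge1Dx _).
  rewrite -[leLHS]mul1r ler_pdivrMr// mulrDl mul1r.
  have : xx ^+ i <= xx ^+ i / (1 - xx) * (1 - xx ^+ i).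
    by rewrite mulrAC ler_pdivlMr ?subr_gt0// ler_pM2l//; lra.
  lra.
rewrite -mulNr expRM_natr; apply: lerXn2r; rewrite ?nnegrE ?expR_ge0//.
by apply: le_trans (expR_ge1Dx _); lra.
Qed.

Section at_size.
Variables (m' r : nat) (w : 'I_r -> C) (gap v : R).
Local Notation m := m'.+1.
Local Notation n := (m'.+1 + r)%N.
Local Notation y := (n%:R : R).
Local Notation topl l := (top iota (wshift m' r w l)).
Let pt2 : R := (y ^+ (60 * (r * r)))^-1.

(** There are four ways to leave [gd], each of probability at most n^-2; the remaining term is the
    death of all points. *)
Lemma pr_det_small : (0 < r)%N -> (100 <= n)%N -> 0 < gap <= 1 -> 4 / gap <= y ^+ 4 ->
  (cdist q)^-1 <= y -> y^-1 <= - ln q / 2 -> (forall l, nsq (w l) <= 1) ->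
  (forall j l, j != l -> gap <= nsq (w j - w l)) -> (r ^ 6 + r * r ^ 6 <= m')%N ->
  ln y <= r%:R -> 49 <= r%:R * - ln (rho q) -> 0 < v ->
  (forall l, (pr x (fun xi => (grm (topl l m xi) < v)%R) <= ((y ^+ 4)^-1)%:E)%E) ->
  (pr x (fun xi => [forall l, (grm (topl l n xi) < pt2 ^+ r * v)%R]) <=
   (4 * (y ^+ 2)^-1 + theta n q r ^+ r)%:E)%E.
Proof.
move=> r1 n100 /andP[gap0 gap1] hgap hc hq w1 wgap rm lny hr v0 hv.
have rn : (r <= n)%N by rewrite leq_addl.
have mn : (m <= n)%N by rewrite leq_addr.
have y100 : 100 <= y by rewrite -[100]/(100%:R) ler_nat.
have y1 : 1 <= y by move: y100; lra.
have y0 : 0 < y by lra.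
have k10 : (0 < r ^ 6)%N by rewrite expn_gt0 r1.
have pk1 : ((m' - r ^ 6).+1 + r ^ 6)%N = m.
  by rewrite addSn subnK// (leq_trans _ rm)// leq_addr.
have /andP[q0 q1] := q01; have /andP[rho0 rho1] := rho01 q01.
have beta0 : 0 < (y ^+ (5 * r + 4))^-1 by rewrite invr_gt0 exprn_gt0.
have kap0 : 0 < (y ^+ (20 * (r * r) + 5 * r + 5))^-1 by rewrite invr_gt0 exprn_gt0.
have L1 : 1 <= y ^+ 5 by rewrite exprn_ege1.
have s20 : 0 < (y ^+ (58 * (r * r)))^-1 by rewrite invr_gt0 exprn_gt0.
have t20 : 0 < pt2 by rewrite invr_gt0 exprn_gt0.
have gap01 : 0 < gap <= 1 by rewrite gap0.
pose L := y ^+ 5; pose N := (n ^ (20 * (r * r)))%N; pose th := (y ^+ (10 * r))^-1.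
pose beta := (y ^+ (5 * r + 4))^-1; pose kap := (y ^+ (20 * (r * r) + 5 * r + 5))^-1.
pose s2 := (y ^+ (58 * (r * r)))^-1; pose p := (m' - r ^ 6)%N.
have pth : 0 < th <= 1 by apply: par_th.
have pN3 : (2 < N)%N by apply: par_N3.
have pkp : 6 * kap <= th ^+ 2 ^+ r * beta by apply: par_kap.
have phth : 6 * (r * r)%:R ^+ 2 * th ^+ 2 * L ^+ r <= beta by apply: par_hth.
have phN : 12 * (r * r)%:R ^+ 2 * L ^+ r / N%:R ^+ 2 <= th ^+ 2 ^+ r * beta by apply: par_N.
have pLb : m%:R ^+ 3 / (cdist q * (r ^ 6)%:R ^+ 2) <= L by apply: par_Lb.
have pbt : 4 * beta * m%:R ^+ 2 * L ^+ r <= 1 by apply: par_beta.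
have ps2 : s2 * ri_const m' r r gap L kap <= 1 by apply: par_s2.
have pst : n%:R * pt2 <= s2 * (- ln q / 2) by apply: par_t2.
eapply le_trans; first by apply: (@pr_last_rows _ _ R P x x_iid q q01 conc iota iota_inj m' r r p (r ^ 6) N w gap L kap th beta s2 pt2 v) => //.
rewrite EFinD; apply: leeD => //.
have mA1 : measf (fun xi : cfg R => ~~ (fr (Zmx (iotaT iota) m' xi) <= L)).
  by apply: measf_neg; apply: measf_le; [apply: measf_fr; exact: mxmeasf_top|exact: measf_cst].
have mA2 : measf (fun xi : cfg R => ~~ (fr (Gmx (iotaT iota) m' r xi) <= L)).
  by apply: measf_neg; apply: measf_le; [apply: measf_fr; exact: mxmeasf_Gmx|exact: measf_cst].
have mA3 : measf (fun xi : cfg R => ~~ net_good q iota m' r r p (r ^ 6) N th beta xi).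
  by apply: measf_neg; apply: measf_net_good.
have mA4 : measf (fun xi : cfg R => has (fun l => (grm (topl l m xi) < v)%R) (enum 'I_r)).
  by apply: measf_has => l; apply: measf_lt; [apply: measf_grm; exact: mxmeasf_top|exact: measf_cst].
have m12 := measf_or mA1 mA2; have m123 := measf_or m12 mA3; have m1234 := measf_or m123 mA4.
apply: (@le_trans _ _ (pr x (fun xi => ((~~ (fr (Zmx (iotaT iota) m' xi) <= L) || ~~ (fr (Gmx (iotaT iota) m' r xi) <= L)) ||
   ~~ net_good q iota m' r r p (r ^ 6) N th beta xi) || has (fun l => (grm (topl l m xi) < v)%R) (enum 'I_r)))).
  apply: pr_le => //; first by apply: measf_neg; apply: measf_gd.
  move=> xi; apply: contraTT; rewrite !negb_or !negbK => /andP[/andP[/andP[h1 h2] h3] /hasPn h4].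
  by rewrite /gd h1 h2 h3 /=; apply/forallP => l; rewrite leNgt; apply: h4; rewrite mem_enum.
have y2 : 0 < (y ^+ 2)^-1 by rewrite invr_gt0 exprn_gt0.
have L0 : 0 < L by rewrite exprn_gt0.
have -> : 4 * (y ^+ 2)^-1 = (y ^+ 2)^-1 + (y ^+ 2)^-1 + (y ^+ 2)^-1 + (y ^+ 2)^-1 by ring.
have Lb a b : (a <= n)%N -> (b <= n)%N -> (a * b)%:R / L <= (y ^+ 2)^-1.
  move=> an bn; rewrite natrM ler_pdivrMr// [leRHS]mulrC ler_pdivlMr ?exprn_gt0//.
  apply: (@le_trans _ _ (y ^+ 2 * y ^+ 2)); last by rewrite -exprD ler_weXn2l.
  by rewrite ler_pM2r ?exprn_gt0// [y ^+ 2]expr2; apply: ler_pM; rewrite ?ler_nat.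
apply: (le_trans (pr_or _ _ _)) => //; rewrite [leRHS]EFinD; apply: leeD; last first.
  apply: (@le_trans _ _ (\sum_(l <- enum 'I_r) (y ^+ 4)^-1)%:E).
    apply: pr_has => [l|l _]; last exact: hv.
    by apply: measf_lt; [apply: measf_grm; exact: mxmeasf_top|exact: measf_cst].
  rewrite lee_fin big_enum sumr_const card_ord -[leLHS]mulr_natl.
  rewrite ler_pdivrMr ?exprn_gt0// mulrC ler_pdivlMr ?exprn_gt0// [_ ^+ 4](exprD _ 2 2).
  rewrite ler_pM2r ?exprn_gt0//; apply: (@le_trans _ _ y); first by rewrite ler_nat.
  by rewrite expr2 ler_peMl// ltW.
apply: (le_trans (pr_or _ _ _)) => //; rewrite [leRHS]EFinD; apply: leeD; last first.
  apply: (le_trans (pr_net_bad x_iid q01 conc iota_inj r N pk1 k10 pth L1 pLb pbt beta0)).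
  rewrite lee_fin; apply: le_trans (par_net r1 rn n100 (introT andP (conj rho0 rho1)) mn lny hr).
  have qr : q <= rho q.
    by rewrite -[leLHS](rho4 q01) [rho q ^+ 4]exprS ler_piMr ?(ltW rho0)// exprn_ile1 ?ltW.
  have kr : (r ^ 6 <= m - r * r ^ 6)%N by move: rm; move: (r ^ 6)%N (r * r ^ 6)%N; clear; lia.
  have qm : q ^+ (m - r * r ^ 6) <= rho q ^+ (r ^ 6).
    apply: (@le_trans _ _ (rho q ^+ (m - r * r ^ 6))); first by apply: lerXn2r; rewrite ?nnegrE ?(ltW q0) ?(ltW rho0).
    by rewrite ler_wiXn2l ?(ltW rho0) ?(ltW rho1).
  rewrite ler_wpM2l ?mulr_ge0 ?exprn_ge0// lerD2l ler_pM2l ?expR_gt0//.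
apply: (le_trans (pr_or _ _ _)) => //; rewrite EFinD; apply: leeD.
  apply: (@le_trans _ _ ((m * m)%:R / L)%:E); last by rewrite lee_fin Lb.
  apply: le_trans (pr_frob (fun (i j : 'I_m) => iotaT iota i j) L0).
  rewrite le_eqVlt; apply/orP; left; apply/eqP; congr (pr x _); apply/funext => xi; congr (~~ (fr _ <= L)).
  by apply/matrixP => i j; rewrite !mxE subr0.
apply: (@le_trans _ _ ((r * m)%:R / L)%:E); last by rewrite lee_fin Lb.
exact: (pr_frob (fun (i : 'I_r) (j : 'I_m) => iotaT iota (m + i) j) L0).
Qed.

End at_size.

(* The points [w l] lie on a short segment issued from [z]; the same potential lower bound holds at one of them with overwhelming probability. *)
Lemma pr_det_small_near (z : C) (dl ep : R) : nsq z < 1 -> 0 < dl -> 0 < ep ->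
  \forall n \near \oo, exists w : 'I_(rt n) -> C, (forall l, nsq (w l - z) <= dl) /\
  (pr x (fun xi => [forall l, (nsq (\det (top iota (Vdiag n ((Num.sqrt (n%:R : R))%:C * w l)) n xi)) <
      n%:R ^+ n * expR (n%:R * (nsq z - 1 - ep)))%R]) <= (5 * (n%:R ^+ 2)^-1)%:E)%E.
Proof.
move=> z1 dl0 ep0; have /andP[q0 q1] := q01; have /andP[rho0 rho1] := rho01 q01.
have lnr : 0 < - ln (rho q) by rewrite oppr_gt0 ln_lt0 ?rho0.
have lnq : 0 < - ln q / 2 by rewrite divr_gt0// oppr_gt0 ln_lt0.
have c0 := cdist_gt0 q01.
(* Small enough that every point stays in the unit disk and close to z, and that nsq (w l) is at
   least nsq z - ep / 4. *)
pose t := Num.min (Num.min 1 (Num.min dl ((1 - nsq z) / 3))) (ep / 8).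
have t0 : 0 < t by rewrite !lt_min ltr01 dl0 !divr_gt0// subr_gt0.
have t1 : t <= 1 by rewrite /t !ge_min lexx.
have t2 : t <= dl by rewrite /t !ge_min lexx !orbT.
have t3 : t <= (1 - nsq z) / 3 by rewrite /t !ge_min lexx !orbT.
have t4 : t <= ep / 8 by rewrite /t !ge_min lexx !orbT.
pose w r (l : 'I_r) : C := z + (t * l.+1%:R / r%:R)%:C.
have nw r (l : 'I_r) (s := t * l.+1%:R / r%:R) : 0 <= s <= t.
  have r0 : 0 < r%:R :> R by rewrite ltr0n (leq_ltn_trans _ (ltn_ord l)).
  rewrite /s divr_ge0 ?mulr_ge0 ?(ltW t0)//= ler_pdivrMr// ler_pM2l// ler_nat; exact: ltn_ord.
have Rez : `|complex.Re z| <= 1.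
  move: z1; rewrite /nsq ler_norml; move: (complex.Re z) (complex.Im z) => a b z1.
  by apply/andP; split; nra.
have nsqw r (l : 'I_r) : nsq z - 2 * t <= nsq (w r l) <= nsq z + 3 * t.
  have /andP[] := nw r l; rewrite /w; move: (t * _ / _) => s s0 st.
  have -> : nsq (z + s%:C) = nsq z + s * (2 * complex.Re z + s).
    by case: z {z1 t t0 t1 t2 t3 t4 w nw s0 st Rez} => a b; rewrite /nsq /=; ring.
  move: Rez; rewrite ler_norml => /andP[]; move: (complex.Re z) (nsq z) => a b h1 h2.
  by apply/andP; split; nra.
have e1 : 0 < ep / 28 by rewrite divr_gt0.
pose cc := expR (- ((1 - expR (ln q / 2)) ^+ 2)^-1).
have cc0 : 0 < cc / 2 by rewrite divr_gt0// expR_gt0.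
have key m' r (n := (m'.+1 + r)%N) (gap := (t / r%:R) ^+ 2) : (0 < r)%N -> (100 <= n)%N -> gap <= 1 ->
    4 / gap <= n%:R ^+ 4 ->
    (cdist q)^-1 <= n%:R -> n%:R^-1 <= - ln q / 2 -> (r ^ 6 + r * r ^ 6 <= m')%N -> ln n%:R <= r%:R :> R ->
    49 <= r%:R * - ln (rho q) -> 120 / ep <= r%:R -> r%:R ^+ 5 <= n%:R :> R -> ln n%:R <= cc / 2 * r%:R ->
    (forall a : C, nsq a <= n%:R ->
    (pr x (fun xi => (grm (top iota (Vdiag n a) (n - r) xi) < n%:R ^+ n * expR (nsq a - n%:R - 7 * (ep / 28) * n%:R))%R)
     <= ((n%:R ^+ 4)^-1)%:E)%E) ->
    (pr x (fun xi => [forall l, (nsq (\det (top iota (Vdiag n ((Num.sqrt (n%:R : R))%:C * w r l)) n xi)) <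
      n%:R ^+ n * expR (n%:R * (nsq z - 1 - ep)))%R]) <= (5 * (n%:R ^+ 2)^-1)%:E)%E.
  move=> r0 n100 gap1 hgap hc hq rm lny hr re r5 l2 hv.
  have y0 : 0 < n%:R :> R by rewrite ltr0n (leq_trans _ n100).
  have rp : 0 < r%:R :> R by rewrite ltr0n.
  (* A quarter of ep is lost in the volume estimate and a quarter in nsq (w l); the other half pays
     for [pt2 ^+ r]. *)
  pose v : R := n%:R ^+ n * expR (n%:R * (nsq z - 1 - ep / 2)).
  have v0 : 0 < v by rewrite mulr_gt0 ?exprn_gt0 ?expR_gt0.
  have gap0 : 0 < gap by rewrite exprn_gt0// divr_gt0.
  have w1 l : nsq (w r l) <= 1 by have /andP[_ h] := nsqw r l; move: h t3; lra.
  have wgap (j l : 'I_r) : j != l -> gap <= nsq (w r j - w r l).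
    move=> jl; have -> : w r j - w r l = (t / r%:R * (j%:R - l%:R))%:C.
      rewrite /w opprD addrACA subrr add0r -rmorphB /=; congr (_%:C); rewrite -!natr1; ring.
    rewrite nsqC exprMn ler_peMr ?(ltW gap0)//.
    have h1 : (j%:Z - l%:Z)%R != 0 by rewrite subr_eq0; move: jl; rewrite -val_eqE /=; clear; lia.
    have -> : (j%:R - l%:R : R) = (j%:Z - l%:Z)%:~R by rewrite rmorphB.
    rewrite -[1]/(1%:~R) -rmorphXn ler_int -gtz0_ge1; move: h1; move: (_ - _) => k h1.
    by rewrite exprn_even_gt0//= h1.
  have hv' l : (pr x (fun xi => (grm (top iota (wshift m' r (w r) l) m'.+1 xi) < v)%R) <= ((n%:R ^+ 4)^-1)%:E)%E.
    pose a : C := (Num.sqrt (n%:R : R))%:C * w r l.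
    have aE : nsq a = n%:R * nsq (w r l) by rewrite /a nsqM nsqC sqr_sqrtr// ltW.
    apply: le_trans (hv a _); last by rewrite aE ler_piMr// ltW.
    have -> : (n - r = m'.+1)%N by rewrite addnK.
    apply: pr_le.
    - by apply: measf_lt; [apply: measf_grm; exact: mxmeasf_top|exact: measf_cst].
    - by apply: measf_lt; [apply: measf_grm; exact: mxmeasf_top|exact: measf_cst].
    move=> xi h; apply: (lt_le_trans h); rewrite ler_pM2l ?exprn_gt0// ler_expR aE.
    have -> : n%:R * nsq (w r l) - n%:R - 7 * (ep / 28) * n%:R = n%:R * (nsq (w r l) - 1 - ep / 4) by field.
    by rewrite ler_pM2l//; have /andP[h1 _] := nsqw r l; move: h1 t4; lra.
  have D := pr_det_small r0 n100 (introT andP (conj gap0 gap1)) hgap hc hq w1 wgap rm lny hr v0 hv'.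
  refine (le_trans (le_trans _ D) _).
    apply: pr_le.
    - apply: measf_forall => l; apply: measf_lt; last exact: measf_cst.
      by apply: measf_nsq; apply: cmeasf_det; exact: mxmeasf_top.
    - apply: measf_forall => l; apply: measf_lt; last exact: measf_cst.
      by apply: measf_grm; exact: mxmeasf_top.
    move=> xi /forallP h; apply/forallP => l; have := h l.
    rewrite -(@grm_square _ (m' + r)%N) => {h} h; apply: (lt_le_trans h).
    rewrite /v mulrCA ler_pM2l ?exprn_gt0//.
    have -> : ((n%:R ^+ (60 * (r * r)))^-1) ^+ r = expR (- ((60 * (r * r) * r)%:R * ln n%:R)) :> R.
      by rewrite exprVn -exprM expRN expRM_natl lnK ?posrE.
    rewrite -expRD ler_expR !natrM.
    have A : r%:R * r%:R * r%:R * ln n%:R <= r%:R * r%:R * r%:R * r%:R :> R by rewrite ler_pM2l ?mulr_gt0.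
    have B : 60 * (r%:R * r%:R * r%:R * r%:R) <= n%:R * (ep / 2).
      apply: (@le_trans _ _ (r%:R ^+ 5 * (ep / 2))); last by rewrite ler_pM2r// divr_gt0.
      have -> : 60 * (r%:R * r%:R * r%:R * r%:R) = (r%:R ^+ 4 : R) * 60 by ring.
      rewrite [_ ^+ 5]exprSr -mulrA ler_pM2l ?exprn_gt0//.
      by move: re; rewrite ler_pdivrMr//; lra.
    move: A B; have -> : 60 * (r%:R * r%:R) * r%:R * ln n%:R = 60 * (r%:R * r%:R * r%:R * ln n%:R) :> R by ring.
    have -> : n%:R * (nsq z - 1 - ep) = n%:R * (nsq z - 1 - ep / 2) - n%:R * (ep / 2) by field.
    by move: (r%:R * r%:R * r%:R * ln n%:R) (r%:R * r%:R * r%:R * r%:R : R) (n%:R * (ep / 2)) (n%:R * _) => *; lra.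
  rewrite lee_fin; have -> : 5 * (n%:R ^+ 2)^-1 = 4 * (n%:R ^+ 2)^-1 + (n%:R ^+ 2)^-1 :> R by ring.
  rewrite lerD2l; apply: (le_trans (theta_pow_le (leq_addl _ _))).
  have -> : (n%:R ^+ 2)^-1 = expR (- (2 * ln n%:R)) :> R by rewrite expRN expRM_natl lnK ?posrE.
  by rewrite ler_expR lerN2 -/cc; move: l2; lra.
near=> n.
have [r1 r3] : 1 <= (rt n)%:R :> R /\ 3 <= (rt n)%:R :> R by split; near: n; exact: near_rt.
have re : 120 / ep <= (rt n)%:R by near: n; exact: near_rt.
have rr : 49 / (- ln (rho q)) <= (rt n)%:R by near: n; exact: near_rt.
have nz : 4 / t ^+ 2 <= n%:R by near: n; exact: near_nat.
have nc : (cdist q)^-1 <= n%:R by near: n; exact: near_nat.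
have nq : (- ln q / 2)^-1 <= n%:R by near: n; exact: near_nat.
have n100 : (100 <= n)%N by near: n; exact: near_ge.
have l1 : ln n%:R <= 1 * (rt n)%:R :> R by near: n; exact: near_ln_rt ltr01.
have l2 : ln n%:R <= cc / 2 * (rt n)%:R by near: n; exact: near_ln_rt cc0.
have hv : forall a : C, nsq a <= n%:R ->
  (pr x (fun xi => (grm (top iota (Vdiag n a) (n - rt n) xi) < n%:R ^+ n * expR (nsq a - n%:R - 7 * (ep / 28) * n%:R))%R)
   <= ((n%:R ^+ 4)^-1)%:E)%E.
  by near: n; exact: (pr_volume_near x_iid mu_std q01 conc iota_inj e1).
have rn : (rt n ^ 16 <= n)%N := rt_le n.
rewrite mul1r in l1.
exists (w (rt n)); split.
  move=> l; have /andP[s0 st] := nw _ l; rewrite /w addrC addKr nsqC; move: s0 st; move: (t * _ / _) => s s0 st.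
  by apply: le_trans t2; nra.
move: (rt n) r1 r3 re rr l1 l2 hv rn => r r1 r3 re rr l1 l2 hv rn.
have r0 : (0 < r)%N by rewrite -(ltr0n R); lra.
have r3' : (3 <= r)%N by rewrite -(ler_nat R).
have r16 : (r ^ 2 * (r * r ^ 6) <= n)%N.
  by apply: leq_trans rn; rewrite -expnS -expnD leq_pexp2l.
have rn' : (r + (r ^ 6 + r * r ^ 6) < n)%N.
  apply: leq_trans r16; have h6 : (0 < r ^ 6)%N by rewrite expn_gt0 r0.
  have h1 : (r <= r * r ^ 6)%N by rewrite leq_pmulr.
  have h2 : (r ^ 6 <= r * r ^ 6)%N by rewrite leq_pmull.
  have h3 : (3 ^ 2 * (r * r ^ 6) <= r ^ 2 * (r * r ^ 6))%N by rewrite leq_mul2r leq_exp2r// r3' orbT.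
  have h4 : (0 < r * r ^ 6)%N by rewrite muln_gt0 r0.
  have gen a b : (r <= b -> a <= b -> 0 < b -> r + (a + b) < 3 ^ 2 * b)%N by clear; lia.
  exact: leq_trans (gen _ _ h1 h2 h4) h3.
have y0 : 0 < n%:R :> R by rewrite ltr0n (leq_trans _ n100).
have r5 : r%:R ^+ 5 <= n%:R :> R.
  by rewrite -natrX ler_nat (leq_trans _ rn)// leq_pexp2l.
have [m' nE] : exists m', n = (m'.+1 + r)%N.
  by exists (n - r).-1; rewrite prednK ?subn_gt0 ?subnK//; move: rn'; clear; lia.
have rm : (r ^ 6 + r * r ^ 6 <= m')%N.
  by move: rn'; rewrite nE; move: (r ^ 6 + r * r ^ 6)%N; clear; lia.
have rp : 0 < r%:R :> R by rewrite ltr0n.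
pose gap := (t / r%:R) ^+ 2.
have gap0 : 0 < gap by rewrite exprn_gt0// divr_gt0.
have gap1 : gap <= 1.
  by rewrite exprn_ile1 ?divr_ge0 ?(ltW t0)// ler_pdivrMr// mul1r (le_trans t1).
have hgap : 4 / gap <= n%:R ^+ 4.
  rewrite /gap expr_div_n invf_div mulrCA [_ ^+ 4](exprD _ 2 2).
  have rnR : r%:R <= n%:R :> R by rewrite ler_nat (leq_trans _ rn)// -[X in (X <= _)%N]expn1 leq_pexp2l.
  have n1 : 1 <= n%:R :> R by rewrite (le_trans r1).
  apply: ler_pM; rewrite ?exprn_ge0 ?divr_ge0 ?exprn_ge0 ?(ltW t0)//.
    by rewrite ler_pXn2r ?nnegrE.
  by apply: (le_trans nz); rewrite expr2 ler_peMl// ltW.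
have hq : n%:R^-1 <= - ln q / 2 by rewrite -[leRHS]invrK lef_pV2 ?posrE ?invr_gt0.
have hr : 49 <= r%:R * - ln (rho q) by rewrite -ler_pdivrMr.
rewrite nE; apply: key; rewrite -?nE//.
Unshelve. all: end_near. Qed.
End lower_bound.

(** * Averages over circles *)

Section roots_of_unity.
Variable R : realType.
Notation C := R[i].
Implicit Types (u z : C) (s : seq C).

Lemma prim_root_exists N : (0 < N)%N -> exists om : C, N.-primitive_root om.
Proof.
move=> N0; have [rs rsE] := closed_field_poly_normal ('X^N - 1 : {poly C}).
rewrite (monicP (monicXnsubC 1 N0)) scale1r in rsE.
have : has N.-primitive_root rs.
  apply: has_prim_root => //.
  - by apply/allP => z zr; rewrite /root_of_unity rsE root_prod_XsubC.
  - rewrite -(@separable_prod_XsubC C) -rsE; apply: separable_Xn_sub_1.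
    by rewrite pnatr_eq0 -lt0n.
  - by rewrite -ltnS -(size_prod_XsubC rs id) -rsE size_XnsubC.
by move=> /hasP[om _ h]; exists om.
Qed.

Lemma sum_prim_root N (om : C) k : N.-primitive_root om -> ~~ (N %| k)%N ->
  \sum_(j < N) (om ^+ j) ^+ k = 0.
Proof.
move=> pr; rewrite (prim_order_dvd pr) => k1.
have : (om ^+ k - 1) * \sum_(j < N) (om ^+ j) ^+ k = 0.
  under eq_bigr do rewrite exprAC.
  by rewrite -subrX1 exprAC (prim_expr_order pr) expr1n subrr.
by move=> /eqP; rewrite mulf_eq0 subr_eq0 (negPf k1) => /eqP.
Qed.

Lemma nsq_prim_root N (om : C) : N.-primitive_root om -> nsq om = 1.
Proof.
move=> pr; have : nsq om ^+ N = 1 by rewrite -nsqX (prim_expr_order pr) nsq1.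
by move=> /eqP; rewrite pexprn_eq1 ?nsq_ge0// => /orP[/eqP N0|/eqP//]; move: (prim_order_gt0 pr); rewrite N0.
Qed.

Lemma mean_value N (om : C) (p : {poly C}) : N.-primitive_root om -> (size p <= N)%N ->
  \sum_(j < N) p.[om ^+ j] = N%:R * p.[0].
Proof.
move=> pr sp; have N0 := prim_order_gt0 pr.
under eq_bigr do rewrite (horner_coef_wide _ sp).
rewrite exchange_big /= horner_coef0.
case: N pr sp N0 => // N pr sp _; rewrite big_ord_recl /= [X in _ + X]big1 ?addr0.
  under eq_bigr do rewrite expr0 mulr1.
  by rewrite sumr_const card_ord mulr_natl.
move=> i _; rewrite -mulr_sumr sum_prim_root ?mulr0//.
by rewrite gtnNdvd// /bump /= ltnS.
Qed.

Lemma nsq_sum_le (I : finType) (a : I -> C) : nsq (\sum_i a i) <= #|I|%:R * \sum_i nsq (a i).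
Proof.
have := fr_sum_le (fun i => (a i)%:M : 'M[C]_1).
by rewrite /fr !big_ord1 summxE; under eq_bigr do rewrite mxE eqxx mulr1n; under [in X in _ <= X -> _]eq_bigr do rewrite !big_ord1 mxE eqxx mulr1n.
Qed.

Lemma nsq_flip (rho : R) u om : nsq om = 1 -> nsq (rho%:C - u^*%C * om) = nsq (rho%:C * om - u).
Proof.
case: u om => a b [c e]; rewrite /nsq /= => h.
have aux P Q : P = Q + (rho ^+ 2 - a ^+ 2 - b ^+ 2) * (1 - (c ^+ 2 + e ^+ 2)) -> P = Q :> R.
  by move=> ->; rewrite h subrr mulr0 addr0.
by apply: aux; ring.
Qed.

(* The factors with [|u| <= rho] are replaced by their reflections across the circle, so that the constant coefficient becomes the product on the left. *)
Lemma prod_max_le_mean (s : seq C) (rho : R) N (om : C) : 0 <= rho -> N.-primitive_root om -> (size s < N)%N ->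
  \prod_(u <- s) Num.max (nsq u) (rho ^+ 2) <=
  N%:R^-1 * \sum_(j < N) \prod_(u <- s) nsq (rho%:C * om ^+ j - u).
Proof.
move=> r0 pr sN; have N0 := prim_order_gt0 pr; have NR : 0 < N%:R :> R by rewrite ltr0n.
pose f u : {poly C} := if rho ^+ 2 <= nsq u then rho%:C *: 'X - u%:P else (rho%:C)%:P - u^*%C *: 'X.
pose p := \prod_(u <- s) f u.
have sf u : (size (f u) <= 2)%N.
  rewrite /f; case: ifP => _; rewrite (leq_trans (size_polyD _ _))// size_polyN geq_max size_polyC;
    by rewrite (leq_trans (size_scale_leq _ _)) ?size_polyX//; case: (_ == 0).
have sp : (size p <= N)%N.
  apply: leq_trans sN; rewrite /p; elim: s {p} => [|u s IH]; first by rewrite big_nil size_poly1.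
  rewrite big_cons (leq_trans (size_polyMleq _ _))//.
  by move: (sf u) IH; move: (size _) (size _) => a b /=; clear; lia.
have p0 : nsq p.[0] = \prod_(u <- s) Num.max (nsq u) (rho ^+ 2).
  rewrite /p horner_prod nsq_prod; apply: eq_bigr => u _; rewrite /f maxEle.
  case: (leP (rho ^+ 2) (nsq u)) => h; rewrite !hornerE /=.
    by rewrite ?mulr0 ?sub0r nsqN; case: (leP (nsq u) (rho ^+ 2)) => // h2; apply: le_anti; rewrite h h2.
  by rewrite ?mulr0 subr0 nsqC (ltW h).
have pj j : nsq p.[om ^+ j] = \prod_(u <- s) nsq (rho%:C * om ^+ j - u).
  rewrite /p horner_prod nsq_prod; apply: eq_bigr => u _; rewrite /f.
  case: ifP => _; rewrite !hornerE//= nsq_flip//.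
  by rewrite nsqX (nsq_prim_root pr) expr1n.
rewrite -p0 mulrC ler_pdivlMr//.
have := nsq_sum_le (fun j : 'I_N => p.[om ^+ j]).
rewrite mean_value// nsqM card_ord -(rmorph_nat (real_complex R)) nsqC expr2 -mulrA ler_pM2l// mulrC.
by under eq_bigr do rewrite pj.
Qed.

(** Factors are exchanged one at a time, through b B - a A = b (B - A) + (b - a) A. *)
Lemma normc_prod_sub (I : Type) (r : seq I) (a b : I -> C) (M e : R) : 0 <= M -> 0 <= e ->
  (forall i, Normc.normc (a i) <= M) -> (forall i, Normc.normc (b i - a i) <= e) ->
  Normc.normc (\prod_(i <- r) b i - \prod_(i <- r) a i) <= (M + e) ^+ size r - M ^+ size r /\
  Normc.normc (\prod_(i <- r) a i) <= M ^+ size r.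
Proof.
move=> M0 e0 ha hb; have hb' i : Normc.normc (b i) <= M + e.
  by rewrite -[b i](subrK (a i)) addrC (le_trans (le_normcD _ _))// lerD.
have N0 (u : C) : 0 <= Normc.normc u by case: u => ? ?; exact: sqrtr_ge0.
elim: r => [|i r [IH1 IH2]]; first by rewrite !big_nil subrr Normc.normc0 expr0 Normc.normc1 subrr.
rewrite !big_cons /=; split; last by rewrite Normc.normcM exprS ler_pM.
set A := \prod_(j <- r) a j in IH1 IH2 *; set B := \prod_(j <- r) b j in IH1 *.
have -> : b i * B - a i * A = b i * (B - A) + (b i - a i) * A by ring.
apply: (le_trans (le_normcD _ _)); rewrite !Normc.normcM !exprS.
have -> : (M + e) * (M + e) ^+ size r - M * M ^+ size r = (M + e) * ((M + e) ^+ size r - M ^+ size r) + e * M ^+ size r by ring.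
by apply: lerD; apply: ler_pM.
Qed.

Lemma pow_perturb N : exists2 e : R, 0 < e & (2 + e) ^+ N <= 2 ^+ N + 1.
Proof.
have : \forall u \near (2 : R), u ^+ N < 2 ^+ N + 1.
  by have /cvgr_lt := @exprn_continuous R N 2; apply; rewrite ltrDl.
move=> /nbhs_ballP[dl /= dl0 h]; exists (dl / 2); first by rewrite divr_gt0.
apply: ltW; apply: h; rewrite /ball /= opprD addNKr normrN gtr0_norm ?divr_gt0//.
by rewrite ltr_pdivrMr// ltr_pMr// ltr1n.
Qed.

Lemma prod_sub_prim_root N (om v : C) : N.-primitive_root om ->
  \prod_(k < N) (v - om ^+ k) = v ^+ N - 1.
Proof.
move=> pr; have := congr1 (horner^~ v) (factor_Xn_sub_1 pr).
rewrite horner_prod big_mkord -polyC1 hornerD hornerN hornerC hornerXn => <-.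
by apply: eq_bigr => k _; rewrite hornerXsubC.
Qed.

(** For exact roots of unity the product is u^N - rho^N, of modulus at most 2 A^N with A = max (|u|,
    rho). A perturbation of size e A per factor adds at most A^N by [pow_perturb], and 9 is the
    square of 2 + 1. *)
Lemma prod_near_circle N (om : C) (rho : R) : 0 < rho -> N.-primitive_root om ->
  exists2 dl, 0 < dl & forall ze : 'I_N -> C, (forall k, nsq (ze k - rho%:C * om ^+ k) <= dl) ->
  forall u, \prod_(k < N) nsq (u - ze k) <= 9 * Num.max (nsq u) (rho ^+ 2) ^+ N.
Proof.
move=> r0 pr; have [e e0 eN] := pow_perturb N.
exists ((e * rho) ^+ 2); first by rewrite exprn_gt0// mulr_gt0.
move=> ze hze u; pose A := Num.max (Normc.normc u) rho.
have nn (v : C) : 0 <= Normc.normc v by case: v => ? ?; exact: sqrtr_ge0.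
have A0 : 0 < A by rewrite lt_max r0 orbT.
have A2 : A ^+ 2 = Num.max (nsq u) (rho ^+ 2).
  rewrite /A -normc_nsq !maxEle ler_pXn2r ?nnegrE ?(ltW r0)//.
  by case: ifP.
have no k : Normc.normc (rho%:C * om ^+ k) = rho.
  apply/eqP; rewrite -(@eqrXn2 _ 2) ?(ltW r0)// normc_nsq nsqM nsqC nsqX (nsq_prim_root pr) expr1n mulr1//.
have ha (k : 'I_N) : Normc.normc (u - rho%:C * om ^+ k) <= 2 * A.
  apply: (le_trans (le_normcD _ _)); rewrite normcN no.
  have a1 : Normc.normc u <= A by rewrite /A le_max lexx.
  have a2 : rho <= A by rewrite /A le_max lexx orbT.
  by rewrite mulr_natl mulr2n lerD.
have hb (k : 'I_N) : Normc.normc (u - ze k - (u - rho%:C * om ^+ k)) <= e * A.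
  have -> : u - ze k - (u - rho%:C * om ^+ k) = - (ze k - rho%:C * om ^+ k) by ring.
  apply: (@le_trans _ _ (e * rho)); last by rewrite ler_pM2l// /A le_max lexx orbT.
  by rewrite normcN -(@ler_pXn2r _ 2) ?nnegrE ?mulr_ge0 ?(ltW e0) ?(ltW r0)// normc_nsq.
have [h1 _] := normc_prod_sub (index_enum 'I_N) (ltac:(lra) : 0 <= 2 * A) (mulr_ge0 (ltW e0) (ltW A0)) ha hb.
have sN : size (index_enum 'I_N) = N by rewrite -[RHS]card_ord cardT enumT.
rewrite sN -mulrDl !exprMn in h1.
have h2 : Normc.normc (\prod_(k < N) (u - rho%:C * om ^+ k)) <= 2 * A ^+ N.
  have E : \prod_(k < N) (u - rho%:C * om ^+ k) = u ^+ N - rho%:C ^+ N.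
    have rC : rho%:C != 0 :> C by rewrite -nsq_eq0 nsqC expf_neq0// gt_eqF.
    transitivity (\prod_(k < N) (rho%:C * (u / rho%:C - om ^+ k))).
      by apply: eq_bigr => k _; rewrite mulrBr mulrCA divff ?mulr1.
    rewrite big_split /= prodr_const card_ord.
    transitivity (rho%:C ^+ N * ((u / rho%:C) ^+ N - 1)).
      by congr (_ * _); exact: prod_sub_prim_root.
    by rewrite mulrBr mulr1 -exprMn mulrCA divff ?mulr1.
  rewrite E (le_trans (le_normcD _ _))// normcN -rmorphXn.
  have nX v : Normc.normc v <= A -> Normc.normc (v ^+ N) <= A ^+ N.
    move=> h; elim: (N) => [|m IH]; first by rewrite !expr0 Normc.normc1.
    by rewrite !exprS Normc.normcM ler_pM.
  have : Normc.normc (u ^+ N) <= A ^+ N by apply: nX; rewrite /A le_max lexx.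
  have : Normc.normc (rho ^+ N)%:C <= A ^+ N.
    rewrite rmorphXn; apply: nX; have := no 0%N; rewrite expr0 mulr1 => ->.
    by rewrite /A le_max lexx orbT.
  lra.
have AN : 0 < A ^+ N by rewrite exprn_gt0.
have h3 : Normc.normc (\prod_(k < N) (u - ze k)) <= 3 * A ^+ N.
  rewrite -[\prod_(k < N) (u - ze k)](subrK (\prod_(k < N) (u - rho%:C * om ^+ k))).
  apply: (le_trans (le_normcD _ _)).
  have : (2 + e) ^+ N * A ^+ N <= (2 ^+ N + 1) * A ^+ N by rewrite ler_pM2r.
  by move: h1 h2; lra.
rewrite -nsq_prod -normc_nsq -A2 exprAC.
have -> : 9 * (A ^+ N) ^+ 2 = (3 * A ^+ N) ^+ 2 by ring.
by rewrite ler_pXn2r ?nnegrE// mulr_ge0// ltW.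
Qed.

(** The mean of ln |w - la|^2 over the circle of radius rho about z is ln (max (|z - la|^2, rho^2)),
    so this sums over the eigenvalues the circle means of a logarithmic potential. *)
Definition potential (z : C) (rho : R) (s : seq C) : R :=
  \sum_(la <- s) ln (Num.max (nsq (z - la)) (rho ^+ 2)).

Lemma ln_prod_max (z : C) (rho : R) s : 0 < rho ->
  expR (potential z rho s) = \prod_(la <- s) Num.max (nsq (z - la)) (rho ^+ 2).
Proof.
move=> r0; rewrite /potential (big_morph _ (@expRD R) (@expR0 R)); apply: eq_bigr => la _.
by rewrite lnK// posrE lt_max exprn_gt0 ?orbT.
Qed.

Lemma potential_le_mean (z : C) (rho : R) s N (om : C) : 0 < rho -> N.-primitive_root om -> (size s < N)%N ->
  expR (potential z rho s) <= N%:R^-1 * \sum_(j < N) \prod_(la <- s) nsq (z + rho%:C * om ^+ j - la).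
Proof.
move=> r0 pr sN; rewrite ln_prod_max//.
have := @prod_max_le_mean [seq la - z | la <- s] rho N om (ltW r0) pr; rewrite size_map => /(_ sN).
rewrite big_map; under eq_bigr do rewrite -nsqN opprB.
under [in X in _ <= X -> _]eq_bigr do rewrite big_map.
move=> /le_trans; apply; rewrite le_eqVlt; apply/orP; left; apply/eqP; congr (_ * _).
by apply: eq_bigr => j _; apply: eq_bigr => la _; congr nsq; ring.
Qed.

(** Multiply the lower bounds at N displaced points of the circle. The mean of nsq over the exact
    points is nsq z + rho^2, and [prod_near_circle] costs ln 9 / N per eigenvalue, at most ep by the
    choice of N. *)
Lemma potential_ge (z : C) (rho ep : R) N : 0 < rho -> (1 < N)%N -> 9 <= expR (ep * N%:R) ->
  exists om : C, N.-primitive_root om /\ exists2 dl, 0 < dl & forall s,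
    (forall k : 'I_N, exists w, nsq (w - (z - rho%:C * om ^+ k)) <= dl /\
       expR ((size s)%:R * (nsq (z - rho%:C * om ^+ k) - 1 - ep)) <= \prod_(la <- s) nsq (w - la)) ->
    (size s)%:R * (nsq z + rho ^+ 2 - 1 - 2 * ep) <= potential z rho s.
Proof.
move=> r0 N1 hN; have N0 : (0 < N)%N by exact: ltnW.
have [om pr] := prim_root_exists N0; exists om; split => //.
have [dl dl0 hdl] := prod_near_circle r0 pr; exists dl => // s /choice[w hw].
have NR : 0 < N%:R :> R by rewrite ltr0n.
have sumE : \sum_(k < N) nsq (z - rho%:C * om ^+ k) = N%:R * (nsq z + rho ^+ 2).
  have E k : nsq (z - rho%:C * om ^+ k) = nsq z + rho ^+ 2 + complex.Re ((- 2 * rho)%:C * z^*%C * om ^+ k).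
    have : nsq (om ^+ k) = 1 by rewrite nsqX (nsq_prim_root pr) expr1n.
    move: (om ^+ k); case: z {hw hdl} => a b [c e]; rewrite /nsq /= => h.
    have aux P Q : P = Q + rho ^+ 2 * (c ^+ 2 + e ^+ 2 - 1) -> P = Q :> R.
      by move=> ->; rewrite h subrr mulr0 addr0.
    by apply: aux; ring.
  under eq_bigr do rewrite E.
  rewrite big_split /= sumr_const card_ord -[(_ + _) *+ N]mulr_natl -[RHS]addr0; congr (_ + _).
  have ReS (I : Type) (r : seq I) (F : I -> C) : \sum_(i <- r) complex.Re (F i) = complex.Re (\sum_(i <- r) F i).
    by elim: r => [|i r IH]; rewrite ?big_nil// !big_cons IH; case: (F i) (\sum_(_ <- _) _) => a b [].
  transitivity (complex.Re (\sum_(i < N) ((- 2 * rho)%:C * z^*%C * om ^+ i))); first exact: ReS.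
  rewrite -mulr_sumr.
  have := @sum_prim_root N om 1 pr; under eq_bigr do rewrite expr1.
  by move=> ->; rewrite ?mulr0// gtnNdvd.
rewrite -(ler_pM2r NR) -ler_expR [X in _ <= X]expRM_natr ln_prod_max//.
apply: (@le_trans _ _ (\prod_(k < N) expR ((size s)%:R * (nsq (z - rho%:C * om ^+ k) - 1 - ep)) * expR (- ((size s)%:R * (ep * N%:R))))).
  rewrite -(big_morph _ (@expRD R) (@expR0 R)) -expRD ler_expR -mulr_sumr big_split /= big_split /= sumE !sumr_const card_ord -(mulr_natr (- 1)) -(mulr_natr (- ep)).
  by rewrite le_eqVlt; apply/orP; left; apply/eqP; ring.
apply: (@le_trans _ _ (\prod_(k < N) \prod_(la <- s) nsq (w k - la) * expR (- ((size s)%:R * (ep * N%:R))))).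
  rewrite ler_pM2r ?expR_gt0//; apply: ler_prod => k _; rewrite expR_ge0 /=; exact: (hw k).2.
rewrite expRN ler_pdivrMr ?expR_gt0// exchange_big /= expRM_natl.
apply: (@le_trans _ _ ((\prod_(la <- s) Num.max (nsq (z - la)) (rho ^+ 2)) ^+ N * 9 ^+ size s)); last first.
  rewrite ler_wpM2l ?exprn_ge0//; first by apply: prodr_ge0 => la _; rewrite le_max nsq_ge0.
  by apply: lerXn2r; rewrite ?nnegrE ?expR_ge0.
rewrite -prodrXl; have -> : (9 : R) ^+ size s = \prod_(la <- s) 9 by rewrite big_const_seq count_predT iter_mulr_1.
rewrite -big_split /=; apply: ler_prod => la _; apply/andP; split; first by apply: prodr_ge0 => k _; exact: nsq_ge0.
rewrite mulrC; have := hdl (fun k => z - w k) _ (z - la).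
have -> : \prod_(k < N) nsq (z - la - (z - w k)) = \prod_(k < N) nsq (w k - la).
  by apply: eq_bigr => k _; congr nsq; ring.
apply=> k; have [h _] := hw k; apply: le_trans h; rewrite -nsqN le_eqVlt; apply/orP; left; apply/eqP.
by congr nsq; ring.
Qed.

End roots_of_unity.

(** * Convergence *)

Section almost_sure.
Context d (T : measurableType d) (R : realType) (P : probability T R).
Notation C := R[i].

Let rsum n : \sum_(0 <= k < n) (k.+1%:R * k.+2%:R)^-1 = 1 - n.+1%:R^-1 :> R.
Proof.
elim: n => [|n IH]; first by rewrite big_geq// invr1 subrr.
rewrite big_nat_recr//= IH -[n.+2%:R]natr1.
have : n.+1%:R != 0 :> R by rewrite pnatr_eq0.
have : n.+1%:R + 1 != 0 :> R by rewrite natr1 pnatr_eq0.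
by move: (n.+1%:R : R) => y h1 h2; field; rewrite ?h1 ?h2.
Qed.

(** Comparison with the telescoping series of 1 / ((k + 1) (k + 2)); the constant [c'] is large
    enough to make the bound trivial for the first indices. *)
Lemma borel_cantelli_sq (c : R) (F : nat -> set T) : (forall n, measurable (F n)) ->
  (\forall n \near \oo, (P (F n) <= (c / n%:R ^+ 2)%:E)%E) ->
  {ae P, forall t, \forall n \near \oo, ~ F n t}.
Proof.
move=> mF [K _ hK].
pose c' := 6 * `|c| + (K.+1%:R * K.+2%:R).
have c0 : 0 <= c' by rewrite addr_ge0 ?mulr_ge0.
have hb k : (P (F k) <= (c' * (k.+1%:R * k.+2%:R)^-1)%:E)%E.
  have k0 : 0 < k.+1%:R * k.+2%:R :> R by rewrite mulr_gt0.
  have [kK|kK] := leqP k K.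
    apply: (le_trans (probability_le1 P (mF k))); rewrite lee_fin -/(c' / _) ler_pdivlMr// mul1r.
    apply: (@le_trans _ _ (K.+1%:R * K.+2%:R)); first by rewrite ler_pM// ler_nat.
    by rewrite /c' lerDr mulr_ge0.
  have k1 : 1 <= k%:R :> R by rewrite ler1n (leq_ltn_trans _ kK).
  apply: (le_trans (hK k (ltnW kK))); rewrite lee_fin ler_pdivrMr; last by rewrite exprn_gt0//; lra.
  rewrite mulrAC ler_pdivlMr//.
  have h1 : k.+1%:R * k.+2%:R <= 6 * k%:R ^+ 2 :> R.
    by rewrite -[k.+2%:R]natr1 -natr1; nra.
  apply: (@le_trans _ _ (`|c| * (6 * k%:R ^+ 2))).
    by apply: (le_trans (ler_wpM2r (ltW k0) (ler_norm c))); rewrite ler_wpM2l.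
  by rewrite mulrA ler_wpM2r ?exprn_ge0// /c' mulrC lerDl mulr_ge0.
have S : (\sum_(0 <= n <oo) P (F n) < +oo)%E.
  apply: (@le_lt_trans _ _ c'%:E); last exact: ltry.
  apply: lime_le; first by apply: is_cvg_nneseries.
  near=> n; apply: (@le_trans _ _ (\sum_(0 <= k < n) (c' * (k.+1%:R * k.+2%:R)^-1)%:E)%E).
    by apply: lee_sum.
  rewrite sumEFin lee_fin -mulr_sumr rsum mulrBr mulr1 lerBlDr lerDl mulr_ge0// invr_ge0.
have Z := lim_sup_set_cvg0 mF S.
exists (lim_sup_set F); split => //.
  by apply: bigcap_measurable => // k _; apply: bigcup_measurable.
move=> t /= nt k _; apply: contrapT => h; apply: nt; exists k => // n /= kn Fn.
by apply: h; exists n.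
Unshelve. all: end_near. Qed.

Variable x : nat * nat -> {RV P >-> C}.
Hypothesis x_iid : iid x.
Local Notation mu := (distribution P (x (0%N, 0%N))).
Hypothesis mu_std : std_law mu.

Definition eigs n t : seq C := eigenvalues ((Num.sqrt (n%:R : R))^-1%:C *: random_matrix x n t).
Local Notation V n w := (Vdiag n ((Num.sqrt (n%:R : R))%:C * w)).

Lemma size_eigs n t : size (eigs n t) = n.
Proof. exact: size_eigenvalues. Qed.

Lemma pair_inj2 : inj2 (@pair nat nat). Proof. by move=> i j i' j' [-> ->]. Qed.

Lemma prod_eigs n t w : (0 < n)%N ->
  \prod_(la <- eigs n t) nsq (w - la) = nsq (\det (top (@pair nat nat) (V n w) n (config x t))) / n%:R ^+ n.
Proof.
move=> n0; have y0 : 0 < n%:R :> R by rewrite ltr0n.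
set s : C := (Num.sqrt (n%:R : R))%:C.
have ns : nsq s = n%:R by rewrite nsqC sqr_sqrtr// ltW.
have s0 : s != 0 by rewrite -nsq_eq0 ns gt_eqF.
have -> : top (@pair nat nat) (V n w) n (config x t) = (- s) *: (w%:M - (Num.sqrt (n%:R : R))^-1%:C *: random_matrix x n t).
  apply/matrixP => i j; rewrite !mxE /config /= fmorphV -/s mulNr mulrBr mulVKf// opprB.
  by congr (_ - _); rewrite mulrnAr.
rewrite detZ nsqM nsqX nsqN ns mulrAC divff ?mul1r ?expf_neq0 ?gt_eqF//.
rewrite -nsq_prod; congr nsq.
have := congr1 (horner^~ w) (char_poly_eigenvalues ((Num.sqrt (n%:R : R))^-1%:C *: random_matrix x n t)).
rewrite horner_prod => E; transitivity (char_poly ((Num.sqrt (n%:R : R))^-1%:C *: random_matrix x n t)).[w].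
  by rewrite E; apply: eq_bigr => la _; rewrite hornerXsubC.
rewrite /char_poly -horner_evalE -det_map_mx; congr (\det _).
by apply/matrixP => i j; rewrite !mxE /= horner_evalE !hornerE hornerMn hornerX.
Qed.

Lemma ex_prod_eigs n w : (0 < n)%N ->
  (\int[P]_t (\prod_(la <- eigs n t) nsq (w - la))%:E = (tmom (n%:R * nsq w) n n / n%:R ^+ n)%:E)%E.
Proof.
move=> n0; have y0 : 0 < n%:R :> R by rewrite ltr0n.
under eq_integral do rewrite prod_eigs// mulrC EFinM.
rewrite ge0_integralZl//; first last.
- by move=> t _; rewrite lee_fin nsq_ge0.
- apply: (measf_config x (f := fun xi => (nsq (\det (top (@pair nat nat) (V n w) n xi)))%:E)).
  by apply: measf_EFin; apply: measf_nsq; apply: cmeasf_det; exact: mxmeasf_top.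
rewrite -[X in tmom X _ _](_ : nsq ((Num.sqrt (n%:R : R))%:C * w) = _); last first.
  by rewrite nsqM nsqC sqr_sqrtr// ltW.
rewrite [RHS]EFinM muleC; congr (_ * _)%E.
have := @EdetE _ _ _ _ x x_iid mu_std _ pair_inj2 n val val ((Num.sqrt (n%:R : R))%:C * w) n val_inj val_inj (leqnn n).
rewrite /Edet /ex => <-; apply: eq_integral => t _; congr (nsq (\det _))%:E.
by apply/matrixP => i j; rewrite !mxE ltn_ord.
Qed.

(** Markov's inequality for the mean over roots of unity of the squared modulus of the
    characteristic polynomial: each term has mean at most e n exp (n (tau - 1)), and the additional
    exp (- n ep) makes the probabilities summable. *)
Lemma as_potential_le (z : C) (rho tau ep : R) : 0 < rho -> 0 < ep ->
  (forall om, nsq om = 1 -> nsq (z + rho%:C * om) <= tau) ->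
  {ae P, forall t, \forall n \near \oo, potential z rho (eigs n t) <= n%:R * (tau - 1 + ep)}.
Proof.
move=> r0 ep0 htau.
have pom n : exists om : C, n.+1.-primitive_root om by exact: prim_root_exists.
have [om hom] := choice pom.
pose Av n t : R := n.+1%:R^-1 * \sum_(j < n.+1) \prod_(la <- eigs n t) nsq (z + rho%:C * om n ^+ j - la).
pose F n : set T := [set t | (0 < n)%N /\ expR (n%:R * (tau - 1 + ep)) <= Av n t].
have mAv n : (0 < n)%N -> measurable_fun setT (Av n).
  move=> n0; apply: measurable_funM; first exact: measurable_cst.
  apply: measurable_sum => j.
  under eq_fun do rewrite prod_eigs//.
  apply: measurable_funM; last exact: measurable_cst.
  by apply: (measf_config x (f := fun xi => nsq (\det (top (@pair nat nat) (V n _) n xi)))); apply: measf_nsq; apply: cmeasf_det; exact: mxmeasf_top.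
have mF n : measurable (F n).
  have [n0|n0] := posnP n; first by rewrite (_ : F n = set0)//; apply/seteqP; split => // t []; rewrite n0.
  have -> : F n = (fun t => expR (n%:R * (tau - 1 + ep)) <= Av n t) @^-1` [set true].
    by apply/seteqP; split => t /=; [case|split].
  rewrite -[X in measurable X]setTI; apply: (measurable_fun_ler (measurable_cst _) (mAv n n0)) => //.
have hF : \forall n \near \oo, (P (F n) <= (1 / n%:R ^+ 2)%:E)%E.
  near=> n.
  have r1 : 1 <= (rt n)%:R :> R by near: n; exact: near_rt.
  have l1 : ln n%:R <= ep / 4 * (rt n)%:R :> R by near: n; apply: near_ln_rt; rewrite divr_gt0.
  have n3 : 4 / ep <= n%:R by near: n; exact: near_nat.
  have n0 : (0 < n)%N by near: n; exact: near_ge.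
  have rn : (rt n)%:R <= n%:R :> R.
    rewrite ler_nat (leq_trans _ (rt_le n))// -[X in (X <= _)%N]expn1 leq_pexp2l// -(ltr0n R); lra.
  have y0 : 0 < n%:R :> R by rewrite ltr0n.
  pose a := expR (n%:R * (tau - 1 + ep)); have a0 : 0 < a by exact: expR_gt0.
  have Av0 t : 0 <= Av n t.
    by rewrite mulr_ge0 ?invr_ge0//; apply: sumr_ge0 => j _; apply: prodr_ge0 => la _; exact: nsq_ge0.
  have FE : F n = [set t | (a%:E <= `|(Av n t)%:E|)%E].
    apply/seteqP; split => t /=; rewrite ger0_norm// lee_fin; by case.
  have := le_integral_abse P measurableT (g := fun t => (Av n t)%:E) (a := a) ltac:(by apply/measurable_EFinP; exact: mAv) a0.
  rewrite setTI -FE => M.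
  have IA : (\int[P]_t `|(Av n t)%:E| <= (expR 1 * n%:R * expR (n%:R * (tau - 1)))%:E)%E.
    under eq_integral do rewrite gee0_abs ?lee_fin//.
    under eq_integral do rewrite /Av EFinM -sumEFin.
    have mp j : measurable_fun setT (fun t => (\prod_(la <- eigs n t) nsq (z + rho%:C * om n ^+ j - la))%:E).
      apply/measurable_EFinP; under eq_fun do rewrite prod_eigs//.
      apply: measurable_funM; last exact: measurable_cst.
      by apply: (measf_config x (f := fun xi => nsq (\det (top (@pair nat nat) (V n _) n xi)))); apply: measf_nsq; apply: cmeasf_det; exact: mxmeasf_top.
    have pp (j : nat) t : (0 <= (\prod_(la <- eigs n t) nsq (z + rho%:C * om n ^+ j - la))%:E)%E.
      by rewrite lee_fin; apply: prodr_ge0 => la _; exact: nsq_ge0.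
    rewrite ge0_integralZl//; first last.
    - by move=> t _; apply: sume_ge0.
    - by apply: emeasurable_sum => j.
    rewrite ge0_integral_sum//.
    under eq_bigr do rewrite ex_prod_eigs//.
    rewrite sumEFin -EFinM lee_fin mulrC ler_pdivrMr//.
    apply: (@le_trans _ _ (\sum_(j < n.+1) (expR 1 * n%:R * expR (n%:R * (tau - 1))))); last first.
      by rewrite sumr_const card_ord -[leLHS]mulr_natr.
    apply: ler_sum => j _; rewrite ler_pdivrMr ?exprn_gt0//.
    have hS := htau (om n ^+ j) ltac:(by rewrite nsqX (nsq_prim_root (hom n)) expr1n).
    apply: (le_trans (tmom_le _ _)); first by rewrite mulr_ge0 ?nsq_ge0.
    apply: (@le_trans _ _ (n`!%:R * expR n%:R * expR (n%:R * (tau - 1)))).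
      rewrite -mulrA -expRD ler_wpM2l// ler_expR.
      have -> : n%:R + n%:R * (tau - 1) = n%:R * tau :> R by ring.
      by rewrite ler_pM2l.
    apply: (le_trans (ler_wpM2r (expR_ge0 _) (fact_le R n0))).
    by rewrite exprS le_eqVlt; apply/orP; left; apply/eqP; ring.
  have -> : P (F n) = ((a^-1)%:E * (a%:E * P (F n)))%E.
    by rewrite muleA -EFinM mulVf ?mul1e// gt_eqF.
  apply: (@le_trans _ _ ((a^-1)%:E * (expR 1 * n%:R * expR (n%:R * (tau - 1)))%:E)%E).
    by apply: lee_wpmul2l; [rewrite lee_fin invr_ge0 ltW|exact: le_trans IA].
  rewrite -EFinM lee_fin ler_pdivlMr ?exprn_gt0// /a -expRN.
  have lE : n%:R = expR (ln n%:R) :> R by rewrite lnK ?posrE.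
  have -> : (n%:R : R) ^+ 2 = expR (2 * ln n%:R) by rewrite expRM_natl -lE.
  rewrite {2}lE -!expRD -[leRHS]expR0 ler_expR.
  have : 4 <= n%:R * ep by rewrite -ler_pdivrMr.
  have : ep / 4 * (rt n)%:R <= ep / 4 * n%:R by rewrite ler_pM2l// divr_gt0.
  by move: l1; lra.
have := borel_cantelli_sq mF hF; apply: filterS => t ht.
near=> n.
have n0 : (0 < n)%N by near: n; exact: near_ge.
have nF : ~ F n t by near: n; exact: ht.
rewrite -ler_expR; apply: (le_trans (potential_le_mean _ r0 (hom n) _)); first by rewrite size_eigs.
by rewrite leNgt; apply/negP => h; apply: nF; split => //; exact: ltW.
Unshelve. all: end_near. Qed.

Lemma as_det_ge (z : C) (dl ep : R) : nsq z < 1 -> 0 < dl -> 0 < ep ->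
  {ae P, forall t, \forall n \near \oo, exists w, nsq (w - z) <= dl /\
    expR (n%:R * (nsq z - 1 - ep)) <= \prod_(la <- eigs n t) nsq (w - la)}.
Proof.
move=> z1 dl0 ep0; have [q q01 conc] := concentration_lt1 mu_std.
have nr := pr_det_small_near x_iid mu_std q01 conc pair_inj2 z1 dl0 ep0.
pose good n (w : 'I_(rt n) -> C) := (forall l, nsq (w l - z) <= dl) /\
  (pr x (fun xi => [forall l, (nsq (\det (top (@pair nat nat) (V n (w l)) n xi)) <
      n%:R ^+ n * expR (n%:R * (nsq z - 1 - ep)))%R]) <= (5 * (n%:R ^+ 2)^-1)%:E)%E.
(* Good points are known to exist only for large n; below, W takes an arbitrary default value. *)
pose W n : 'I_(rt n) -> C := if pselect (exists w, good n w) is left e then projT1 (cid e) else fun=> 0.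
have gW n : (exists w, good n w) -> good n (W n).
  by move=> e; rewrite /W; case: pselect => // e'; exact: projT2 (cid e').
pose b n (xi : cfg R) := [forall l, (nsq (\det (top (@pair nat nat) (V n (W n l)) n xi)) <
      n%:R ^+ n * expR (n%:R * (nsq z - 1 - ep)))%R].
have mb n : measf (b n).
  apply: measf_forall => l; apply: measf_lt; last exact: measf_cst.
  by apply: measf_nsq; apply: cmeasf_det; exact: mxmeasf_top.
pose F n := [set t | b n (config x t)].
have mF n : measurable (F n).
  rewrite -[X in measurable X]setTI.
  exact: (measf_config x (mb n) measurableT (Y := [set true])).
have hF : \forall n \near \oo, (P (F n) <= (5 / n%:R ^+ 2)%:E)%E.
  near=> n; have [_ h] : good n (W n) by apply: gW; near: n.
  by rewrite /F -(prE x (mb n)).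
have := borel_cantelli_sq mF hF; apply: filterS => t ht.
near=> n.
have n0 : (0 < n)%N by near: n; exact: near_ge.
have nF : ~ F n t by near: n; exact: ht.
have [hw _] : good n (W n) by apply: gW; near: n.
move: nF => /negP; rewrite /b negb_forall => /existsP[l]; rewrite -leNgt => hl.
exists (W n l); split => //.
by rewrite prod_eigs// ler_pdivlMr ?exprn_gt0 ?ltr0n// mulrC.
Unshelve. all: end_near. Qed.

Lemma near_forall_ord N (A : 'I_N -> nat -> Prop) :
  (forall k, \forall n \near \oo, A k n) -> \forall n \near \oo, forall k, A k n.
Proof.
move=> h; have /choice[K hK] : forall k, exists K, forall n, (K <= n)%N -> A k n.
  by move=> k; have [K _ hK] := h k; exists K.
exists (\max_k K k)%N => // n /= hn k; apply: hK; exact: leq_trans (leq_bigmax k) hn.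
Qed.

Lemma as_potential_ge (z : C) (rho ep : R) : 0 < rho -> 0 < ep ->
  (forall om, nsq om = 1 -> nsq (z - rho%:C * om) < 1) ->
  {ae P, forall t, \forall n \near \oo, n%:R * (nsq z + rho ^+ 2 - 1 - 2 * ep) <= potential z rho (eigs n t)}.
Proof.
move=> r0 ep0 hz; pose N := (Num.truncn (9 / ep)).+2.
have hN : 9 <= expR (ep * N%:R).
  apply: le_trans (expR_ge1Dx _).
  have : 9 / ep <= N%:R.
    by have /andP[_ /ltW h] := truncn_itv (ltac:(by rewrite divr_ge0// ltW) : 0 <= 9 / ep); rewrite (le_trans h)// ler_nat.
  by rewrite ler_pdivrMr// mulrC; lra.
have [om [pr [dl dl0 H]]] := potential_ge z r0 (isT : (1 < N)%N) hN.
have : {ae P, forall t, forall k : nat, \forall n \near \oo, exists w, nsq (w - (z - rho%:C * om ^+ k)) <= dl /\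
    expR (n%:R * (nsq (z - rho%:C * om ^+ k) - 1 - ep)) <= \prod_(la <- eigs n t) nsq (w - la)}.
  apply: ae_foralln => k; apply: as_det_ge => //; apply: hz.
  by rewrite nsqX (nsq_prim_root pr) expr1n.
apply: filterS => t ht; have := near_forall_ord (fun k : 'I_N => ht k).
apply: filterS => n hn; have := H (eigs n t); rewrite size_eigs; apply => k; exact: hn.
Qed.

(** Both potentials are close to n (nsq z + rho^2 - 1), rho being the radius; their difference
    isolates the mass near z. The term 4 r2 collects 3 r2 from the value of tau and r2 from the
    error terms. *)
Lemma as_bump (z : C) (r1 r2 : R) : 0 < r1 -> 0 < r2 <= 1 -> nsq z <= 1 ->
  (forall om, nsq om = 1 -> nsq (z - r1%:C * om) < 1) ->
  {ae P, forall t, \forall n \near \oo,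
    n%:R * (r1 ^+ 2 - 4 * r2) <= potential z r1 (eigs n t) - potential z r2 (eigs n t)}.
Proof.
move=> r10 /andP[r20 r21] z1 hz; have ep0 : 0 < r2 / 3 by rewrite divr_gt0.
have htau om : nsq om = 1 -> nsq (z + r2%:C * om) <= nsq z + 3 * r2.
  move=> h; have : nsq (z + r2%:C * om) <= nsq z + r2 ^+ 2 + r2 * (nsq z + nsq om).
    have -> : nsq z + r2 ^+ 2 + r2 * (nsq z + nsq om) = nsq z + r2 ^+ 2 * nsq om + r2 * (nsq z + nsq om) by rewrite h mulr1.
    rewrite -subr_ge0; case: z {hz z1 h} om => a b [c e]; rewrite /nsq /=.
    rewrite [leRHS](_ : _ = r2 * ((a - c) ^+ 2 + (b - e) ^+ 2)); last by ring.
    by rewrite mulr_ge0 ?addr_ge0 ?sqr_ge0// ltW.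
  by rewrite h; move: z1; move: (nsq z) => s; nra.
have A := as_potential_le r20 ep0 htau; have B := as_potential_ge r10 ep0 hz.
apply: filterS2 A B => t; apply: filterS2 => n A B.
have : n%:R * (r1 ^+ 2 - 4 * r2) = n%:R * (nsq z + r1 ^+ 2 - 1 - 2 * (r2 / 3)) - n%:R * (nsq z + 3 * r2 - 1 + r2 / 3) by field.
by move: A B; lra.
Qed.

End almost_sure.

(** * Disks and integration over layers *)

Section disks.
Variable R : realType.
Notation C := R[i].
Local Notation lam := (@lebesgue_measure R).
Local Notation leb := (@lebesgue_complex R).

Lemma lebesgue_affine (a s : R) (A : set (measurableTypeR R)) : 0 < s -> measurable A ->
  (s%:E * lam ((fun x => a + s * x)%R @^-1` A) = lam A)%E.
Proof.
move=> s0 mA; have mf : measurable_fun [set: measurableTypeR R] ((fun x => a + s * x) : measurableTypeR R -> measurableTypeR R).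
  by apply: measurable_funD => //; apply: measurable_funM.
pose sn : {nonneg R} := NngNum (ltW s0).
have E := @lebesgue_measure_unique R (mscale sn (pushforward lam ((fun x => a + s * x) : measurableTypeR R -> measurableTypeR R))).
rewrite [RHS]E// => _ [[x1 x2]] _ <-.
change (lam `]x1, x2]%classic = s%:E * lam ((fun x => a + s * x)%R @^-1` `]x1, x2]%classic))%E.
rewrite (_ : _ @^-1` _ = `](x1 - a) / s, (x2 - a) / s]%classic); last first.
  apply/seteqP; split => y /=; rewrite !in_itv /= ltr_pdivrMr// ler_pdivlMr// ltrBlDr lerBrDr;
  by rewrite [s * y]mulrC [a + _]addrC.
rewrite !lebesgue_measure_itv /= !lte_fin ltr_pM2r ?invr_gt0// ltrD2r.
case: ifP => _; last by rewrite mule0.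
by rewrite -!EFinD -EFinM; congr (_%:E); field; rewrite gt_eqF.
Qed.

Lemma lebesgue2_affine (a b s : R) (A : set (measurableTypeR R * measurableTypeR R)) : 0 < s -> measurable A ->
  ((s ^+ 2)%:E * (lam \x lam) ((fun p => (a + s * p.1, b + s * p.2))%R @^-1` A) = (lam \x lam) A)%E.
Proof.
move=> s0 mA; pose g (p : measurableTypeR R * measurableTypeR R) : measurableTypeR R * measurableTypeR R := (a + s * p.1, b + s * p.2).
have mg : measurable_fun setT g.
  apply: measurable_fun_pair.
    by apply: measurable_funD => //; apply: measurable_funM => //; exact: measurable_fst.
  by apply: measurable_funD => //; apply: measurable_funM => //; exact: measurable_snd.
pose sn : {nonneg R} := NngNum (exprn_ge0 2 (ltW s0)).
have E := @product_measure_unique _ _ _ _ _ lam lam (mscale sn (pushforward (lam \x lam)%E g)).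
rewrite -/g; symmetry; rewrite E// => X Y mX mY.
change ((s ^+ 2)%:E * (lam \x lam)%E (((fun x => a + s * x)%R @^-1` X) `*` ((fun x => b + s * x)%R @^-1` Y)) = lam X * lam Y)%E.
have mp c (Z : set (measurableTypeR R)) : measurable Z -> measurable ((fun x => c + s * x) @^-1` Z : set (measurableTypeR R)).
  move=> mZ; rewrite -[X in measurable X]setTI.
  suff mf : measurable_fun [set: measurableTypeR R] ((fun x => c + s * x) : measurableTypeR R -> measurableTypeR R) by exact: mf.
  by apply: measurable_funD => //; apply: measurable_funM.
rewrite product_measure1E; [|exact: mp|exact: mp].
by rewrite expr2 EFinM muleACA lebesgue_affine// lebesgue_affine.
Qed.

Definition disk (c : C) (r : R) : set C := [set z | nsq (z - c) <= r ^+ 2].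

Lemma measurable_nsq_sub (c : C) : measurable_fun setT (fun z : C => nsq (z - c)).
Proof.
have -> : (fun z => nsq (z - c)) = (fun z => (complex.Re z - complex.Re c) ^+ 2 + (complex.Im z - complex.Im c) ^+ 2).
  by apply/funext => z; case: z c => a b [e f].
apply: measurable_funD; apply: measurable_funX; apply: measurable_funB => //.
  exact: measurable_Re.
exact: measurable_Im.
Qed.

Lemma measurable_disk c r : measurable (disk c r).
Proof.
have -> : disk c r = (fun z : C => nsq (z - c) <= r ^+ 2) @^-1` [set true] by [].
rewrite -[X in measurable X]setTI; apply: measurable_fun_ler => //; exact: measurable_nsq_sub.
Qed.

Lemma unit_diskE : @unit_disk R = disk 0 1.
Proof.
have E (z : C) : (`|z| <= 1) = (nsq z <= 1).
  by rewrite -[RHS]lecR nsqE expr_le1.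
by apply/seteqP; split => z; rewrite /unit_disk /disk /= subr0 expr1n E.
Qed.

(** This is pi; its value cancels between the small disks and the normalization of the uniform
    law. *)
Definition disk_area : R := fine (leb (@unit_disk R)).

Lemma disk_areaE : leb (@unit_disk R) = disk_area%:E.
Proof. by rewrite /disk_area fineK// ge0_fin_numE ?lebesgue_unit_disk_lty. Qed.

Lemma disk_area_gt0 : 0 < disk_area.
Proof. by rewrite -lte_fin -disk_areaE lebesgue_unit_disk_gt0. Qed.

Lemma leb_disk c r : 0 < r -> leb (disk c r) = (r ^+ 2 * disk_area)%:E.
Proof.
move=> r0; rewrite EFinM -disk_areaE unit_diskE /lebesgue_complex /pushforward.
have md c' r' : measurable (@complex_of_pair R @^-1` disk c' r').
  by rewrite -[X in measurable X]setTI; apply: measurable_complex_of_pair => //; exact: measurable_disk.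
rewrite -(lebesgue2_affine (complex.Re c) (complex.Im c) r0); last exact: md.
congr (_ * (_ \x _) _)%E; apply/seteqP; split => -[u v]; rewrite /disk /= subr0 expr1n;
have -> : nsq (complex_of_pair (complex.Re c + r * u, complex.Im c + r * v) - c) = r ^+ 2 * nsq (complex_of_pair (u, v)) by
  [case: c => a b; rewrite /nsq /=; ring];
by rewrite ger_pMr ?exprn_gt0.
Qed.

(** Telescoping over the radii r1 q^j: one step changes the logarithm by at most - 2 ln q, and only
    if la lies within the larger radius. *)
Lemma potential_sub_le (z la : C) (r1 q : R) J : 0 < r1 -> 0 < q < 1 ->
  ln (Num.max (nsq (z - la)) (r1 ^+ 2)) - ln (Num.max (nsq (z - la)) ((r1 * q ^+ J) ^+ 2)) <=
  \sum_(j < J) (2 * - ln q) * ((nsq (z - la) <= (r1 * q ^+ j) ^+ 2)%R)%:R.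
Proof.
move=> r0 /andP[q0 q1]; have lq : ln q < 0 by rewrite ln_lt0 ?q0.
elim: J => [|J IH]; first by rewrite big_ord0 expr0 mulr1 subrr.
rewrite big_ord_recr /=; set u := nsq (z - la) in IH *.
set A := ln _ in IH *; set B := ln (Num.max u ((r1 * q ^+ J) ^+ 2)) in IH; set D := ln (Num.max u ((r1 * q ^+ J.+1) ^+ 2)).
suff : B - D <= 2 * - ln q * ((u <= (r1 * q ^+ J) ^+ 2)%R)%:R by lra.
have p k : 0 < (r1 * q ^+ k) ^+ 2 by rewrite exprn_gt0 ?mulr_gt0 ?exprn_gt0.
case: (leP u _) => h; rewrite ?mulr1 ?mulr0 /B /D.
  rewrite (elimT max_idPr h) lerBlDl; apply: (@le_trans _ _ (ln ((r1 * q ^+ J.+1) ^+ 2) + 2 * - ln q)).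
    have -> : (r1 * q ^+ J.+1) ^+ 2 = (r1 * q ^+ J) ^+ 2 * q ^+ 2 by rewrite [q ^+ J.+1]exprSr mulrA exprMn.
    by rewrite lnM ?posrE ?p ?exprn_gt0// [ln (q ^+ 2)]lnXn// mulr2n; lra.
  by rewrite lerD2r ler_ln ?posrE ?p ?lt_max ?p ?orbT// le_max lexx orbT.
rewrite !max_l ?subrr// ?(ltW h)//; apply: le_trans (ltW h).
rewrite ler_pXn2r ?nnegrE ?mulr_ge0 ?exprn_ge0 ?(ltW r0) ?(ltW q0)//.
by rewrite ler_pM2l// exprSr ler_piMr ?exprn_ge0 ?(ltW q0) ?(ltW q1).
Qed.

(** Integrate the layer bound against f. The layer of radius r1 q^j about la has area r1^2 q^(2 j)
    [disk_area], and a geometric series appears. The resulting factor 2 (- ln q) / (1 - q^2) tends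
    to 1 as q tends to 1, so the bound is sharp in the limit. *)
Lemma esd_disk_lower (f : C -> R) (s : seq C) (ep r1 q c R0 : R) J : measurable_fun setT f ->
  (forall z, 0 <= f z) -> 0 <= ep -> 0 < r1 -> 0 < q < 1 -> 0 <= c ->
  (forall z la, nsq (z - la) <= r1 ^+ 2 -> f z <= f la + ep) ->
  (forall z, disk 0 R0 z -> (size s)%:R * c <= potential z r1 s - potential z (r1 * q ^+ J) s) ->
  (((size s)%:R * c)%:E * \int[leb]_(z in disk 0%R R0) (f z)%:E <=
   (\sum_(la <- s) (f la + ep) * (r1 ^+ 2 * disk_area * (2 * - ln q / (1 - q ^+ 2))))%:E)%E.
Proof.
move=> mf f0 ep0 r0 /andP[q0 q1] c0 hosc hpot.
have lq : 0 < 2 * - ln q by rewrite mulr_gt0// oppr_gt0 ln_lt0 ?q0.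
have fe la : 0 <= f la + ep by rewrite addr_ge0.
have rq j : 0 < r1 * q ^+ j by rewrite mulr_gt0 ?exprn_gt0.
have mF : measurable_fun setT (fun z => (f z)%:E) by exact/measurable_EFinP.
rewrite -ge0_integralZl//; first last.
- by rewrite lee_fin mulr_ge0.
- by move=> z _; rewrite lee_fin.
- exact: measurable_funTS.
- exact: measurable_disk.
pose G z := (\sum_(la <- s) \sum_(j < J) ((f la + ep) * (2 * - ln q))%:E * (\1_(disk la (r1 * q ^+ j)) z)%:E)%E.
have mI la j : measurable_fun setT (fun z : C => (((f la + ep) * (2 * - ln q))%:E * (\1_(disk la (r1 * q ^+ j)) z)%:E)%E).
  by apply/measurable_EFinP; apply: measurable_funM => //; exact: measurable_indic (measurable_disk _ _).
have pI la j z : (0 <= ((f la + ep) * (2 * - ln q))%:E * (\1_(disk la (r1 * q ^+ j)) z)%:E)%E.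
  rewrite -EFinM lee_fin; apply: mulr_ge0; last by rewrite indicE.
  by apply: mulr_ge0 => //; exact: ltW.
apply: (@le_trans _ _ (\int[leb]_(z in disk 0%R R0) G z)%E).
  apply: ge0_le_integral; first exact: measurable_disk.
  - by move=> z _; rewrite -EFinM lee_fin !mulr_ge0.
  - by apply: measurable_funTS; apply/measurable_EFinP; apply: measurable_funM.
  - by apply: measurable_funTS; apply: emeasurable_sum => la; apply: emeasurable_sum => j.
  move=> z Dz; rewrite /G; under eq_bigr do rewrite sumEFin.
  rewrite sumEFin -EFinM lee_fin.
  apply: (@le_trans _ _ (f z * (potential z r1 s - potential z (r1 * q ^+ J) s))).
    by rewrite mulrC ler_wpM2l// hpot.
  rewrite /potential -sumrB mulr_sumr; apply: ler_sum => la _.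
  apply: (@le_trans _ _ (f z * \sum_(j < J) (2 * - ln q) * ((nsq (z - la) <= (r1 * q ^+ j) ^+ 2)%R)%:R)).
    by rewrite ler_wpM2l// potential_sub_le// q0.
  rewrite mulr_sumr; apply: ler_sum => j _; rewrite indicE.
  have -> : (z \in disk la (r1 * q ^+ j)) = (nsq (z - la) <= (r1 * q ^+ j) ^+ 2).
    by apply/idP/idP; rewrite inE.
  case: (leP (nsq (z - la)) ((r1 * q ^+ j) ^+ 2)) => h; rewrite ?mulr0// !mulr1.
  rewrite ler_pM2r//; apply: hosc; apply: (le_trans h).
  rewrite ler_pXn2r ?nnegrE ?(ltW r0) ?(ltW (rq j))//.
  by rewrite ler_piMr ?(ltW r0)// exprn_ile1 ?(ltW q0) ?(ltW q1).
apply: (@le_trans _ _ (\int[leb]_z G z)%E).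
  apply: ge0_subset_integral => //; first exact: measurable_disk.
  - by apply: emeasurable_sum => la; apply: emeasurable_sum => j.
  - by move=> z _; apply: sume_ge0 => la _; apply: sume_ge0.
rewrite /G ge0_integral_sum//; first last.
- by move=> la z _; apply: sume_ge0.
- by move=> la; apply: emeasurable_sum => j.
rewrite -sumEFin; apply: lee_sum => la _.
rewrite ge0_integral_sum//.
apply: (@le_trans _ _ (\sum_(j < J) ((f la + ep) * (2 * - ln q) * ((r1 * q ^+ j) ^+ 2 * disk_area))%:E)%E).
  apply: lee_sum => j _; rewrite ge0_integralZl//; first last.
  - by rewrite lee_fin mulr_ge0// ltW.
  - by apply/measurable_EFinP; exact: measurable_indic (measurable_disk _ _).
  rewrite integral_indic//; last exact: measurable_disk.
  rewrite setIT; apply: (@le_trans _ _ (((f la + ep) * (2 * - ln q))%:E * leb (disk la (r1 * q ^+ j)))%E); first exact: lexx.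
  by rewrite leb_disk// -EFinM.
rewrite sumEFin lee_fin -mulr_sumr -[leLHS]mulrA ler_wpM2l//.
have -> : \sum_(j < J) (r1 * q ^+ j) ^+ 2 * disk_area = r1 ^+ 2 * disk_area * \sum_(j < J) (q ^+ 2) ^+ j.
  by rewrite mulr_sumr; apply: eq_bigr => j _; rewrite exprMn exprAC; ring.
have q2 : 0 < 1 - q ^+ 2 by rewrite subr_gt0 exprn_ilt1// ltW.
have G2 : \sum_(j < J) (q ^+ 2) ^+ j <= (1 - q ^+ 2)^-1.
  rewrite -[leRHS]mul1r ler_pdivlMr// mulrC -opprB mulNr -subrX1 opprB gerBl.
  by rewrite !exprn_ge0// ltW.
rewrite [leRHS](_ : _ = 2 * - ln q * (r1 ^+ 2 * disk_area * (1 - q ^+ 2)^-1)); last by ring.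
by rewrite ler_pM2l// ler_wpM2l// mulr_ge0 ?exprn_ge0 ?(ltW r0) ?(ltW disk_area_gt0).
Qed.

Lemma integral_uniform_disk (f : C -> R) : measurable_fun setT f -> (forall z, 0 <= f z) ->
  (\int[@uniform_disk R]_z (f z)%:E = (disk_area^-1)%:E * \int[leb]_(z in disk 0%R 1) (f z)%:E)%E.
Proof.
move=> mf f0; have V0 := disk_area_gt0.
have mF D : measurable_fun D (fun z => (f z)%:E) by apply: measurable_funTS; exact/measurable_EFinP.
have mD := measurable_disk 0 1.
pose rs : {measure set C -> \bar R} := mrestr leb mD.
pose vn : {nonneg R} := NngNum (ltW (ltac:(by rewrite invr_gt0) : 0 < disk_area^-1)).
transitivity (\int[mscale vn rs]_z (f z)%:E)%E.
  apply: eq_measure_integral => A mA _.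
  change (@uniform_disk R A = (disk_area^-1)%:E * leb (A `&` disk 0%R 1))%E.
  have ev : leb (setT `&` @unit_disk R) = disk_area%:E by rewrite setTI disk_areaE.
  rewrite /uniform_disk /mnormalize; case: ifP => [/orP[] /eqP|_].
  - move=> h; have : leb (setT `&` @unit_disk R) = 0%E by exact: h.
    by rewrite ev => -[h']; have := V0; rewrite h' ltxx.
  - move=> h; have : leb (setT `&` @unit_disk R) = +oo%E by exact: h.
    by rewrite ev.
  change (leb (A `&` @unit_disk R) * ((fine (leb (setT `&` @unit_disk R)))^-1)%:E = (disk_area^-1)%:E * leb (A `&` disk 0%R 1))%E.
  by rewrite ev muleC unit_diskE.
transitivity ((disk_area^-1)%:E * \int[rs]_z (f z)%:E)%E.
  by apply: (@ge0_integral_mscale _ _ _ rs setT measurableT vn) => [|z _]; [exact: mF|rewrite lee_fin].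
apply: (congr1 (fun u => (disk_area^-1)%:E * u)%E).
rewrite -(setUv (disk 0 1)) ge0_integral_setU//; first last.
- by rewrite disj_set2E setICr.
- by move=> z _; rewrite lee_fin.
- exact: measurableC.
rewrite [X in (_ + X)%E](_ : _ = 0)%E ?adde0.
  apply: eq_measure_integral => A mA AD; rewrite /rs /mrestr.
  by congr (leb _); apply/setIidl.
rewrite (@eq_measure_integral _ _ _ _ mzero).
  by rewrite integral_measure_zero.
move=> A mA AD; change (leb (A `&` disk 0%R 1) = 0%E).
rewrite (_ : A `&` _ = set0); first exact: lebesgue_complex0.
by apply/seteqP; split => // z [/AD].
Qed.

Lemma integral_disk_shrink (f : C -> R) (M R0 : R) : measurable_fun setT f ->
  (forall z, 0 <= f z <= M) -> 0 < R0 <= 1 ->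
  (\int[leb]_(z in disk 0%R 1) (f z)%:E <= \int[leb]_(z in disk 0%R R0) (f z)%:E + (M * (disk_area * (1 - R0 ^+ 2)))%:E)%E.
Proof.
move=> mf fM /andP[R00 R01].
have mF D : measurable_fun D (fun z => (f z)%:E) by apply: measurable_funTS; exact/measurable_EFinP.
have m1 := measurable_disk 0 1; have m0 := measurable_disk 0 R0.
have sub : disk 0 R0 `<=` disk 0 1.
  move=> z /le_trans; apply; rewrite expr1n exprn_ile1//; exact: ltW.
have mdf : measurable (disk 0 1 `\` disk 0 R0) by exact: measurableD.
rewrite -{1}(setDUK sub) ge0_integral_setU//; first last.
- by rewrite disj_set2E setDIK.
- by move=> z _; rewrite lee_fin; have /andP[] := fM z.
apply: leeD => //.
apply: (@le_trans _ _ (\int[leb]_(z in disk 0%R 1 `\` disk 0%R R0) (cst M%:E) z)%E).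
  apply: ge0_le_integral => //.
  - by move=> z _; rewrite lee_fin; have /andP[] := fM z.
  - by move=> z _; rewrite lee_fin; have /andP[] := fM z.
rewrite integral_cst// EFinM lee_wpmul2l//.
  by rewrite lee_fin; have /andP[h /(le_trans h)] := fM 0.
have E1 : leb (disk 0 1) = disk_area%:E by rewrite leb_disk// expr1n mul1r.
have E0 : leb (disk 0 R0) = (R0 ^+ 2 * disk_area)%:E by rewrite leb_disk.
have : (leb (disk 0%R 1 `\` disk 0%R R0) + leb (disk 0%R R0) = leb (disk 0%R 1))%E.
  rewrite -measureU//; first by rewrite setUC setDUK.
  by rewrite setDE -setIA setICl setI0.
rewrite E1 E0; change (leb (disk 0%R 1 `\` disk 0%R R0) + (R0 ^+ 2 * disk_area)%:E = disk_area%:E ->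
  leb (disk 0%R 1 `\` disk 0%R R0) <= (disk_area * (1 - R0 ^+ 2))%:E)%E.
case: (leb _) => [u|//|//] /=; rewrite -EFinD => -[h]; rewrite lee_fin; lra.
Qed.

End disks.

(** * Almost sure bounds uniform in the centre *)

Section convergence.
Context d (T : measurableType d) (R : realType) (P : probability T R).
Notation C := R[i].
Local Notation leb := (@lebesgue_complex R).

Lemma ae_forall_count (I : countType) (A : I -> T -> Prop) :
  (forall i, {ae P, forall t, A i t}) -> {ae P, forall t, forall i, A i t}.
Proof.
move=> h.
have : {ae P, forall t, forall n : nat, if @choice.unpickle I n is Some i then A i t else True}.
  by apply: ae_foralln => n; case: (choice.unpickle n) => [i|]; [exact: h|exact: aeW].
by apply: filterS => t ht i; have := ht (choice.pickle i); rewrite choice.pickleK.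
Qed.

(** The logarithm of max (|z - la|, r) has slope at most 1 / r as a function of z. *)
Lemma potential_lip (z g : C) (r dl : R) (s : seq C) : 0 < r -> 0 <= dl -> nsq (z - g) <= dl ^+ 2 ->
  potential z r s <= potential g r s + (size s)%:R * (2 * (dl / r)).
Proof.
move=> r0 dl0 zg.
have nn (v : C) : 0 <= Normc.normc v by case: v => ? ?; exact: sqrtr_ge0.
have -> : (size s)%:R * (2 * (dl / r)) = \sum_(la <- s) (2 * (dl / r)).
  by rewrite big_const_seq count_predT iter_addr_0 mulr_natl.
rewrite /potential -big_split /=; apply: ler_sum => la _.
set m := Num.max (nsq (g - la)) (r ^+ 2); have m0 : 0 < m by rewrite lt_max exprn_gt0 ?orbT.
have M0 : 0 < Num.max (nsq (z - la)) (r ^+ 2) by rewrite lt_max exprn_gt0 ?orbT.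
rewrite -[2 * (dl / r)]expRK -lnM ?posrE ?expR_gt0// ler_ln ?posrE ?mulr_gt0 ?expR_gt0//.
pose A := Num.sqrt m; have A2 : A ^+ 2 = m by rewrite sqr_sqrtr// ltW.
have A0 : 0 <= A by exact: sqrtr_ge0.
have rA : r <= A by rewrite -(ler_pXn2r (n := 2)) ?nnegrE ?(ltW r0)// A2 le_max lexx orbT.
have gA : Normc.normc (g - la) <= A by rewrite -(ler_pXn2r (n := 2)) ?nnegrE// A2 normc_nsq le_max lexx.
have zd : Normc.normc (z - g) <= dl by rewrite -(ler_pXn2r (n := 2)) ?nnegrE// normc_nsq.
have zA : Normc.normc (z - la) <= A + dl.
  have -> : z - la = (g - la) + (z - g) by ring.
  by apply: (le_trans (le_normcD _ _)); exact: lerD.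
apply: (@le_trans _ _ ((A * expR (dl / r)) ^+ 2)); last by rewrite exprMn A2 -expRM_natl.
apply: (@le_trans _ _ ((A + dl) ^+ 2)).
  rewrite ge_max -normc_nsq; apply/andP; split; apply: lerXn2r; rewrite ?nnegrE ?addr_ge0 ?(ltW r0)//.
  by rewrite (le_trans rA)// lerDl.
apply: lerXn2r; rewrite ?nnegrE ?addr_ge0 ?mulr_ge0 ?expR_ge0//.
apply: (@le_trans _ _ (A * (1 + dl / r))); last by rewrite ler_wpM2l// expR_ge1Dx.
rewrite mulrDr mulr1 lerD2l mulrCA ler_peMr// ler_pdivlMr// mul1r//.
Qed.

Variable x : nat * nat -> {RV P >-> C}.
Hypothesis x_iid : iid x.
Local Notation mu := (distribution P (x (0%N, 0%N))).
Hypothesis mu_std : std_law mu.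
Local Notation eigs := (eigs x).

Definition grid (K j k : nat) : C := (j%:R / K.+1%:R - 1) +i* (k%:R / K.+1%:R - 1).
Definition rad_of (a : nat) : R := a.+2%:R^-1.
Definition ratio_of (b : nat) : R := (1 + b.+1%:R^-1)^-1.

(** Centres, radii and ratios run through countable families, so that a single null set serves all
    test functions and all precisions. *)
Definition regular t := forall (i : (nat * nat * nat) * (nat * nat * nat)),
  let: ((a, b, J), (K, j, k)) := i in
  nsq (grid K j k) <= 1 -> (forall om, nsq om = 1 -> nsq (grid K j k - (rad_of a)%:C * om) < 1) ->
  \forall n \near \oo, n%:R * (rad_of a ^+ 2 - 4 * (rad_of a * ratio_of b ^+ J)) <=
    potential (grid K j k) (rad_of a) (eigs n t) - potential (grid K j k) (rad_of a * ratio_of b ^+ J) (eigs n t).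

Lemma rad_of_gt0 a : 0 < rad_of a. Proof. by rewrite invr_gt0. Qed.
Lemma rad_of_le a : rad_of a <= 2^-1. Proof. by rewrite lef_pV2 ?posrE// ler_nat. Qed.
Lemma ratio_of01 b : 0 < ratio_of b < 1.
Proof.
have h : 0 < b.+1%:R^-1 :> R by rewrite invr_gt0.
by rewrite /ratio_of invr_gt0 invf_lt1 ?ltrDl ?h ?addr_gt0.
Qed.

Lemma as_regular : {ae P, forall t, regular t}.
Proof.
apply: ae_forall_count => -[[[a b] J] [[K j] k]].
have [g1|g1] := leP (nsq (grid K j k)) 1; last first.
  by apply: aeW => t h.
have [hz|hz] := pselect (forall om, nsq om = 1 -> nsq (grid K j k - (rad_of a)%:C * om) < 1); last by apply: aeW => t _ h.
have /andP[q0 q1] := ratio_of01 b; have r0 := rad_of_gt0 a.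
have r2 : 0 < rad_of a * ratio_of b ^+ J <= 1.
  rewrite mulr_gt0 ?exprn_gt0//= mulr_ile1 ?exprn_ge0 ?exprn_ile1 ?(ltW r0) ?(ltW q0) ?(ltW q1)//.
  by have := rad_of_le a; lra.
by apply: filterS (as_bump x_iid mu_std r0 r2 g1 hz) => t ht _ _.
Qed.

(** A finite grid of mesh at most dl / 2 and the Lipschitz bound extend the inequality to all
    centres; this is what raises the coefficient of r2 from 4 to 5. *)
Lemma regular_uniform t a b J : regular t ->
  \forall n \near \oo, forall z, disk 0 (1 - 2 * rad_of a) z ->
    n%:R * (rad_of a ^+ 2 - 5 * (rad_of a * ratio_of b ^+ J)) <=
    potential z (rad_of a) (eigs n t) - potential z (rad_of a * ratio_of b ^+ J) (eigs n t).
Proof.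
move=> reg; have /andP[q0 q1] := ratio_of01 b; have r0 := rad_of_gt0 a; have rl := rad_of_le a.
have q2 : 0 < ratio_of b ^+ J <= 1 by rewrite exprn_gt0//= exprn_ile1 ?(ltW q0) ?(ltW q1).
set r1 := rad_of a in r0 rl *; set r2 := r1 * ratio_of b ^+ J.
have r20 : 0 < r2 by rewrite mulr_gt0// exprn_gt0.
have r21 : r2 <= r1 by rewrite ler_piMr ?(ltW r0)//; case/andP: q2.
(* Each of the two potentials then moves by at most n r2 / 2 between z and its grid point. *)
pose dl := r2 ^+ 2 / 4.
have dl0 : 0 < dl by rewrite divr_gt0// exprn_gt0.
have dlr : dl < r1.
  rewrite /dl; have : r2 ^+ 2 <= r1 * 1 by rewrite expr2; apply: ler_pM; rewrite ?(ltW r20)//; lra.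
  by move: r0; lra.
pose K := Num.truncn (2 / dl).
have K1 : 2 / dl < K.+1%:R by have /andP[] := truncn_itv (ltac:(by rewrite divr_ge0// ltW) : 0 <= 2 / dl).
have K0 : 0 < K.+1%:R :> R by [].
have hK : K.+1%:R^-1 <= dl / 2.
  have -> : dl / 2 = (2 / dl)^-1 by rewrite invf_div.
  have D2 : 0 < 2 / dl by exact: divr_gt0 _ dl0.
  by rewrite lef_pV2 ?posrE ?D2// (ltW K1).
have nn (v : C) : 0 <= Normc.normc v by case: v => ? ?; exact: sqrtr_ge0.
have near_g : \forall n \near \oo, forall j k : 'I_(2 * K.+1).+1,
   nsq (grid K j k) <= 1 -> (forall om, nsq om = 1 -> nsq (grid K j k - r1%:C * om) < 1) ->
   n%:R * (r1 ^+ 2 - 4 * r2) <= potential (grid K j k) r1 (eigs n t) - potential (grid K j k) r2 (eigs n t).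
  apply: near_forall_ord => j; apply: near_forall_ord => k.
  have [g1|g1] := leP (nsq (grid K j k)) 1; last first.
    by near=> n; move=> h.
  have [hz|hz] := pselect (forall om, nsq om = 1 -> nsq (grid K j k - r1%:C * om) < 1); last by near=> n; move=> _ h.
  by have := reg ((a, b, J), (K, nat_of_ord j, nat_of_ord k)) g1 hz; apply: filterS => n h _ _.
apply: filterS near_g => n hn z Dz.
have coord (u : R) : -1 <= u <= 1 -> exists2 j : 'I_(2 * K.+1).+1, (j%:R / K.+1%:R - 1 <= u) & u < j%:R / K.+1%:R - 1 + K.+1%:R^-1.
  move=> /andP[u1 u2]; have h0 : 0 <= (u + 1) * K.+1%:R by rewrite mulr_ge0//; lra.
  have /andP[t1 t2] := truncn_itv h0.
  have jl : (Num.truncn ((u + 1) * K.+1%:R) < (2 * K.+1).+1)%N.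
    by rewrite ltnS -(ler_nat R) (le_trans t1)// natrM ler_pM2r//; lra.
  exists (Ordinal jl) => /=; first by rewrite lerBlDr ler_pdivrMr.
  have : u + 1 < (Num.truncn ((u + 1) * K.+1%:R)).+1%:R / K.+1%:R by rewrite ltr_pdivlMr.
  by rewrite -natr1 mulrDl mul1r => h; rewrite addrAC ltrBrDr.
have nz : nsq z <= (1 - 2 * r1) ^+ 2 by move: Dz; rewrite /disk /= subr0.
have nz1 : Normc.normc z <= 1 - 2 * r1.
  by rewrite -(ler_pXn2r (n := 2)) ?nnegrE// ?normc_nsq//; lra.
have z1 : nsq z <= 1 by apply: (le_trans nz); rewrite exprn_ile1//; lra.
have [[j j1 j2] [k k1 k2]] : (exists2 j : 'I_(2 * K.+1).+1, (j%:R / K.+1%:R - 1 <= complex.Re z) & complex.Re z < j%:R / K.+1%:R - 1 + K.+1%:R^-1) /\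
   (exists2 j : 'I_(2 * K.+1).+1, (j%:R / K.+1%:R - 1 <= complex.Im z) & complex.Im z < j%:R / K.+1%:R - 1 + K.+1%:R^-1).
  by split; apply: coord; move: z1; rewrite /nsq; move: (complex.Re z) (complex.Im z) => u v h; apply/andP; split; nra.
have cl (g v : R) : g <= v -> v < g + K.+1%:R^-1 -> (v - g) ^+ 2 <= (dl / 2) ^+ 2.
  have d20 : 0 <= dl / 2 by exact: divr_ge0 (ltW dl0) _.
  move=> h1 h2; apply: lerXn2r; rewrite ?nnegrE ?subr_ge0 ?d20//.
  by rewrite lerBlDr (le_trans (ltW h2))// addrC lerD2r.
have zg : nsq (z - grid K j k) <= dl ^+ 2.
  have -> : nsq (z - grid K j k) = (complex.Re z - (j%:R / K.+1%:R - 1)) ^+ 2 + (complex.Im z - (k%:R / K.+1%:R - 1)) ^+ 2.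
    by case: z {hn Dz nz nz1 z1 j1 j2 k1 k2} => u v; rewrite /nsq /grid /=.
  move: j1 j2 k1 k2; move: (j%:R / _ - 1) (k%:R / _ - 1) (complex.Re z) (complex.Im z) => g1 g2 u v *.
  have A : (u - g1) ^+ 2 <= (dl / 2) ^+ 2 by exact: cl.
  have B : (v - g2) ^+ 2 <= (dl / 2) ^+ 2 by exact: cl.
  by have := sqr_ge0 dl; move: A B; rewrite !exprMn => A B; nra.
have ng : Normc.normc (grid K j k) <= 1 - 2 * r1 + dl.
  have -> : grid K j k = z + (- (z - grid K j k)) by rewrite opprB addrC subrK.
  apply: (le_trans (le_normcD _ _)); rewrite normcN; apply: lerD => //.
  by rewrite -(ler_pXn2r (n := 2)) ?nnegrE ?(ltW dl0)// normc_nsq.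
have g1 : nsq (grid K j k) <= 1.
  by rewrite -normc_nsq exprn_ile1//; lra.
have gz om : nsq om = 1 -> nsq (grid K j k - r1%:C * om) < 1.
  move=> o1; rewrite -normc_nsq exprn_ilt1//; apply: (le_lt_trans (le_normcD _ _)); rewrite normcN Normc.normcM.
  have -> : Normc.normc om = 1 by apply/eqP; rewrite -(@eqrXn2 _ 2)// normc_nsq o1 expr1n.
  have -> : Normc.normc r1%:C = r1.
    by apply/eqP; rewrite -(@eqrXn2 _ 2) ?(ltW r0)// normc_nsq nsqC.
  lra.
have := hn j k g1 gz.
have := potential_lip (eigs n t) r20 (ltW dl0) zg.
have := potential_lip (eigs n t) r0 (ltW dl0) (ltac:(by rewrite -nsqN opprB) : nsq (grid K j k - z) <= dl ^+ 2).
rewrite size_eigs.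
have d1 : dl / r1 <= r2 / 4.
  rewrite ler_pdivrMr// /dl expr2; have : r2 * r2 <= r2 * r1 by rewrite ler_pM2l.
  by lra.
have d2 : dl / r2 <= r2 / 4.
  by rewrite ler_pdivrMr// /dl expr2; lra.
have n0 : 0 <= n%:R :> R by [].
have e1 : n%:R * (2 * (dl / r1)) <= n%:R * (r2 / 2) by rewrite ler_wpM2l//; lra.
have e2 : n%:R * (2 * (dl / r2)) <= n%:R * (r2 / 2) by rewrite ler_wpM2l//; lra.
have -> : n%:R * (r1 ^+ 2 - 5 * r2) = n%:R * (r1 ^+ 2 - 4 * r2) - n%:R * r2 by ring.
have -> : n%:R * r2 = n%:R * (r2 / 2) + n%:R * (r2 / 2) by field.
move: e1 e2; move: (potential _ _ _) (potential _ _ _) (potential _ _ _) (potential _ _ _) (n%:R * _) (n%:R * _) (n%:R * _) (n%:R * _); clear.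
by move=> *; lra.
Unshelve. all: end_near. Qed.

End convergence.

Section limits.
Context d (T : measurableType d) (R : realType) (P : probability T R).
Notation C := R[i].
Local Notation leb := (@lebesgue_complex R).
Variable x : nat * nat -> {RV P >-> C}.
Local Notation eigs := (eigs x).
Local Notation mean n t f := ((n%:R : R)^-1 * \sum_(la <- eigs n t) f la).

(** [regular_uniform] feeds [esd_disk_lower] on the disk of radius 1 - 2 r. The four errors of ep /
    4 are the oscillation of f at scale r, the missing annulus, the layer factor, and the inner
    radius. *)
Lemma regular_liminf t (f : C -> R) (M : R) : regular x t -> measurable_fun setT f -> 0 < M ->
  (forall z, 0 <= f z <= M) ->
  (forall ep : R, 0 < ep -> exists2 dl, 0 < dl & forall z la, nsq (z - la) <= dl ^+ 2 -> f z <= f la + ep) ->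
  forall ep, 0 < ep -> \forall n \near \oo,
    fine (\int[@uniform_disk R]_z (f z)%:E)%E - ep <= mean n t f.
Proof.
move=> reg mf M0 fM osc ep ep0; have V0 := disk_area_gt0 R.
have f0 z : 0 <= f z by have /andP[] := fM z.
have e4 : 0 < ep / 4 by rewrite divr_gt0.
have [dl dl0 hosc] := osc _ e4.
pose a := Num.truncn (dl^-1 + 16 * M / ep).
have A0 : 0 <= dl^-1 + 16 * M / ep by rewrite addr_ge0 ?invr_ge0 ?(ltW dl0)// divr_ge0 ?(ltW ep0)// mulr_ge0// ltW.
have /andP[_ a1] := truncn_itv A0.
have a2 : dl^-1 + 16 * M / ep <= a.+2%:R by rewrite (le_trans (ltW a1))// ler_nat.
have B0 : 0 < 16 * M / ep by rewrite divr_gt0// mulr_gt0.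
have r0 := rad_of_gt0 R a; have rl := rad_of_le R a.
have r_dl : rad_of R a <= dl.
  rewrite /rad_of -[leRHS]invrK lef_pV2 ?posrE ?invr_gt0//; apply: le_trans a2; lra.
have r_M : 4 * M * rad_of R a <= ep / 4.
  rewrite /rad_of ler_pdivrMr//; have : 16 * M / ep <= a.+2%:R by apply: le_trans a2; rewrite lerDr invr_ge0 ltW.
  by rewrite ler_pdivrMr//; lra.
pose b := Num.truncn (12 * M / ep).
have /andP[_ b1] := truncn_itv (ltac:(by rewrite divr_ge0 ?(ltW ep0)// mulr_ge0// ltW) : 0 <= 12 * M / ep).
pose u : R := b.+1%:R^-1; have u0 : 0 < u by rewrite invr_gt0.
have u1 : u <= 1 by rewrite invf_le1// ler1n.
have uM : 3 * u * M <= ep / 4.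
  rewrite /u mulrAC ler_pdivrMr//; move: b1; rewrite ltr_pdivrMr//; lra.
have /andP[q0 q1] := ratio_of01 R b.
pose eta := Num.min (2^-1) (ep / (4 * M)).
have eta0 : 0 < eta by rewrite lt_min invr_gt0 ltr0n/= divr_gt0// mulr_gt0.
have eta1 : eta <= 2^-1 by rewrite /eta ge_min lexx.
have etaM : eta * M <= ep / 4.
  have : eta <= ep / (4 * M) by rewrite /eta ge_min lexx orbT.
  by rewrite ler_pdivlMr ?mulr_gt0//; lra.
have [J hJ] : exists J, ratio_of R b ^+ J < eta * rad_of R a / 5.
  have q1' : `|ratio_of R b| < 1 by rewrite gtr0_norm.
  have /cvgr_lt := cvg_expr q1' => /(_ (eta * rad_of R a / 5)) [].
    by rewrite divr_gt0// mulr_gt0.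
  by move=> J _ hJ; exists J; apply: (hJ J) => /=.
pose I := fine (\int[@uniform_disk R]_z (f z)%:E)%E.
have mF D : measurable_fun D (fun z => (f z)%:E) by apply: measurable_funTS; exact/measurable_EFinP.
have IE : (\int[leb]_(z in disk 0%R 1) (f z)%:E = (disk_area R * I)%:E)%E /\ I <= M.
  have h0 : (0 <= \int[@uniform_disk R]_z (f z)%:E)%E by apply: integral_ge0 => z _; rewrite lee_fin.
  have hM : (\int[@uniform_disk R]_z (f z)%:E <= M%:E)%E.
    apply: (@le_trans _ _ (\int[@uniform_disk R]_z (cst M%:E z))%E).
      apply: ge0_le_integral => //.
      - by move=> z _; rewrite lee_fin.
      - by move=> z _; rewrite lee_fin; case/andP: (fM z).
    rewrite integral_cst//; apply: (@le_trans _ _ (M%:E * 1)%E); last by rewrite mule1.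
    apply: lee_wpmul2l; first by rewrite lee_fin ltW.
    exact: (@probability_le1 _ _ _ (@uniform_disk R) _ measurableT).
  have hI : (\int[@uniform_disk R]_z (f z)%:E = I%:E)%E.
    by rewrite /I fineK// ge0_fin_numE// (le_lt_trans hM)// ltry.
  split; last by rewrite -lee_fin -hI.
  by rewrite EFinM -hI integral_uniform_disk// muleA -EFinM divff ?mul1e// gt_eqF.
have [IE1 IM] := IE.
(* The disk degenerates when the radius is 1/2; the lower bound wanted below is then nonpositive. *)
have R0 : 0 < 1 - 2 * rad_of R a \/ 1 - 2 * rad_of R a = 0.
  by case: (ltrgtP 0 (1 - 2 * rad_of R a)) => h; [left|move: rl h; lra|right].
have c0 : 0 <= rad_of R a ^+ 2 - 5 * (rad_of R a * ratio_of R b ^+ J) /\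
  (1 - eta) * rad_of R a ^+ 2 <= rad_of R a ^+ 2 - 5 * (rad_of R a * ratio_of R b ^+ J).
  have h : 5 * (rad_of R a * ratio_of R b ^+ J) <= eta * rad_of R a ^+ 2.
    have : rad_of R a * ratio_of R b ^+ J <= rad_of R a * (eta * rad_of R a / 5) by rewrite ler_pM2l// ltW.
    by rewrite expr2; lra.
  have h2 : eta * rad_of R a ^+ 2 <= 2^-1 * rad_of R a ^+ 2 by rewrite ler_wpM2r// sqr_ge0.
  by have := sqr_ge0 (rad_of R a); split; lra.
have [c00 c1] := c0.
(* For q = 1 / (1 + u), - ln q <= u and 1 - q^2 = u (2 + u) / (1 + u)^2. *)
have kap : 2 * - ln (ratio_of R b) / (1 - ratio_of R b ^+ 2) <= (1 + u) ^+ 2.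
  have lq : - ln (ratio_of R b) <= u.
    rewrite /ratio_of lnV ?posrE ?addr_gt0// opprK -/u -[leRHS]expRK ler_ln ?posrE ?expR_gt0 ?addr_gt0//.
    exact: expR_ge1Dx.
  have e1 : 1 - ratio_of R b ^+ 2 = u * (2 + u) / (1 + u) ^+ 2.
    by rewrite /ratio_of -/u exprVn; field; rewrite gt_eqF ?addr_gt0.
  rewrite e1 invf_div mulrA ler_pdivrMr ?mulr_gt0 ?addr_gt0// mulrC ler_wpM2l ?sqr_ge0//.
  by apply: (@le_trans _ _ (2 * u)); [rewrite ler_pM2l|nra].
have unif := regular_uniform a b J reg.
near=> n.
have n1 : (0 < n)%N by near: n; exact: near_ge.
have nR : 0 < n%:R :> R by rewrite ltr0n.
have hn : forall z, disk 0 (1 - 2 * rad_of R a) z -> n%:R * (rad_of R a ^+ 2 - 5 * (rad_of R a * ratio_of R b ^+ J)) <=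
    potential z (rad_of R a) (eigs n t) - potential z (rad_of R a * ratio_of R b ^+ J) (eigs n t) by near: n.
pose Av := mean n t f.
have Av0 : 0 <= Av by rewrite mulr_ge0 ?invr_ge0//; apply: sumr_ge0.
suff key : (1 - eta) * (I - 4 * M * rad_of R a) <= (1 + u) ^+ 2 * (Av + ep / 4).
  rewrite -/I -/Av; have [X0|X0] := leP (I - 4 * M * rad_of R a) 0; first by move: X0 r_M Av0 ep0; lra.
  have [AM|AM] := leP M (Av + ep / 4); first by move: AM IM ep0; lra.
  have A0' : 0 <= Av + ep / 4 by rewrite addr_ge0// ltW.
  have h1 : (1 + u) ^+ 2 * (Av + ep / 4) <= (Av + ep / 4) + 3 * u * M.
    have : (2 * u + u ^+ 2) * (Av + ep / 4) <= 3 * u * M.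
      apply: ler_pM => //; [by rewrite addr_ge0 ?sqr_ge0// mulr_ge0// ltW|by rewrite expr2; nra|exact: ltW].
    by move=> h; have -> : (1 + u) ^+ 2 * (Av + ep / 4) = (Av + ep / 4) + (2 * u + u ^+ 2) * (Av + ep / 4) by [ring]; rewrite lerD2l.
  have h2 : eta * (I - 4 * M * rad_of R a) <= eta * M.
    by rewrite ler_pM2l// lerBlDr (le_trans IM)// lerDl !mulr_ge0// ltW.
  by move: key h1 h2 r_M uM etaM ep0; lra.
have osc' z la : nsq (z - la) <= rad_of R a ^+ 2 -> f z <= f la + ep / 4.
  by move=> h; apply: hosc; apply: (le_trans h); rewrite ler_pXn2r ?nnegrE ?(ltW r0) ?(ltW dl0).
have := @esd_disk_lower R f (eigs n t) (ep / 4) (rad_of R a) (ratio_of R b) _ (1 - 2 * rad_of R a) J mf f0 (ltW e4) r0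
  (ratio_of01 R b) c00 osc'; rewrite size_eigs => /(_ hn).
set r := rad_of R a in r0 rl r_dl r_M c1 c00 R0 *.
set cc := r ^+ 2 - 5 * _ in c1 c00 *; set ka := 2 * - ln _ / _ in kap *.
have V0' := ltW V0.
have sumE : \sum_(la <- eigs n t) (f la + ep / 4) * (r ^+ 2 * disk_area R * ka) = n%:R * (Av + ep / 4) * (r ^+ 2 * disk_area R * ka).
  rewrite -mulr_suml big_split /= big_const_seq count_predT iter_addr_0 size_eigs; congr (_ * _).
  by rewrite /Av mulrDr mulVKf ?gt_eqF// mulr_natl.
rewrite sumE => main.
have low : ((disk_area R * (I - 4 * M * r))%:E <= \int[leb]_(z in disk 0%R (1 - 2 * r)) (f z)%:E)%E.
  have [Rp|Rz] := R0.
    have := integral_disk_shrink mf fM (ltac:(by rewrite Rp/=; lra) : 0 < 1 - 2 * r <= 1).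
    rewrite IE1; case: (\int[leb]_(z in _) _)%E => [v|_|]; last 2 first.
    - exact: leey.
    - by rewrite addNye leeNy_eq.
    rewrite -EFinD !lee_fin.
    have : M * (disk_area R * (1 - (1 - 2 * r) ^+ 2)) <= M * (disk_area R * (4 * r)).
      by rewrite !ler_pM2l//; have := sqr_ge0 r; nra.
    by move=> h1 h2; nra.
  apply: (@le_trans _ _ 0%E); last by apply: integral_ge0 => z _; rewrite lee_fin.
  rewrite lee_fin mulr_ge0_le0// subr_le0 (le_trans IM)//.
  by have -> : r = 2^-1 by [move: Rz; lra]; lra.
have main2 : n%:R * cc * (disk_area R * (I - 4 * M * r)) <= n%:R * (Av + ep / 4) * (r ^+ 2 * disk_area R * ka).
  rewrite -lee_fin; apply: le_trans main; rewrite EFinM lee_wpmul2l// lee_fin mulr_ge0//.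
have [X0|X0] := leP (I - 4 * M * r) 0.
  apply: (@le_trans _ _ 0); first by rewrite mulr_ge0_le0//; lra.
  by rewrite mulr_ge0 ?sqr_ge0// addr_ge0// ltW.
have A0' : 0 <= Av + ep / 4 by rewrite addr_ge0// ltW.
have r2 : 0 < r ^+ 2 by rewrite exprn_gt0.
rewrite -(ler_pM2l (mulr_gt0 (mulr_gt0 nR V0) r2)).
apply: (@le_trans _ _ (n%:R * cc * (disk_area R * (I - 4 * M * r)))).
  have : (1 - eta) * r ^+ 2 * (n%:R * disk_area R * (I - 4 * M * r)) <= cc * (n%:R * disk_area R * (I - 4 * M * r)).
    by rewrite ler_wpM2r// mulr_ge0 ?mulr_ge0// ltW.
  by lra.
apply: (le_trans main2).
have : n%:R * (Av + ep / 4) * (r ^+ 2 * disk_area R) * ka <= n%:R * (Av + ep / 4) * (r ^+ 2 * disk_area R) * (1 + u) ^+ 2.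
  by rewrite ler_wpM2l// mulr_ge0 ?mulr_ge0// ?ltW.
by lra.
Unshelve. all: end_near. Qed.

End limits.

(** * Measurability of linear statistics *)

Section continuity_of_roots.
Variable R : realType.
Notation C := R[i].
Local Notation nc := (@Normc.normc R).
Implicit Types (s q : seq C) (p : {poly C}).

Let nc_ge0 (u : C) : 0 <= nc u. Proof. by case: u => ? ?; exact: sqrtr_ge0. Qed.

Definition rpoly s : {poly C} := \prod_(la <- s) ('X - la%:P).
Definition coef_close (e : R) p1 p2 := forall k, nc (p1 - p2)`_k <= e.

Lemma rpoly_cons la s : rpoly (la :: s) = ('X - la%:P) * rpoly s.
Proof. by rewrite /rpoly big_cons. Qed.

Lemma size_rpoly s : size (rpoly s) = (size s).+1.
Proof. by rewrite /rpoly size_prod_XsubC. Qed.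

Lemma rpoly_perm s q : perm_eq s q -> rpoly s = rpoly q.
Proof. by move=> h; rewrite /rpoly (perm_big _ h). Qed.

Lemma normc_horner p (n : nat) (e B : R) (z : C) : (size p <= n)%N -> 1 <= B -> nc z <= B ->
  (forall k, nc p`_k <= e) -> nc p.[z] <= n%:R * (e * B ^+ n).
Proof.
move=> pn B1 zB pe; rewrite (horner_coef_wide _ pn).
have e0 : 0 <= e by apply: le_trans (pe 0%N).
have zX k : nc (z ^+ k) <= B ^+ k.
  elim: k => [|k IH]; first by rewrite !expr0 Normc.normc1.
  by rewrite !exprS Normc.normcM ler_pM.
have aux m : (m <= n)%N -> nc (\sum_(i < m) p`_i * z ^+ i) <= m%:R * (e * B ^+ n).
  elim: m => [|m IH] mn; first by rewrite big_ord0 Normc.normc0 mul0r.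
  rewrite big_ord_recr /= -natr1 mulrDl mul1r (le_trans (le_normcD _ _))// lerD ?IH ?(ltnW mn)//.
  by rewrite Normc.normcM ler_pM// (le_trans (zX m))// ler_weXn2l// (ltnW mn).
exact: aux.
Qed.

(* Synthetic division by ['X - z], read off from the top coefficient down. *)
Lemma coef_div_XsubC p D (n : nat) (e B : R) (z : C) : ('X - z%:P) * p = D -> (size p <= n)%N ->
  1 <= B -> nc z <= B -> (forall k, nc D`_k <= e) -> forall k, nc p`_k <= n%:R * (e * B ^+ n).
Proof.
move=> pD pn B1 zB De k.
have e0 : 0 <= e by apply: le_trans (De 0%N).
have B0 : 0 <= B by apply: le_trans B1.
have rec i : p`_i = D`_i.+1 + z * p`_i.+1.
  by rewrite -pD mulrBl coefB mul_polyC coefZ coefXM /= subrK.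
have aux j i : (n <= i + j)%N -> nc p`_i <= j%:R * (e * B ^+ j).
  elim: j i => [|j IH] i ij; first by rewrite addn0 in ij; rewrite nth_default ?(leq_trans pn ij)// Normc.normc0 mul0r.
  rewrite rec (le_trans (le_normcD _ _))// -natr1 mulrDl mul1r addrC lerD//.
    have -> : j%:R * (e * B ^+ j.+1) = B * (j%:R * (e * B ^+ j)) by rewrite exprS; ring.
    by rewrite Normc.normcM ler_pM// IH// addSn -addnS.
  by rewrite (le_trans (De _))// ler_peMr// exprn_ege1.
have [nk|kn] := leqP n k; first by rewrite nth_default ?(leq_trans pn)// Normc.normc0 !mulr_ge0 ?exprn_ge0.
by apply: aux; rewrite leq_addl.
Qed.

(** At a root la of the given polynomial the perturbed one is small, so it has a root a near la.
    Dividing each polynomial by its factor keeps the coefficients close, and induction matches the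
    remaining roots. *)
Lemma roots_match s (e : R) : 0 < e -> exists2 dl, 0 < dl & forall q, size q = size s ->
  coef_close dl (rpoly q) (rpoly s) -> exists2 q', perm_eq q q' & all2 (fun a b => nc (a - b) <= e) q' s.
Proof.
elim: s e => [|la s IH] e e0.
  by exists 1 => // q /size0nil -> _; exists [::].
have [d1 d10 hd1] := IH e e0.
pose n := (size s).+2; pose B := nc la + 2.
have B1 : 1 <= B by rewrite /B; have := nc_ge0 la; lra.
have B0 : 0 < B by lra.
have [S hS] : exists S : R, forall k, nc (rpoly s)`_k <= S.
  exists (\sum_(i < n) nc (rpoly s)`_i) => k; have [kn|nk] := ltnP k n.
    by rewrite (bigD1 (Ordinal kn)) //= lerDl; apply: sumr_ge0.
  by rewrite nth_default ?Normc.normc0 ?sumr_ge0// size_rpoly ltnW.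
have S0 : 0 <= S by apply: le_trans (hS 0%N).
pose W := n%:R * B ^+ n; have W0 : 0 < W by rewrite mulr_gt0 ?exprn_gt0.
pose et := Num.min (Num.min 1 e) (d1 / (2 * (S + 1) * W)).
have S10 : 0 < S + 1 by exact: ltr_wpDl S0 ltr01.
have S1 : 0 < 2 * (S + 1) * W by exact: mulr_gt0 (mulr_gt0 (ltr0Sn _ 1) S10) W0.
have et0 : 0 < et by rewrite !lt_min ltr01 e0 divr_gt0.
have et1 : et <= 1 by rewrite /et !ge_min lexx.
have ete : et <= e by rewrite /et !ge_min lexx orbT.
have etd : et * (S + 1) * W <= d1 / 2.
  have : et <= d1 / (2 * (S + 1) * W) by rewrite /et !ge_min lexx !orbT.
  by rewrite ler_pdivlMr//; lra.
(* The first bound makes the perturbed polynomial smaller than et^n at la, hence a root within et;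
   the second keeps the quotients within d1 of each other. *)
pose dl := Num.min (et ^+ n / (W + 1)) (et * (S + 1)).
have W1 : 0 < W + 1 by exact: ltr_wpDl (ltW W0) ltr01.
have dl0 : 0 < dl by rewrite lt_min; apply/andP; split; [exact: divr_gt0 (exprn_gt0 _ et0) W1|exact: mulr_gt0].
have dlW : dl * W < et ^+ n.
  have : dl <= et ^+ n / (W + 1) by rewrite /dl ge_min lexx.
  by rewrite ler_pdivlMr// mulrDr mulr1 => h; apply: lt_le_trans h; rewrite ltrDl.
have dle : dl <= et * (S + 1) by rewrite /dl ge_min lexx orbT.
exists dl => // q sq hq.
have sd : (size (rpoly q - rpoly (la :: s))%R <= n)%N.
  by rewrite (leq_trans (size_polyD _ _))// size_polyN !size_rpoly sq maxnn.
have lB : nc la <= B by rewrite /B lerDl.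
have ev : nc (rpoly q).[la] < et ^+ n.
  have := normc_horner sd B1 lB hq.
  rewrite hornerD hornerN rpoly_cons hornerM hornerXsubC subrr mul0r subr0 => h.
  by apply: le_lt_trans dlW; rewrite /W mulrCA.
have [a aq ale] : exists2 a, a \in q & nc (la - a) <= et.
  apply: contrapT => no.
  have : et ^+ n <= nc (rpoly q).[la].
    rewrite /rpoly horner_prod.
    apply: (@le_trans _ _ (et ^+ size q)); first by rewrite sq /= ler_wiXn2l ?(ltW et0).
    have : forall b, b \in q -> et <= nc (la - b).
      by move=> b bq; rewrite leNgt; apply/negP => h; apply: no; exists b => //; exact: ltW.
    elim: (q) => [|b r IHr] hr; first by rewrite big_nil Normc.normc1.
    rewrite big_cons hornerXsubC Normc.normcM exprS; apply: ler_pM; rewrite ?exprn_ge0 ?(ltW et0)//.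
      by apply: hr; rewrite mem_head.
    by apply: IHr => c cr; apply: hr; rewrite inE cr orbT.
  by move=> /le_lt_trans /(_ ev); rewrite ltxx.
have pq := perm_to_rem aq; set r := rem a q in pq.
have sr : size r = size s by have := perm_size pq; rewrite sq /= => -[].
have aB : nc a <= B.
  have -> : a = la + - (la - a) by rewrite opprB addrC subrK.
  rewrite (le_trans (le_normcD _ _))// normcN /B lerD// (le_trans ale)// (le_trans et1)//; lra.
have key : coef_close d1 (rpoly r) (rpoly s).
  pose D := (rpoly q - rpoly (la :: s)) + (a - la)%:P * rpoly s.
  have DE : ('X - a%:P) * (rpoly r - rpoly s) = D.
    by rewrite /D (rpoly_perm pq) !rpoly_cons polyCB; ring.
  have sD : (size (rpoly r - rpoly s)%R <= n)%N.
    by rewrite (leq_trans (size_polyD _ _))// size_polyN !size_rpoly sr maxnn /n.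
  have hD k : nc D`_k <= dl + et * S.
    rewrite /D coefD (le_trans (le_normcD _ _))// lerD ?hq// coefCM Normc.normcM ler_pM//.
    by rewrite -opprB normcN.
  move=> k; apply: (le_trans (coef_div_XsubC DE sD B1 aB hD k)).
  rewrite mulrCA -/W; apply: (@le_trans _ _ (2 * (et * (S + 1)) * W)).
    rewrite ler_pM2r//; lra.
  by move: etd; lra.
have [r' pr hr] := hd1 r sr key.
exists (a :: r'); first by rewrite (perm_trans pq)// perm_cons.
by rewrite /= hr andbT -opprB normcN (le_trans ale).
Qed.

Lemma sum_roots_continuous (f : C -> R) s (e : R) : 0 < e ->
  (forall ep : R, 0 < ep -> exists2 dl, 0 < dl & forall z la, nsq (z - la) <= dl ^+ 2 -> `|f z - f la| <= ep) ->
  exists2 dl, 0 < dl & forall q, size q = size s -> coef_close dl (rpoly q) (rpoly s) ->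
    `|\sum_(la <- q) f la - \sum_(la <- s) f la| <= e.
Proof.
move=> e0 uf; have e1 : 0 < e / (size s).+1%:R by rewrite divr_gt0.
have [r r0 hr] := uf _ e1; have [dl dl0 hdl] := roots_match s r0.
exists dl => // q sq hq; have [q' pq hq'] := hdl q sq hq.
rewrite (perm_big _ pq) /=; apply: (@le_trans _ _ ((size s)%:R * (e / (size s).+1%:R))).
  have {hq sq pq} := hq'; clear hdl dl0 hq'; move: (e / _) hr {e1} => c hr.
  elim: s q' => [|b s IH] [|a q']//=; first by rewrite !big_nil subrr normr0 mul0r.
  move=> /andP[ab h]; rewrite !big_cons opprD addrACA -natr1 mulrDl mul1r addrC.
  rewrite (le_trans (ler_normD _ _))// lerD ?IH// hr//.
  by rewrite -normc_nsq lerXn2r ?nnegrE ?(ltW r0).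
by rewrite mulrCA ler_piMr ?(ltW e0)// ler_pdivrMr// mul1r ler_nat.
Qed.

End continuity_of_roots.

Section test_functions.
Variable R : realType.
Notation C := R[i].
Variable f : C -> R.
Hypothesis tf : test_function f.
Local Notation K := (closure [set z | f z != 0]).

(** Balls of the complex numbers have complex radii; neighbourhoods are restated here with real
    ones. *)
Lemma near_nsqP (z0 : C) (A : set C) : nbhs z0 A <-> exists2 r : R, 0 < r & forall w, nsq (z0 - w) < r ^+ 2 -> A w.
Proof.
have normE (u : C) : `|u| = (Normc.normc u)%:C by case: u.
have nn (v : C) : 0 <= Normc.normc v by case: v => ? ?; exact: sqrtr_ge0.
have lt2 (u : C) (r : R) : 0 < r -> (nsq u < r ^+ 2) = (`|u| < r%:C).
  by move=> r0; rewrite normE ltcR -normc_nsq ltr_pXn2r ?nnegrE// ltW.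
split=> [/nbhs_ballP[[e e'] /= e0 h]|[r r0 h]].
  move: e0; rewrite ltcE /= => /andP[/eqP e'0 e0]; subst e'.
  by exists e => // w; rewrite lt2// => hw; apply: h.
apply/nbhs_ballP; exists r%:C; first by rewrite /= ltcR.
by move=> w hw; apply: h; rewrite lt2.
Qed.

Lemma test_near (z0 : C) (ep : R) : 0 < ep -> exists2 r : R, 0 < r & forall w, nsq (z0 - w) < r ^+ 2 -> `|f z0 - f w| <= ep.
Proof.
move=> ep0; have [cf _] := tf; apply/near_nsqP.
by have /cvgrPdist_le := cf z0; apply.
Qed.

Lemma test_out z : ~ K z -> f z = 0.
Proof. by move=> nK; apply: contrapT => /eqP h; apply: nK; exact: subset_closure. Qed.

Lemma test_bounded : exists2 M : R, 0 < M & forall z, `|f z| <= M.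
Proof.
have [_ /compact_near_coveringP cK] := tf.
have : \forall M \near +oo, K `<=` [set z | `|f z| <= M].
  apply: cK => z0 _; have [r r0 hr] := test_near z0 ltr01.
  exists ([set w | nsq (z0 - w) < r ^+ 2], [set M | `|f z0| + 1 <= M]).
    split; first by apply/near_nsqP; exists r.
    by apply: nbhs_pinfty_ge; rewrite num_real.
  move=> [w M] [/= h1 h2]; apply: le_trans h2.
  have -> : f w = f z0 + - (f z0 - f w) by rewrite opprB addrC subrK.
  by rewrite (le_trans (ler_normD _ _))// normrN lerD// hr.
move=> h; have [M [M0 hM]] : exists M, 0 < M /\ K `<=` [set z | `|f z| <= M].
  near +oo_R => M; exists M; split; near: M => //; exact: nbhs_pinfty_gt.
exists M => // z; have [Kz|Kz] := pselect (K z); first exact: hM.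
by rewrite test_out// normr0 ltW.
Unshelve. all: end_near. Qed.

Lemma test_unif (ep : R) : 0 < ep -> exists2 dl : R, 0 < dl & forall z la, nsq (z - la) <= dl ^+ 2 -> `|f z - f la| <= ep.
Proof.
move=> ep0; have [_ /compact_near_coveringP cK] := tf.
have e20 : 0 < ep / 2 by rewrite divr_gt0.
have nn (v : C) : 0 <= Normc.normc v by case: v => ? ?; exact: sqrtr_ge0.
have : \forall dl \near 0^'+, K `<=` [set z | forall la, nsq (z - la) <= dl ^+ 2 -> `|f z - f la| <= ep].
  apply: cK => z0 _; have [r r0 hr] := test_near z0 e20.
  have r20 : 0 < r / 2 by rewrite divr_gt0.
  exists ([set w | nsq (z0 - w) < (r / 2) ^+ 2], [set dl | 0 < dl < r / 2]).
    split; first by apply/near_nsqP; exists (r / 2).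
    by near=> u; apply/andP; split; near: u; [exact: nbhs_right_gt|exact: nbhs_right_lt].
  move=> [w dl] [/= h1 /andP[d0 d1]] la h2.
  have a1 : Normc.normc (z0 - w) < r / 2 by rewrite -(ltr_pXn2r (n := 2)) ?nnegrE ?(ltW r20)// normc_nsq.
  have a2 : Normc.normc (w - la) <= dl by rewrite -(ler_pXn2r (n := 2)) ?nnegrE ?(ltW d0)// normc_nsq.
  have h3 : nsq (z0 - la) < r ^+ 2.
    rewrite -normc_nsq ltr_pXn2r ?nnegrE ?(ltW r0)//.
    have -> : z0 - la = (z0 - w) + (w - la) by rewrite addrA subrK.
    by apply: (le_lt_trans (le_normcD _ _)); lra.
  have h4 : nsq (z0 - w) < r ^+ 2 by apply: (lt_trans h1); rewrite ltr_pXn2r ?nnegrE ?(ltW r0) ?(ltW r20)//; lra.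
  have -> : f w - f la = - (f z0 - f w) + (f z0 - f la) by ring.
  by rewrite (le_trans (ler_normD _ _))// normrN [leRHS]splitr lerD ?hr.
move=> h; have [dl [d0 hd]] : exists dl : R, 0 < dl /\ K `<=` [set z | forall la, nsq (z - la) <= dl ^+ 2 -> `|f z - f la| <= ep].
  near (0 : R)^'+ => dl; exists dl; split; near: dl => //; exact: nbhs_right_gt.
exists dl => // z la zl; have [Kz|Kz] := pselect (K z); first exact: hd.
have [Kl|Kl] := pselect (K la); last by rewrite !test_out// subrr normr0 ltW.
have zl' : nsq (la - z) <= dl ^+ 2 by rewrite -nsqN opprB.
by rewrite -normrN opprB; exact: (hd la Kl z zl').
Unshelve. all: end_near. Qed.

Lemma test_measurable : measurable_fun setT f.
Proof.
apply: (measurability (@RGenOInfty.G R) (RGenOInfty.measurableE R)).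
move=> _ [_ [y ->] <-]; rewrite setTI; apply: sub_sigma_algebra.
apply: open_comp; first by move=> z _; have [cf _] := tf; exact: cf.
exact: interval_open.
Qed.

End test_functions.

Section measurability.
Context d (T : measurableType d) (R : realType) (P : probability T R).
Notation C := R[i].
Variable x : nat * nat -> {RV P >-> C}.
Local Notation eigs := (eigs x).

Lemma cmeasf_coef_det n (M : cfg R -> 'M[{poly C}]_n) :
  (forall i j k, cmeasf (fun xi => (M xi i j)`_k)) -> forall k, cmeasf (fun xi => (\det (M xi))`_k).
Proof.
move=> hM k; under eq_fun do rewrite /determinant coef_sum.
apply: cmeasf_sum => s.
under eq_fun do rewrite mulr_sign.
have hP (g : 'I_n -> 'I_n) : forall (r : seq 'I_n) k, cmeasf (fun xi => (\prod_(i <- r) M xi i (g i))`_k).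
  elim=> [|i r IH] m; first by under eq_fun do rewrite big_nil; exact: cmeasf_cst.
  under eq_fun do rewrite big_cons coefM.
  by apply: cmeasf_sum => j; apply: cmeasfM.
case: (perm.odd_perm s) => /=; last by apply: hP.
by under eq_fun do rewrite coefN; apply: cmeasfN; exact: hP.
Qed.

Definition cpoly n (xi : cfg R) : {poly C} :=
  char_poly ((Num.sqrt (n%:R : R))^-1%:C *: \matrix_(i < n, j < n) (xi (nat_of_ord i, nat_of_ord j) : C)).

Lemma cpolyE n t : cpoly n (config x t) = rpoly (eigs n t).
Proof. by rewrite /rpoly -char_poly_eigenvalues. Qed.

Lemma cmeasf_cpoly n k : cmeasf (fun xi => (cpoly n xi)`_k).
Proof.
apply: cmeasf_coef_det => i j m; under eq_fun do rewrite !mxE coefB coefC.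
apply: cmeasfB; first exact: cmeasf_cst.
case: eqP => _; last exact: cmeasf_cst.
by apply: cmeasfM; [exact: cmeasf_cst|exact: cmeasf_coord].
Qed.

Lemma coef_close_box (p1 p2 : {poly C}) n (dl h : R) (r : 'I_n.+1 -> R * R) : size p1 = n.+1 -> size p2 = n.+1 ->
  0 < dl -> 2 * h <= dl / 2 ->
  (forall k : 'I_n.+1, `|complex.Re p1`_k - (r k).1| < h /\ `|complex.Im p1`_k - (r k).2| < h) ->
  (forall k : 'I_n.+1, `|complex.Re p2`_k - (r k).1| < h /\ `|complex.Im p2`_k - (r k).2| < h) -> coef_close dl p1 p2.
Proof.
move=> s1 s2 dl0 hm hp1 hp2 k; have [kn|nk] := ltnP k n.+1; last first.
  have szd : (size (p1 - p2)%R <= k)%N.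
    by apply: (leq_trans (size_polyD _ _)); rewrite size_polyN s1 s2 maxnn.
  by rewrite (nth_default _ szd) Normc.normc0 ltW.
have [] := hp1 (Ordinal kn); have [] := hp2 (Ordinal kn); rewrite /= coefB.
move: p1`_k p2`_k (r _).1 (r _).2 => [a1 a2] [b1 b2] r1 r2 /=.
rewrite !ltr_distl => /andP[x1 x2] /andP[x3 x4] /andP[x5 x6] /andP[x7 x8].
rewrite -(ler_pXn2r (n := 2)) ?nnegrE ?sqrtr_ge0 ?(ltW dl0)// sqr_sqrtr ?addr_ge0 ?sqr_ge0//.
have y1 : `|a1 - b1| <= dl / 2 by rewrite ler_norml; apply/andP; split; lra.
have y2 : `|a2 - b2| <= dl / 2 by rewrite ler_norml; apply/andP; split; lra.
have d2 : 0 <= dl / 2 by rewrite divr_ge0// ltW.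
have z1 : (a1 - b1) ^+ 2 <= (dl / 2) ^+ 2 by rewrite -real_normK ?num_real// lerXn2r ?nnegrE.
have z2 : (a2 - b2) ^+ 2 <= (dl / 2) ^+ 2 by rewrite -real_normK ?num_real// lerXn2r ?nnegrE.
by apply: (le_trans (lerD z1 z2)); have := sqr_ge0 dl; rewrite exprMn exprVn; lra.
Qed.

(** The list of eigenvalues comes from a mere choice and is not known to be measurable. The sum of f
    over it is continuous in the coefficients of the characteristic polynomial, so the event is a
    countable union of rational boxes of coefficients. *)
Lemma measurable_sum_eigs (f : C -> R) n (c e : R) : test_function f ->
  measurable [set t | `|\sum_(la <- eigs n t) f la - c| < e].
Proof.
move=> tf; set G := [set t | _].
have sz t : size (cpoly n (config x t)) = n.+1.
  by rewrite cpolyE size_rpoly (size_eigs x n t).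
pose b (i : {ffun 'I_n.+1 -> rat * rat} * nat) (xi : cfg R) := [forall k : 'I_n.+1,
  (`|complex.Re (cpoly n xi)`_k - ratr (i.1 k).1| < i.2.+1%:R^-1) &&
  (`|complex.Im (cpoly n xi)`_k - ratr (i.1 k).2| < i.2.+1%:R^-1)].
have mb i : measf (b i).
  apply: measf_forall => k; have [h1 h2] := cmeasf_cpoly n k.
  by apply: measf_and; apply: measf_lt; try exact: measf_cst; move=> d' S Xi mXi;
    apply: measurableT_comp => //; apply: measurable_funB => //; [exact: h1|exact: h2].
pose F i := if `[< [set t | b i (config x t)] `<=` G >] then [set t | b i (config x t)] else set0.
have -> : G = \bigcup_i F i.
  apply/seteqP; split => [t Gt|t [i _]]; last by rewrite /F; case: asboolP => // + h; exact.
  have e0 : 0 < (e - `|\sum_(la <- eigs n t) f la - c|) / 2 by rewrite divr_gt0// subr_gt0.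
  have [dl dl0 hdl] := sum_roots_continuous (eigs n t) e0 (test_unif tf).
  pose m := Num.truncn (4 / dl).
  have /andP[_ m1] := truncn_itv (ltac:(by rewrite divr_ge0// ltW) : 0 <= 4 / dl).
  have hm : 2 * m.+1%:R^-1 <= dl / 2.
    have m0 : 0 < m.+1%:R :> R by [].
    by move: m1; rewrite ltr_pdivrMr// => m1; rewrite ler_pdivlMr// mulrAC ler_pdivrMr//; lra.
  have dense (u : R) : exists q : rat, `|u - ratr q| < m.+1%:R^-1.
    have mi : 0 < m.+1%:R^-1 :> R by rewrite invr_gt0.
    have [q] := @rat_in_itvoo R (u - m.+1%:R^-1) (u + m.+1%:R^-1) ltac:(by rewrite ltrD2l gtrN).
    by rewrite in_itv /= => /andP[h1 h2]; exists q; rewrite ltr_distlC h1.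
  have /choice[q hq] : forall k : 'I_n.+1, exists p : rat * rat,
      `|complex.Re (cpoly n (config x t))`_k - ratr p.1| < m.+1%:R^-1 /\
      `|complex.Im (cpoly n (config x t))`_k - ratr p.2| < m.+1%:R^-1.
    move=> k; have [p1 h1] := dense (complex.Re (cpoly n (config x t))`_k).
    by have [p2 h2] := dense (complex.Im (cpoly n (config x t))`_k); exists (p1, p2).
  exists ([ffun k => q k], m) => //; rewrite /F; case: asboolP => [_|]; last first.
    case; move=> t' /forallP /= h; rewrite /G /=.
    have hs : size (eigs n t') = size (eigs n t).
      exact: (etrans (size_eigs x n t') (esym (size_eigs x n t))).
    have hc : coef_close dl (cpoly n (config x t')) (cpoly n (config x t)).
      move: hq h (sz t') (sz t); move: (cpoly n (config x t')) (cpoly n (config x t)) => p1 p2 hq h s1 s2.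
      apply: (coef_close_box (r := fun k => (ratr (q k).1, ratr (q k).2)) s1 s2 dl0 hm); last exact: hq.
      by move=> k; have /andP[] := h k; rewrite !ffunE; split.
    rewrite (cpolyE n t') (cpolyE n t) in hc.
    have := hdl (eigs n t') hs hc.
    move=> h1; have -> : \sum_(la <- eigs n t') f la - c =
      (\sum_(la <- eigs n t') f la - \sum_(la <- eigs n t) f la) + (\sum_(la <- eigs n t) f la - c) by rewrite addrA subrK.
    by apply: (le_lt_trans (ler_normD _ _)); move: h1 e0; lra.
  by apply/forallP => k /=; rewrite ffunE; have [-> ->] := hq k.
apply: countable_bigcupT_measurable => // i.
rewrite /F; case: asboolP => _ //.
rewrite -[X in measurable X]setTI.
exact: (measf_config x (mb i) measurableT (Y := [set true])).
Qed.

End measurability.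

(** * From linear statistics to convergence of measures *)

Section circular_law.
Context d (T : measurableType d) (R : realType) (P : probability T R).
Notation C := R[i].

(** Passage from f to the nonnegative functions M + f and M - f, for which [regular_liminf] is
    available. *)
Lemma Rintegral_addC (m : {measure set C -> \bar R}) (f : C -> R) (M : R) :
  m setT = 1%E -> measurable_fun setT f -> (forall z, `|f z| <= M) ->
  fine (\int[m]_z (f z + M)%:E)%E = \int[m]_z f z + M /\
  fine (\int[m]_z (M - f z)%:E)%E = M - \int[m]_z f z.
Proof.
move=> m1 mf fM; have fin : (m setT < +oo)%E by rewrite m1 ltry.
have bd (g : C -> R) : (forall z, `|g z| <= M) -> measurable_fun setT g -> m.-integrable setT (EFin \o g).
  move=> gM mg; apply: measurable_bounded_integrable => //.
  by exists M; split; [exact: num_real|move=> y My z _ /=; exact: le_trans (ltW My)].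
have M0 : 0 <= M by exact: le_trans (fM 0).
have i1 := bd f fM mf.
have i2 : m.-integrable setT (EFin \o cst M) by apply: bd => // z; rewrite ger0_norm.
have c : \int[m]_z cst M z = M by rewrite Rintegral_cst// m1 mulr1.
split; first by rewrite -[in RHS]c -RintegralD.
by rewrite -[in RHS]c -RintegralB.
Qed.

Lemma integral_esd n (A : 'M[C]_n) (g : C -> R) : measurable_fun setT g -> (forall z, 0 <= g z) ->
  (\int[esd A]_z (g z)%:E)%E = (n%:R^-1 * \sum_(la <- eigenvalues A) g la)%:E.
Proof.
move=> mg g0; have mG : measurable_fun setT (fun z => (g z)%:E) by exact/measurable_EFinP.
have pG z : setT z -> (0 <= (g z)%:E)%E by rewrite lee_fin.
rewrite /esd (@ge0_integral_mscale _ _ _ _ setT measurableT (n%:R^-1)%:nng _ mG pG) EFinM.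
apply: (congr1 (fun u => ((n%:R^-1 : R)%:E * u)%E)).
rewrite ge0_integral_measure_sum// [in RHS](big_nth 0) size_eigenvalues big_mkord -sumEFin.
by apply: eq_bigr => i _; rewrite integral_dirac// diracT mul1e.
Qed.

Lemma std_law_distribution (X : {RV P >-> C}) : mean_zero P X -> unit_variance P X -> std_law (distribution P X).
Proof.
move=> [mRe mIm] var; have mN : measurable_fun setT (fun u : C => (nsq u)%:E).
  have -> : (fun u : C => (nsq u)%:E) = EFin \o (fun u => nsq (u - 0)).
    by apply/funext => u /=; rewrite subr0.
  by apply/measurable_EFinP; exact: measurable_nsq_sub.
have tr0 (h : C -> \bar R) : measurable_fun setT h -> (forall u, 0 <= h u)%E ->
    (\int[distribution P X]_u h u = \int[P]_t h (X t))%E.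
  by move=> mh h0; rewrite ge0_integral_distribution.
have tr (g : C -> R) : measurable_fun setT g -> (\int[distribution P X]_u (g u)%:E = \int[P]_t (g (X t))%:E)%E.
  move=> mg; have mG : measurable_fun setT (fun u => (g u)%:E) by exact/measurable_EFinP.
  rewrite integralE [RHS]integralE; congr (_ - _)%E.
    rewrite tr0; [|exact: measurable_funepos|by move=> u; rewrite ?funeposE ?funenegE le_max lexx orbT].
    by apply: eq_integral => t _; rewrite ?funeposE ?funenegE.
  rewrite tr0; [|exact: measurable_funeneg|by move=> u; rewrite ?funeposE ?funenegE le_max lexx orbT].
  by apply: eq_integral => t _; rewrite ?funeposE ?funenegE.
split.
- rewrite ge0_integral_distribution//; last by move=> u; rewrite lee_fin nsq_ge0.
  rewrite -[RHS]var unlock; apply: eq_integral => t _ /=.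
  by rewrite normc_nsq.
- by rewrite tr; [rewrite -[RHS]mRe unlock|exact: measurable_Re].
- by rewrite tr; [rewrite -[RHS]mIm unlock|exact: measurable_Im].
Qed.

(** P (F n) is at most the probability of the union of the later events, which decreases to that of
    their limsup, a null set. *)
Lemma cvg_probability_ae (F : nat -> set T) : (forall n, measurable (F n)) ->
  {ae P, forall t, \forall n \near \oo, ~ F n t} -> P (F n) @[n --> \oo] --> 0%E.
Proof.
move=> mF h.
have mU n : measurable (\bigcup_(k >= n) F k) by apply: bigcup_measurable.
have L0 : P (lim_sup_set F) = 0%E.
  have [N [mN PN hN]] := h.
  apply/eqP; rewrite -measure_le0 -PN; apply: le_measure; rewrite ?inE//.
    by apply: bigcap_measurable => // k _.
  move=> t Lt; apply: hN => /= -[n0 _ hn].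
  by have [k /= nk Fk] := Lt n0 Logic.I; exact: hn Fk.
have c := lim_sup_set_cvg P F mF (ltac:(by rewrite (le_lt_trans (probability_le1 P (mU 0%N)))// ltry) : (P (\bigcup_(k >= 0) F k) < +oo)%E).
move: c; rewrite [X in _ --> X -> _](_ : _ = 0%E); last exact: L0.
move=> c.
apply: (squeeze_cvge _ (cvg_cst 0%E) c).
near=> n; rewrite measure_ge0 /=; apply: le_measure; rewrite ?inE//.
by move=> t Ft; exists n => /=.
Unshelve. all: end_near. Qed.

Variable x : nat * nat -> {RV P >-> C}.
Local Notation esdn n t := (esd ((Num.sqrt (n%:R : R))^-1%:C *: random_matrix x n t)).

Lemma Rintegral_esd (f : C -> R) n t : test_function f -> (0 < n)%N ->
  \int[esdn n t]_z f z = n%:R^-1 * \sum_(la <- eigs x n t) f la.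
Proof.
move=> tf n0; have [M M0 fM] := test_bounded tf; have mf := test_measurable tf.
have [h _] := @Rintegral_addC (esdn n t : {measure set C -> \bar R}) f M (esd_setT _ n0) mf fM.
have g0 z : 0 <= f z + M by move: (fM z); rewrite ler_norml => /andP[h1 _]; lra.
have nR : n%:R != 0 :> R by rewrite pnatr_eq0 -lt0n.
apply/(addIr M); rewrite -h integral_esd//; last exact: measurable_funD.
rewrite /= -/(eigs x n t) big_split /= big_const_seq count_predT iter_addr_0 size_eigs mulrDr -[M *+ n]mulr_natl mulKf//.
Qed.

Lemma regular_cvg t (f : C -> R) : regular x t -> test_function f ->
  (\int[esdn n t]_z f z) @[n --> \oo] --> \int[@uniform_disk R]_z f z.
Proof.
move=> reg tf; have [M M0 fM] := test_bounded tf; have mf := test_measurable tf.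
have fM' z : - M <= f z <= M by rewrite -ler_norml.
have [u1 u2] := Rintegral_addC (@probability_setT _ _ _ (@uniform_disk R)) mf fM.
have M20 : 0 < M + M by rewrite addr_gt0.
have unif := test_unif tf.
have osc (g : C -> R) : (forall z la, `|g z - g la| <= `|f z - f la|) ->
    forall ep : R, 0 < ep -> exists2 dl, 0 < dl & forall z la, nsq (z - la) <= dl ^+ 2 -> g z <= g la + ep.
  move=> gf ep ep0; have [dl dl0 hd] := unif _ ep0; exists dl => // z la /hd hz.
  by rewrite -lerBlDl (le_trans (ler_norm _))// (le_trans (gf _ _)).
apply/cvgrPdist_le => ep ep0.
have A := regular_liminf reg (measurable_funD mf (measurable_cst M)) M20
  (ltac:(by move=> z; have /andP[h1 h2] := fM' z; apply/andP; split; rewrite /=; lra))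
  (osc (fun z => f z + M) (ltac:(by move=> z la; rewrite opprD addrACA subrr addr0))) ep0.
have B := regular_liminf reg (measurable_funB (measurable_cst M) mf) M20
  (ltac:(by move=> z; have /andP[h1 h2] := fM' z; apply/andP; split; rewrite /=; lra))
  (osc (fun z => M - f z) (ltac:(by move=> z la; rewrite opprB addrC -addrA [_ + (M - _)]addrA addNr add0r -normrN opprB addrC)))  ep0.
rewrite /= in A B; near=> n.
have n0 : (0 < n)%N by near: n; exact: near_ge.
have nR : n%:R != 0 :> R by rewrite pnatr_eq0 -lt0n.
have A' : fine (\int[@uniform_disk R]_z (f z + M)%:E)%E - ep <= n%:R^-1 * \sum_(la <- eigs x n t) (f la + M) by near: n; exact: A.
have B' : fine (\int[@uniform_disk R]_z (M - f z)%:E)%E - ep <= n%:R^-1 * \sum_(la <- eigs x n t) (M - f la) by near: n; exact: B.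
rewrite Rintegral_esd//.
have s1 : n%:R^-1 * \sum_(la <- eigs x n t) (f la + M) = n%:R^-1 * \sum_(la <- eigs x n t) f la + M.
  by rewrite big_split /= big_const_seq count_predT iter_addr_0 size_eigs mulrDr -[M *+ n]mulr_natl mulKf.
have s2 : n%:R^-1 * \sum_(la <- eigs x n t) (M - f la) = M - n%:R^-1 * \sum_(la <- eigs x n t) f la.
  by rewrite sumrB big_const_seq count_predT iter_addr_0 size_eigs mulrBr -[M *+ n]mulr_natl mulKf.
rewrite s1 u1 in A'; rewrite s2 u2 in B'.
by rewrite ler_norml; apply/andP; split; move: A' B'; lra.
Unshelve. all: end_near. Qed.

End circular_law.

Theorem theorem1p13 (R : realType) (d : measure_display) (T : measurableType d)
    (P : probability T R) (x : nat * nat -> {RV P >-> R[i]})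
    (x_iid : iid x)
    (x_mean : forall ij, mean_zero P (x ij))
    (x_var : forall ij, unit_variance P (x ij)) :
  let mu (n : nat) (t : T) : {measure set R[i] -> \bar R} :=
    esd ((Num.sqrt (n%:R : R))^-1%:C *: random_matrix x n t) in
  cvg_measure_in_probability P mu (@uniform_disk R) /\
  cvg_measure_almost_surely P mu (@uniform_disk R).
Proof.
move=> mu; have mu_std := std_law_distribution (x_mean (0%N, 0%N)) (x_var (0%N, 0%N)).
have reg := as_regular x_iid mu_std.
split; last by apply: filterS reg => t ht f tf; exact: regular_cvg.
move=> f tf ep ep0.
(* At n = 0 the ESD is not a probability measure, and the formula for linear statistics is stated
   for positive n; one term does not affect the limit. *)
pose F n : set T := if n is 0%N then set0 else
  [set t | ep <= `|\int[mu n t]_z f z - \int[@uniform_disk R]_z f z|].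
have mF n : measurable (F n).
  case: n => [|n]; first exact: measurable0.
  set c := \int[@uniform_disk R]_z f z.
  have -> : F n.+1 = ~` [set t | `|\sum_(la <- eigs x n.+1 t) f la - n.+1%:R * c| < n.+1%:R * ep].
    have n0 : 0 < n.+1%:R :> R by [].
    apply/seteqP; split => t; rewrite /F /= /mu Rintegral_esd// -/c;
    have -> : n.+1%:R^-1 * \sum_(la <- eigs x n.+1 t) f la - c =
      n.+1%:R^-1 * (\sum_(la <- eigs x n.+1 t) f la - n.+1%:R * c) by [rewrite mulrBr mulKf// gt_eqF];
    rewrite normrM gtr0_norm ?invr_gt0// [n.+1%:R^-1 * _]mulrC ler_pdivlMr// mulrC.
      by move=> h; apply/negP; rewrite -leNgt.
    by move=> /negP; rewrite -leNgt [_ * ep]mulrC.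
  by apply: measurableC; exact: measurable_sum_eigs.
have -> : P [set t | ep <= `|\int[mu n t]_z f z - \int[@uniform_disk R]_z f z|] @[n --> \oo] --> 0%E =
    (P (F n) @[n --> \oo] --> 0%E).
  apply/propext; split; apply: cvg_trans; apply: near_eq_cvg;
  by exists 1%N => // -[|n].
apply: cvg_probability_ae => //; apply: filterS reg => t ht.
have /cvgrPdist_lt := regular_cvg ht tf => /(_ ep ep0); apply: filterS => -[|n] /=; first by move=> _ [].
by move=> h; rewrite distrC => /le_lt_trans /(_ h); rewrite ltxx.
Qed.
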